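(* Let $R>0$ and $\theta\in(0,\pi/2)$ be fixed. Let $\boldsymbol f=(f_1,f_2)$ be a vector field with components $f_1,f_2\in C_0^\infty(\mathbb{D}_R)$. Then $\boldsymbol f$ is uniquely recovered from $\mathcal{L}\boldsymbol f(\beta,d)$ and $\mathcal{T}\boldsymbol f(\beta,d)$ known for $d\in[0,R]$ and $\beta\in[0,2\pi)$. That is, if $\boldsymbol f$ and $\boldsymbol g$ are two such vector fields with $\mathcal{L}\boldsymbol f(\beta,d)=\mathcal{L}\boldsymbol g(\beta,d)$ and $\mathcal{T}\boldsymbol f(\beta,d)=\mathcal{T}\boldsymbol g(\beta,d)$ for all $\beta\in[0,2\pi)$ and $d\in[0,R]$, then $\boldsymbol f=\boldsymbol g$.
   Context: $\mathbb{D}_R$ denotes the disk of radius $R$ centered at the origin of $\mathbb{R}^2$. The angle $\theta\in(0,\pi/2)$ is fixed. $C_0^\infty(\mathbb{D}_R)$ denotes smooth (scalar) functions with compact support in $\mathbb{D}_R$; they are extended by zero to all of $\mathbb{R}^2$. For $\beta\in[0,2\pi)$ put $\boldsymbol x_\beta=(R\cos\beta,R\sin\beta)$, $\boldsymbol u_\beta=-(\cos\beta,\sin\beta)$, $\boldsymbol v_\beta=-(\cos(\theta+\beta),\sin(\theta+\beta))$. For a vector $\boldsymbol w=(w_1,w_2)$ let $\boldsymbol w^\perp=(-w_2,w_1)$, so $\boldsymbol u_\beta^\perp=(\sin\beta,-\cos\beta)$ and $\boldsymbol v_\beta^\perp=(\sin(\theta+\beta),-\cos(\theta+\beta))$. For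 a vector field $\boldsymbol f=(f_1,f_2)$ with components in $C_0^\infty(\mathbb{D}_R)$, the longitudinal V-line transform and the transverse V-line transform are, for $\beta\in[0,2\pi)$ and $d\in[0,2R]$, $$\mathcal{L}\boldsymbol f(\beta,d)=\int_0^d \boldsymbol u_\beta\cdot\boldsymbol f(\boldsymbol x_\beta+s\boldsymbol u_\beta)\,ds+\int_0^\infty \boldsymbol v_\beta\cdot\boldsymbol f(\boldsymbol x_\beta+d\boldsymbol u_\beta+s\boldsymbol v_\beta)\,ds,$$ $$\mathcal{T}\boldsymbol f(\beta,d)=\int_0^d \boldsymbol u_\beta^\perp\cdot\boldsymbol f(\boldsymbol x_\beta+s\boldsymbol u_\beta)\,ds+\int_0^\infty \boldsymbol v_\beta^\perp\cdot\boldsymbol f(\boldsymbol x_\beta+d\boldsymbol u_\beta+s\boldsymbol v_\beta)\,ds.$$ *)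

(* Defs.v *)
From Stdlib Require Import Reals List.
From Coquelicot Require Import Coquelicot.
Open Scope R_scope.

Definition closure_of {T : UniformSpace} (A : T -> Prop) (p : T) : Prop :=
  forall U : T -> Prop, locally p U -> exists q : T, U q /\ A q.

(* Stdlib's [compact] only concerns subsets of [R]. *)
Definition compact_set {T : UniformSpace} (K : T -> Prop) : Prop :=
  forall (I : Type) (U : I -> T -> Prop),
    (forall i, open (U i)) ->
    (forall p, K p -> exists i, U i p) ->
    exists l : list I, forall p, K p -> exists i, In i l /\ U i p.

Definition support (h : R * R -> R) : R * R -> Prop :=
  closure_of (fun p : R * R => h p <> 0).

Definition disk (rad : R) (p : R * R) : Prop :=
  fst p ^ 2 + snd p ^ 2 < rad ^ 2.

Definition smooth (h : R * R -> R) : Prop :=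
  forall (n : nat) (x y : R), ex_diff_n (fun u v => h (u, v)) n x y.

(* A function of C_0^infty(D) is represented by its extension by zero, which is
   smooth on the whole plane because the support is a compact subset of the
   open set [D]. *)
Definition smooth_compact_support (D : R * R -> Prop) (h : R * R -> R) : Prop :=
  smooth h /\ compact_set (support h) /\ (forall p, support h p -> D p).

Definition smooth_field (rad : R) (f : R * R -> R * R) : Prop :=
  smooth_compact_support (disk rad) (fun p => fst (f p)) /\
  smooth_compact_support (disk rad) (fun p => snd (f p)).

Definition dot (a b : R * R) : R := fst a * fst b + snd a * snd b.

Definition perp (w : R * R) : R * R := (- snd w, fst w).

Definition along (p : R * R) (s : R) (w : R * R) : R * R :=
  (fst p + s * fst w, snd p + s * snd w).

Definition x_pt (rad beta : R) : R * R := (rad * cos beta, rad * sin beta).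

Definition u_dir (beta : R) : R * R := (- cos beta, - sin beta).

Definition v_dir (theta beta : R) : R * R :=
  (- cos (theta + beta), - sin (theta + beta)).

(* The improper integrals below converge for the fields considered: their
   integrands are continuous and vanish for large s. *)
Definition longitudinal (rad theta : R) (f : R * R -> R * R) (beta d : R) : R :=
  RInt (fun s => dot (u_dir beta) (f (along (x_pt rad beta) s (u_dir beta)))) 0 d
  + RInt_gen
      (fun s => dot (v_dir theta beta)
         (f (along (along (x_pt rad beta) d (u_dir beta)) s (v_dir theta beta))))
      (at_point 0) (Rbar_locally p_infty).

Definition transverse (rad theta : R) (f : R * R -> R * R) (beta d : R) : R :=
  RInt (fun s => dot (perp (u_dir beta))
          (f (along (x_pt rad beta) s (u_dir beta)))) 0 d
  + RInt_gen
      (fun s => dot (perp (v_dir theta beta))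
         (f (along (along (x_pt rad beta) d (u_dir beta)) s (v_dir theta beta))))
      (at_point 0) (Rbar_locally p_infty).

(* Main.v *)
Require Import Defs.
From Stdlib Require Import Reals ZArith Lra Lia Psatz.
From Coquelicot Require Import Coquelicot.
Open Scope R_scope.

(** Both transforms are linear, so the claim is that [F = f - g] vanishes if its
    transforms do.  Read [F] as a complex-valued function.  For a unit vector [w]
    the number [dot w p + i dot (perp w) p] is the complex product of [p] with the
    conjugate of [w]; hence the longitudinal and the transverse data combine into
    a single complex equation ([transforms_vline]): for all [beta] and [0 < r < rad],

      int_r^rad F(x e^{i beta}) dx
        + e^{- i th} int_0^oo F((r - t e^{i th}) e^{i beta}) dt = 0.

    This equation is invariant under rotations, so it decouples into one equation
    [Vt f = 0] on [(0, rad)] for each angular mode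
    [f (x) = int_0^{2 pi} F(x e^{i t}) e^{- i n t} dt] ([fmode_V_zero]).  Both terms
    of [Vt f] are homogeneous under dilations, so the Mellin transform
    [Phi (la) = int_0 f(x) x^{- la - 1} dx] satisfies

      vmult (la) * Phi (la) = data_mellin (la),

    where the right-hand side is an integral of [Vt f] over radii [r >= rad] only
    ([mellin_identity]), hence of size [rad^{- N}] on the line [Re la = N].  If the
    multiplier [vmult] is not too small there, [Phi] has the same size, and
    inverting the Mellin transform gives [|f(x)| <= C (x / rad)^N] for arbitrarily
    large [N], that is [f(x) = 0] for [x < rad] ([inversion_bound],
    [flat_mode_zero]).  Uniqueness of Fourier coefficients then gives [F = 0].

    Two things have to be shown.  The first is the lower bound for the multiplier
    [vmult (la) = - 1 / (la + 1) + e^{- i th} M (la)].  A total derivative along the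
    second branch ([vint_recursion]) yields the recursion

      (mu + 1) mu M(mu) = sin^2 th (mu^2 - n^2) M(mu - 2) + (mu cos th - i n sin th),

    which continues [M] to the right and forgets its initial values at the rate
    [sin^2 th < 1].  The outcome is [vmult (la + z) = A + B (sin th)^z + o(1 / |la|)]
    for small [z], with [|A| = tan th / |la|] ([mult_slow_limit]).  Such a function
    may be small somewhere, but not on both of two concentric circles
    ([two_circles], [vmult_circle]), and the mean value of [Phi] over the better
    circle is its value at the centre ([Phi_decay_one]).

    The second is that [Phi (la)] converges for large [Re la] only if [f] is flat at
    the origin.  The operators [x d/dx - j] preserve the equation and remove the
    Taylor coefficient of degree [j] ([kill]).  For large [j] the coefficient
    vanishes by itself ([flat_step]): near the integers of the parity of [n] the
    multiplier is bounded away from zero, so the Mellin transform cannot have the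
    pole which a nonzero coefficient would produce.  After finitely many [j] the
    function is flat, hence zero, and the Euler equations [x f' = j f] are solved
    backwards from [f = 0] beyond [rad] ([Esub_zero]). *)

(** * Integrals depending on a parameter *)

Lemma RInt_param_continuous (g : R -> R -> R) (c d x0 : R) :
  c <= d ->
  (forall y, c <= y <= d -> continuity_2d_pt g x0 y) ->
  (forall x y, c <= y <= d -> continuous (g x) y) ->
  continuous (fun x => RInt (g x) c d) x0.
Proof.
  intros Hcd H2 H1.
  assert (Hex : forall x, ex_RInt (g x) c d).
  { intros x; apply (ex_RInt_continuous (V := R_CompleteNormedModule)).
    intros y; rewrite Rmin_left, Rmax_right by lra; apply H1. }
  apply continuity_pt_filterlim. intros eps Heps.
  assert (He : 0 < eps / (2 * (d - c + 1))) by (apply Rdiv_lt_0_compat; lra).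
  destruct (uniform_continuity_2d_1d' g c d x0 H2 (mkposreal _ He)) as [del Hdel].
  exists (del / 2); split; [apply is_pos_div_2|].
  intros x [_ Hx]; simpl in *; unfold R_dist in *.
  pose proof (cond_pos del) as Hdp.
  assert (Hx' : x0 - del <= x <= x0 + del) by (apply Rabs_def2 in Hx; lra).
  rewrite <- (RInt_minus (V := R_CompleteNormedModule) (g x) (g x0)) by apply Hex.
  apply Rle_lt_trans with ((d - c) * (eps / (2 * (d - c + 1)))).
  - apply (norm_RInt_le_const (V := R_NormedModule)
             (fun y => minus (g x y) (g x0 y)) c d _ _ Hcd).
    + intros y Hy. left. apply (Hdel y x0 y x); try lra.
      rewrite Rminus_diag, Rabs_R0; lra.
    + apply (RInt_correct (V := R_CompleteNormedModule)).
      apply (ex_RInt_minus (V := R_NormedModule) (g x) (g x0)); apply Hex.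
  - assert (H3 : (d - c) * (eps / (2 * (d - c + 1))) = eps * ((d - c) / (2 * (d - c + 1)))).
    { field; lra. }
    rewrite H3.
    assert ((d - c) / (2 * (d - c + 1)) < 1).
    { apply Rmult_lt_reg_r with (2 * (d - c + 1)); [lra|]. field_simplify; lra. }
    nra.
Qed.

(** Clamping the variables extends a function from a rectangle to the plane, so that
    hypotheses on the rectangle become the global ones of the library lemmas. *)
Definition clamp (a b x : R) : R := Rmax a (Rmin b x).

Lemma clamp_id a b x : a <= x <= b -> clamp a b x = x.
Proof. intros H; unfold clamp. rewrite Rmin_right, Rmax_right; lra. Qed.

Lemma clamp_in a b x : a <= b -> a <= clamp a b x <= b.
Proof.
  intros H; unfold clamp, Rmax, Rmin.
  destruct (Rle_dec b x); destruct (Rle_dec _ _); lra.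
Qed.

Lemma clamp_lip a b x y : Rabs (clamp a b x - clamp a b y) <= Rabs (x - y).
Proof.
  unfold clamp, Rmax, Rmin, Rabs.
  destruct (Rle_dec b x), (Rle_dec b y);
  repeat destruct (Rle_dec _ _); repeat destruct (Rcase_abs _); lra.
Qed.

Lemma clamp_continuity_2d (g : R -> R -> R) a b c d :
  a <= b -> c <= d ->
  (forall x y, a <= x <= b -> c <= y <= d -> continuity_2d_pt g x y) ->
  forall x y, continuity_2d_pt (fun u v => g (clamp a b u) (clamp c d v)) x y.
Proof.
  intros Hab Hcd H x y eps.
  destruct (H _ _ (clamp_in a b x Hab) (clamp_in c d y Hcd) eps) as [del Hd].
  exists del. intros u v Hu Hv. apply Hd.
  - eapply Rle_lt_trans; [apply clamp_lip|exact Hu].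
  - eapply Rle_lt_trans; [apply clamp_lip|exact Hv].
Qed.

Lemma continuity_2d_pt_snd (g : R -> R -> R) x y :
  continuity_2d_pt g x y -> continuous (g x) y.
Proof.
  intros H. apply continuity_pt_filterlim. intros eps Heps.
  destruct (H (mkposreal eps Heps)) as [del Hd].
  exists del; split; [apply cond_pos|]. intros v [_ Hv].
  apply Hd; [rewrite Rminus_diag, Rabs_R0; apply cond_pos|exact Hv].
Qed.

Lemma continuity_2d_pt_swap (g : R -> R -> R) x y :
  continuity_2d_pt g x y -> continuity_2d_pt (fun u v => g v u) y x.
Proof.
  intros H eps. destruct (H eps) as [del Hd]. exists del.
  intros u v Hu Hv; apply Hd; assumption.
Qed.

Lemma continuity_2d_pt_fst (g : R -> R -> R) x y :
  continuity_2d_pt g x y -> continuous (fun u => g u y) x.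
Proof.
  intros H. apply (continuity_2d_pt_snd (fun u v => g v u)).
  now apply continuity_2d_pt_swap.
Qed.

(** Both sides vanish for [b = a] and have the same derivative in [b]. *)
Lemma RInt_swap_global (g : R -> R -> R) a b c d :
  a <= b -> c <= d ->
  (forall x y, continuity_2d_pt g x y) ->
  RInt (fun x => RInt (g x) c d) a b = RInt (fun y => RInt (fun x => g x y) a b) c d.
Proof.
  intros Hab Hcd H.
  assert (Hy : forall x y, continuous (g x) y) by (intros; now apply continuity_2d_pt_snd).
  assert (Hx : forall x y, continuous (fun u => g u y) x)
    by (intros; now apply continuity_2d_pt_fst).
  assert (Exx : forall y u v, ex_RInt (fun x => g x y) u v).
  { intros. apply (ex_RInt_continuous (V := R_CompleteNormedModule)). intros; apply Hx. }
  set (K := fun t => RInt (fun y => RInt (fun x => g x y) a t) c d).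
  assert (Ci : forall x, continuous (fun x => RInt (g x) c d) x).
  { intros x. apply RInt_param_continuous; [lra| |]; intros; auto. }
  assert (DK : forall t, is_derive K t (RInt (g t) c d)).
  { intros t. unfold K.
    assert (D1 : forall y t, is_derive (fun u => RInt (fun x => g x y) a u) t (g t y)).
    { intros y t'. apply (is_derive_RInt (V := R_NormedModule) (fun x => g x y) _ a).
      - apply filter_forall. intros u. apply (RInt_correct (V := R_CompleteNormedModule)), Exx.
      - apply Hx. }
    replace (RInt (g t) c d) with
      (RInt (fun y => Derive (fun u => RInt (fun x => g x y) a u) t) c d).
    2:{ apply RInt_ext. intros y _. apply is_derive_unique, D1. }
    apply (is_derive_RInt_param (fun u y => RInt (fun x => g x y) a u)).
    - apply filter_forall. intros u y _. eexists; apply D1.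
    - intros y _. apply continuity_2d_pt_ext with g; [|apply H].
      intros u v. symmetry. apply is_derive_unique, D1.
    - apply filter_forall. intros u. apply (ex_RInt_continuous (V := R_CompleteNormedModule)).
      intros y _.
      destruct (Rle_dec a u) as [Hau|Hau].
      + apply (RInt_param_continuous (fun y x => g x y) a u y Hau); intros; auto.
        apply continuity_2d_pt_swap, H.
      + apply continuous_ext with (fun y => opp (RInt (fun x => g x y) u a)).
        { intros z. apply (opp_RInt_swap (V := R_CompleteNormedModule)). apply Exx. }
        apply (continuous_opp (V := R_NormedModule)).
        apply (RInt_param_continuous (fun y x => g x y) u a y); [lra| |]; intros; auto.
        apply continuity_2d_pt_swap, H. }
  assert (E : RInt (fun x => RInt (g x) c d) a b = K b - K a).
  { apply is_RInt_unique.
    apply (is_RInt_derive (V := R_CompleteNormedModule) K); intros; auto. }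
  rewrite E. unfold K.
  rewrite (RInt_ext (V := R_CompleteNormedModule) (fun y => RInt (fun x => g x y) a a) (fun _ => 0)).
  2:{ intros; apply (RInt_point (V := R_CompleteNormedModule)). }
  rewrite (RInt_const (V := R_CompleteNormedModule)). unfold scal; simpl; unfold mult; simpl.
  ring.
Qed.

Lemma RInt_swap_order (g : R -> R -> R) a b c d :
  a <= b -> c <= d ->
  (forall x y, a <= x <= b -> c <= y <= d -> continuity_2d_pt g x y) ->
  RInt (fun x => RInt (g x) c d) a b = RInt (fun y => RInt (fun x => g x y) a b) c d.
Proof.
  intros Hab Hcd H.
  pose proof (RInt_swap_global _ a b c d Hab Hcd
                (clamp_continuity_2d g a b c d Hab Hcd H)) as E.
  simpl in E.
  transitivity (RInt (fun x => RInt (fun y => g (clamp a b x) (clamp c d y)) c d) a b).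
  - apply RInt_ext. intros x Hx. rewrite Rmin_left, Rmax_right in Hx by lra.
    apply RInt_ext. intros y Hy. rewrite Rmin_left, Rmax_right in Hy by lra.
    rewrite !clamp_id by lra. reflexivity.
  - rewrite E.
    apply RInt_ext. intros x Hx. rewrite Rmin_left, Rmax_right in Hx by lra.
    apply RInt_ext. intros y Hy. rewrite Rmin_left, Rmax_right in Hy by lra.
    rewrite !clamp_id by lra. reflexivity.
Qed.

(** * Calculus of complex-valued functions of a real variable *)

(** A function with a derivative computed by [auto_derive] is continuous. *)
Ltac derive_cont := apply (ex_derive_continuous (V := R_NormedModule)); auto_derive; auto.

Definition ccont (f : R -> C) (x : R) : Prop :=
  continuous (fun t => fst (f t)) x /\ continuous (fun t => snd (f t)) x.

Definition ccont2 (g : R -> R -> C) (x y : R) : Prop :=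
  continuity_2d_pt (fun u v => fst (g u v)) x y /\
  continuity_2d_pt (fun u v => snd (g u v)) x y.

Definition cder (f : R -> C) (x : R) (l : C) : Prop :=
  is_derive (fun t => fst (f t)) x (fst l) /\ is_derive (fun t => snd (f t)) x (snd l).

Definition cint (f : R -> C) (a b : R) : C :=
  (RInt (fun t => fst (f t)) a b, RInt (fun t => snd (f t)) a b).

Definition cexp (z : C) : C := (exp (fst z) * cos (snd z), exp (fst z) * sin (snd z)).

Lemma Ceq (z w : C) : fst z = fst w -> snd z = snd w -> z = w.
Proof. destruct z, w; simpl; now intros -> ->. Qed.

Lemma cexp_plus z w : cexp (z + w)%C = (cexp z * cexp w)%C.
Proof.
  unfold cexp; apply Ceq; simpl; rewrite exp_plus, ?cos_plus, ?sin_plus; ring.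
Qed.

Lemma cexp_0 : cexp 0%C = 1%C.
Proof. unfold cexp; apply Ceq; simpl; rewrite exp_0, ?cos_0, ?sin_0; ring. Qed.

Lemma Cmod_cexp z : Cmod (cexp z) = exp (fst z).
Proof.
  unfold cexp, Cmod; simpl.
  replace (_ + _) with (Rsqr (exp (fst z))).
  - apply sqrt_Rsqr. left; apply exp_pos.
  - pose proof (sin2_cos2 (snd z)) as H. unfold Rsqr in *. nra.
Qed.

Lemma Cmod_le_sum z : Cmod z <= Rabs (fst z) + Rabs (snd z).
Proof.
  replace z with (RtoC (fst z) + Ci * RtoC (snd z))%C at 1.
  - eapply Rle_trans; [apply Cmod_triangle|].
    rewrite Cmod_mult, !Cmod_R, Cmod_Ci. lra.
  - apply Ceq; simpl; ring.
Qed.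

Lemma fst_le_Cmod (z : C) : Rabs (fst z) <= Cmod z.
Proof. apply re_le_Cmod. Qed.

Lemma snd_le_Cmod (z : C) : Rabs (snd z) <= Cmod z.
Proof. eapply Rle_trans; [apply Rmax_r|apply Rmax_Cmod]. Qed.

Lemma ccont_ext f g x : (forall t, f t = g t) -> ccont f x -> ccont g x.
Proof.
  intros H [A B]; split; [eapply continuous_ext; [|exact A]|eapply continuous_ext; [|exact B]];
  intros t; simpl; now rewrite H.
Qed.

Lemma ccont_const c x : ccont (fun _ => c) x.
Proof. split; apply continuous_const. Qed.

Lemma ccont_plus f g x : ccont f x -> ccont g x -> ccont (fun t => (f t + g t)%C) x.
Proof.
  intros [A B] [A' B']; split; simpl.
  - apply (continuous_plus (V := R_NormedModule) (fun t => fst (f t)) (fun t => fst (g t))); auto.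
  - apply (continuous_plus (V := R_NormedModule) (fun t => snd (f t)) (fun t => snd (g t))); auto.
Qed.

Lemma rcont_mult (f g : R -> R) x :
  continuous f x -> continuous g x -> continuous (fun t => f t * g t) x.
Proof. intros; apply (continuous_mult (K := R_AbsRing) f g); auto. Qed.

Lemma rcont_plus (f g : R -> R) x :
  continuous f x -> continuous g x -> continuous (fun t => f t + g t) x.
Proof. intros; apply (continuous_plus (V := R_NormedModule) f g); auto. Qed.

Lemma rcont_minus (f g : R -> R) x :
  continuous f x -> continuous g x -> continuous (fun t => f t - g t) x.
Proof. intros; apply (continuous_minus (V := R_NormedModule) f g); auto. Qed.

Lemma ccont_mult f g x : ccont f x -> ccont g x -> ccont (fun t => (f t * g t)%C) x.
Proof.
  intros [A B] [A' B']; split; simpl.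
  - apply (rcont_minus (fun t => fst (f t) * fst (g t)) (fun t => snd (f t) * snd (g t)));
    apply rcont_mult; auto.
  - apply (rcont_plus (fun t => fst (f t) * snd (g t)) (fun t => snd (f t) * fst (g t)));
    apply rcont_mult; auto.
Qed.

Lemma ccont_opp f x : ccont f x -> ccont (fun t => (- f t)%C) x.
Proof.
  intros H. apply ccont_ext with (fun t => ((-1)%R * f t)%C).
  - intros t; apply Ceq; simpl; ring.
  - apply ccont_mult; [apply ccont_const|exact H].
Qed.

Lemma ccont_minus f g x : ccont f x -> ccont g x -> ccont (fun t => (f t - g t)%C) x.
Proof. intros; apply ccont_plus; [|apply ccont_opp]; auto. Qed.

Lemma ccont_RtoC (h : R -> R) x : continuous h x -> ccont (fun t => RtoC (h t)) x.
Proof. intros H; split; simpl; [exact H|apply continuous_const]. Qed.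

Lemma ccont_comp (f : R -> C) (h : R -> R) x :
  continuous h x -> ccont f (h x) -> ccont (fun t => f (h t)) x.
Proof.
  intros H [A B]; split.
  - apply (continuous_comp h (fun t => fst (f t))); auto.
  - apply (continuous_comp h (fun t => snd (f t))); auto.
Qed.

Lemma ccont_cexp f x : ccont f x -> ccont (fun t => cexp (f t)) x.
Proof.
  intros [A B]; split; simpl; apply rcont_mult.
  - apply (continuous_comp (fun t => fst (f t)) exp); auto. apply continuous_exp.
  - apply (continuous_comp (fun t => snd (f t)) cos); auto. apply continuous_cos.
  - apply (continuous_comp (fun t => fst (f t)) exp); auto. apply continuous_exp.
  - apply (continuous_comp (fun t => snd (f t)) sin); auto. apply continuous_sin.
Qed.

Lemma ccont2_plus f g x y :
  ccont2 f x y -> ccont2 g x y -> ccont2 (fun u v => (f u v + g u v)%C) x y.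
Proof. intros [A B] [A' B']; split; simpl; apply continuity_2d_pt_plus; auto. Qed.

Lemma ccont2_mult f g x y :
  ccont2 f x y -> ccont2 g x y -> ccont2 (fun u v => (f u v * g u v)%C) x y.
Proof.
  intros [A B] [A' B']; split; simpl.
  - apply continuity_2d_pt_minus; apply continuity_2d_pt_mult; auto.
  - apply continuity_2d_pt_plus; apply continuity_2d_pt_mult; auto.
Qed.

Lemma ccont2_RtoC (h : R -> R -> R) x y :
  continuity_2d_pt h x y -> ccont2 (fun u v => RtoC (h u v)) x y.
Proof. intros H; split; simpl; [exact H|apply continuity_2d_pt_const]. Qed.

Lemma rcont2_comp (f : R -> R) (h : R -> R -> R) x y :
  continuity_2d_pt h x y -> continuous f (h x y) -> continuity_2d_pt (fun u v => f (h u v)) x y.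
Proof.
  intros H A. apply continuity_1d_2d_pt_comp; auto. now apply continuity_pt_filterlim.
Qed.

Lemma ccont2_comp (f : R -> C) (h : R -> R -> R) x y :
  continuity_2d_pt h x y -> ccont f (h x y) -> ccont2 (fun u v => f (h u v)) x y.
Proof.
  intros H [A B]; split.
  - apply (rcont2_comp (fun t => fst (f t))); auto.
  - apply (rcont2_comp (fun t => snd (f t))); auto.
Qed.

Lemma ccont2_cexp f x y : ccont2 f x y -> ccont2 (fun u v => cexp (f u v)) x y.
Proof.
  intros [A B]; split; simpl; apply continuity_2d_pt_mult.
  - apply (rcont2_comp exp); auto. apply continuous_exp.
  - apply (rcont2_comp cos); auto. apply continuous_cos.
  - apply (rcont2_comp exp); auto. apply continuous_exp.
  - apply (rcont2_comp sin); auto. apply continuous_sin.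
Qed.

Lemma ccont2_fst_var (f : R -> C) x y : ccont f x -> ccont2 (fun u _ => f u) x y.
Proof. intros; apply (ccont2_comp f (fun u _ => u)); auto. apply continuity_2d_pt_id1. Qed.

Lemma ccont2_snd_var (f : R -> C) x y : ccont f y -> ccont2 (fun _ v => f v) x y.
Proof. intros; apply (ccont2_comp f (fun _ v => v)); auto. apply continuity_2d_pt_id2. Qed.

Lemma ccont2_ccont_snd g x y : ccont2 g x y -> ccont (g x) y.
Proof. intros [A B]; split; apply continuity_2d_pt_snd in A, B; auto. Qed.

Lemma ccont2_ccont_fst g x y : ccont2 g x y -> ccont (fun u => g u y) x.
Proof. intros [A B]; split; apply continuity_2d_pt_fst in A, B; auto. Qed.

Lemma cder_ext f g x l : (forall t, f t = g t) -> cder f x l -> cder g x l.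
Proof.
  intros H [A B]; split; [eapply is_derive_ext; [|exact A]|eapply is_derive_ext; [|exact B]];
  intros t; simpl; now rewrite H.
Qed.

Lemma cder_eq f x l l' : cder f x l -> l = l' -> cder f x l'.
Proof. now intros H <-. Qed.

Lemma cder_unique f x l l' : cder f x l -> cder f x l' -> l = l'.
Proof.
  intros [A B] [A' B']. apply Ceq.
  - rewrite <- (is_derive_unique _ _ _ A). now apply is_derive_unique.
  - rewrite <- (is_derive_unique _ _ _ B). now apply is_derive_unique.
Qed.

Lemma cder_const c x : cder (fun _ => c) x 0%C.
Proof. split; simpl; auto_derive; auto. Qed.

Lemma cder_plus f g x l m : cder f x l -> cder g x m -> cder (fun t => (f t + g t)%C) x (l + m)%C.
Proof.
  intros [A B] [A' B']; split; simpl.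
  - apply (is_derive_plus (V := R_NormedModule) (fun t => fst (f t))); auto.
  - apply (is_derive_plus (V := R_NormedModule) (fun t => snd (f t))); auto.
Qed.

Lemma rder_mult (f g : R -> R) x l m :
  is_derive f x l -> is_derive g x m -> is_derive (fun t => f t * g t) x (l * g x + f x * m).
Proof. intros A B. apply (is_derive_mult (K := R_AbsRing) f g x l m); auto. intros; apply Rmult_comm. Qed.

Lemma cder_mult f g x l m :
  cder f x l -> cder g x m -> cder (fun t => (f t * g t)%C) x (l * g x + f x * m)%C.
Proof.
  intros [A B] [A' B']; split; simpl.
  - pose proof (rder_mult _ _ _ _ _ A A') as H1. pose proof (rder_mult _ _ _ _ _ B B') as H2.
    pose proof (is_derive_minus (V := R_NormedModule) _ _ _ _ _ H1 H2) as H.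
    match type of H with is_derive _ _ ?v => match goal with |- is_derive _ _ ?w =>
      replace w with v; [exact H|] end end.
    unfold minus, plus, opp; simpl; ring.
  - pose proof (rder_mult _ _ _ _ _ A B') as H1. pose proof (rder_mult _ _ _ _ _ B A') as H2.
    pose proof (is_derive_plus (V := R_NormedModule) _ _ _ _ _ H1 H2) as H.
    match type of H with is_derive _ _ ?v => match goal with |- is_derive _ _ ?w =>
      replace w with v; [exact H|] end end.
    unfold minus, plus, opp; simpl; ring.
Qed.

Lemma cder_scal c f x l : cder f x l -> cder (fun t => (c * f t)%C) x (c * l)%C.
Proof.
  intros H. eapply cder_eq; [apply cder_mult; [apply cder_const|exact H]|]. apply Ceq; simpl; ring.
Qed.

Lemma cder_RtoC (h : R -> R) x l : is_derive h x l -> cder (fun t => RtoC (h t)) x (RtoC l).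
Proof. intros H; split; simpl; [exact H|auto_derive; auto]. Qed.

Lemma cder_minus f g x l m : cder f x l -> cder g x m -> cder (fun t => (f t - g t)%C) x (l - m)%C.
Proof.
  intros H K. apply cder_ext with (fun t => (f t + (-1)%R * g t)%C).
  - intros t; apply Ceq; simpl; ring.
  - eapply cder_eq; [apply cder_plus; [exact H|apply cder_scal, K]|]. apply Ceq; simpl; ring.
Qed.

Lemma cder_comp (f : R -> C) (h : R -> R) x l m :
  is_derive h x m -> cder f (h x) l -> cder (fun t => f (h t)) x (RtoC m * l)%C.
Proof.
  intros H [A B]; split; simpl.
  - replace (m * fst l - 0 * snd l) with (scal m (fst l)) by (unfold scal; simpl; unfold mult; simpl; ring).
    apply (is_derive_comp (fun t => fst (f t)) h); auto.
  - replace (m * snd l + 0 * fst l) with (scal m (snd l)) by (unfold scal; simpl; unfold mult; simpl; ring).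
    apply (is_derive_comp (fun t => snd (f t)) h); auto.
Qed.

Lemma cder_cexp f x l : cder f x l -> cder (fun t => cexp (f t)) x (l * cexp (f x))%C.
Proof.
  intros [A B]; split; simpl.
  - evar_last; [apply rder_mult|].
    + apply (is_derive_comp exp); [apply is_derive_Reals, derivable_pt_lim_exp|exact A].
    + apply (is_derive_comp cos); [apply is_derive_Reals, derivable_pt_lim_cos|exact B].
    + unfold scal; simpl; unfold mult; simpl; ring.
  - evar_last; [apply rder_mult|].
    + apply (is_derive_comp exp); [apply is_derive_Reals, derivable_pt_lim_exp|exact A].
    + apply (is_derive_comp sin); [apply is_derive_Reals, derivable_pt_lim_sin|exact B].
    + unfold scal; simpl; unfold mult; simpl; ring.
Qed.

Lemma rder_cont (f : R -> R) x l : is_derive f x l -> continuous f x.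
Proof. intros H. apply (ex_derive_continuous (V := R_NormedModule)). now exists l. Qed.

Lemma cder_ccont f x l : cder f x l -> ccont f x.
Proof. intros [A B]; split; eapply rder_cont; eauto. Qed.

Definition ccont_on (f : R -> C) (a b : R) : Prop := forall x, a <= x <= b -> ccont f x.

Lemma ccont_on_ex f a b : a <= b -> ccont_on f a b ->
  ex_RInt (fun t => fst (f t)) a b /\ ex_RInt (fun t => snd (f t)) a b.
Proof.
  intros Hab H; split; apply (ex_RInt_continuous (V := R_CompleteNormedModule));
  intros x; rewrite Rmin_left, Rmax_right by lra; intros Hx; apply (H x Hx).
Qed.

Lemma cint_ext f g a b : a <= b -> (forall x, a < x < b -> f x = g x) -> cint f a b = cint g a b.
Proof.
  intros Hab H; apply Ceq; simpl; apply RInt_ext; intros x;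
  rewrite Rmin_left, Rmax_right by lra; intros Hx; now rewrite H.
Qed.

Lemma cint_plus f g a b : a <= b -> ccont_on f a b -> ccont_on g a b ->
  cint (fun t => (f t + g t)%C) a b = (cint f a b + cint g a b)%C.
Proof.
  intros Hab Hf Hg. destruct (ccont_on_ex _ _ _ Hab Hf), (ccont_on_ex _ _ _ Hab Hg).
  apply Ceq; simpl; apply (RInt_plus (V := R_CompleteNormedModule)); auto.
Qed.

Lemma rRInt_scal (f : R -> R) k a b : ex_RInt f a b -> RInt (fun t => k * f t) a b = k * RInt f a b.
Proof. intros; apply (RInt_scal (V := R_CompleteNormedModule)); auto. Qed.

Lemma rRInt_minus (f g : R -> R) a b : ex_RInt f a b -> ex_RInt g a b ->
  RInt (fun t => f t - g t) a b = RInt f a b - RInt g a b.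
Proof. intros; apply (RInt_minus (V := R_CompleteNormedModule)); auto. Qed.

Lemma rRInt_plus (f g : R -> R) a b : ex_RInt f a b -> ex_RInt g a b ->
  RInt (fun t => f t + g t) a b = RInt f a b + RInt g a b.
Proof. intros; apply (RInt_plus (V := R_CompleteNormedModule)); auto. Qed.

Lemma rex_scal (f : R -> R) k a b : ex_RInt f a b -> ex_RInt (fun t => k * f t) a b.
Proof. intros; apply (ex_RInt_scal (V := R_NormedModule) f); auto. Qed.

Lemma cint_scal c f a b : a <= b -> ccont_on f a b ->
  cint (fun t => (c * f t)%C) a b = (c * cint f a b)%C.
Proof.
  intros Hab Hf. destruct (ccont_on_ex _ _ _ Hab Hf) as [A B].
  apply Ceq; simpl.
  - rewrite (rRInt_minus (fun t => fst c * fst (f t)) (fun t => snd c * snd (f t)));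
    try apply rex_scal; auto. rewrite !rRInt_scal; auto.
  - rewrite (rRInt_plus (fun t => fst c * snd (f t)) (fun t => snd c * fst (f t)));
    try apply rex_scal; auto. rewrite !rRInt_scal; auto.
Qed.

Lemma cint_minus f g a b : a <= b -> ccont_on f a b -> ccont_on g a b ->
  cint (fun t => (f t - g t)%C) a b = (cint f a b - cint g a b)%C.
Proof.
  intros Hab Hf Hg. destruct (ccont_on_ex _ _ _ Hab Hf), (ccont_on_ex _ _ _ Hab Hg).
  apply Ceq; simpl; apply (RInt_minus (V := R_CompleteNormedModule)); auto.
Qed.

Lemma cint_Chasles f a b c : a <= b -> b <= c -> ccont_on f a c ->
  (cint f a b + cint f b c)%C = cint f a c.
Proof.
  intros Hab Hbc H.
  assert (H1 : ccont_on f a b) by (intros x Hx; apply H; lra).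
  assert (H2 : ccont_on f b c) by (intros x Hx; apply H; lra).
  destruct (ccont_on_ex _ _ _ Hab H1), (ccont_on_ex _ _ _ Hbc H2).
  apply Ceq; simpl; apply (RInt_Chasles (V := R_CompleteNormedModule)); auto.
Qed.

(** The factor 2 comes from estimating the real and the imaginary part separately. *)
Lemma cint_dominated f (g : R -> R) a b : a <= b -> ccont_on f a b -> ex_RInt g a b ->
  (forall x, a <= x <= b -> Cmod (f x) <= g x) -> Cmod (cint f a b) <= 2 * RInt g a b.
Proof.
  intros Hab Hf Hg H. destruct (ccont_on_ex _ _ _ Hab Hf) as [A B].
  eapply Rle_trans; [apply Cmod_le_sum|]. simpl.
  assert (K1 : Rabs (RInt (fun t => fst (f t)) a b) <= RInt g a b).
  { apply (norm_RInt_le (V := R_NormedModule) (fun t => fst (f t)) g a b); auto.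
    - intros x Hx. eapply Rle_trans; [apply fst_le_Cmod|]; auto.
    - now apply (RInt_correct (V := R_CompleteNormedModule)).
    - now apply (RInt_correct (V := R_CompleteNormedModule)). }
  assert (K2 : Rabs (RInt (fun t => snd (f t)) a b) <= RInt g a b).
  { apply (norm_RInt_le (V := R_NormedModule) (fun t => snd (f t)) g a b); auto.
    - intros x Hx. eapply Rle_trans; [apply snd_le_Cmod|]; auto.
    - now apply (RInt_correct (V := R_CompleteNormedModule)).
    - now apply (RInt_correct (V := R_CompleteNormedModule)). }
  lra.
Qed.

Lemma rRInt_const k a b : RInt (fun _ => k) a b = (b - a) * k.
Proof. apply (RInt_const (V := R_CompleteNormedModule)). Qed.

Lemma cint_bound f K a b : a <= b -> ccont_on f a b ->
  (forall x, a <= x <= b -> Cmod (f x) <= K) -> Cmod (cint f a b) <= 2 * K * (b - a).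
Proof.
  intros Hab Hf H.
  eapply Rle_trans; [apply (cint_dominated f (fun _ => K)); auto; apply ex_RInt_const|].
  rewrite rRInt_const. lra.
Qed.

Lemma cint_derive F f a b : a <= b -> (forall x, a <= x <= b -> cder F x (f x)) ->
  ccont_on f a b -> cint f a b = (F b - F a)%C.
Proof.
  intros Hab HF Hf. apply Ceq; simpl; apply is_RInt_unique.
  - apply (is_RInt_derive (V := R_CompleteNormedModule) (fun t => fst (F t)) (fun t => fst (f t)));
    intros x; rewrite Rmin_left, Rmax_right by lra; intros Hx; [apply (HF x Hx)|apply (Hf x Hx)].
  - apply (is_RInt_derive (V := R_CompleteNormedModule) (fun t => snd (F t)) (fun t => snd (f t)));
    intros x; rewrite Rmin_left, Rmax_right by lra; intros Hx; [apply (HF x Hx)|apply (Hf x Hx)].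
Qed.

Lemma cint_point f a : cint f a a = 0%C.
Proof. apply Ceq; simpl; apply (RInt_point (V := R_CompleteNormedModule)). Qed.

Lemma cint_swap_order g a b c d : a <= b -> c <= d ->
  (forall x y, a <= x <= b -> c <= y <= d -> ccont2 g x y) ->
  cint (fun x => cint (g x) c d) a b = cint (fun y => cint (fun x => g x y) a b) c d.
Proof.
  intros Hab Hcd H. apply Ceq; simpl.
  - apply (RInt_swap_order (fun x y => fst (g x y))); auto. intros; now apply H.
  - apply (RInt_swap_order (fun x y => snd (g x y))); auto. intros; now apply H.
Qed.

(** Substitution [x = h t] with [h] increasing. *)
Lemma cint_comp f (h dh : R -> R) a b : a <= b -> h a <= h b ->
  (forall t, a <= t <= b -> ccont f (h t)) ->
  (forall t, a <= t <= b -> is_derive h t (dh t) /\ continuous dh t) ->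
  cint (fun t => (RtoC (dh t) * f (h t))%C) a b = cint f (h a) (h b).
Proof.
  intros Hab Hh Hf Hd. apply Ceq; simpl.
  - rewrite <- (RInt_comp (V := R_CompleteNormedModule) (fun t => fst (f t)) h dh a b).
    + apply RInt_ext; intros; unfold scal; simpl; unfold mult; simpl; ring.
    + intros t; rewrite Rmin_left, Rmax_right by lra; intros Ht; apply (Hf t Ht).
    + intros t; rewrite Rmin_left, Rmax_right by lra; intros Ht; apply (Hd t Ht).
  - rewrite <- (RInt_comp (V := R_CompleteNormedModule) (fun t => snd (f t)) h dh a b).
    + apply RInt_ext; intros; unfold scal; simpl; unfold mult; simpl; ring.
    + intros t; rewrite Rmin_left, Rmax_right by lra; intros Ht; apply (Hf t Ht).
    + intros t; rewrite Rmin_left, Rmax_right by lra; intros Ht; apply (Hd t Ht).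
Qed.

Lemma cint_zero (f : R -> C) (a b : R) : a <= b -> (forall x, a < x < b -> f x = 0%C) -> cint f a b = 0%C.
Proof.
  intros Hab H. rewrite (cint_ext f (fun _ => 0%C) a b Hab H).
  apply Ceq; simpl; rewrite rRInt_const; ring.
Qed.

(** * The recursion satisfied by the multiplier *)

(** Eventually [y (S k) <= q * y k + eps'] for some [q < 1] and an [eps'] of choice. *)
Lemma contraction_to_0 (al be y : nat -> R) (a : R) :
  a < 1 -> is_lim_seq al a -> is_lim_seq be 0 ->
  (forall k, 0 <= al k) -> (forall k, 0 <= y k) ->
  (forall k, y (S k) = al k * y k + be k) ->
  is_lim_seq y 0.
Proof.
  intros Ha Hal Hbe Al0 Y0 HS.
  set (q := Rmax (1/2) ((1 + a) / 2)).
  assert (Hq : 0 < q < 1 /\ a < q).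
  { unfold q. pose proof (Rmax_l (1/2) ((1+a)/2)). pose proof (Rmax_r (1/2) ((1+a)/2)).
    split; [split; [lra|apply Rmax_lub_lt; lra]|lra]. }
  destruct Hq as [Hq Haq].
  assert (E1 : exists N, forall k, (N <= k)%nat -> al k <= q).
  { assert (He : 0 < q - a) by lra.
    apply is_lim_seq_spec in Hal. destruct (Hal (mkposreal _ He)) as [N HN].
    exists N. intros k Hk. specialize (HN k Hk). simpl in HN. apply Rabs_def2 in HN. lra. }
  destruct E1 as [N1 HN1].
  apply is_lim_seq_spec. intros eps. pose proof (cond_pos eps) as He.
  assert (He2 : 0 < eps * (1 - q) / 2) by (apply Rdiv_lt_0_compat; [apply Rmult_lt_0_compat; lra|lra]).
  apply is_lim_seq_spec in Hbe. destruct (Hbe (mkposreal _ He2)) as [N2 HN2].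
  set (N := max N1 N2).
  assert (B : forall k, y (N + k)%nat <= eps / 2 + q ^ k * y N).
  { induction k as [|k IH].
    - rewrite Nat.add_0_r, pow_O. lra.
    - rewrite Nat.add_succ_r, HS.
      assert (al (N + k)%nat <= q) by (apply HN1; lia).
      assert (be (N + k)%nat < eps * (1 - q) / 2).
      { specialize (HN2 (N + k)%nat ltac:(lia)). simpl in HN2. apply Rabs_def2 in HN2. lra. }
      assert (al (N + k)%nat * y (N + k)%nat <= q * y (N + k)%nat)
        by (apply Rmult_le_compat_r; auto).
      simpl. nra. }
  assert (G : is_lim_seq (fun k => q ^ k * y N) 0).
  { replace (Finite 0) with (Rbar_mult 0 (y N)) by (simpl; f_equal; ring).
    apply is_lim_seq_scal_r. apply is_lim_seq_geom. rewrite Rabs_pos_eq; lra. }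
  apply is_lim_seq_spec in G.
  assert (He3 : 0 < eps / 2) by lra.
  destruct (G (mkposreal _ He3)) as [N3 HN3].
  exists (N + N3)%nat. intros k Hk.
  replace k with (N + (k - N))%nat by lia.
  specialize (B (k - N)%nat). specialize (HN3 (k - N)%nat ltac:(lia)). simpl in HN3.
  apply Rabs_def2 in HN3. rewrite Rminus_0_r, Rabs_pos_eq; auto. lra.
Qed.

(** One step [M(mu - 2) -> M(mu)] of the recursion
    [(mu + 1) mu M(mu) = s^2 (mu^2 - n^2) M(mu - 2) + (c mu - i n s)]. *)
Definition mult_next (n s c : R) (mu M : C) : C :=
  ((RtoC (s * s) * (mu * mu - RtoC (n * n)) * M + (RtoC c * mu - Ci * RtoC (n * s))) /
   ((mu + 1) * mu))%C.

Lemma Cmod_minus_ge (a b : C) : Cmod a - Cmod b <= Cmod (a - b).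
Proof.
  assert (Cmod a <= Cmod (a - b) + Cmod b).
  { replace a with ((a - b) + b)%C at 1 by ring. apply Cmod_triangle. }
  lra.
Qed.

Lemma Cmod_plus_ge (a b : C) : Cmod a - Cmod b <= Cmod (a + b).
Proof. replace (a + b)%C with (a - (- b))%C by ring. rewrite <- (Cmod_opp b). apply Cmod_minus_ge. Qed.

Lemma Cmod_sub_le (a b : C) : Cmod (a - b) <= Cmod a + Cmod b.
Proof. rewrite <- (Cmod_opp b). apply Cmod_triangle. Qed.

Lemma neq0_of_Cmod (z : C) (r : R) : 0 < r -> r <= Cmod z -> z <> 0%C.
Proof. intros Hr H. apply Cmod_gt_0. lra. Qed.

Lemma Cmod_div_le (a z : C) (A X : R) : z <> 0%C -> / Cmod z <= X -> Cmod a <= A ->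
  Cmod (a / z) <= A * X.
Proof.
  intros Hz HX HA. rewrite Cmod_div by auto. unfold Rdiv.
  apply Rmult_le_compat; auto; [apply Cmod_ge_0|].
  left; apply Rinv_0_lt_compat, Cmod_gt_0, Hz.
Qed.

Lemma inv_compare (x y k : R) : 0 < x -> 0 < k -> x <= k * y -> / y <= k * / x.
Proof.
  intros Hx Hk H. assert (0 < y) by nra.
  apply Rmult_le_reg_r with (x * y); [nra|]. field_simplify; lra.
Qed.

(** The coefficients of the recursion are [s^2 + O(1/mu)] and [c/mu + O(1/mu^2)], so
    that [M(mu) = 1/(c mu)] solves it up to [O(1/mu^2)] because [s^2 + c^2 = 1].  The
    second bound concerns the defect of the relation
    [M(mu') - 1/(c mu) = sig (M(mu) - 1/(c mu))] between the values of two solutions at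
    nearby points: multiplied by [|mu|], it is contracted by [s^2] up to [O(1/mu)]. *)
Lemma mult_next_bound (n s c S : R) : 0 < s < 1 -> 0 < c < 1 -> s * s + c * c = 1 -> 0 <= S ->
  exists B, 0 < B /\ forall mu mu' sig M0 M0' M1 M1' : C,
    1 / 2 <= Cmod mu -> 1 / 2 <= Cmod (mu + 1) -> 1 / 2 <= Cmod (mu - 2) ->
    Cmod (mu' - mu) <= 1 / 4 -> Cmod sig <= S ->
    M1 = mult_next n s c mu M0 -> M1' = mult_next n s c mu' M0' ->
    Cmod M1 <= s * s * (1 + B * / Cmod mu) * Cmod M0 + B * / Cmod mu /\
    Cmod mu * Cmod (M1' - sig * M1 - (1 - sig) / (RtoC c * mu)) <=
      s * s * (1 + B * / Cmod mu) *
        (Cmod (mu - 2) * Cmod (M0' - sig * M0 - (1 - sig) / (RtoC c * (mu - 2))))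
      + B * (1 + Cmod M0) * / Cmod mu.
Proof.
  intros Hs Hc Hsc HS.
  set (n2 := n * n). assert (Hn2 : 0 <= n2) by (unfold n2; nra).
  set (K1 := 10 * (2 * n2 + 1)).
  set (K2 := 10 * n2 + 100 * (n2 + 1)).
  set (a := c + Rabs n * s).
  assert (Ha : 0 < a) by (unfold a; pose proof (Rabs_pos n); nra).
  set (K3 := 100 * a + 10 * c).
  set (K5 := K2 * S + (1 + S) * / c * (10 * K1 + 20) + K3 + S * (10 * a)).
  assert (HK1 : 0 < K1) by (unfold K1; lra).
  assert (HK2 : 0 < K2) by (unfold K2; lra).
  assert (HK3 : 0 < K3) by (unfold K3; lra).
  assert (Hic : 0 < / c) by (apply Rinv_0_lt_compat; lra).
  assert (HK5 : 0 < K5).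
  { unfold K5. assert (0 <= K2 * S) by nra. assert (0 <= S * (10 * a)) by nra.
    assert (0 < (1 + S) * / c * (10 * K1 + 20)).
    { apply Rmult_lt_0_compat; [|lra]. apply Rmult_lt_0_compat; lra. }
    lra. }
  assert (HSa : 0 <= S * (10 * a)) by nra.
  assert (HKS : 0 <= K2 * S) by nra.
  assert (HSc : 0 < (1 + S) * / c * (10 * K1 + 20)).
  { apply Rmult_lt_0_compat; [|lra]. apply Rmult_lt_0_compat; lra. }
  assert (Hss : 0 < s * s < 1) by nra.
  exists (K1 + 20 + 40 * K1 + 10 * a + 10 * c + K5 + 20 * a + c).
  set (B := K1 + 20 + 40 * K1 + 10 * a + 10 * c + K5 + 20 * a + c).
  assert (HB : 0 < B) by (unfold B; lra). split; [exact HB|].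
  intros mu mu' sig M0 M0' M1 M1' Hm Hm1 Hm2 Hz Hsig E1 E1'.
  set (X := / Cmod mu).
  assert (Hmp : 0 < Cmod mu) by lra.
  assert (HX : 0 < X) by (apply Rinv_0_lt_compat; lra).
  assert (HXm : Cmod mu * X = 1) by (unfold X; field; lra).
  assert (HX2 : X <= 2) by nra.
  assert (C1 : Cmod 1%C = 1) by exact Cmod_1.
  assert (C2 : Cmod 2%C = 2) by (rewrite Cmod_R, Rabs_pos_eq; lra).
  assert (HXX : 0 < X * X) by (apply Rmult_lt_0_compat; lra).
  assert (HnX : 0 <= n2 * X) by (apply Rmult_le_pos; lra).
  assert (HnXX : 0 <= n2 * (X * X)) by (apply Rmult_le_pos; lra).
  assert (HaXX : 0 < a * (X * X)) by (apply Rmult_lt_0_compat; lra).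
  assert (HcXX : 0 < c * (X * X)) by (apply Rmult_lt_0_compat; lra).
  assert (G1 : Cmod mu <= 10 * Cmod (mu + 1)).
  { pose proof (Cmod_plus_ge mu 1). rewrite C1 in H. lra. }
  assert (G2 : Cmod mu <= 10 * Cmod mu').
  { pose proof (Cmod_plus_ge mu (mu' - mu)). replace (mu + (mu' - mu))%C with mu' in H by ring. lra. }
  assert (G3 : Cmod mu <= 10 * Cmod (mu' + 1)).
  { pose proof (Cmod_plus_ge (mu + 1) (mu' - mu)) as H.
    replace (mu + 1 + (mu' - mu))%C with (mu' + 1)%C in H by ring.
    pose proof (Cmod_plus_ge mu 1) as H'. rewrite C1 in H'. lra. }
  assert (G4 : Cmod mu <= Cmod (mu - 2) + 2).
  { pose proof (Cmod_minus_ge mu 2) as H. rewrite C2 in H. lra. }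
  assert (G5 : Cmod mu <= 10 * Cmod (mu - 2)) by lra.
  assert (N0 : mu <> 0%C) by (apply neq0_of_Cmod with (1/2); lra).
  assert (N1 : (mu + 1)%C <> 0%C) by (apply neq0_of_Cmod with (1/2); lra).
  assert (N2 : mu' <> 0%C) by (apply neq0_of_Cmod with (1/20); lra).
  assert (N3 : (mu' + 1)%C <> 0%C) by (apply neq0_of_Cmod with (1/20); lra).
  assert (N4 : (mu - 2)%C <> 0%C) by (apply neq0_of_Cmod with (1/2); lra).
  assert (Nc : RtoC c <> 0%C) by (intros H; apply RtoC_inj in H; lra).
  assert (I1 : / Cmod (mu + 1) <= 10 * X) by (apply inv_compare; lra).
  assert (I2 : / Cmod mu' <= 10 * X) by (apply inv_compare; lra).
  assert (I3 : / Cmod (mu' + 1) <= 10 * X) by (apply inv_compare; lra).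
  assert (I5 : / Cmod (mu - 2) <= 10 * X) by (apply inv_compare; lra).
  assert (I0 : / Cmod mu <= X) by (unfold X; lra).
  assert (Mn2 : Cmod (RtoC n2) <= n2) by (rewrite Cmod_R, Rabs_pos_eq; lra).
  assert (Mn3 : Cmod (RtoC n2 - 1) <= n2 + 1).
  { eapply Rle_trans; [apply Cmod_sub_le|]. rewrite C1; lra. }
  assert (Mn4 : Cmod (RtoC c + Ci * RtoC (n * s)) <= a).
  { eapply Rle_trans; [apply Cmod_triangle|]. rewrite Cmod_mult, Cmod_Ci, !Cmod_R, Rabs_mult.
    rewrite (Rabs_pos_eq s), (Rabs_pos_eq c) by lra. unfold a; lra. }
  set (rho := fun m : C => (1 - RtoC n2 / m + (RtoC n2 - 1) / (m + 1))%C).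
  set (dl := (mu' - mu)%C).
  assert (R1 : Cmod (rho mu - 1) <= K1 * X).
  { unfold rho. replace (_ - 1)%C with (- (RtoC n2 / mu) + (RtoC n2 - 1) / (mu + 1))%C by ring.
    eapply Rle_trans; [apply Cmod_triangle|]. rewrite Cmod_opp.
    pose proof (Cmod_div_le _ _ _ _ N0 I0 Mn2). pose proof (Cmod_div_le _ _ _ _ N1 I1 Mn3).
    unfold K1. lra. }
  assert (R2 : Cmod (rho mu' - 1) <= K1 * X).
  { unfold rho. replace (_ - 1)%C with (- (RtoC n2 / mu') + (RtoC n2 - 1) / (mu' + 1))%C by ring.
    eapply Rle_trans; [apply Cmod_triangle|]. rewrite Cmod_opp.
    pose proof (Cmod_div_le _ _ _ _ N2 I2 Mn2). pose proof (Cmod_div_le _ _ _ _ N3 I3 Mn3).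
    unfold K1. lra. }
  assert (R3 : Cmod (rho mu' - rho mu) <= K2 * X * X).
  { replace (rho mu' - rho mu)%C with
      (RtoC n2 * dl / mu' / mu + - ((RtoC n2 - 1) * dl / (mu' + 1) / (mu + 1)))%C.
    2:{ unfold rho, dl. field. auto. }
    eapply Rle_trans; [apply Cmod_triangle|]. rewrite Cmod_opp.
    assert (P1 : Cmod (RtoC n2 * dl) <= n2 * 1).
    { rewrite Cmod_mult. apply Rmult_le_compat; try apply Cmod_ge_0; auto. unfold dl; lra. }
    assert (P2 : Cmod ((RtoC n2 - 1) * dl) <= (n2 + 1) * 1).
    { rewrite Cmod_mult. apply Rmult_le_compat; try apply Cmod_ge_0; auto. unfold dl; lra. }
    pose proof (Cmod_div_le _ _ _ _ N0 I0 (Cmod_div_le _ _ _ _ N2 I2 P1)).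
    pose proof (Cmod_div_le _ _ _ _ N1 I1 (Cmod_div_le _ _ _ _ N3 I3 P2)).
    unfold K2. lra. }
  set (kap := fun m : C => (RtoC c / m - (RtoC c + Ci * RtoC (n * s)) / m / (m + 1))%C).
  assert (Q1 : Cmod (kap mu - RtoC c / mu) <= 10 * a * X * X).
  { unfold kap. replace (_ - RtoC c / mu)%C with (- ((RtoC c + Ci * RtoC (n * s)) / mu / (mu + 1)))%C by ring.
    rewrite Cmod_opp.
    pose proof (Cmod_div_le _ _ _ _ N1 I1 (Cmod_div_le _ _ _ _ N0 I0 Mn4)). lra. }
  assert (Mc : Cmod (RtoC c) <= c) by (rewrite Cmod_R, Rabs_pos_eq; lra).
  assert (Q2 : Cmod (kap mu' - RtoC c / mu) <= K3 * X * X).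
  { unfold kap. replace (_ - RtoC c / mu)%C with
      (- ((RtoC c + Ci * RtoC (n * s)) / mu' / (mu' + 1)) + - (RtoC c * dl / mu' / mu))%C.
    2:{ unfold dl; field; auto. }
    eapply Rle_trans; [apply Cmod_triangle|]. rewrite !Cmod_opp.
    pose proof (Cmod_div_le _ _ _ _ N3 I3 (Cmod_div_le _ _ _ _ N2 I2 Mn4)).
    assert (P1 : Cmod (RtoC c * dl) <= c * 1).
    { rewrite Cmod_mult. apply Rmult_le_compat; try apply Cmod_ge_0; auto. unfold dl; lra. }
    pose proof (Cmod_div_le _ _ _ _ N0 I0 (Cmod_div_le _ _ _ _ N2 I2 P1)).
    unfold K3. lra. }
  assert (F1 : M1 = (RtoC (s * s) * rho mu * M0 + kap mu)%C).
  { rewrite E1. unfold mult_next, rho, kap. fold n2. rewrite RtoC_mult. field. auto. }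
  assert (F1' : M1' = (RtoC (s * s) * rho mu' * M0' + kap mu')%C).
  { rewrite E1'. unfold mult_next, rho, kap. fold n2. rewrite RtoC_mult. field. auto. }
  assert (Mss : Cmod (RtoC (s * s)) = s * s) by (rewrite Cmod_R, Rabs_pos_eq; lra).
  assert (T1 : Cmod (rho mu) <= 1 + K1 * X).
  { replace (rho mu) with (1 + (rho mu - 1))%C by ring.
    eapply Rle_trans; [apply Cmod_triangle|]. rewrite C1; lra. }
  assert (T2 : Cmod (rho mu') <= 1 + K1 * X).
  { replace (rho mu') with (1 + (rho mu' - 1))%C by ring.
    eapply Rle_trans; [apply Cmod_triangle|]. rewrite C1; lra. }
  pose proof (Cmod_ge_0 M0) as PM0.
  split.
  - rewrite F1. eapply Rle_trans; [apply Cmod_triangle|].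
    rewrite !Cmod_mult, Mss.
    assert (U1 : Cmod (kap mu) <= B * X).
    { replace (kap mu) with (RtoC c / mu + (kap mu - RtoC c / mu))%C by ring.
      eapply Rle_trans; [apply Cmod_triangle|].
      pose proof (Cmod_div_le _ _ _ _ N0 I0 Mc).
      assert (0 <= a * X) by (apply Rmult_le_pos; lra).
      pose proof (Rmult_le_compat_l (10 * (a * X)) X 2 ltac:(lra) HX2).
      assert ((20 * a + c) * X <= B * X) by (apply Rmult_le_compat_r; unfold B; lra). lra. }
    assert (U2 : s * s * Cmod (rho mu) * Cmod M0 <= s * s * (1 + B * X) * Cmod M0).
    { apply Rmult_le_compat_r; auto. apply Rmult_le_compat_l; [lra|].
      assert (K1 * X <= B * X) by (apply Rmult_le_compat_r; unfold B; lra). lra. }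
    lra.
  - set (D0 := (M0' - sig * M0 - (1 - sig) / (RtoC c * (mu - 2)))%C).
    assert (ID : (M1' - sig * M1 - (1 - sig) / (RtoC c * mu))%C =
      (RtoC (s * s) * rho mu' * D0 +
       (RtoC (s * s) * sig * (rho mu' - rho mu) * M0 +
        ((1 - sig) * (RtoC (s * s) / RtoC c) * ((rho mu' - 1) / (mu - 2) + 2 / (mu - 2) / mu) +
         ((kap mu' - RtoC c / mu) - sig * (kap mu - RtoC c / mu)))))%C).
    { assert (Hcs : RtoC c = ((1 - RtoC (s * s)) / RtoC c)%C).
      { replace (1 - RtoC (s * s))%C with (RtoC (c * c)).
        - rewrite RtoC_mult. field. auto.
        - rewrite <- RtoC_minus. f_equal. lra. }
      rewrite F1, F1'. unfold D0.
      transitivity (RtoC (s * s) * rho mu' * M0' + kap mu' - sig * (RtoC (s * s) * rho mu * M0 + kap mu)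
         - (1 - sig) * (1 / (RtoC c * mu)))%C; [field; auto|].
      replace (1 / (RtoC c * mu))%C with ((RtoC (s * s) / RtoC c) / mu + RtoC c / mu)%C.
      2:{ rewrite Hcs at 2. field; auto. }
      field; auto. }
    assert (SB : Cmod (1 - sig) <= 1 + S).
    { eapply Rle_trans; [apply Cmod_sub_le|]. rewrite C1; lra. }
    assert (V1 : Cmod (RtoC (s * s) * sig * (rho mu' - rho mu) * M0) <= K2 * S * X * X * Cmod M0).
    { rewrite !Cmod_mult, Mss. apply Rmult_le_compat_r; auto.
      assert (s * s * Cmod sig <= S).
      { apply Rle_trans with (1 * Cmod sig); [|lra].
        apply Rmult_le_compat_r; [apply Cmod_ge_0|lra]. }
      assert (0 <= s * s * Cmod sig) by (apply Rmult_le_pos; [lra|apply Cmod_ge_0]).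
      replace (K2 * S * X * X) with (S * (K2 * X * X)) by ring.
      apply Rmult_le_compat; auto; apply Cmod_ge_0. }
    assert (V2 : Cmod ((1 - sig) * (RtoC (s * s) / RtoC c) * ((rho mu' - 1) / (mu - 2) + 2 / (mu - 2) / mu))
                 <= (1 + S) * / c * (10 * K1 + 20) * X * X).
    { rewrite !Cmod_mult.
      assert (W1 : Cmod (RtoC (s * s) / RtoC c) <= / c).
      { rewrite Cmod_div by auto. rewrite Mss, Cmod_R, Rabs_pos_eq by lra.
        apply Rmult_le_reg_r with c; [lra|]. field_simplify; lra. }
      assert (W2 : Cmod ((rho mu' - 1) / (mu - 2) + 2 / (mu - 2) / mu) <= (10 * K1 + 20) * X * X).
      { eapply Rle_trans; [apply Cmod_triangle|].
        pose proof (Cmod_div_le _ _ _ _ N4 I5 R2).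
        assert (P : Cmod 2%C <= 2) by lra.
        pose proof (Cmod_div_le _ _ _ _ N0 I0 (Cmod_div_le _ _ _ _ N4 I5 P)). lra. }
      replace ((1 + S) * / c * (10 * K1 + 20) * X * X) with ((1 + S) * / c * ((10 * K1 + 20) * X * X)) by ring.
      apply Rmult_le_compat; auto; try apply Cmod_ge_0.
      - apply Rmult_le_pos; apply Cmod_ge_0.
      - apply Rmult_le_compat; auto; apply Cmod_ge_0. }
    assert (V3 : Cmod ((kap mu' - RtoC c / mu) - sig * (kap mu - RtoC c / mu)) <= (K3 + S * (10 * a)) * X * X).
    { eapply Rle_trans; [apply Cmod_sub_le|]. rewrite Cmod_mult.
      assert (Cmod sig * Cmod (kap mu - RtoC c / mu) <= S * (10 * a * X * X))
        by (apply Rmult_le_compat; auto; apply Cmod_ge_0).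
      lra. }
    assert (V : Cmod (M1' - sig * M1 - (1 - sig) / (RtoC c * mu)) <=
       s * s * (1 + K1 * X) * Cmod D0 + K5 * (1 + Cmod M0) * X * X).
    { rewrite ID.
      eapply Rle_trans; [apply Cmod_triangle|]. apply Rplus_le_compat.
      - rewrite !Cmod_mult, Mss. apply Rmult_le_compat_r; [apply Cmod_ge_0|].
        apply Rmult_le_compat_l; lra.
      - eapply Rle_trans; [apply Cmod_triangle|].
        pose proof (Cmod_triangle ((1 - sig) * (RtoC (s * s) / RtoC c) * ((rho mu' - 1) / (mu - 2) + 2 / (mu - 2) / mu))
           ((kap mu' - RtoC c / mu) - sig * (kap mu - RtoC c / mu))) as TT.
        assert (Z1 : K2 * S * X * X * Cmod M0 <= K5 * X * X * Cmod M0).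
        { apply Rmult_le_compat_r; auto.
          replace (K2 * S * X * X) with (K2 * S * (X * X)) by ring.
          replace (K5 * X * X) with (K5 * (X * X)) by ring.
          apply Rmult_le_compat_r; [lra|unfold K5; lra]. }
        assert (Z2 : (1 + S) * / c * (10 * K1 + 20) * X * X + (K3 + S * (10 * a)) * X * X <= K5 * X * X).
        { replace (_ + _) with (((1 + S) * / c * (10 * K1 + 20) + (K3 + S * (10 * a))) * (X * X)) by ring.
          replace (K5 * X * X) with (K5 * (X * X)) by ring.
          apply Rmult_le_compat_r; [lra|]. unfold K5; lra. }
        lra. }
    fold X. fold D0.
    assert (GM : Cmod mu <= (1 + 20 * X) * Cmod (mu - 2)).
    { pose proof (Rmult_le_compat_l X _ _ (Rlt_le _ _ HX) G5). lra. }
    pose proof (Cmod_ge_0 D0) as PD0.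
    assert (GB : (1 + K1 * X) * (1 + 20 * X) <= 1 + B * X).
    { assert (0 <= K1 * X) by (apply Rmult_le_pos; lra).
      pose proof (Rmult_le_compat_l (20 * (K1 * X)) X 2 ltac:(lra) HX2).
      assert ((K1 + 20 + 40 * K1) * X <= B * X) by (apply Rmult_le_compat_r; unfold B; lra). lra. }
    assert (L1 : Cmod mu * (s * s * (1 + K1 * X) * Cmod D0) <=
                 s * s * (1 + B * X) * (Cmod (mu - 2) * Cmod D0)).
    { replace (Cmod mu * (s * s * (1 + K1 * X) * Cmod D0)) with
        (s * s * ((1 + K1 * X) * Cmod mu) * Cmod D0) by ring.
      replace (s * s * (1 + B * X) * (Cmod (mu - 2) * Cmod D0)) with
        (s * s * ((1 + B * X) * Cmod (mu - 2)) * Cmod D0) by ring.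
      apply Rmult_le_compat_r; auto. apply Rmult_le_compat_l; [lra|].
      apply Rle_trans with ((1 + K1 * X) * ((1 + 20 * X) * Cmod (mu - 2))).
      - apply Rmult_le_compat_l; [|exact GM].
        assert (0 <= K1 * X) by (apply Rmult_le_pos; lra). lra.
      - rewrite <- Rmult_assoc. apply Rmult_le_compat_r; [lra|exact GB]. }
    assert (L2 : Cmod mu * (K5 * (1 + Cmod M0) * X * X) <= B * (1 + Cmod M0) * X).
    { replace (Cmod mu * (K5 * (1 + Cmod M0) * X * X)) with
        ((Cmod mu * X) * (K5 * ((1 + Cmod M0) * X))) by ring.
      rewrite HXm. rewrite Rmult_1_l.
      replace (B * (1 + Cmod M0) * X) with (B * ((1 + Cmod M0) * X)) by ring.
      apply Rmult_le_compat_r; [apply Rmult_le_pos; lra|unfold B; lra]. }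
    assert (L3 := Rmult_le_compat_l _ _ _ (Cmod_ge_0 mu) V). rewrite Rmult_plus_distr_l in L3. lra.
Qed.

Definition stepped (mu0 : C) (k : nat) : C := (mu0 + RtoC (2 * INR k))%C.

Lemma stepped_S mu0 k : (stepped mu0 (S k) - 2)%C = stepped mu0 k.
Proof. unfold stepped. rewrite S_INR. apply Ceq; simpl; ring. Qed.

(** The majorant of a sequence with [y (S k) <= al k * y k + be k]. *)
Fixpoint affine_rec (al be : nat -> R) (y0 : R) (k : nat) : R :=
  match k with 0%nat => y0 | S j => al j * affine_rec al be y0 j + be j end.

Lemma affine_rec_pos al be y0 : 0 <= y0 -> (forall k, 0 <= al k) -> (forall k, 0 <= be k) ->
  forall k, 0 <= affine_rec al be y0 k.
Proof.
  intros H0 Ha Hb; induction k; simpl; auto.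
  apply Rplus_le_le_0_compat; auto. apply Rmult_le_pos; auto.
Qed.

Lemma is_lim_seq_inv_step : is_lim_seq (fun k => / Rmax (1 / 2) (2 * INR k - 6)) 0.
Proof.
  apply is_lim_seq_spec. intros eps. pose proof (cond_pos eps).
  destruct (nfloor_ex (/ eps)) as [N [_ HN]]; [left; now apply Rinv_0_lt_compat|].
  exists (N + 7)%nat. intros k Hk.
  assert (INR N + 7 <= INR k).
  { apply le_INR in Hk. rewrite plus_INR in Hk. simpl in Hk. lra. }
  pose proof (Rmax_r (1/2) (2 * INR k - 6)). pose proof (pos_INR N).
  rewrite Rminus_0_r, Rabs_pos_eq.
  - rewrite <- (Rinv_inv eps). apply Rinv_lt_contravar.
    + apply Rmult_lt_0_compat; [now apply Rinv_0_lt_compat|lra].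
    + lra.
  - left; apply Rinv_0_lt_compat. lra.
Qed.

(** Over many steps the defect of [mult_next_bound] tends to zero, faster than
    [1/|mu|].  The point is the uniformity: [K] depends on the initial values only
    through the bound [B0].  The real parts are at least [2 k - 6], whence the
    majorants for [1/|mu|]. *)
Lemma mult_slow_limit (n s c S0 B0 : R) : 0 < s < 1 -> 0 < c < 1 -> s * s + c * c = 1 ->
  0 <= S0 -> 0 <= B0 -> forall eta, 0 < eta ->
  exists K : nat, forall (mu0 zeta sig : C) (M M' : nat -> C),
    (forall k, 1 / 2 <= Cmod (stepped mu0 k)) ->
    (forall k, 1 / 2 <= Cmod (stepped mu0 k + 1)) ->
    Cmod zeta <= 1 / 4 -> Cmod sig <= S0 -> -6 <= fst mu0 ->
    (forall k, M (S k) = mult_next n s c (stepped mu0 (S k)) (M k)) ->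
    (forall k, M' (S k) = mult_next n s c (stepped mu0 (S k) + zeta)%C (M' k)) ->
    Cmod (M 0%nat) <= B0 ->
    Cmod mu0 * Cmod (M' 0%nat - sig * M 0%nat - (1 - sig) / (RtoC c * mu0)) <= B0 ->
    forall k, (K <= k)%nat ->
    Cmod (stepped mu0 k) *
      Cmod (M' k - sig * M k - (1 - sig) / (RtoC c * stepped mu0 k)) <= eta.
Proof.
  intros Hs Hc Hsc HS HB0 eta Heta.
  destruct (mult_next_bound n s c S0 Hs Hc Hsc HS) as [B [HB HM]].
  set (xi := fun k => / Rmax (1 / 2) (2 * INR k - 6)).
  assert (Hxi : forall k, 0 < xi k).
  { intros k. apply Rinv_0_lt_compat. pose proof (Rmax_l (1/2) (2 * INR k - 6)). lra. }
  assert (Lxi : is_lim_seq (fun k => xi (S k)) 0) by (apply (is_lim_seq_incr_1 xi), is_lim_seq_inv_step).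
  set (al := fun k => s * s * (1 + B * xi (S k))).
  assert (Hal : forall k, 0 <= al k).
  { intros k. unfold al. pose proof (Hxi (S k)). apply Rmult_le_pos; [nra|].
    pose proof (Rmult_lt_0_compat _ _ HB H). lra. }
  assert (Lal : is_lim_seq al (s * s)).
  { unfold al. replace (Finite (s * s)) with (Finite (s * s * (1 + B * 0))) by (f_equal; ring).
    apply is_lim_seq_mult'; [apply is_lim_seq_const|].
    apply is_lim_seq_plus'; [apply is_lim_seq_const|].
    apply is_lim_seq_mult'; [apply is_lim_seq_const|exact Lxi]. }
  set (be1 := fun k => B * xi (S k)).
  assert (Hbe1 : forall k, 0 <= be1 k).
  { intros k. unfold be1. pose proof (Hxi (S k)). left. now apply Rmult_lt_0_compat. }
  assert (Lbe1 : is_lim_seq be1 0).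
  { unfold be1. replace (Finite 0) with (Finite (B * 0)) by (f_equal; ring).
    apply is_lim_seq_mult'; [apply is_lim_seq_const|exact Lxi]. }
  set (y1 := affine_rec al be1 B0).
  assert (Hy1 : forall k, 0 <= y1 k) by (apply affine_rec_pos; auto).
  assert (Ly1 : is_lim_seq y1 0).
  { apply (contraction_to_0 al be1 y1 (s * s)); auto. nra. }
  set (be2 := fun k => B * (1 + y1 k) * xi (S k)).
  assert (Hbe2 : forall k, 0 <= be2 k).
  { intros k. unfold be2. pose proof (Hxi (S k)). pose proof (Hy1 k).
    apply Rmult_le_pos; [|lra]. apply Rmult_le_pos; lra. }
  assert (Lbe2 : is_lim_seq be2 0).
  { unfold be2. replace (Finite 0) with (Finite (B * (1 + 0) * 0)) by (f_equal; ring).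
    apply is_lim_seq_mult'; [|exact Lxi].
    apply is_lim_seq_mult'; [apply is_lim_seq_const|].
    apply is_lim_seq_plus'; [apply is_lim_seq_const|exact Ly1]. }
  set (y2 := affine_rec al be2 B0).
  assert (Ly2 : is_lim_seq y2 0).
  { apply (contraction_to_0 al be2 y2 (s * s)); auto; [nra|]. apply affine_rec_pos; auto. }
  apply is_lim_seq_spec in Ly2. destruct (Ly2 (mkposreal _ Heta)) as [K HK].
  exists K. intros mu0 zeta sig M M' H1 H2 Hz Hsig Hre HMk HMk' M00 D00 k Hk.
  assert (Hinv : forall j, / Cmod (stepped mu0 j) <= xi j).
  { intros j. unfold xi. apply Rinv_le_contravar.
    - pose proof (Rmax_l (1/2) (2 * INR j - 6)). lra.
    - apply Rmax_lub; [apply H1|].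
      eapply Rle_trans; [|apply fst_le_Cmod]. eapply Rle_trans; [|apply Rle_abs].
      unfold stepped; simpl. lra. }
  set (D := fun j => (M' j - sig * M j - (1 - sig) / (RtoC c * stepped mu0 j))%C).
  assert (ss0 : 0 < s * s) by nra.
  assert (Rec : forall j, Cmod (M j) <= y1 j /\ Cmod (stepped mu0 j) * Cmod (D j) <= y2 j).
  { induction j as [|j [IH1 IH2]].
    - split; [exact M00|]. unfold D.
      replace (stepped mu0 0) with mu0 by (unfold stepped; apply Ceq; simpl; ring). exact D00.
    - destruct (HM (stepped mu0 (S j)) (stepped mu0 (S j) + zeta)%C sig (M j) (M' j) (M (S j)) (M' (S j)))
        as [A1 A2]; auto.
      + rewrite stepped_S. apply H1.
      + replace (stepped mu0 (S j) + zeta - stepped mu0 (S j))%C with zeta by ring. exact Hz.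
      + rewrite stepped_S in A2.
        pose proof (Hinv (S j)) as HI. pose proof (Cmod_ge_0 (M j)).
        assert (BI : B * / Cmod (stepped mu0 (S j)) <= B * xi (S j)) by (apply Rmult_le_compat_l; lra).
        assert (AI : s * s * (1 + B * / Cmod (stepped mu0 (S j))) <= al j)
          by (unfold al; apply Rmult_le_compat_l; lra).
        assert (AI0 : 0 <= s * s * (1 + B * / Cmod (stepped mu0 (S j)))).
        { apply Rmult_le_pos; [lra|].
          assert (0 < / Cmod (stepped mu0 (S j))) by (apply Rinv_0_lt_compat; specialize (H1 (S j)); lra).
          pose proof (Rmult_lt_0_compat _ _ HB H0). lra. }
        split.
        * eapply Rle_trans; [exact A1|]. simpl. apply Rplus_le_compat; [|exact BI].
          apply Rmult_le_compat; auto.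
        * eapply Rle_trans; [exact A2|]. simpl. apply Rplus_le_compat.
          -- apply Rmult_le_compat; auto. apply Rmult_le_pos; apply Cmod_ge_0.
          -- unfold be2. apply Rmult_le_compat; auto.
             ++ apply Rmult_le_pos; lra.
             ++ left; apply Rinv_0_lt_compat; specialize (H1 (S j)); lra.
             ++ apply Rmult_le_compat_l; lra. }
  destruct (Rec k) as [_ R2]. specialize (HK k Hk). simpl in HK.
  apply Rabs_def2 in HK. unfold D in R2. lra.
Qed.

(** ** A sum of two exponentials is not small on two concentric circles *)

Lemma cexp_sub1_bound a : Cmod (cexp a - 1) <= 2 * Cmod a * exp (Cmod a).
Proof.
  assert (E : (cexp a - 1)%C = cint (fun t => (a * cexp (RtoC t * a))%C) 0 1).
  { rewrite (cint_derive (fun t => cexp (RtoC t * a)%C)).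
    - replace (RtoC 1 * a)%C with a by ring. replace (RtoC 0 * a)%C with (RtoC 0) by ring.
      now rewrite cexp_0.
    - lra.
    - intros t _. apply (cder_cexp (fun t => (RtoC t * a)%C)).
      eapply cder_eq; [apply cder_mult; [apply cder_RtoC; apply (is_derive_id (K := R_AbsRing))|apply cder_const]|].
      apply Ceq; unfold one; simpl; ring.
    - intros t _. apply ccont_mult; [apply ccont_const|]. apply ccont_cexp.
      apply ccont_mult; [apply ccont_RtoC, continuous_id|apply ccont_const]. }
  rewrite E.
  eapply Rle_trans; [apply (cint_bound _ (Cmod a * exp (Cmod a)))|].
  - lra.
  - intros t _. apply ccont_mult; [apply ccont_const|]. apply ccont_cexp.
    apply ccont_mult; [apply ccont_RtoC, continuous_id|apply ccont_const].
  - intros t Ht. rewrite Cmod_mult, Cmod_cexp. apply Rmult_le_compat_l; [apply Cmod_ge_0|].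
    simpl. assert (t * fst a - 0 * snd a <= Cmod a).
    { pose proof (fst_le_Cmod a). pose proof (Rle_abs (fst a)). pose proof (Cmod_ge_0 a). nra. }
    destruct H; [left; now apply exp_increasing|rewrite H; lra].
  - lra.
Qed.

(** By the first order Taylor formula [exp a - exp b - (a - b)] is the integral of
    [(a - b) (exp w - 1)] over the segment from [b] to [a], where [exp w - 1] is small. *)
Lemma cexp_sub_lower a b : Cmod a <= 1 / 16 -> Cmod b <= 1 / 16 ->
  Cmod (a - b) / 4 <= Cmod (cexp a - cexp b).
Proof.
  intros Ha Hb.
  set (F := fun t : R => (cexp (b + RtoC t * (a - b)) - RtoC t * (a - b))%C).
  assert (Hc : forall t, ccont (fun t => cexp (b + RtoC t * (a - b))%C) t).
  { intros t. apply ccont_cexp, ccont_plus; [apply ccont_const|].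
    apply ccont_mult; [apply ccont_RtoC, continuous_id|apply ccont_const]. }
  assert (E : (cexp a - cexp b - (a - b))%C =
     cint (fun t => ((a - b) * (cexp (b + RtoC t * (a - b)) - 1))%C) 0 1).
  { rewrite (cint_derive F).
    - unfold F. replace (b + RtoC 1 * (a - b))%C with a by ring.
      replace (b + RtoC 0 * (a - b))%C with b by ring. ring.
    - lra.
    - intros t _. unfold F. eapply cder_eq.
      + apply cder_minus.
        * apply cder_cexp. apply cder_plus; [apply cder_const|].
          apply cder_mult; [apply cder_RtoC; apply (is_derive_id (K := R_AbsRing))|apply cder_const].
        * apply cder_mult; [apply cder_RtoC; apply (is_derive_id (K := R_AbsRing))|apply cder_const].
      + unfold one; simpl. ring.
    - intros t _. apply ccont_mult; [apply ccont_const|].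
      apply ccont_minus; [apply Hc|apply ccont_const]. }
  assert (Bd : Cmod (cexp a - cexp b - (a - b)) <= Cmod (a - b) * (3 / 4)).
  { rewrite E. eapply Rle_trans; [apply (cint_bound _ (Cmod (a - b) * (3 / 8)))|].
    - lra.
    - intros t _. apply ccont_mult; [apply ccont_const|].
      apply ccont_minus; [apply Hc|apply ccont_const].
    - intros t Ht. rewrite Cmod_mult. apply Rmult_le_compat_l; [apply Cmod_ge_0|].
      set (w := (b + RtoC t * (a - b))%C).
      assert (Hw : Cmod w <= 1 / 16).
      { replace w with (RtoC (1 - t) * b + RtoC t * a)%C by (unfold w; apply Ceq; simpl; ring).
        eapply Rle_trans; [apply Cmod_triangle|]. rewrite !Cmod_mult, !Cmod_R, !Rabs_pos_eq by lra. nra. }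
      eapply Rle_trans; [apply cexp_sub1_bound|].
      assert (exp (Cmod w) <= 3).
      { apply Rle_trans with (exp 1); [|apply exp_le_3].
        left; apply exp_increasing; lra. }
      pose proof (Cmod_ge_0 w). pose proof (exp_pos (Cmod w)). nra.
    - lra. }
  pose proof (Cmod_plus_ge (a - b) (cexp a - cexp b - (a - b))) as H.
  replace (a - b + (cexp a - cexp b - (a - b)))%C with (cexp a - cexp b)%C in H by ring.
  lra.
Qed.

(** If the function came close to zero at a point of either circle, then [B] times the
    difference of the two exponentials would be small.  The points are at least [r / 2]
    apart, so the exponentials are not close; hence [B] would be small, and with it [A]. *)
Lemma two_circles (W t r : R) : 0 < W -> 0 < t -> 0 < r -> W * r <= 1 / 16 ->
  exists c1, 0 < c1 /\ forall (A B : C) (m : C -> C) (l : R), 0 < l ->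
    Cmod A = t * l ->
    (forall z, Cmod z <= r -> Cmod (m z - (A + B * cexp (RtoC (- W) * z))) <= c1 * l) ->
    (forall z, Cmod z = r -> c1 * l <= Cmod (m z)) \/
    (forall z, Cmod z = r / 2 -> c1 * l <= Cmod (m z)).
Proof.
  intros HW Ht Hr HWr.
  assert (Hkap : 0 < W * r) by nra.
  set (c1 := t / (2 * (2 + 64 / (W * r)))).
  assert (Hden : 0 < 2 + 64 / (W * r)).
  { assert (0 < 64 / (W * r)) by (apply Rdiv_lt_0_compat; lra). lra. }
  assert (Hc1 : 0 < c1) by (unfold c1; apply Rdiv_lt_0_compat; lra).
  exists c1; split; [exact Hc1|].
  intros A B m l Hl HA Hm.
  destruct (Classical_Prop.classic (forall z, Cmod z = r -> c1 * l <= Cmod (m z))) as [|N1]; [now left|].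
  right. intros z2 Hz2. apply Rnot_lt_le. intros N2.
  apply N1. intros z1 Hz1. apply Rnot_lt_le. intros N3.
  assert (E1 := Hm z1 ltac:(lra)). assert (E2 := Hm z2 ltac:(lra)).
  set (e1 := cexp (RtoC (- W) * z1)) in *. set (e2 := cexp (RtoC (- W) * z2)) in *.
  assert (S1 : Cmod (A + B * e1) < 2 * c1 * l).
  { replace (A + B * e1)%C with (m z1 - (m z1 - (A + B * e1)))%C by ring.
    eapply Rle_lt_trans; [apply Cmod_sub_le|]. lra. }
  assert (S2 : Cmod (A + B * e2) < 2 * c1 * l).
  { replace (A + B * e2)%C with (m z2 - (m z2 - (A + B * e2)))%C by ring.
    eapply Rle_lt_trans; [apply Cmod_sub_le|]. lra. }
  assert (S3 : Cmod B * Cmod (e1 - e2) < 4 * c1 * l).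
  { rewrite <- Cmod_mult. replace (B * (e1 - e2))%C with ((A + B * e1) - (A + B * e2))%C by ring.
    eapply Rle_lt_trans; [apply Cmod_sub_le|]. lra. }
  assert (W1 : Cmod (RtoC (- W) * z1) = W * r).
  { rewrite Cmod_mult, Cmod_R, Rabs_Ropp, Rabs_pos_eq, Hz1 by lra. reflexivity. }
  assert (W2 : Cmod (RtoC (- W) * z2) = W * (r / 2)).
  { rewrite Cmod_mult, Cmod_R, Rabs_Ropp, Rabs_pos_eq, Hz2 by lra. reflexivity. }
  assert (S4 : W * r / 8 <= Cmod (e1 - e2)).
  { pose proof (cexp_sub_lower (RtoC (- W) * z1)%C (RtoC (- W) * z2)%C ltac:(lra) ltac:(nra)) as H.
    pose proof (Cmod_minus_ge (RtoC (- W) * z1)%C (RtoC (- W) * z2)%C). unfold e1, e2. lra. }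
  assert (SB : Cmod B < 32 * c1 * l / (W * r)).
  { apply Rmult_lt_reg_r with (W * r / 8); [lra|].
    replace (32 * c1 * l / (W * r) * (W * r / 8)) with (4 * c1 * l) by (field; nra).
    pose proof (Cmod_ge_0 B). nra. }
  assert (Se : Cmod e1 <= 2).
  { unfold e1. rewrite Cmod_cexp.
    apply Rle_trans with (exp (1/16)).
    - assert (fst (RtoC (- W) * z1)%C <= 1/16).
      { pose proof (fst_le_Cmod (RtoC (- W) * z1)%C). pose proof (Rle_abs (fst (RtoC (- W) * z1)%C)). lra. }
      destruct H; [left; now apply exp_increasing|rewrite H; lra].
    - pose proof (exp_ineq1_le (-(1/16))) as H. rewrite exp_Ropp in H.
      pose proof (exp_pos (1/16)).
      apply Rmult_le_reg_l with (/ exp (1/16)); [now apply Rinv_0_lt_compat|].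
      rewrite Rinv_l by lra. lra. }
  assert (SA : Cmod A <= 2 * c1 * l + 64 * c1 * l / (W * r)).
  { replace A with ((A + B * e1) - B * e1)%C by ring.
    eapply Rle_trans; [apply Cmod_sub_le|]. rewrite Cmod_mult.
    assert (Cmod B * Cmod e1 <= 32 * c1 * l / (W * r) * 2).
    { apply Rmult_le_compat; try apply Cmod_ge_0; lra. }
    lra. }
  assert (Ec : 2 * c1 * l + 64 * c1 * l / (W * r) = t * l / 2).
  { unfold c1. field. split; [lra|]. nra. }
  nra.
Qed.

Lemma ccont2_squeeze (f : R -> R -> C) (g : R -> R -> R) x y :
  locally_2d (fun u v => Cmod (f u v) <= g u v) x y -> continuity_2d_pt g x y -> g x y = 0 ->
  ccont2 f x y.
Proof.
  intros H Hg G0.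
  assert (F0 : f x y = 0%C).
  { apply Cmod_eq_0, Rle_antisym; [|apply Cmod_ge_0].
    rewrite <- G0. apply (locally_2d_singleton _ _ _ H). }
  split; intros eps; specialize (Hg eps); rewrite F0; simpl.
  - apply locally_2d_impl with (2 := Hg). revert H. apply locally_2d_impl, locally_2d_forall.
    intros u v H1 H2. rewrite G0, Rminus_0_r in H2. rewrite Rminus_0_r.
    eapply Rle_lt_trans; [apply fst_le_Cmod|]. eapply Rle_lt_trans; [exact H1|].
    eapply Rle_lt_trans; [apply Rle_abs|exact H2].
  - apply locally_2d_impl with (2 := Hg). revert H. apply locally_2d_impl, locally_2d_forall.
    intros u v H1 H2. rewrite G0, Rminus_0_r in H2. rewrite Rminus_0_r.
    eapply Rle_lt_trans; [apply snd_le_Cmod|]. eapply Rle_lt_trans; [exact H1|].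
    eapply Rle_lt_trans; [apply Rle_abs|exact H2].
Qed.

Lemma ccont_squeeze (f : R -> C) (g : R -> R) x :
  locally x (fun t => Cmod (f t) <= g t) -> continuous g x -> g x = 0 -> ccont f x.
Proof.
  intros H Hg G0.
  apply (ccont2_ccont_snd (fun _ v => f v) x x).
  apply (ccont2_squeeze (fun _ v => f v) (fun _ v => g v)).
  - destruct H as [d Hd]. exists d. intros u v _ Hv. apply Hd, Hv.
  - apply (rcont2_comp g (fun _ v => v)); auto. apply continuity_2d_pt_id2.
  - exact G0.
Qed.

(** This convention matters: continuity of several integrands at an end point is proved
    by a bound valid on both sides of it. *)
Lemma ln_nonpos x : x <= 0 -> ln x = 0.
Proof. intros H. unfold ln. destruct (Rlt_dec 0 x); [exfalso; lra|reflexivity]. Qed.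

Lemma ln_le_0 x : x <= 1 -> ln x <= 0.
Proof.
  intros H. destruct (Rle_lt_dec x 0); [rewrite ln_nonpos; lra|].
  rewrite <- ln_1. destruct H; [left; apply ln_increasing; lra|rewrite H; lra].
Qed.

Lemma exp_le_mono a b : a <= b -> exp a <= exp b.
Proof. intros [H| ->]; [left; now apply exp_increasing|lra]. Qed.

Lemma exp_le_1 a : a <= 0 -> exp a <= 1.
Proof. intros; rewrite <- exp_0; now apply exp_le_mono. Qed.

(** * The multiplier at the start of the recursion *)

Definition psic (th : R) : R := PI / 2 - th.

(** The unit complex number [e^{i n (psi - psic)}], the angular factor seen along
    the second branch in direction [psi]. *)
Definition ker (n th psi : R) : C := cexp (0, n * (psi - psic th)).

(** [cos psi ^ (- mu - 2)], written so as to be continuous where [cos] vanishes. *)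
Definition cpw (mu : C) (psi : R) : C :=
  (RtoC (cos psi * cos psi) * cexp (- (mu + 4) * RtoC (ln (cos psi))))%C.

(** With [d = sin th / cos psi], the distance to the origin of the point of the second
    branch in direction [psi] for a vertex at distance 1, this is the integral of
    [d ^ mu * e^{i n (psi - psic)} * sin th / cos psi ^ 2]. *)
Definition mult_base (n th : R) (mu : C) : C :=
  (cexp ((mu + 1) * RtoC (ln (sin th))) *
   cint (fun psi => (cpw mu psi * ker n th psi)%C) (- (PI / 2)) (psic th))%C.

Lemma Cmod_ker n th psi : Cmod (ker n th psi) = 1.
Proof. unfold ker. rewrite Cmod_cexp. simpl. apply exp_0. Qed.

Lemma cder_ker n th psi : cder (ker n th) psi (Ci * RtoC n * ker n th psi)%C.
Proof.
  unfold ker. apply (cder_cexp (fun psi => (0, n * (psi - psic th)))).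
  split; simpl; auto_derive; auto; simpl; ring.
Qed.

Lemma ccont_ker n th psi : ccont (ker n th) psi.
Proof. eapply cder_ccont, cder_ker. Qed.

Lemma Cmod_cpw mu psi : fst mu <= -4 -> Cmod (cpw mu psi) <= cos psi * cos psi.
Proof.
  intros H. unfold cpw. rewrite Cmod_mult, Cmod_R, Rabs_pos_eq, Cmod_cexp by nra.
  rewrite <- Rmult_1_r. apply Rmult_le_compat_l; [nra|]. apply exp_le_1. simpl.
  pose proof (ln_le_0 (cos psi) (proj2 (COS_bound psi))). nra.
Qed.

Lemma cos_sq_le_1 psi : cos psi * cos psi <= 1.
Proof. pose proof (COS_bound psi). nra. Qed.

Lemma continuous_lncos psi : 0 < cos psi -> continuous (fun t => ln (cos t)) psi.
Proof.
  intros H. apply (continuous_comp cos ln); [apply continuous_cos|].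
  derive_cont.
Qed.

Lemma cos_pos_inside psi th : 0 < th < PI / 2 -> - (PI / 2) < psi <= psic th -> 0 < cos psi.
Proof. unfold psic. intros H H'. apply cos_gt_0; lra. Qed.

Lemma ccont_cpw mu psi : fst mu <= -4 -> 0 <= cos psi -> ccont (cpw mu) psi.
Proof.
  intros Hm [H|H].
  - unfold cpw. apply ccont_mult.
    + apply ccont_RtoC, rcont_mult; apply continuous_cos.
    + apply ccont_cexp, ccont_mult; [apply ccont_const|]. apply ccont_RtoC. now apply continuous_lncos.
  - apply ccont_squeeze with (fun t => cos t * cos t).
    + apply filter_forall. intros t. now apply Cmod_cpw.
    + apply rcont_mult; apply continuous_cos.
    + rewrite <- H. ring.
Qed.

Lemma ccont_on_base n th mu : 0 < th < PI / 2 -> fst mu <= -4 ->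
  ccont_on (fun psi => (cpw mu psi * ker n th psi)%C) (- (PI / 2)) (psic th).
Proof.
  intros Hth Hm psi Hpsi. apply ccont_mult; [|apply ccont_ker].
  apply ccont_cpw; auto. apply cos_ge_0; unfold psic in *; lra.
Qed.

Lemma ln_sin_neg th : 0 < th < PI / 2 -> ln (sin th) < 0.
Proof.
  intros H. rewrite <- ln_1. apply ln_increasing.
  - apply sin_gt_0; lra.
  - rewrite <- sin_PI2. apply sin_increasing_1; lra.
Qed.

Lemma psic_bounds th : 0 < th < PI / 2 -> 0 < psic th < PI / 2 /\ psic th - - (PI / 2) <= 4.
Proof. intros H; unfold psic. pose proof PI_4. lra. Qed.

Lemma mult_base_bound n th mu : 0 < th < PI / 2 -> -7 <= fst mu <= -4 ->
  Cmod (mult_base n th mu) <= 8 * exp (- 6 * ln (sin th)).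
Proof.
  intros Hth Hm. unfold mult_base. rewrite Cmod_mult, Cmod_cexp.
  pose proof (ln_sin_neg th Hth). destruct (psic_bounds th Hth) as [P1 P2].
  assert (A : Cmod (cint (fun psi => (cpw mu psi * ker n th psi)%C) (- (PI / 2)) (psic th)) <= 8).
  { eapply Rle_trans; [apply (cint_bound _ 1)|].
    - lra.
    - apply ccont_on_base; auto; lra.
    - intros psi _. rewrite Cmod_mult, Cmod_ker, Rmult_1_r.
      eapply Rle_trans; [apply Cmod_cpw; lra|apply cos_sq_le_1].
    - lra. }
  rewrite Rmult_comm. apply Rmult_le_compat; auto; [apply Cmod_ge_0|left; apply exp_pos|].
  apply exp_le_mono. simpl. nra.
Qed.

(** The aim is that [M(mu + zeta) - (sin th)^zeta M(mu)] is [O(1/|mu|)] uniformly in the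
    imaginary part of [mu].  The integrand is [cos ^ (- mu - 2)] times
    [h = cos ^ (- zeta) - 1]; it oscillates with phase proportional to [ln cos], whose
    only stationary point is the foot [psi = 0] of the perpendicular, and there [h]
    vanishes to second order.  So one integration by parts, with boundary term [F] and
    remainder [g], gains the factor [1/(mu + 1)] without a loss at [psi = 0]. *)
Section BaseVariation.

Variables (n th : R) (mu zeta : C).
Hypothesis Hth : 0 < th < PI / 2.
Hypothesis Hmu : -6 <= fst mu <= -5.
Hypothesis Hz : Cmod zeta <= 1 / 4.

Let lc (psi : R) : R := ln (cos psi).
Let h (psi : R) : C := (cexp (- zeta * RtoC (lc psi)) - 1)%C.
Let pw (psi : R) : C := cexp (- (mu + 1) * RtoC (lc psi)).
Let f (psi : R) : C :=
  (RtoC (cos psi * cos psi) * cexp (- (mu + 4) * RtoC (lc psi)) * h psi * ker n th psi)%C.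
Let F (psi : R) : C := (/ (mu + 1) * (pw psi * (h psi * RtoC (/ sin psi) * ker n th psi)))%C.
Let g (psi : R) : C :=
  (/ (mu + 1) * (pw psi *
    ((zeta * RtoC (/ cos psi) * cexp (- zeta * RtoC (lc psi))
      - h psi * RtoC (cos psi * (/ sin psi * / sin psi))
      + h psi * RtoC (/ sin psi) * (Ci * RtoC n)) * ker n th psi)))%C.

Let zre : Rabs (fst zeta) <= 1 / 4.
Proof. pose proof (fst_le_Cmod zeta); lra. Qed.

Let mu1 : (mu + 1)%C <> 0%C.
Proof. intros E. apply (f_equal fst) in E. simpl in E. lra. Qed.

Let lc_exp psi : 0 < cos psi -> exp (lc psi) = cos psi.
Proof. intros; unfold lc; now apply exp_ln. Qed.

Let lc_neg psi : lc psi <= 0.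
Proof. apply ln_le_0. apply COS_bound. Qed.

Let lc_bound psi : 0 < cos psi -> - lc psi <= Rsqr (sin psi) * (/ cos psi * / cos psi) / 2.
Proof.
  intros H.
  assert (E : exp (-2 * lc psi) = / cos psi * / cos psi).
  { replace (-2 * lc psi) with (- lc psi + - lc psi) by ring.
    rewrite exp_plus, exp_Ropp, lc_exp by auto. reflexivity. }
  pose proof (exp_ineq1_le (-2 * lc psi)) as K. rewrite E in K.
  pose proof (sin2_cos2 psi) as S. unfold Rsqr in *.
  assert (sin psi * sin psi * (/ cos psi * / cos psi) = / cos psi * / cos psi - 1).
  { replace (sin psi * sin psi) with (1 - cos psi * cos psi) by lra. field. lra. }
  lra.
Qed.

Let cexp_z psi : 0 < cos psi -> Cmod (cexp (- zeta * RtoC (lc psi))) <= exp (- lc psi).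
Proof.
  intros H. rewrite Cmod_cexp. apply exp_le_mono. simpl.
  pose proof (lc_neg psi). pose proof zre as K. apply Rabs_le_between in K. nra.
Qed.

Let h_bound psi : 0 < cos psi -> Cmod (h psi) <= Rsqr (sin psi) * exp (-3 * lc psi).
Proof.
  intros H. unfold h. eapply Rle_trans; [apply cexp_sub1_bound|].
  assert (A : Cmod (- zeta * RtoC (lc psi)) <= - lc psi / 4).
  { rewrite Cmod_mult, Cmod_opp, Cmod_R. pose proof (lc_neg psi).
    rewrite (Rabs_left1 (lc psi)) by auto. nra. }
  pose proof (lc_neg psi) as L. pose proof (lc_bound psi H) as LB.
  pose proof (Cmod_ge_0 (- zeta * RtoC (lc psi))) as A0.
  assert (X : exp (Cmod (- zeta * RtoC (lc psi))) <= exp (- lc psi)) by (apply exp_le_mono; lra).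
  pose proof (exp_pos (Cmod (- zeta * RtoC (lc psi)))).
  assert (Y : exp (-3 * lc psi) = / cos psi * / cos psi * exp (- lc psi)).
  { replace (-3 * lc psi) with (- lc psi + - lc psi + - lc psi) by ring.
    rewrite !exp_plus, !exp_Ropp, lc_exp by auto. reflexivity. }
  rewrite Y. rewrite <- Rmult_assoc.
  apply Rmult_le_compat; try lra.
Qed.

Let pw_bound psi : Cmod (pw psi) <= exp (4 * lc psi).
Proof.
  unfold pw. rewrite Cmod_cexp. apply exp_le_mono. simpl. pose proof (lc_neg psi). nra.
Qed.

Let inv_cos psi : 0 < cos psi -> / cos psi = exp (- lc psi).
Proof. intros; now rewrite exp_Ropp, lc_exp. Qed.

Let der_F psi : 0 < cos psi -> sin psi <> 0 -> cder F psi (f psi + g psi)%C.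
Proof.
  intros Hc Hs.
  assert (Dl : is_derive lc psi (- (sin psi * / cos psi))).
  { unfold lc. auto_derive; [auto|]. simpl. field. lra. }
  assert (Dh : cder h psi (zeta * RtoC (sin psi * / cos psi) * cexp (- zeta * RtoC (lc psi)))%C).
  { unfold h. eapply cder_eq.
    - apply cder_minus; [|apply cder_const]. apply (cder_cexp (fun t => (- zeta * RtoC (lc t))%C)).
      apply cder_scal, cder_RtoC, Dl.
    - rewrite RtoC_opp. ring. }
  assert (Dp : cder pw psi ((mu + 1) * RtoC (sin psi * / cos psi) * pw psi)%C).
  { unfold pw. eapply cder_eq.
    - apply (cder_cexp (fun t => (- (mu + 1) * RtoC (lc t))%C)). apply cder_scal, cder_RtoC, Dl.
    - rewrite RtoC_opp. ring. }
  assert (Ds : cder (fun t => RtoC (/ sin t)) psi (RtoC (- (cos psi * (/ sin psi * / sin psi))))).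
  { apply cder_RtoC. auto_derive; auto. simpl. field. auto. }
  unfold F. eapply cder_eq.
  - apply cder_scal. apply cder_mult; [exact Dp|].
    apply cder_mult; [|apply cder_ker]. apply cder_mult; [exact Dh|exact Ds].
  - assert (Hp : (RtoC (cos psi * cos psi) * cexp (- (mu + 4) * RtoC (lc psi)))%C =
                 (RtoC (/ cos psi) * pw psi)%C).
    { unfold pw. replace (- (mu + 1) * RtoC (lc psi))%C with
        (- (mu + 4) * RtoC (lc psi) + RtoC (3 * lc psi))%C.
      2:{ apply Ceq; simpl; ring. }
      rewrite cexp_plus.
      replace (cexp (RtoC (3 * lc psi))) with (RtoC (cos psi * cos psi * cos psi)).
      2:{ apply Ceq; simpl.
          - rewrite cos_0. replace (3 * lc psi) with (lc psi + lc psi + lc psi) by ring.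
            rewrite !exp_plus, lc_exp by auto. ring.
          - rewrite sin_0. ring. }
      rewrite !RtoC_mult, RtoC_inv by lra. field.
      intros E; apply RtoC_inj in E; lra. }
    unfold f, g. rewrite Hp.
    rewrite !RtoC_mult, RtoC_opp, !RtoC_mult, !RtoC_inv by lra.
    field. repeat split; auto; intros E; apply RtoC_inj in E; lra.
Qed.

Let F_bound psi : 0 < cos psi -> sin psi <> 0 -> Cmod (F psi) <= / Cmod (mu + 1).
Proof.
  intros Hc Hs. unfold F. rewrite !Cmod_mult, Cmod_ker, Cmod_inv, Cmod_R by auto.
  rewrite Rmult_1_r. rewrite <- (Rmult_1_r (/ Cmod (mu + 1))) at 2.
  apply Rmult_le_compat_l; [left; apply Rinv_0_lt_compat, Cmod_gt_0, mu1|].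
  assert (A : Cmod (h psi) * Rabs (/ sin psi) <= exp (-3 * lc psi)).
  { rewrite Rabs_inv. assert (0 < Rabs (sin psi)) by now apply Rabs_pos_lt.
    apply Rmult_le_reg_r with (Rabs (sin psi)); auto. rewrite Rmult_assoc, Rinv_l, Rmult_1_r by lra.
    eapply Rle_trans; [now apply h_bound|]. rewrite (Rsqr_abs (sin psi)). unfold Rsqr.
    assert (Rabs (sin psi) <= 1) by (apply Rabs_le; apply SIN_bound).
    pose proof (exp_pos (-3 * lc psi)).
    assert (0 <= exp (-3 * lc psi) * Rabs (sin psi)) by nra. nra. }
  eapply Rle_trans; [apply Rmult_le_compat; [apply Cmod_ge_0| |apply pw_bound|exact A]|].
  - apply Rmult_le_pos; [apply Cmod_ge_0|apply Rabs_pos].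
  - rewrite <- exp_plus. apply exp_le_1. pose proof (lc_neg psi). lra.
Qed.

Let g_bound psi : 0 < cos psi -> sin psi <> 0 -> Cmod (g psi) <= (2 + Rabs n) * / Cmod (mu + 1).
Proof.
  intros Hc Hs. unfold g. rewrite (Cmod_mult (/ (mu + 1))), Cmod_inv by auto. rewrite Rmult_comm.
  apply Rmult_le_compat_r; [left; apply Rinv_0_lt_compat, Cmod_gt_0, mu1|].
  rewrite !Cmod_mult, Cmod_ker, Rmult_1_r.
  assert (Sp : 0 < Rabs (sin psi)) by now apply Rabs_pos_lt.
  assert (S1 : Rabs (sin psi) <= 1) by (apply Rabs_le; apply SIN_bound).
  assert (Sq : Rsqr (sin psi) = Rabs (sin psi) * Rabs (sin psi)) by (rewrite (Rsqr_abs (sin psi)); reflexivity).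
  pose proof (h_bound psi Hc) as HB. rewrite Sq in HB.
  assert (E3 := exp_pos (-3 * lc psi)).
  assert (A1 : Cmod (zeta * RtoC (/ cos psi) * cexp (- zeta * RtoC (lc psi))) <= exp (-3 * lc psi)).
  { rewrite !Cmod_mult, Cmod_R, Rabs_pos_eq by (left; now apply Rinv_0_lt_compat).
    rewrite inv_cos by auto.
    pose proof (cexp_z psi Hc). pose proof (exp_pos (- lc psi)). pose proof (Cmod_ge_0 zeta).
    apply Rle_trans with (1 * exp (- lc psi) * exp (- lc psi)).
    - apply Rmult_le_compat; auto; [|apply Cmod_ge_0|]; nra.
    - rewrite Rmult_1_l, <- exp_plus. apply exp_le_mono. pose proof (lc_neg psi). lra. }
  assert (A2 : Cmod (h psi * RtoC (cos psi * (/ sin psi * / sin psi))) <= exp (-3 * lc psi)).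
  { rewrite Cmod_mult, Cmod_R, Rabs_mult, Rabs_mult, !Rabs_inv.
    assert (Rabs (cos psi) <= 1) by (apply Rabs_le; apply COS_bound).
    pose proof (Rabs_pos (cos psi)).
    apply Rle_trans with (Rabs (sin psi) * Rabs (sin psi) * exp (-3 * lc psi) *
                         (1 * (/ Rabs (sin psi) * / Rabs (sin psi)))).
    - assert (0 < / Rabs (sin psi)) by now apply Rinv_0_lt_compat.
      apply Rmult_le_compat; auto; [apply Cmod_ge_0| |].
      + apply Rmult_le_pos; auto. nra.
      + apply Rmult_le_compat_r; auto. nra.
    - right. field. lra. }
  assert (A3 : Cmod (h psi * RtoC (/ sin psi) * (Ci * RtoC n)) <= Rabs n * exp (-3 * lc psi)).
  { rewrite !Cmod_mult, Cmod_Ci, !Cmod_R, Rabs_inv.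
    assert (Cmod (h psi) * / Rabs (sin psi) <= exp (-3 * lc psi)).
    { apply Rmult_le_reg_r with (Rabs (sin psi)); auto. rewrite Rmult_assoc, Rinv_l, Rmult_1_r by lra.
      pose proof (Rmult_le_compat_r (Rabs (sin psi) * exp (-3 * lc psi)) _ _
        ltac:(apply Rmult_le_pos; lra) S1). lra. }
    pose proof (Rmult_le_compat_l (Rabs n) _ _ (Rabs_pos n) H). lra. }
  assert (A : Cmod (zeta * RtoC (/ cos psi) * cexp (- zeta * RtoC (lc psi))
      - h psi * RtoC (cos psi * (/ sin psi * / sin psi))
      + h psi * RtoC (/ sin psi) * (Ci * RtoC n)) <= (2 + Rabs n) * exp (-3 * lc psi)).
  { eapply Rle_trans; [apply Cmod_triangle|].
    pose proof (Cmod_sub_le (zeta * RtoC (/ cos psi) * cexp (- zeta * RtoC (lc psi)))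
       (h psi * RtoC (cos psi * (/ sin psi * / sin psi)))). lra. }
  eapply Rle_trans; [apply Rmult_le_compat; [apply Cmod_ge_0|apply Cmod_ge_0|apply pw_bound|exact A]|].
  replace (exp (4 * lc psi) * ((2 + Rabs n) * exp (-3 * lc psi))) with
    ((2 + Rabs n) * exp (4 * lc psi + -3 * lc psi)) by (rewrite exp_plus; ring).
  rewrite <- (Rmult_1_r (2 + Rabs n)) at 2. apply Rmult_le_compat_l; [pose proof (Rabs_pos n); lra|].
  apply exp_le_1. pose proof (lc_neg psi). lra.
Qed.

Let f_alt psi : f psi = (cpw (mu + zeta) psi * ker n th psi - cpw mu psi * ker n th psi)%C.
Proof.
  unfold f, h, cpw. fold (lc psi).
  replace (- (mu + zeta + 4) * RtoC (lc psi))%C with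
    (- (mu + 4) * RtoC (lc psi) + - zeta * RtoC (lc psi))%C by ring.
  rewrite cexp_plus. ring.
Qed.

Let zre' : fst (mu + zeta)%C <= -4.
Proof. pose proof zre as K. apply Rabs_le_between in K. simpl. lra. Qed.

Let f_cont psi : - (PI / 2) <= psi <= psic th -> ccont f psi.
Proof.
  intros H. apply ccont_ext with (fun psi => (cpw (mu + zeta) psi * ker n th psi - cpw mu psi * ker n th psi)%C).
  - intros t; symmetry; apply f_alt.
  - apply ccont_minus; apply (ccont_on_base n th); auto. lra.
Qed.

Let f_bound psi : Cmod (f psi) <= 2.
Proof.
  rewrite f_alt. eapply Rle_trans; [apply Cmod_sub_le|].
  rewrite !Cmod_mult, Cmod_ker, !Rmult_1_r.
  pose proof (Cmod_cpw (mu + zeta)%C psi zre'). pose proof (Cmod_cpw mu psi ltac:(lra)).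
  pose proof (cos_sq_le_1 psi). lra.
Qed.

Let piece a b : - (PI / 2) < a -> a <= b -> b <= psic th ->
  (forall psi, a <= psi <= b -> sin psi <> 0) ->
  Cmod (cint f a b) <= (2 + 8 * (2 + Rabs n)) * / Cmod (mu + 1).
Proof.
  intros Ha Hab Hb Hs. destruct (psic_bounds th Hth) as [P1 P2].
  assert (Hc : forall psi, a <= psi <= b -> 0 < cos psi) by (intros; apply (cos_pos_inside psi th); lra).
  assert (Hg : ccont_on g a b).
  { intros psi Hpsi. specialize (Hc psi Hpsi). specialize (Hs psi Hpsi).
    assert (Cl : continuous lc psi) by now apply continuous_lncos.
    assert (Cs : continuous (fun t => / sin t) psi).
    { derive_cont. }
    assert (Cc : continuous (fun t => / cos t) psi).
    { apply (ex_derive_continuous (V := R_NormedModule)). auto_derive. lra. }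
    assert (Ce : forall k : C, ccont (fun t => cexp (k * RtoC (lc t))) psi).
    { intros k. apply ccont_cexp, ccont_mult; [apply ccont_const|now apply ccont_RtoC]. }
    assert (Ch : ccont h psi) by (apply ccont_minus; [apply Ce|apply ccont_const]).
    unfold g. apply ccont_mult; [apply ccont_const|]. apply ccont_mult; [apply Ce|].
    apply ccont_mult; [|apply ccont_ker]. apply ccont_plus; [apply ccont_minus|].
    - apply ccont_mult; [|apply Ce]. apply ccont_mult; [apply ccont_const|now apply ccont_RtoC].
    - apply ccont_mult; [exact Ch|]. apply ccont_RtoC, rcont_mult; [apply continuous_cos|now apply rcont_mult].
    - apply ccont_mult; [|apply ccont_const]. apply ccont_mult; [exact Ch|now apply ccont_RtoC]. }
  assert (Hf : ccont_on f a b) by (intros psi Hpsi; apply f_cont; lra).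
  assert (E : cint f a b = (F b - F a - cint g a b)%C).
  { rewrite <- (cint_derive F (fun psi => (f psi + g psi)%C) a b); auto.
    - rewrite cint_plus by auto. ring.
    - intros x Hx; apply ccont_plus; auto. }
  rewrite E.
  pose proof (F_bound a (Hc a ltac:(lra)) (Hs a ltac:(lra))).
  pose proof (F_bound b (Hc b ltac:(lra)) (Hs b ltac:(lra))).
  assert (G : Cmod (cint g a b) <= 2 * ((2 + Rabs n) * / Cmod (mu + 1)) * (b - a)).
  { apply cint_bound; auto. }
  assert (I : 0 < / Cmod (mu + 1)) by (apply Rinv_0_lt_compat, Cmod_gt_0, mu1).
  pose proof (Rabs_pos n).
  assert (K0 : 0 <= (2 + Rabs n) * / Cmod (mu + 1)) by (apply Rmult_le_pos; lra).
  assert (G' : 2 * ((2 + Rabs n) * / Cmod (mu + 1)) * (b - a) <= 8 * ((2 + Rabs n) * / Cmod (mu + 1))).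
  { assert (b - a <= 4) by lra. nra. }
  eapply Rle_trans; [apply Cmod_sub_le|]. pose proof (Cmod_sub_le (F b) (F a)). lra.
Qed.

(** The integration by parts is carried out away from [psi = 0] and [psi = - PI / 2];
    the intervals left out can be arbitrarily short, and [f] is bounded on them. *)
Lemma base_variation_integral :
  Cmod (cint f (- (PI / 2)) (psic th)) <= 2 * (2 + 8 * (2 + Rabs n)) * / Cmod (mu + 1).
Proof.
  destruct (psic_bounds th Hth) as [P1 P2]. pose proof PI_RGT_0 as PP.
  set (L := 2 * (2 + 8 * (2 + Rabs n)) * / Cmod (mu + 1)).
  apply Rnot_lt_le. intros N.
  set (e := Cmod (cint f (- (PI / 2)) (psic th)) - L) in *.
  assert (He : 0 < e) by (unfold e; lra).
  set (d := Rmin (Rmin (psic th / 2) (PI / 8)) (e / 16)).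
  assert (Hd : 0 < d /\ d <= psic th / 2 /\ d <= PI / 8 /\ d <= e / 16).
  { unfold d. repeat split.
    - repeat apply Rmin_glb_lt; lra.
    - eapply Rle_trans; [apply Rmin_l|apply Rmin_l].
    - eapply Rle_trans; [apply Rmin_l|apply Rmin_r].
    - apply Rmin_r. }
  destruct Hd as [D0 [D1 [D2 D3]]].
  assert (Cf : forall a b, - (PI / 2) <= a -> b <= psic th -> ccont_on f a b).
  { intros a b Ha Hb x Hx. apply f_cont. lra. }
  assert (E : cint f (- (PI / 2)) (psic th) =
    (cint f (- (PI / 2)) (- (PI / 2) + d) + (cint f (- (PI / 2) + d) (- d) +
      (cint f (- d) d + cint f d (psic th))))%C).
  { rewrite (cint_Chasles f (- d) d (psic th)) by (try lra; apply Cf; lra).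
    rewrite (cint_Chasles f (- (PI / 2) + d) (- d) (psic th)) by (try lra; apply Cf; lra).
    rewrite (cint_Chasles f (- (PI / 2)) (- (PI / 2) + d) (psic th)) by (try lra; apply Cf; lra).
    reflexivity. }
  assert (B1 : Cmod (cint f (- (PI / 2)) (- (PI / 2) + d)) <= 2 * 2 * (- (PI / 2) + d - - (PI / 2)))
    by (apply cint_bound; [lra|apply Cf; lra|intros; apply f_bound]).
  assert (B2 : Cmod (cint f (- d) d) <= 2 * 2 * (d - - d))
    by (apply cint_bound; [lra|apply Cf; lra|intros; apply f_bound]).
  assert (B3 := piece (- (PI / 2) + d) (- d) ltac:(lra) ltac:(lra) ltac:(lra)
    ltac:(intros; apply Rlt_not_eq, sin_lt_0_var; lra)).
  assert (B4 := piece d (psic th) ltac:(lra) ltac:(lra) ltac:(lra)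
    ltac:(intros; apply Rgt_not_eq, sin_gt_0; lra)).
  assert (T : Cmod (cint f (- (PI / 2)) (psic th)) <=
    Cmod (cint f (- (PI / 2)) (- (PI / 2) + d)) + (Cmod (cint f (- (PI / 2) + d) (- d)) +
      (Cmod (cint f (- d) d) + Cmod (cint f d (psic th))))).
  { rewrite E at 1.
    eapply Rle_trans; [apply Cmod_triangle|]. apply Rplus_le_compat_l.
    eapply Rle_trans; [apply Cmod_triangle|]. apply Rplus_le_compat_l. apply Cmod_triangle. }
  unfold e in *. unfold L in *. lra.
Qed.

Lemma mult_base_variation :
  Cmod mu * Cmod (mult_base n th (mu + zeta) - cexp (RtoC (ln (sin th)) * zeta) * mult_base n th mu)
  <= exp (- 6 * ln (sin th)) * (4 * (2 + 8 * (2 + Rabs n))).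
Proof.
  destruct (psic_bounds th Hth) as [P1 P2]. pose proof (ln_sin_neg th Hth) as LN.
  assert (E : (mult_base n th (mu + zeta) - cexp (RtoC (ln (sin th)) * zeta) * mult_base n th mu)%C =
     (cexp ((mu + zeta + 1) * RtoC (ln (sin th))) * cint f (- (PI / 2)) (psic th))%C).
  { unfold mult_base.
    replace ((mu + zeta + 1) * RtoC (ln (sin th)))%C with
      (RtoC (ln (sin th)) * zeta + (mu + 1) * RtoC (ln (sin th)))%C by ring.
    rewrite cexp_plus.
    replace (cint f (- (PI / 2)) (psic th)) with
      (cint (fun psi => (cpw (mu + zeta) psi * ker n th psi)%C) (- (PI / 2)) (psic th) -
       cint (fun psi => (cpw mu psi * ker n th psi)%C) (- (PI / 2)) (psic th))%C.
    - ring.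
    - rewrite <- cint_minus; try (apply ccont_on_base; auto; lra); try lra.
      apply cint_ext; [lra|]. intros psi _. symmetry. apply f_alt. }
  rewrite E, Cmod_mult, Cmod_cexp.
  pose proof base_variation_integral as B.
  assert (X : exp (fst ((mu + zeta + 1) * RtoC (ln (sin th)))%C) <= exp (-6 * ln (sin th))).
  { apply exp_le_mono. simpl. pose proof zre as K. apply Rabs_le_between in K. nra. }
  assert (M1 : 1 <= Cmod (mu + 1)).
  { eapply Rle_trans; [|apply fst_le_Cmod]. simpl. rewrite Rabs_left; lra. }
  assert (M2 : Cmod mu <= 2 * Cmod (mu + 1)).
  { pose proof (Cmod_plus_ge mu 1). rewrite Cmod_1 in H. lra. }
  pose proof (Cmod_ge_0 (cint f (- (PI / 2)) (psic th))) as I0.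
  assert (Y : Cmod mu * Cmod (cint f (- (PI / 2)) (psic th)) <= 4 * (2 + 8 * (2 + Rabs n))).
  { set (q := 2 + 8 * (2 + Rabs n)) in *.
    assert (0 < q) by (unfold q; pose proof (Rabs_pos n); lra).
    apply Rle_trans with (2 * Cmod (mu + 1) * (2 * q * / Cmod (mu + 1))).
    - apply Rmult_le_compat; auto. apply Cmod_ge_0.
    - right. field. lra. }
  rewrite <- Rmult_assoc, (Rmult_comm (Cmod mu)), Rmult_assoc.
  apply Rmult_le_compat; auto; [left; apply exp_pos|].
  apply Rmult_le_pos; [apply Cmod_ge_0|exact I0].
Qed.

End BaseVariation.

(** * Lower bounds for the multiplier *)

(** The continuation of [mult_base] by [J] steps of the recursion; it is used for exponents
    [mu] with [-7 <= Re mu - 2 * J <= -4]. *)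
Fixpoint mult_ext (n th : R) (J : nat) (mu : C) : C :=
  match J with
  | 0%nat => mult_base n th mu
  | S J => mult_next n (sin th) (cos th) mu (mult_ext n th J (mu - 2)%C)
  end.

(** The factor by which the V-line transform multiplies the Mellin transform: the first
    branch contributes [- 1/(la + 1)], the second one [e^{- i th}] times the integral over
    the directions. *)
Definition vmult (n th : R) (J : nat) (la : C) : C :=
  (- (1 / (la + 1)) + cexp (0, - th)%R * mult_ext n th J la)%C.

Lemma sin_cos_bounds th : 0 < th < PI / 2 ->
  0 < sin th < 1 /\ 0 < cos th < 1 /\ sin th * sin th + cos th * cos th = 1.
Proof.
  intros H.
  assert (0 < sin th) by (apply sin_gt_0; lra).
  assert (0 < cos th) by (apply cos_gt_0; lra).
  pose proof (sin2_cos2 th) as E. unfold Rsqr in E. repeat split; auto; nra.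
Qed.

Lemma mult_ext_stepped n th mu0 k :
  mult_ext n th (S k) (stepped mu0 (S k)) =
  mult_next n (sin th) (cos th) (stepped mu0 (S k)) (mult_ext n th k (stepped mu0 k)).
Proof. simpl. now rewrite stepped_S. Qed.

Lemma mult_ext_stepped_shift n th mu0 z k :
  mult_ext n th (S k) (stepped mu0 (S k) + z)%C =
  mult_next n (sin th) (cos th) (stepped mu0 (S k) + z)%C (mult_ext n th k (stepped mu0 k + z)%C).
Proof.
  simpl. replace (stepped mu0 (S k) + z - 2)%C with (stepped mu0 k + z)%C; auto.
  rewrite <- stepped_S. ring.
Qed.

(** The leading terms [- 1/la] and [e^{- i th} / (la cos th)] do not cancel: their sum is
    [- i tan th / la]. *)
Lemma leading_coefficient th : 0 < th < PI / 2 ->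
  (-1 + cexp (0, - th)%R / RtoC (cos th))%C = (RtoC (- tan th) * Ci)%C.
Proof.
  intros H. destruct (sin_cos_bounds th H) as [Hs [Hc _]].
  unfold Cdiv. rewrite <- RtoC_inv by lra.
  unfold cexp, tan. apply Ceq; simpl; rewrite exp_0, ?cos_neg, ?sin_neg; field; lra.
Qed.

(** On the line [Re mu = - 11/2 + 2 k] all the denominators of the recursion stay away
    from zero. *)
Lemma half_odd_far k (y : R) (a : R) : a = 0 \/ a = 1 ->
  1 / 2 <= Cmod (stepped (- (11 / 2), y) k + RtoC a).
Proof.
  intros Ha. eapply Rle_trans; [|apply fst_le_Cmod]. unfold stepped; simpl.
  assert (H : (INR k <= 2 \/ 3 <= INR k)).
  { destruct (Nat.le_gt_cases k 2) as [L|L].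
    - left. apply (le_INR k 2) in L. simpl in L. lra.
    - right. apply (le_INR 3 k) in L. simpl in L. lra. }
  unfold Rabs. destruct (Rcase_abs _); destruct Ha as [-> | ->]; lra.
Qed.

(** By [mult_slow_limit] and [leading_coefficient], near [la] the multiplier is
    [A + B (sin th)^z] up to [o(1/|la|)], with [|A| = tan th / |la|].  The real part [- 11/2]
    at which the recursion starts is half a unit away from the integers and leaves room
    for [z] in the range of [mult_base]. *)
Lemma vmult_circle (n th : R) : 0 < th < PI / 2 ->
  exists r c1 : R, exists K : nat, 0 < r <= 1 / 4 /\ 0 < c1 /\
  forall (J : nat) (y : R), (K <= J)%nat ->
    let la := (2 * INR J - 11 / 2, y) : C in
    (forall z, Cmod z = r -> c1 * / Cmod la <= Cmod (vmult n th J (la + z))) \/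
    (forall z, Cmod z = r / 2 -> c1 * / Cmod la <= Cmod (vmult n th J (la + z))).
Proof.
  intros Hth. destruct (sin_cos_bounds th Hth) as [Hs [Hc Hsc]].
  pose proof (ln_sin_neg th Hth) as LN.
  set (W := - ln (sin th)).
  assert (HW : 0 < W) by (unfold W; lra).
  assert (Ht : 0 < tan th) by (apply tan_gt_0; lra).
  set (r := Rmin (1 / 4) (1 / (16 * W))).
  assert (Hr : 0 < r /\ r <= 1 / 4 /\ W * r <= 1 / 16).
  { assert (0 < 1 / (16 * W)) by (apply Rdiv_lt_0_compat; lra).
    unfold r; repeat split; [apply Rmin_glb_lt; lra|apply Rmin_l|].
    apply Rle_trans with (W * (1 / (16 * W))); [|right; field; lra].
    apply Rmult_le_compat_l; [lra|apply Rmin_r]. }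
  destruct Hr as [Hr0 [Hr1 Hr2]].
  destruct (two_circles W (tan th) r HW Ht Hr0 Hr2) as [c1 [Hc1 TC]].
  set (S0 := exp (W / 4)).
  assert (HS0 : 0 < S0) by apply exp_pos.
  set (B0 := Rmax (8 * exp (- 6 * ln (sin th)))
     (exp (- 6 * ln (sin th)) * (4 * (2 + 8 * (2 + Rabs n))) + (1 + S0) / cos th)).
  assert (HB0 : 0 <= B0).
  { eapply Rle_trans; [|apply Rmax_l]. pose proof (exp_pos (-6 * ln (sin th))). lra. }
  destruct (mult_slow_limit n (sin th) (cos th) S0 B0 Hs Hc Hsc ltac:(lra) HB0 (c1 / 2) ltac:(lra))
    as [K1 HK1].
  destruct (nfloor_ex (5 / c1 + 5)) as [K2 [_ HK2]].
  { assert (0 < 5 / c1) by (apply Rdiv_lt_0_compat; lra). lra. }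
  exists r, c1, (K1 + K2 + 6)%nat. repeat split; auto.
  intros J y HJ la.
  set (mu0 := (- (11 / 2), y) : C).
  assert (Ela : la = stepped mu0 J) by (unfold la, mu0, stepped; apply Ceq; simpl; ring).
  assert (HJr : INR K2 + 6 <= INR J).
  { assert ((K2 + 6 <= J)%nat) as HJ2 by lia. apply le_INR in HJ2. rewrite plus_INR in HJ2.
    simpl in HJ2. lra. }
  assert (Hl : 2 * INR J - 11 / 2 <= Cmod la).
  { eapply Rle_trans; [|apply fst_le_Cmod]. apply Rle_abs. }
  assert (H5 : 0 < 5 / c1) by (apply Rdiv_lt_0_compat; lra).
  assert (Hl2 : 5 / c1 + 5 <= Cmod la) by lra.
  assert (Hl0 : 0 < Cmod la) by lra.
  assert (Nl : la <> 0%C) by now apply Cmod_gt_0.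
  assert (Nc : RtoC (cos th) <> 0%C) by (intros E; apply RtoC_inj in E; lra).
  apply (TC ((-1 + cexp (0, - th)%R / RtoC (cos th)) / la)%C
            (cexp (0, - th)%R * (mult_ext n th J la - 1 / (RtoC (cos th) * la)))%C
            (fun z => vmult n th J (la + z)) (/ Cmod la)).
  - now apply Rinv_0_lt_compat.
  - rewrite leading_coefficient, Cmod_div, Cmod_mult, Cmod_Ci, Cmod_R by auto.
    rewrite Rabs_Ropp, Rabs_pos_eq by lra. unfold Rdiv. ring.
  - intros z Hz.
    set (sig := cexp (RtoC (- W) * z)).
    assert (Hsig : Cmod sig <= S0).
    { unfold sig, S0. rewrite Cmod_cexp. apply exp_le_mono. simpl.
      pose proof (fst_le_Cmod z) as F. assert (Rabs (fst z) <= 1 / 4) by lra.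
      apply Rabs_le_between in H. nra. }
    assert (Hz4 : Cmod z <= 1 / 4) by lra.
    assert (SL := HK1 mu0 z sig (fun k => mult_ext n th k (stepped mu0 k))
      (fun k => mult_ext n th k (stepped mu0 k + z)%C)).
    assert (N1 : (la + z + 1)%C <> 0%C).
    { apply neq0_of_Cmod with 1; [lra|].
      pose proof (Cmod_plus_ge la (z + 1)) as P. pose proof (Cmod_triangle z 1) as P'.
      rewrite Cmod_1 in P'. replace (la + z + 1)%C with (la + (z + 1))%C by ring. lra. }
    assert (EQ : (vmult n th J (la + z) -
       ((-1 + cexp (0, - th)%R / RtoC (cos th)) / la +
        cexp (0, - th)%R * (mult_ext n th J la - 1 / (RtoC (cos th) * la)) * sig))%C =
      ((z + 1) / la / (la + z + 1) +
       cexp (0, - th)%R * (mult_ext n th J (la + z) - sig * mult_ext n th J la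
           - (1 - sig) / (RtoC (cos th) * la)))%C).
    { unfold vmult. field. auto. }
    rewrite EQ. eapply Rle_trans; [apply Cmod_triangle|].
    assert (B1 : Cmod ((z + 1) / la / (la + z + 1)) <= c1 / 2 * / Cmod la).
    { rewrite !Cmod_div by auto. unfold Rdiv at 1. rewrite (Rmult_comm (_ / _)). unfold Rdiv at 1.
      rewrite <- Rmult_assoc. apply Rmult_le_compat_r; [left; now apply Rinv_0_lt_compat|].
      pose proof (Cmod_plus_ge la (z + 1)) as P. pose proof (Cmod_triangle z 1) as P'.
      rewrite Cmod_1 in P'. replace (la + (z + 1))%C with (la + z + 1)%C in P by ring.
      assert (Q : 5 / c1 <= Cmod (la + z + 1)) by lra.
      assert (Q0 : 0 < Cmod (la + z + 1)) by lra.
      apply Rmult_le_reg_l with (Cmod (la + z + 1)); auto.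
      rewrite <- Rmult_assoc, Rinv_r, Rmult_1_l by lra.
      assert (5 / 2 <= Cmod (la + z + 1) * (c1 / 2)).
      { apply Rle_trans with (5 / c1 * (c1 / 2)); [right; field; lra|].
        apply Rmult_le_compat_r; lra. }
      lra. }
    assert (B2 : Cmod (cexp (0, - th)%R * (mult_ext n th J (la + z) - sig * mult_ext n th J la
           - (1 - sig) / (RtoC (cos th) * la))) <= c1 / 2 * / Cmod la).
    { rewrite Cmod_mult, Cmod_cexp. simpl. rewrite exp_0, Rmult_1_l.
      apply Rmult_le_reg_l with (Cmod la); auto.
      replace (Cmod la * (c1 / 2 * / Cmod la)) with (c1 / 2) by (field; lra).
      rewrite Ela. apply SL; auto.
      - intros k. pose proof (half_odd_far k y 0 (or_introl eq_refl)) as H.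
        rewrite <- (Cplus_0_r (stepped mu0 k)). exact H.
      - intros k. apply (half_odd_far k y 1 (or_intror eq_refl)).
      - simpl. lra.
      - intros k. apply mult_ext_stepped.
      - intros k. apply mult_ext_stepped_shift.
      - replace (stepped mu0 0) with mu0 by (unfold stepped; apply Ceq; simpl; ring).
        eapply Rle_trans; [apply mult_base_bound; auto; simpl; lra|apply Rmax_l].
      - replace (stepped mu0 0) with mu0 by (unfold stepped; apply Ceq; simpl; ring).
        simpl mult_ext.
        assert (Nm : mu0 <> 0%C) by (intros E; apply (f_equal fst) in E; simpl in E; lra).
        assert (Pm : 0 < Cmod mu0) by now apply Cmod_gt_0.
        assert (V := mult_base_variation n th mu0 z Hth ltac:(simpl; lra) Hz4).
        replace (cexp (RtoC (ln (sin th)) * z)) with sig in V.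
        2:{ unfold sig, W. now rewrite Ropp_involutive. }
        apply Rle_trans with (exp (-6 * ln (sin th)) * (4 * (2 + 8 * (2 + Rabs n))) + (1 + S0) / cos th);
          [|apply Rmax_r].
        eapply Rle_trans; [apply Rmult_le_compat_l; [lra|apply Cmod_sub_le]|].
        rewrite Rmult_plus_distr_l. apply Rplus_le_compat; [exact V|].
        rewrite Cmod_div, Cmod_mult, Cmod_R, (Rabs_pos_eq (cos th)) by (try lra; now apply Cmult_neq_0).
        replace (Cmod mu0 * (Cmod (1 - sig) / (cos th * Cmod mu0))) with (Cmod (1 - sig) / cos th)
          by (field; lra).
        unfold Rdiv. apply Rmult_le_compat_r; [left; apply Rinv_0_lt_compat; lra|].
        eapply Rle_trans; [apply Cmod_sub_le|]. rewrite Cmod_1. lra.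
      - lia. }
    lra.
Qed.

(** A step of the recursion carries a bound [w0] for the value to a bound [w1]; here [w0]
    and [w1] are the values of weights such as [1] and [1/e] at a small parameter [e]. *)
Lemma mult_next_weighted (n s c A C0 w0 w1 : R) (mu M : C) :
  0 <= s <= 1 -> 0 <= C0 -> 0 <= A -> (mu + 1)%C <> 0%C -> mu <> 0%C ->
  Cmod M <= C0 * w0 -> 0 <= w0 -> 0 <= w1 ->
  Cmod (mu * mu - RtoC (n * n)) * w0 <= A * w1 * Cmod ((mu + 1) * mu) ->
  Cmod (RtoC c * mu - Ci * RtoC (n * s)) <= A * w1 * Cmod ((mu + 1) * mu) ->
  Cmod (mult_next n s c mu M) <= (A * C0 + A) * w1.
Proof.
  intros Hs HC HA N1 N0 HM W0 W1 H1 H2.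
  assert (Np : ((mu + 1) * mu)%C <> 0%C) by now apply Cmult_neq_0.
  assert (Pp : 0 < Cmod ((mu + 1) * mu)) by now apply Cmod_gt_0.
  unfold mult_next. rewrite Cmod_div by auto.
  apply Rmult_le_reg_r with (Cmod ((mu + 1) * mu)); auto.
  unfold Rdiv. rewrite Rmult_assoc, Rinv_l, Rmult_1_r by lra.
  eapply Rle_trans; [apply Cmod_triangle|].
  rewrite !(Cmod_mult _ M), (Cmod_mult (RtoC (s * s))), Cmod_R, Rabs_pos_eq by nra.
  set (q := Cmod (mu * mu - RtoC (n * n))) in *.
  assert (Q0 : 0 <= q) by apply Cmod_ge_0.
  assert (S1 : s * s * q * Cmod M <= A * C0 * w1 * Cmod ((mu + 1) * mu)).
  { apply Rle_trans with (1 * q * (C0 * w0)).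
    - apply Rmult_le_compat; auto; [nra|apply Cmod_ge_0|]. apply Rmult_le_compat_r; nra.
    - replace (1 * q * (C0 * w0)) with (C0 * (q * w0)) by ring.
      replace (A * C0 * w1 * Cmod ((mu + 1) * mu)) with (C0 * (A * w1 * Cmod ((mu + 1) * mu))) by ring.
      now apply Rmult_le_compat_l. }
  lra.
Qed.

Lemma stepped_real (e b : R) k : stepped (RtoC (b + e)) k = RtoC (b + 2 * INR k + e).
Proof. unfold stepped. rewrite <- RtoC_plus. f_equal. ring. Qed.

Lemma Cmod_quad x : Cmod ((RtoC x + 1) * RtoC x) = Rabs (x + 1) * Rabs x.
Proof. rewrite Cmod_mult, <- RtoC_plus, !Cmod_R. reflexivity. Qed.

Lemma Cmod_sqdiff x n : Cmod (RtoC x * RtoC x - RtoC (n * n)) = Rabs (x * x - n * n).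
Proof. now rewrite <- RtoC_mult, <- RtoC_minus, Cmod_R. Qed.

Lemma Cmod_drive x n s c : 0 <= s <= 1 -> 0 <= c <= 1 ->
  Cmod (RtoC c * RtoC x - Ci * RtoC (n * s)) <= Rabs x + Rabs n.
Proof.
  intros Hs Hc. eapply Rle_trans; [apply Cmod_sub_le|].
  rewrite !Cmod_mult, Cmod_Ci, !Cmod_R, Rabs_mult, (Rabs_pos_eq s), (Rabs_pos_eq c) by lra.
  pose proof (Rabs_pos x). pose proof (Rabs_pos n). nra.
Qed.

(** The continuation along the real points [b + 2 k + e], to be studied as [e] tends to 0. *)
Definition near_seq (n th b : R) (k : nat) (e : R) : C :=
  mult_ext n th k (RtoC (b + 2 * INR k + e)).

Definition bounded_by (w : R -> R) (f : R -> C) : Prop :=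
  exists C0, 0 <= C0 /\ forall e, 0 < e < 1 / 8 -> Cmod (f e) <= C0 * w e.

Lemma near_seq_S n th b k e :
  near_seq n th b (S k) e =
  mult_next n (sin th) (cos th) (RtoC (b + 2 * INR (S k) + e)) (near_seq n th b k e).
Proof.
  unfold near_seq. cbn [mult_ext].
  replace (RtoC (b + 2 * INR (S k) + e) - 2)%C with (RtoC (b + 2 * INR k + e)); [reflexivity|].
  rewrite <- RtoC_minus, S_INR. f_equal. ring.
Qed.

Lemma near_seq_step n th b k (w0 w1 : R -> R) A : 0 < th < PI / 2 ->
  (forall e, 0 < e < 1 / 8 -> 0 <= w0 e /\ 0 <= w1 e) -> 0 <= A ->
  (forall e, 0 < e < 1 / 8 ->
     let x := b + 2 * INR (S k) + e in
     x <> 0 /\ x + 1 <> 0 /\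
     Rabs (x * x - n * n) * w0 e <= A * w1 e * (Rabs (x + 1) * Rabs x) /\
     Rabs x + Rabs n <= A * w1 e * (Rabs (x + 1) * Rabs x)) ->
  bounded_by w0 (near_seq n th b k) -> bounded_by w1 (near_seq n th b (S k)).
Proof.
  intros Hth Hw HA Hx [C0 [HC0 HB]]. destruct (sin_cos_bounds th Hth) as [Hs [Hc Hsc]].
  exists (A * C0 + A). split; [nra|]. intros e He.
  destruct (Hx e He) as [X0 [X1 [X2 X3]]]. destruct (Hw e He) as [W0 W1].
  rewrite near_seq_S. apply (mult_next_weighted n (sin th) (cos th) A C0 (w0 e)); auto; try lra.
  - rewrite <- RtoC_plus. intros E; apply RtoC_inj in E; lra.
  - intros E; apply RtoC_inj in E; lra.
  - now rewrite Cmod_sqdiff, Cmod_quad.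
  - rewrite Cmod_quad. eapply Rle_trans; [apply Cmod_drive; lra|]. auto.
Qed.

Definition wone (e : R) : R := 1.
(** The two weights: bounded near the point, and a simple pole there. *)
Definition winv (e : R) : R := / e.

(** A step at which neither denominator is small keeps the bound. *)
Lemma near_seq_regular n th b k w : 0 < th < PI / 2 -> w = wone \/ w = winv ->
  (forall e, 0 < e < 1 / 8 -> 1 / 2 <= Rabs (b + 2 * INR (S k) + e) /\
                             1 / 2 <= Rabs (b + 2 * INR (S k) + e + 1)) ->
  bounded_by w (near_seq n th b k) -> bounded_by w (near_seq n th b (S k)).
Proof.
  intros Hth Hw Hx.
  set (q := Rabs b + 2 * INR (S k) + 1).
  assert (Hq : 0 < q) by (unfold q; pose proof (Rabs_pos b); pose proof (pos_INR (S k)); lra).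
  assert (Hq2 : 0 < q * q) by nra.
  pose proof (Rabs_pos n) as Hn0. assert (Hnn : 0 <= n * n) by nra.
  apply (near_seq_step n th b k w w (4 * (q * q + n * n + q + Rabs n))); auto.
  - intros e He. destruct Hw as [-> | ->]; unfold wone, winv; [lra|].
    assert (0 < / e) by (apply Rinv_0_lt_compat; lra). lra.
  - nra.
  - intros e He x. destruct (Hx e He) as [H1 H2]. fold x in H1, H2.
    assert (Xq : Rabs x <= q).
    { unfold x, q. pose proof (pos_INR (S k)).
      eapply Rle_trans; [apply Rabs_triang|]. rewrite (Rabs_pos_eq e) by lra.
      eapply Rle_trans; [apply Rplus_le_compat_r, Rabs_triang|].
      rewrite (Rabs_pos_eq (2 * INR (S k))) by lra. lra. }
    assert (P4 : 1 / 4 <= Rabs (x + 1) * Rabs x) by nra.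
    assert (W : 0 < w e /\ 1 <= w e).
    { destruct Hw as [-> | ->]; unfold wone, winv; [lra|].
      assert (1 <= / e) by (rewrite <- Rinv_1; apply Rinv_le_contravar; lra). lra. }
    assert (Xs : Rabs (x * x - n * n) <= q * q + n * n).
    { unfold Rminus. eapply Rle_trans; [apply Rabs_triang|].
      rewrite Rabs_Ropp, Rabs_mult, (Rabs_pos_eq (n * n)) by lra.
      pose proof (Rabs_pos x). nra. }
    set (T := q * q + n * n + q + Rabs n).
    assert (HT : 0 < T) by (unfold T; lra).
    assert (G : T * w e <= 4 * T * w e * (Rabs (x + 1) * Rabs x)).
    { assert (0 < T * w e) by (apply Rmult_lt_0_compat; lra). nra. }
    repeat split.
    + intros E. rewrite E, Rabs_R0 in H1. lra.
    + intros E. rewrite E, Rabs_R0 in H2. lra.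
    + eapply Rle_trans; [|exact G]. apply Rmult_le_compat_r; [lra|]. unfold T; lra.
    + eapply Rle_trans; [|exact G]. unfold T. nra.
Qed.

Lemma near_seq_base n th b : 0 < th < PI / 2 -> b = -6 \/ b = -5 ->
  bounded_by wone (near_seq n th b 0).
Proof.
  intros Hth Hb. exists (8 * exp (- 6 * ln (sin th))). split.
  - pose proof (exp_pos (-6 * ln (sin th))). lra.
  - intros e He. unfold wone. rewrite Rmult_1_r. apply mult_base_bound; auto. simpl.
    destruct Hb as [-> | ->]; lra.
Qed.

Lemma near_seq_regular_iter n th b w k0 m : 0 < th < PI / 2 -> w = wone \/ w = winv ->
  1 / 2 <= b + 2 * INR (S k0) ->
  bounded_by w (near_seq n th b k0) -> bounded_by w (near_seq n th b (k0 + m)).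
Proof.
  intros Hth Hw Hb H. induction m as [|m IH].
  - now rewrite Nat.add_0_r.
  - rewrite Nat.add_succ_r. apply near_seq_regular; auto. intros e He.
    assert (INR (S k0) <= INR (S (k0 + m))) by (apply le_INR; lia).
    rewrite !Rabs_pos_eq; lra.
Qed.

(** At [|n|] the factor [mu ^ 2 - n ^ 2] is [O(e)] and compensates the pole. *)
Lemma near_seq_cancel n th b k : 0 < th < PI / 2 -> 1 <= Rabs n ->
  b + 2 * INR (S k) = Rabs n ->
  bounded_by winv (near_seq n th b k) -> bounded_by wone (near_seq n th b (S k)).
Proof.
  intros Hth Hn Hb. set (q := Rabs n) in *.
  assert (Hq : n * n = q * q) by (unfold q; rewrite <- Rabs_mult, Rabs_pos_eq; nra).
  apply (near_seq_step n th b k winv wone (2 * q + 1)); auto; try lra.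
  - intros e He. unfold winv, wone. assert (0 < / e) by (apply Rinv_0_lt_compat; lra). lra.
  - intros e He x. assert (Ex : x = q + e) by (unfold x; lra).
    rewrite Hq. fold q. unfold winv, wone.
    rewrite (Rabs_pos_eq x), (Rabs_pos_eq (x + 1)) by lra.
    assert (P1 : 1 <= (x + 1) * x) by nra.
    repeat split; try lra.
    + replace (x * x - q * q) with (e * (2 * q + e)) by (rewrite Ex; ring).
      rewrite Rabs_pos_eq by nra. replace (e * (2 * q + e) * / e) with (2 * q + e) by (field; lra). nra.
    + nra.
Qed.

(** The start [b] is chosen so that the recursion reaches [|n|].  On its way it passes
    the point [0] or [-1], where a denominator vanishes and a simple pole may arise; at
    [|n|] the factor [mu^2 - n^2] removes it, and from there on no denominator is small.
    For [n = 0] both happen in the same step. *)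
Lemma near_seq_after_pole nu th : 0 < th < PI / 2 ->
  exists b a, (b = -6 \/ b = -5) /\ b + 2 * INR (a + 4) = Rabs (IZR nu) + 2 /\
    bounded_by wone (near_seq (IZR nu) th b (a + 4)).
Proof.
  intros Hth. set (n := IZR nu).
  assert (HN : Rabs n = INR (Z.abs_nat nu)).
  { unfold n. rewrite <- abs_IZR, INR_IZR_INZ, Zabs2Nat.id_abs. reflexivity. }
  set (N := Z.abs_nat nu) in *.
  assert (Hnn : n * n = INR N * INR N) by (rewrite <- HN, <- Rabs_mult, Rabs_pos_eq; nra).
  pose proof (pos_INR N) as HN0.
  destruct (Nat.Even_or_Odd N) as [[a Ha]|[a Ha]].
  - (* [b = -6], and the pole is at [mu = 0] *)
    assert (HNa : INR N = 2 * INR a) by (rewrite Ha, mult_INR; simpl; ring).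
    exists (-6), a.
    assert (E : -6 + 2 * INR (a + 4) = Rabs n + 2) by (rewrite HN, HNa, plus_INR; simpl; ring).
    split; [auto|]. split; [exact E|].
    assert (S2 : bounded_by wone (near_seq n th (-6) 2)).
    { do 2 (apply near_seq_regular; auto;
        [intros e He; simpl INR; split; rewrite Rabs_left; lra|]).
      apply near_seq_base; auto. }
    assert (S3 : bounded_by wone (near_seq n th (-6) (a + 3))).
    { destruct a as [|a].
      - apply (near_seq_step n th (-6) 2 wone wone 1); auto; try lra.
        + intros; unfold wone; lra.
        + intros e He x. assert (Ex : x = e) by (unfold x; simpl; ring).
          simpl in HNa. assert (n * n = 0) by (rewrite Hnn, HNa; ring).
          rewrite HN, HNa, H. unfold wone. replace (2 * 0) with 0 by ring.
          rewrite (Rabs_pos_eq x), (Rabs_pos_eq (x + 1)) by lra.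
          rewrite (Rabs_pos_eq (x * x - 0)) by nra. repeat split; try lra; nra.
      - assert (S3 : bounded_by winv (near_seq n th (-6) 3)).
        { apply (near_seq_step n th (-6) 2 wone winv (n * n + INR N + 1)); auto; try nra.
          - intros e He. unfold winv, wone. assert (0 < / e) by (apply Rinv_0_lt_compat; lra). lra.
          - intros e He x. assert (Ex : x = e) by (unfold x; simpl; ring). unfold winv, wone.
            rewrite HN, (Rabs_pos_eq x), (Rabs_pos_eq (x + 1)) by lra.
            replace ((n * n + INR N + 1) * / e * ((x + 1) * x)) with ((n * n + INR N + 1) * (1 + e))
              by (rewrite Ex; field; lra).
            repeat split; try lra; try nra.
            assert (Rabs (x * x - n * n) <= x * x + n * n) by (apply Rabs_le; nra). nra. }
        replace (S a + 3)%nat with (S (3 + a))%nat by lia.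
        apply near_seq_cancel; auto.
        + rewrite HN, HNa, S_INR. pose proof (pos_INR a). lra.
        + rewrite HN, HNa. rewrite !S_INR, plus_INR. simpl. ring.
        + apply near_seq_regular_iter; auto. simpl. lra. }
    replace (a + 4)%nat with (S (a + 3))%nat by lia. apply near_seq_regular; auto.
    intros e He. replace (S (a + 3))%nat with (a + 4)%nat by lia.
    rewrite !Rabs_pos_eq; lra.
  - (* [b = -5], and the pole is at [mu = -1] *)
    assert (HNa : INR N = 2 * INR a + 1) by (rewrite Ha, plus_INR, mult_INR; simpl; ring).
    exists (-5), a. pose proof (pos_INR a) as Ha0.
    assert (E : -5 + 2 * INR (a + 4) = Rabs n + 2) by (rewrite HN, HNa, plus_INR; simpl; ring).
    split; [auto|]. split; [exact E|].
    assert (S1 : bounded_by wone (near_seq n th (-5) 1)).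
    { apply near_seq_regular; auto; [intros e He; simpl INR; split; rewrite Rabs_left; lra|].
      apply near_seq_base; auto. }
    assert (S2 : bounded_by winv (near_seq n th (-5) 2)).
    { apply (near_seq_step n th (-5) 1 wone winv (2 * (n * n + INR N + 1))); auto; try nra.
      - intros e He. unfold winv, wone. assert (0 < / e) by (apply Rinv_0_lt_compat; lra). lra.
      - intros e He x. assert (Ex : x = -1 + e) by (unfold x; simpl; ring). unfold winv, wone.
        rewrite HN, (Rabs_left x), (Rabs_pos_eq (x + 1)) by lra.
        replace (2 * (n * n + INR N + 1) * / e * ((x + 1) * - x)) with (2 * (n * n + INR N + 1) * (1 - e))
          by (rewrite Ex; field; lra).
        repeat split; try lra; try nra.
        assert (Rabs (x * x - n * n) <= x * x + n * n) by (apply Rabs_le; nra). nra. }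
    assert (S3 : bounded_by wone (near_seq n th (-5) (a + 3))).
    { replace (a + 3)%nat with (S (2 + a))%nat by lia.
      apply near_seq_cancel; auto.
      - rewrite HN, HNa. lra.
      - rewrite HN, HNa, S_INR, plus_INR. simpl. ring.
      - apply near_seq_regular_iter; auto. simpl. lra. }
    replace (a + 4)%nat with (S (a + 3))%nat by lia. apply near_seq_regular; auto.
    intros e He. replace (S (a + 3))%nat with (a + 4)%nat by lia.
    rewrite !Rabs_pos_eq; lra.
Qed.

(** After the pole has been removed, [mult_slow_limit] with [sig = 0] gives
    [M(mu) = 1/(c mu) + o(1/mu)], so the multiplier is close to [- i tan th / la]. *)
Lemma vmult_near_integer nu th : 0 < th < PI / 2 ->
  exists K : nat, forall k : nat, (K <= k)%nat ->
  exists (J : nat) (c0 : R), 0 < c0 /\ forall e, 0 < e < 1 / 8 ->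
    let x := Rabs (IZR nu) + 2 + 2 * INR k + e in
    -7 <= x - 2 * INR J <= -4 /\ c0 <= Cmod (vmult (IZR nu) th J (RtoC x)).
Proof.
  intros Hth. set (n := IZR nu).
  destruct (sin_cos_bounds th Hth) as [Hs [Hc Hsc]].
  assert (Ht : 0 < tan th) by (apply tan_gt_0; lra).
  destruct (near_seq_after_pole nu th Hth) as [b [a [Hb [Eb [C0 [HC0 HB]]]]]]. fold n in Eb, HB.
  pose proof (Rabs_pos n) as Hn.
  assert (Hic : 0 < / cos th) by (apply Rinv_0_lt_compat; lra).
  set (B0 := (Rabs n + 3) * C0 + C0 + / cos th).
  assert (HB0 : 0 <= B0) by (unfold B0; nra).
  destruct (mult_slow_limit n (sin th) (cos th) 0 B0 Hs Hc Hsc ltac:(lra) HB0 (tan th / 4) ltac:(lra))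
    as [K1 HK1].
  destruct (nfloor_ex (4 / tan th)) as [K2 [_ HK2]].
  { left. apply Rdiv_lt_0_compat; lra. }
  exists (K1 + K2 + 1)%nat. intros k Hk.
  assert (Hk2 : 4 / tan th < INR k).
  { assert (H : (K2 + 1 <= k)%nat) by lia. apply le_INR in H. rewrite plus_INR in H. simpl in H. lra. }
  set (x0 := Rabs n + 2 + 2 * INR k).
  exists (a + 4 + k)%nat, (tan th / (4 * (x0 + 1))).
  assert (Hx0 : 0 < x0) by (unfold x0; pose proof (pos_INR k); lra).
  split; [apply Rdiv_lt_0_compat; lra|].
  intros e He x. split.
  - unfold x, x0. rewrite plus_INR. destruct Hb as [-> | ->]; lra.
  - set (mu0 := RtoC (Rabs n + 2 + e)).
    assert (Est : forall j, stepped mu0 j = RtoC (Rabs n + 2 + 2 * INR j + e)).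
    { intros j. unfold mu0. rewrite <- stepped_real. reflexivity. }
    assert (Cst : forall j, Cmod (stepped mu0 j) = Rabs n + 2 + 2 * INR j + e).
    { intros j. rewrite Est, Cmod_R, Rabs_pos_eq; auto. pose proof (pos_INR j). lra. }
    set (M := fun j => mult_ext n th (a + 4 + j) (stepped mu0 j)).
    assert (M0 : Cmod (M 0%nat) <= C0).
    { unfold M. rewrite Nat.add_0_r, Est.
      replace (Rabs n + 2 + 2 * INR 0 + e) with (b + 2 * INR (a + 4) + e) by (simpl; lra).
      eapply Rle_trans; [apply HB; exact He|]. unfold wone; lra. }
    assert (Hmu0 : Cmod mu0 = Rabs n + 2 + e) by (unfold mu0; rewrite Cmod_R, Rabs_pos_eq; lra).
    assert (Nm0 : mu0 <> 0%C) by (apply Cmod_gt_0; lra).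
    assert (Nc : RtoC (cos th) <> 0%C) by (intros E; apply RtoC_inj in E; lra).
    assert (SL := HK1 mu0 0%C 0%C M M).
    assert (D : Cmod (stepped mu0 k) * Cmod (M k - 0 * M k - (1 - 0) / (RtoC (cos th) * stepped mu0 k))
                <= tan th / 4).
    { apply SL.
      - intros j. rewrite Cst. pose proof (pos_INR j). lra.
      - intros j. pose proof (Cmod_plus_ge (stepped mu0 j) 1) as P. rewrite Cst, Cmod_1 in P.
        pose proof (pos_INR j). lra.
      - rewrite Cmod_0. lra.
      - rewrite Cmod_0. lra.
      - unfold mu0; simpl. lra.
      - intros j. unfold M. rewrite Nat.add_succ_r. simpl. now rewrite stepped_S.
      - intros j. unfold M. rewrite Nat.add_succ_r. simpl. rewrite stepped_S, Cplus_0_r. reflexivity.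
      - unfold B0. assert (0 <= (Rabs n + 3) * C0) by nra. lra.
      - replace (M 0%nat - 0 * M 0%nat - (1 - 0) / (RtoC (cos th) * mu0))%C with
          (M 0%nat - 1 / (RtoC (cos th) * mu0))%C by (field; auto).
        eapply Rle_trans; [apply Rmult_le_compat_l; [apply Cmod_ge_0|apply Cmod_sub_le]|].
        rewrite Cmod_div, Cmod_mult, Cmod_1, Cmod_R, (Rabs_pos_eq (cos th))
          by (try lra; now apply Cmult_neq_0).
        rewrite Hmu0, Rmult_plus_distr_l.
        replace ((Rabs n + 2 + e) * (1 / (cos th * (Rabs n + 2 + e)))) with (/ cos th) by (field; lra).
        assert ((Rabs n + 2 + e) * Cmod (M 0%nat) <= (Rabs n + 3) * C0).
        { apply Rmult_le_compat; auto; try lra. apply Cmod_ge_0. }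
        unfold B0. lra.
      - lia. }
    assert (Ex : RtoC x = stepped mu0 k) by (rewrite Est; reflexivity).
    fold (M k). set (la := stepped mu0 k) in *.
    assert (Hla : Cmod la = x).
    { rewrite <- Ex, Cmod_R, Rabs_pos_eq; auto. unfold x, x0. pose proof (pos_INR k). lra. }
    assert (Hx : 0 < x) by (unfold x, x0; pose proof (pos_INR k); lra).
    assert (Nl : la <> 0%C) by (apply Cmod_gt_0; lra).
    assert (Hl1 : Cmod (la + 1) = x + 1).
    { rewrite <- Ex, <- RtoC_plus, Cmod_R, Rabs_pos_eq; lra. }
    assert (N1 : (la + 1)%C <> 0%C) by (apply Cmod_gt_0; lra).
    set (E := (M k - 0 * M k - (1 - 0) / (RtoC (cos th) * la))%C) in *.
    assert (V : vmult n th (a + 4 + k) (RtoC x) =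
      ((-1 + cexp (0, - th)%R / RtoC (cos th)) / la + (1 / la / (la + 1) + cexp (0, - th)%R * E))%C).
    { unfold vmult. rewrite Ex. fold (M k). unfold E. fold la. change (mult_ext n th (a + 4 + k) la) with (M k). field. auto. }
    rewrite V, leading_coefficient by auto.
    eapply Rle_trans; [|apply Cmod_plus_ge].
    rewrite Cmod_div, Cmod_mult, Cmod_Ci, Cmod_R, Rabs_Ropp, (Rabs_pos_eq (tan th)), Hla by (auto; lra).
    assert (T : Cmod (1 / la / (la + 1) + cexp (0, - th)%R * E) <= tan th / 2 / x).
    { eapply Rle_trans; [apply Cmod_triangle|].
      rewrite Cmod_mult, Cmod_cexp. simpl. rewrite exp_0, Rmult_1_l.
      rewrite !Cmod_div, Cmod_1, Hl1, Hla by auto.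
      rewrite Hla in D.
      assert (P1 : 1 / x / (x + 1) <= tan th / 4 / x).
      { apply Rmult_le_reg_l with x; auto.
        replace (x * (1 / x / (x + 1))) with (1 / (x + 1)) by (field; lra).
        replace (x * (tan th / 4 / x)) with (tan th / 4) by (field; lra).
        assert (4 / tan th < x + 1) by (unfold x, x0; pose proof (pos_INR k); lra).
        apply Rmult_le_reg_r with (x + 1); [lra|].
        replace (1 / (x + 1) * (x + 1)) with 1 by (field; lra).
        apply Rle_trans with (tan th / 4 * (4 / tan th)); [right; field; lra|].
        apply Rmult_le_compat_l; lra. }
      assert (P2 : Cmod E <= tan th / 4 / x).
      { apply Rmult_le_reg_l with x; auto.
        replace (x * (tan th / 4 / x)) with (tan th / 4) by (field; lra). exact D. }
      replace (tan th / 2 / x) with (tan th / 4 / x + tan th / 4 / x) by (field; lra). lra. }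
    assert (F : tan th / (4 * (x0 + 1)) <= tan th * 1 / x - tan th / 2 / x).
    { replace (tan th * 1 / x - tan th / 2 / x) with (tan th * / (2 * x)) by (field; lra).
      unfold Rdiv. apply Rmult_le_compat_l; [lra|]. apply Rinv_le_contravar; unfold x, x0 in *; lra. }
    lra.
Qed.

(** * Smooth functions and the Euler operator *)

Definition dC (f : R -> C) (x : R) : C :=
  (Derive (fun t => fst (f t)) x, Derive (fun t => snd (f t)) x).

Lemma dC_eq f x l : cder f x l -> dC f x = l.
Proof. intros [A B]. apply Ceq; simpl; now apply is_derive_unique. Qed.

Lemma cder_dC f x l : cder f x l -> cder f x (dC f x).
Proof. intros H. now rewrite (dC_eq _ _ _ H). Qed.

Fixpoint Ck (k : nat) (f : R -> C) : Prop :=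
  match k with
  | 0%nat => forall x, ccont f x
  | S k => (forall x, cder f x (dC f x)) /\ Ck k (dC f)
  end.

Definition csmooth (f : R -> C) : Prop := forall k, Ck k f.

Lemma csmooth_cder f x : csmooth f -> cder f x (dC f x).
Proof. intros H. apply (H 1%nat). Qed.

Lemma csmooth_ccont f x : csmooth f -> ccont f x.
Proof. intros H. apply (H 0%nat). Qed.

Lemma csmooth_dC f : csmooth f -> csmooth (dC f).
Proof. intros H k. apply (H (S k)). Qed.

Lemma dC_ext f g : (forall x, f x = g x) -> forall x, dC f x = dC g x.
Proof.
  intros H x. apply Ceq; simpl; apply Derive_ext; intros t; now rewrite H.
Qed.

Lemma Ck_ext k : forall f g, (forall x, f x = g x) -> Ck k f -> Ck k g.
Proof.
  induction k as [|k IH]; simpl; intros f g H Hf.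
  - intros x. eapply ccont_ext; [exact H|apply Hf].
  - destruct Hf as [A B]. split.
    + intros x. rewrite <- (dC_ext f g H). eapply cder_ext; [exact H|apply A].
    + apply (IH (dC f)); auto. now apply dC_ext.
Qed.

Lemma Ck_plus k : forall f g, Ck k f -> Ck k g -> Ck k (fun x => (f x + g x)%C).
Proof.
  induction k as [|k IH]; simpl; intros f g Hf Hg.
  - intros x; apply ccont_plus; auto.
  - destruct Hf as [A B], Hg as [A' B']. split.
    + intros x. eapply cder_dC. apply cder_plus; auto.
    + apply (Ck_ext k (fun x => (dC f x + dC g x)%C)); [|apply IH; auto].
      intros x. symmetry. apply dC_eq, cder_plus; auto.
Qed.

Lemma Ck_scal k c : forall f, Ck k f -> Ck k (fun x => (c * f x)%C).
Proof.
  induction k as [|k IH]; simpl; intros f Hf.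
  - intros x; apply ccont_mult; auto. apply ccont_const.
  - destruct Hf as [A B]. split.
    + intros x. eapply cder_dC. apply cder_scal; auto.
    + apply (Ck_ext k (fun x => (c * dC f x)%C)); [|apply IH; auto].
      intros x. symmetry. apply dC_eq, cder_scal; auto.
Qed.

Lemma cder_id_mult f x l : cder f x l -> cder (fun t => (RtoC t * f t)%C) x (f x + RtoC x * l)%C.
Proof.
  intros H. eapply cder_eq.
  - apply cder_mult; [apply cder_RtoC; apply (is_derive_id (K := R_AbsRing))|exact H].
  - unfold one; simpl. ring.
Qed.

Lemma Ck_S_k k : forall f, Ck (S k) f -> Ck k f.
Proof.
  induction k as [|k IH]; intros f [A B].
  - intros x. eapply cder_ccont, A.
  - split; [exact A|]. apply IH, B.
Qed.

Lemma Ck_id_mult k : forall f, Ck k f -> Ck k (fun x => (RtoC x * f x)%C).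
Proof.
  induction k as [|k IH]; intros f Hf.
  - intros x. apply ccont_mult; [apply ccont_RtoC, continuous_id|apply Hf].
  - pose proof (Ck_S_k k f Hf) as Hf'. destruct Hf as [A B]. split.
    + intros x. eapply cder_dC, cder_id_mult, A.
    + apply (Ck_ext k (fun x => (f x + RtoC x * dC f x)%C)).
      * intros x. symmetry. apply dC_eq, cder_id_mult, A.
      * apply Ck_plus; [exact Hf'|]. apply IH, B.
Qed.

Definition Eul (f : R -> C) (x : R) : C := (RtoC x * dC f x)%C.

(** The operator [x d/dx - k]; on [x ^ j] it is multiplication by [j - k]. *)
Definition Esub (k : R) (f : R -> C) (x : R) : C := (Eul f x - RtoC k * f x)%C.

Lemma csmooth_Esub k f : csmooth f -> csmooth (Esub k f).
Proof.
  intros H j. unfold Esub, Eul.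
  apply (Ck_ext j (fun x => (RtoC x * dC f x + RtoC (- k) * f x)%C)).
  - intros x. apply Ceq; simpl; ring.
  - apply Ck_plus; [apply Ck_id_mult; now apply csmooth_dC|apply Ck_scal, H].
Qed.

Definition vanishes (rad : R) (f : R -> C) : Prop := forall x, rad <= Rabs x -> f x = 0%C.

Lemma is_derive_flat_side (f : R -> R) x l (sg : R) : sg = 1 \/ sg = -1 ->
  (forall t, 0 <= t -> f (x + sg * t) = 0) -> is_derive f x l -> l = 0.
Proof.
  intros Hs Hf D. apply is_derive_Reals in D.
  destruct (Req_dec l 0) as [|N]; auto. exfalso.
  assert (Hl : 0 < Rabs l / 2) by (apply Rabs_pos_lt in N; lra).
  destruct (D _ Hl) as [d Hd]. pose proof (cond_pos d) as Pd.
  specialize (Hd (sg * (d / 2))).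
  rewrite (Hf (d / 2)) in Hd by lra. pose proof (Hf 0 ltac:(lra)) as F0.
  rewrite Rmult_0_r, Rplus_0_r in F0. rewrite F0 in Hd.
  replace ((0 - 0) / (sg * (d / 2)) - l) with (- l) in Hd.
  2:{ field. destruct Hs as [-> | ->]; lra. }
  rewrite Rabs_Ropp in Hd.
  assert (Rabs l < Rabs l / 2).
  { apply Hd; destruct Hs as [-> | ->]; try lra; [rewrite Rabs_pos_eq|rewrite Rabs_left]; lra. }
  lra.
Qed.

Lemma vanishes_dC rad f : 0 < rad -> csmooth f -> vanishes rad f -> vanishes rad (dC f).
Proof.
  intros Hr Hf Hv x Hx. destruct (csmooth_cder f x Hf) as [A B].
  assert (S : exists sg, (sg = 1 \/ sg = -1) /\ forall t, 0 <= t -> f (x + sg * t) = 0%C).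
  { unfold Rabs in Hx. destruct (Rcase_abs x).
    - exists (-1). split; auto. intros t Ht. apply Hv. rewrite Rabs_left; lra.
    - exists 1. split; auto. intros t Ht. apply Hv. rewrite Rabs_pos_eq; lra. }
  destruct S as [sg [Hs Hf0]]. apply Ceq.
  - eapply is_derive_flat_side; [exact Hs| |exact A]. intros t Ht. simpl. now rewrite Hf0.
  - eapply is_derive_flat_side; [exact Hs| |exact B]. intros t Ht. simpl. now rewrite Hf0.
Qed.

Lemma vanishes_Esub rad k f : 0 < rad -> csmooth f -> vanishes rad f -> vanishes rad (Esub k f).
Proof.
  intros Hr Hf Hv x Hx. unfold Esub, Eul. rewrite (vanishes_dC rad f Hr Hf Hv x Hx), (Hv x Hx). ring.
Qed.

Lemma cder_cint_param (g g' : R -> R -> C) a b x : a <= b ->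
  locally x (fun u => forall t, a <= t <= b -> cder (fun u => g u t) u (g' u t)) ->
  (forall t, a <= t <= b -> ccont2 g' x t) ->
  locally x (fun u => ccont_on (g u) a b) ->
  cder (fun u => cint (g u) a b) x (cint (g' x) a b).
Proof.
  intros Hab Hd Hc Hi.
  assert (Key : forall (p : C -> R) , (p = fst \/ p = snd) ->
    is_derive (fun u => RInt (fun t => p (g u t)) a b) x (RInt (fun t => p (g' x t)) a b)).
  { intros p Hp.
    assert (Dp : locally x (fun u => forall t, a <= t <= b ->
               is_derive (fun u => p (g u t)) u (p (g' u t)))).
    { revert Hd; apply filter_imp. intros u H t Ht. destruct (H t Ht) as [A B].
      destruct Hp as [-> | ->]; assumption. }
    apply is_derive_ext with (fun u => RInt (fun t => p (g u (clamp a b t))) a b).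
    { intros u. apply RInt_ext. intros t Ht. rewrite Rmin_left, Rmax_right in Ht by lra.
      rewrite clamp_id by lra. reflexivity. }
    replace (RInt (fun t => p (g' x t)) a b) with
      (RInt (fun t => Derive (fun u => p (g u (clamp a b t))) x) a b).
    2:{ apply RInt_ext. intros t Ht. rewrite Rmin_left, Rmax_right in Ht by lra.
        rewrite clamp_id by lra. apply is_derive_unique.
        apply (locally_singleton _ _ Dp). lra. }
    apply (is_derive_RInt_param (fun u t => p (g u (clamp a b t)))).
    - revert Dp; apply filter_imp. intros u H t _. eexists. apply H, clamp_in, Hab.
    - intros t _. apply continuity_2d_pt_ext_loc with (fun u v => p (g' u (clamp a b v))).
      + destruct Dp as [d Hdd]. exists d. intros u v Hu Hv. symmetry.
        apply is_derive_unique. apply (Hdd u Hu), clamp_in, Hab.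
      + intros eps. destruct (Hc _ (clamp_in a b t Hab)) as [A B].
        assert (P : continuity_2d_pt (fun u v => p (g' u v)) x (clamp a b t))
          by (destruct Hp as [-> | ->]; assumption).
        destruct (P eps) as [d Hdd]. exists d. intros u v Hu Hv. apply Hdd; auto.
        eapply Rle_lt_trans; [apply clamp_lip|exact Hv].
    - revert Hi; apply filter_imp. intros u H.
      apply (ex_RInt_ext (V := R_NormedModule)) with (fun t => p (g u t)).
      + intros t Ht. rewrite Rmin_left, Rmax_right in Ht by lra. rewrite clamp_id by lra. reflexivity.
      + destruct (ccont_on_ex _ _ _ Hab H). destruct Hp as [-> | ->]; assumption. }
  split; apply Key; auto.
Qed.

Lemma ccont_cint_param (g : R -> R -> C) c d x0 : c <= d ->
  (forall y, c <= y <= d -> ccont2 g x0 y) ->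
  (forall x, ccont_on (g x) c d) ->
  ccont (fun x => cint (g x) c d) x0.
Proof.
  intros Hcd H1 H2.
  assert (Key : forall (p : C -> R) , (p = fst \/ p = snd) ->
     continuous (fun x => RInt (fun t => p (g x t)) c d) x0).
  { intros p Hp.
    apply continuous_ext with (fun x => RInt (fun t => p (g x (clamp c d t))) c d).
    { intros u. apply RInt_ext. intros t Ht. rewrite Rmin_left, Rmax_right in Ht by lra.
      rewrite clamp_id by lra. reflexivity. }
    apply (RInt_param_continuous (fun x t => p (g x (clamp c d t)))); auto.
    - intros y _ eps. destruct (H1 _ (clamp_in c d y Hcd)) as [A B].
      assert (P : continuity_2d_pt (fun u v => p (g u v)) x0 (clamp c d y))
          by (destruct Hp as [-> | ->]; assumption).
      destruct (P eps) as [e He]. exists e. intros u v Hu Hv. apply He; auto.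
      eapply Rle_lt_trans; [apply clamp_lip|exact Hv].
    - intros x y _. apply continuity_pt_filterlim. intros eps Heps.
      destruct (H2 x _ (clamp_in c d y Hcd)) as [A B].
      assert (P : continuous (fun v => p (g x v)) (clamp c d y))
          by (destruct Hp as [-> | ->]; assumption).
      apply continuity_pt_filterlim in P. destruct (P eps Heps) as [e [He P']].
      exists e. split; auto. intros v [_ Hv]. simpl in *. unfold R_dist in *.
      destruct (Req_dec (clamp c d y) (clamp c d v)) as [E|N].
      + rewrite E, Rminus_diag, Rabs_R0. exact Heps.
      + apply P'. split; [split; [exact I|exact N]|].
        eapply Rle_lt_trans; [apply clamp_lip|exact Hv]. }
  split; apply Key; auto.
Qed.

(** * The V-line transform of an angular mode *)

(** [vint i f r] is the integral along the second branch of the V with vertex at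
    distance [r], of [f] times the angular factor and the weight [d ^ (-2 i)],
    where [r d] is the distance to the origin; [psi] is the angle at the origin
    between the running point and the foot of the perpendicular. *)
Definition vker (n th : R) (i : nat) (psi : R) : C :=
  (ker n th psi * RtoC (sin th / (cos psi * cos psi) * (cos psi / sin th) ^ (2 * i)))%C.

Definition vfun (n th : R) (i : nat) (f : R -> C) (r psi : R) : C :=
  (f (r * sin th / cos psi)%R * vker n th i psi)%C.

Definition vint (n th : R) (i : nat) (f : R -> C) (r : R) : C :=
  cint (vfun n th i f r) (- (PI / 2)) (psic th).

(** For a vertex at this distance or beyond, even the foot of the perpendicular on the
    line of the second branch is outside the disk of radius [rad]. *)
Definition outer (rad th : R) : R := rad / sin th.

(** The data produced by an angular mode: the two summands are the integrals along the
    two branches, the second one parametrized by direction. *)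
Definition Vt (rad n th : R) (f : R -> C) (r : R) : C :=
  (cint f r (outer rad th) + cexp (0, - th)%R * (RtoC r * vint n th 0 f r))%C.

Lemma vker_cos0 n th i psi : cos psi = 0 -> vker n th i psi = 0%C.
Proof.
  intros H. unfold vker. rewrite H, Rmult_0_l. unfold Rdiv. rewrite Rinv_0, Rmult_0_r, Rmult_0_l. ring.
Qed.

Lemma ccont_vker n th i psi : 0 < th < PI / 2 -> cos psi <> 0 -> ccont (vker n th i) psi.
Proof.
  intros Hth H. destruct (sin_cos_bounds th Hth) as [Hs _]. unfold vker. apply ccont_mult; [apply ccont_ker|].
  apply ccont_RtoC. apply rcont_mult.
  - apply (ex_derive_continuous (V := R_NormedModule)). auto_derive. nra.
  - derive_cont.
Qed.

Lemma vfun_zero rad n th i f r psi : 0 < th < PI / 2 -> vanishes rad f -> 0 < r ->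
  rad * Rabs (cos psi) <= r * sin th -> vfun n th i f r psi = 0%C.
Proof.
  intros Hth Hv Hr H. destruct (sin_cos_bounds th Hth) as [Hs _]. unfold vfun.
  destruct (Req_dec (cos psi) 0) as [E|E].
  - rewrite vker_cos0 by auto. ring.
  - rewrite Hv; [ring|]. assert (0 < Rabs (cos psi)) by now apply Rabs_pos_lt.
    unfold Rdiv. rewrite !Rabs_mult, Rabs_inv, (Rabs_pos_eq r), (Rabs_pos_eq (sin th)) by lra.
    apply Rmult_le_reg_r with (Rabs (cos psi)); auto.
    rewrite Rmult_assoc, Rinv_l, Rmult_1_r by lra. exact H.
Qed.

(** Where [cos psi = 0] the formula for the integrand is meaningless, but near such a
    direction the running point is outside the support. *)
Lemma vfun_cont rad n th i f r psi : 0 < th < PI / 2 -> 0 < rad -> (forall x, ccont f x) ->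
  vanishes rad f -> 0 < r -> ccont2 (vfun n th i f) r psi.
Proof.
  intros Hth Hrad Hf Hv Hr. destruct (sin_cos_bounds th Hth) as [Hs _].
  destruct (Req_dec (cos psi) 0) as [E|E].
  - apply ccont2_squeeze with (fun _ _ => 0); [|apply continuity_2d_pt_const|reflexivity].
    assert (He : 0 < r / 2 * sin th / rad) by (apply Rdiv_lt_0_compat; nra).
    assert (Cc : continuity_pt cos psi) by apply continuity_cos.
    destruct (Cc _ He) as [d [Hd Hc]].
    assert (Hm : 0 < Rmin d (r / 2)) by (apply Rmin_glb_lt; lra).
    exists (mkposreal _ Hm). intros u v Hu Hw. simpl in *.
    pose proof (Rmin_l d (r / 2)). pose proof (Rmin_r d (r / 2)).
    assert (Hu' : r / 2 < u) by (apply Rabs_def2 in Hu; lra).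
    rewrite (vfun_zero rad); auto; [rewrite Cmod_0; lra|lra|].
    assert (Hcv : Rabs (cos v) < r / 2 * sin th / rad).
    { destruct (Req_dec psi v) as [Ev|Ev].
      - rewrite <- Ev, E, Rabs_R0. exact He.
      - specialize (Hc v). simpl in Hc. unfold R_dist in Hc. rewrite E, Rminus_0_r in Hc.
        apply Hc. split; [split; [exact I|auto]|lra]. }
    apply Rle_trans with (rad * (r / 2 * sin th / rad)).
    + apply Rmult_le_compat_l; lra.
    + replace (rad * (r / 2 * sin th / rad)) with (r / 2 * sin th) by (field; lra).
      apply Rmult_le_compat_r; lra.
  - unfold vfun. apply ccont2_mult.
    + apply (ccont2_comp f (fun u v => u * sin th / cos v)); auto.
      unfold Rdiv. apply continuity_2d_pt_mult.
      * apply continuity_2d_pt_mult; [apply continuity_2d_pt_id1|apply continuity_2d_pt_const].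
      * apply (rcont2_comp (fun v => / cos v) (fun _ v => v)); [apply continuity_2d_pt_id2|].
        derive_cont.
    + apply ccont2_snd_var, ccont_vker; auto.
Qed.

Lemma vfun_ccont_on rad n th i f r a b : 0 < th < PI / 2 -> 0 < rad -> (forall x, ccont f x) ->
  vanishes rad f -> 0 < r -> ccont_on (vfun n th i f r) a b.
Proof. intros. intros psi _. apply ccont2_ccont_snd, (vfun_cont rad); auto. Qed.

Lemma locally_pos r : 0 < r -> locally r (fun u => 0 < u).
Proof.
  intros H. exists (mkposreal _ H). intros u Hu. unfold ball in Hu; simpl in Hu.
  unfold AbsRing_ball, abs, minus, plus, opp in Hu; simpl in Hu. apply Rabs_def2 in Hu. lra.
Qed.

Lemma psic_ge th : 0 < th < PI / 2 -> - (PI / 2) <= psic th.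
Proof. unfold psic; lra. Qed.

Lemma ccont2_Eul_over rad f n th i r psi : 0 < th < PI / 2 -> 0 < rad -> csmooth f -> vanishes rad f -> 0 < r ->
  ccont2 (fun u t => (RtoC (/ u) * vfun n th i (Eul f) u t)%C) r psi.
Proof.
  intros Hth Hrad Hf Hv Hr. apply ccont2_mult.
  - apply ccont2_RtoC. apply continuity_2d_pt_inv; [apply continuity_2d_pt_id1|lra].
  - apply (vfun_cont rad); auto.
    + intros x. apply ccont_mult; [apply ccont_RtoC, continuous_id|]. now apply csmooth_ccont, csmooth_dC.
    + intros x Hx. unfold Eul. rewrite (vanishes_dC rad f Hrad Hf Hv x Hx). ring.
Qed.

Lemma cder_vint rad n th i f r : 0 < th < PI / 2 -> 0 < rad -> csmooth f -> vanishes rad f -> 0 < r ->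
  cder (vint n th i f) r (RtoC (/ r) * vint n th i (Eul f) r)%C.
Proof.
  intros Hth Hrad Hf Hv Hr. pose proof (psic_ge th Hth) as Hp. unfold vint.
  assert (Ce : forall psi u, 0 < u -> ccont2 (vfun n th i (Eul f)) u psi).
  { intros psi u Hu. apply (vfun_cont rad); auto.
    - intros x. apply ccont_mult; [apply ccont_RtoC, continuous_id|]. now apply csmooth_ccont, csmooth_dC.
    - intros x Hx. unfold Eul. rewrite (vanishes_dC rad f Hrad Hf Hv x Hx). ring. }
  rewrite <- cint_scal; auto.
  2:{ intros psi _. eapply ccont2_ccont_snd, Ce, Hr. }
  apply (cder_cint_param (vfun n th i f) (fun u t => (RtoC (/ u) * vfun n th i (Eul f) u t)%C)); auto.
  - generalize (locally_pos r Hr); apply filter_imp. intros u Hu t _.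
    destruct (Req_dec (cos t) 0) as [E|E].
    + apply cder_ext with (fun _ => 0%C).
      { intros w. unfold vfun. rewrite vker_cos0 by auto. ring. }
      eapply cder_eq; [apply cder_const|]. unfold vfun. rewrite vker_cos0 by auto. ring.
    + unfold vfun. eapply cder_eq.
      * apply cder_mult; [|apply cder_const].
        apply (cder_comp f (fun u => u * sin th / cos t)); [|now apply csmooth_cder].
        auto_derive; auto.
      * unfold Eul. replace (RtoC (u * sin th / cos t)) with (RtoC u * RtoC (1 * sin th * / cos t))%C.
        2:{ rewrite <- RtoC_mult. f_equal. field; auto. }
        assert (RtoC u <> 0%C) by (intros X; apply RtoC_inj in X; lra).
        rewrite (RtoC_inv u) by lra. field. auto.
  - intros t _. now apply (ccont2_Eul_over rad).
  - generalize (locally_pos r Hr); apply filter_imp. intros u Hu. apply (vfun_ccont_on rad); auto.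
    intros x; now apply csmooth_ccont.
Qed.

Lemma cder_cint_lower f r b : (forall x, ccont f x) -> cder (fun u => cint f u b) r (- f r)%C.
Proof.
  intros Hf.
  assert (Ex : forall (p : C -> R) u v, (p = fst \/ p = snd) -> ex_RInt (fun t => p (f t)) u v).
  { intros p u v Hp. apply (ex_RInt_continuous (V := R_CompleteNormedModule)). intros x _.
    destruct Hp as [-> | ->]; apply (Hf x). }
  split; simpl.
  - apply (is_derive_RInt' (V := R_NormedModule) (fun t => fst (f t)) _ r b); [|apply (Hf r)].
    apply filter_forall. intros u. apply (RInt_correct (V := R_CompleteNormedModule)), (Ex fst); auto.
  - apply (is_derive_RInt' (V := R_NormedModule) (fun t => snd (f t)) _ r b); [|apply (Hf r)].
    apply filter_forall. intros u. apply (RInt_correct (V := R_CompleteNormedModule)), (Ex snd); auto.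
Qed.

(** The transform intertwines [x d/dx] and [r d/dr - 1], by dilation invariance. *)
Lemma cder_Vt rad n th k f r : 0 < th < PI / 2 -> 0 < rad -> csmooth f -> vanishes rad f ->
  0 < r <= outer rad th ->
  exists l, cder (Vt rad n th f) r l /\
    Vt rad n th (Esub k f) r = (RtoC r * l - (1 + RtoC k) * Vt rad n th f r)%C.
Proof.
  intros Hth Hrad Hf Hv [Hr Hr2]. destruct (sin_cos_bounds th Hth) as [Hs _].
  pose proof (psic_ge th Hth) as Hp.
  assert (Cf : forall x, ccont f x) by (intros; now apply csmooth_ccont).
  assert (Ce : forall x, ccont (Eul f) x).
  { intros x. apply ccont_mult; [apply ccont_RtoC, continuous_id|]. now apply csmooth_ccont, csmooth_dC. }
  assert (Ve : vanishes rad (Eul f)).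
  { intros x Hx. unfold Eul. rewrite (vanishes_dC rad f Hrad Hf Hv x Hx). ring. }
  set (o := outer rad th) in *.
  assert (Ho : rad <= Rabs o).
  { unfold o, outer. rewrite Rabs_pos_eq; [|left; apply Rdiv_lt_0_compat; lra].
    apply Rmult_le_reg_r with (sin th); [lra|]. unfold Rdiv. rewrite Rmult_assoc, Rinv_l by lra. nra. }
  eexists. split.
  - unfold Vt. apply cder_plus; [apply cder_cint_lower; auto|].
    apply cder_scal. apply cder_id_mult. apply (cder_vint rad); auto.
  - assert (E1 : vint n th 0 (Esub k f) r = (vint n th 0 (Eul f) r - RtoC k * vint n th 0 f r)%C).
    { unfold vint. rewrite <- cint_scal by (auto; apply (vfun_ccont_on rad); auto).
      rewrite <- cint_minus; auto.
      - apply cint_ext; auto. intros psi _. unfold vfun, Esub. ring.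
      - apply (vfun_ccont_on rad); auto.
      - intros psi _. apply ccont_mult; [apply ccont_const|].
        apply (vfun_ccont_on rad n th 0 f r psi psi); auto. lra. }
    assert (E2 : cint (Eul f) r o = (- (RtoC r * f r) - cint f r o)%C).
    { assert (H : cint (fun x => (f x + Eul f x)%C) r o = (RtoC o * f o - RtoC r * f r)%C).
      { apply (cint_derive (fun x => (RtoC x * f x)%C)); auto.
        - intros x _. apply cder_id_mult. now apply csmooth_cder.
        - intros x _. apply ccont_plus; auto. }
      rewrite cint_plus in H by (auto; intros x _; auto).
      rewrite (Hv o Ho) in H.
      replace (cint (Eul f) r o) with ((cint f r o + cint (Eul f) r o) - cint f r o)%C by ring.
      rewrite H. ring. }
    assert (E3 : cint (Esub k f) r o = (cint (Eul f) r o - RtoC k * cint f r o)%C).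
    { unfold Esub. rewrite cint_minus; auto.
      - rewrite cint_scal; auto. intros x _; auto.
      - intros x _; auto.
      - intros x _. apply ccont_mult; [apply ccont_const|auto]. }
    unfold Vt. fold o. rewrite E1, E3, E2.
    assert (RtoC r <> 0%C) by (intros X; apply RtoC_inj in X; lra).
    rewrite (RtoC_inv r) by lra. field. auto.
Qed.

(** * The recursion for the second branch *)

Lemma is_derive_weight s (i : nat) psi : s <> 0 -> cos psi <> 0 ->
  is_derive (fun t => (cos t / s) ^ (2 * i)) psi
    (- (2 * INR i) * (sin psi / cos psi) * (cos psi / s) ^ (2 * i)).
Proof.
  intros Hs Hc.
  replace (2 * INR i) with (INR (2 * i)) by (rewrite mult_INR; simpl; ring).
  generalize (2 * i)%nat; intros m.
  evar_last.
  - apply (is_derive_pow (fun t => cos t / s) m psi (- sin psi / s)).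
    auto_derive; auto. field; auto.
  - destruct m as [|m].
    + simpl. ring.
    + rewrite <- tech_pow_Rmult. cbn [pred]. generalize (INR (S m)). intros q. field; auto.
Qed.

Lemma dC_Eul_comb f k x : csmooth f -> dC (Esub k f) x = (dC f x + RtoC x * dC (dC f) x - RtoC k * dC f x)%C.
Proof.
  intros Hf. apply dC_eq. unfold Esub, Eul.
  apply cder_minus.
  - apply cder_id_mult. now apply csmooth_cder, csmooth_dC.
  - apply cder_scal. now apply csmooth_cder.
Qed.

Lemma Esub_Esub a b f x : csmooth f ->
  Esub a (Esub b f) x = (Eul (Eul f) x - RtoC (a + b) * Eul f x + RtoC (a * b) * f x)%C.
Proof.
  intros Hf.
  assert (E0 : forall k, dC (Esub k f) x = (dC f x + RtoC x * dC (dC f) x - RtoC k * dC f x)%C)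
    by (intros; now apply dC_Eul_comb).
  assert (E1 : dC (Eul f) x = (dC f x + RtoC x * dC (dC f) x)%C).
  { apply dC_eq. unfold Eul. apply cder_id_mult. now apply csmooth_cder, csmooth_dC. }
  unfold Esub at 1. unfold Eul at 1. rewrite E0. unfold Eul at 1. rewrite E1.
  unfold Esub, Eul. rewrite RtoC_plus, RtoC_mult. ring.
Qed.

(** With [E = x d/dx], the difference of the two integrands is the derivative in [psi] of
    [sin th * (tan psi * (E - 2 i) f - i n f)] times the weight and the angular factor;
    behind this is the Laplacian [x ^ (-2) (E ^ 2 - n ^ 2)] in polar coordinates.  At the
    vertex, [psi = psic], this expression gives the local terms; at the other end it
    vanishes with [f]. *)
Lemma vint_recursion rad n th (i : nat) f r : 0 < th < PI / 2 -> 0 < rad ->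
  csmooth f -> vanishes rad f -> 0 < r ->
  vint n th i (Esub (2 * INR i - 1) (Esub (2 * INR i) f)) r =
  (RtoC (sin th * sin th) * vint n th (S i) (Esub (2 * INR i + n) (Esub (2 * INR i - n) f)) r +
   (RtoC (cos th) * Esub (2 * INR i) f r - Ci * RtoC (n * sin th) * f r))%C.
Proof.
  intros Hth Hrad Hf Hv Hr. destruct (sin_cos_bounds th Hth) as [Hs [Hc Hsc]].
  destruct (psic_bounds th Hth) as [P1 P2]. pose proof PI_RGT_0 as PP.
  set (s := sin th) in *. set (k := 2 * INR i) in *.
  set (D := Esub k f).
  assert (SD : csmooth D) by now apply csmooth_Esub.
  assert (VD : vanishes rad D) by now apply vanishes_Esub.
  set (D2 := Esub k D).
  assert (SD2 : csmooth D2) by now apply csmooth_Esub.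
  assert (VD2 : vanishes rad D2) by now apply vanishes_Esub.
  set (f1 := Esub (k - 1) D). set (f2 := Esub (k + n) (Esub (k - n) f)).
  assert (S1 : csmooth f1) by now apply csmooth_Esub.
  assert (V1 : vanishes rad f1) by now apply vanishes_Esub.
  assert (S2 : csmooth f2) by (unfold f2; now do 2 apply csmooth_Esub).
  assert (V2 : vanishes rad f2).
  { unfold f2. apply vanishes_Esub; auto; [now apply csmooth_Esub|now apply vanishes_Esub]. }
  assert (E1 : forall x, f1 x = (D2 x + D x)%C).
  { intros x. unfold f1, D2. unfold Esub at 1 2. rewrite RtoC_minus. ring. }
  assert (E2 : forall x, f2 x = (D2 x - RtoC (n * n) * f x)%C).
  { intros x. unfold f2, D2, D. rewrite !Esub_Esub by auto.
    replace (k + n + (k - n)) with (k + k) by ring.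
    replace ((k + n) * (k - n)) with (k * k - n * n) by ring.
    rewrite RtoC_minus. ring. }
  set (w := fun t : R => (cos t / s) ^ (2 * i)).
  set (hh := fun t : R => r * s / cos t).
  set (tn := fun t : R => sin t / cos t).
  set (W := fun t : R => (RtoC s * (RtoC (tn t) * (D (hh t) * RtoC (w t)) - Ci * RtoC n * (f (hh t) * RtoC (w t))) * ker n th t)%C).
  set (diff := fun t => (vfun n th i f1 r t - RtoC (s * s) * vfun n th (S i) f2 r t)%C).
  assert (Cdiff : forall a b, ccont_on diff a b).
  { intros a b t _. apply ccont_minus.
    - apply (vfun_ccont_on rad n th i f1 r t t); auto; [intros; now apply csmooth_ccont|lra].
    - apply ccont_mult; [apply ccont_const|].
      apply (vfun_ccont_on rad n th (S i) f2 r t t); auto; [intros; now apply csmooth_ccont|lra]. }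
  assert (DG : forall g t, csmooth g -> cos t <> 0 ->
    cder (fun t => (g (hh t) * RtoC (w t))%C) t (RtoC (tn t) * (Esub k g (hh t) * RtoC (w t)))%C).
  { intros g t Hg Ht. eapply cder_eq.
    - apply cder_mult.
      + apply (cder_comp g hh t (dC g (hh t)) (hh t * tn t)); [|now apply csmooth_cder].
        unfold hh, tn. auto_derive; auto. field; auto.
      + apply cder_RtoC. apply is_derive_weight; auto. lra.
    - unfold Esub, Eul. fold (w t). fold (tn t). fold k.
      rewrite !RtoC_mult, RtoC_opp. ring. }
  assert (DW : forall t, cos t <> 0 -> cder W t (diff t)).
  { intros t Ht. unfold W.
    assert (Dt : is_derive tn t (1 / (cos t * cos t))).
    { unfold tn. auto_derive; auto. pose proof (sin2_cos2 t) as Q. unfold Rsqr in Q.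
      replace (1 / (cos t * cos t)) with ((sin t * sin t + cos t * cos t) / (cos t * cos t)) by (rewrite Q; reflexivity).
      field; auto. }
    eapply cder_eq.
    - apply cder_mult; [|apply cder_ker]. apply cder_scal. apply cder_minus.
      + apply cder_mult; [apply cder_RtoC, Dt|apply DG; auto].
      + apply cder_scal. apply DG; auto.
    - unfold diff, vfun, vker. fold s. fold (hh t). rewrite E1, E2. fold D. fold D2. fold (w t).
      replace ((cos t / s) ^ (2 * S i)) with (w t * (cos t / s * (cos t / s))).
      2:{ unfold w. replace (2 * S i)%nat with (S (S (2 * i)))%nat by lia. simpl. ring. }
      set (F0 := f (hh t)). set (F1 := D (hh t)). set (F2 := D2 (hh t)).
      unfold tn.
      assert (Hct : RtoC (cos t) <> 0%C) by (intros X; apply RtoC_inj in X; auto).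
      assert (Hss : RtoC s <> 0%C) by (intros X; apply RtoC_inj in X; lra).
      pose proof (sin2_cos2 t) as Q. unfold Rsqr in Q.
      assert (QC : (RtoC (sin t) * RtoC (sin t))%C = (1 - RtoC (cos t) * RtoC (cos t))%C).
      { rewrite <- !RtoC_mult, <- RtoC_minus. f_equal. lra. }
      assert (QI : (Ci * Ci)%C = (-1)%C) by (apply Ceq; simpl; ring).
      assert (RD : forall a b, b <> 0 -> RtoC (a / b) = (RtoC a / RtoC b)%C)
        by (intros; apply RtoC_div; auto).
      rewrite !RtoC_mult, !RD by nra. rewrite !RtoC_mult.
      transitivity ((RtoC s * RtoC (w t) * ker n th t *
         (F1 / (RtoC (cos t) * RtoC (cos t)) + (RtoC (sin t) * RtoC (sin t)) * F2 / (RtoC (cos t) * RtoC (cos t))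
           - (Ci * Ci) * RtoC n * RtoC n * F0))%C); [field; auto|].
      rewrite QC, QI. field. auto. }
  (* a lower limit below which everything vanishes *)
  set (de := Rmin (r * s / rad) (PI / 2)).
  assert (Hde : 0 < de /\ de <= r * s / rad /\ de <= PI / 2).
  { unfold de. repeat split; [|apply Rmin_l|apply Rmin_r].
    apply Rmin_glb_lt; [apply Rdiv_lt_0_compat; nra|lra]. }
  destruct Hde as [de0 [de1 de2]].
  set (a := - (PI / 2) + de).
  assert (Hcos : forall t, - (PI / 2) <= t <= a -> rad * Rabs (cos t) <= r * s).
  { intros t Ht. rewrite Rabs_pos_eq by (apply cos_ge_0; unfold a in Ht; lra).
    assert (cos t <= t + PI / 2).
    { replace (cos t) with (sin (t + PI / 2)) by (rewrite sin_plus, cos_PI2, sin_PI2; ring).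
      destruct (Req_dec (t + PI / 2) 0) as [Z|Z].
      - rewrite Z, sin_0. lra.
      - left. apply sin_lt_x. lra. }
    apply Rle_trans with (rad * (r * s / rad)); [|right; field; lra].
    apply Rmult_le_compat_l; [lra|]. unfold a in Ht. lra. }
  assert (Ha : - (PI / 2) <= a <= psic th) by (unfold a; lra).
  assert (I1 : cint diff (- (PI / 2)) a = 0%C).
  { apply cint_zero; [lra|]. intros t Ht. unfold diff.
    rewrite !(vfun_zero rad) by (auto; apply Hcos; lra). ring. }
  assert (I2 : cint diff a (psic th) = W (psic th)).
  { rewrite (cint_derive W); [|lra| |apply Cdiff].
    - replace (W a) with (RtoC 0); [ring|]. unfold W.
      assert (Hca : 0 < cos a) by (apply cos_gt_0; unfold a; lra).
      assert (Hha : rad <= Rabs (hh a)).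
      { pose proof (Hcos a ltac:(lra)) as H. rewrite (Rabs_pos_eq (cos a)) in H by lra.
        unfold hh. rewrite Rabs_pos_eq; [|left; apply Rdiv_lt_0_compat; nra].
        apply Rmult_le_reg_r with (cos a); auto. unfold Rdiv. rewrite Rmult_assoc, Rinv_l by lra. lra. }
      rewrite (VD _ Hha), (Hv _ Hha). ring.
    - intros t Ht. apply DW. apply Rgt_not_eq. apply cos_gt_0; unfold a in Ht; lra. }
  assert (CP : cos (psic th) = s) by (unfold psic, s; apply cos_shift).
  assert (SP : sin (psic th) = cos th) by (unfold psic; apply sin_shift).
  assert (WP : W (psic th) = (RtoC (cos th) * D r - Ci * RtoC (n * s) * f r)%C).
  { unfold W, w, hh, tn. rewrite CP, SP.
    replace (r * s / s) with r by (field; lra). replace (s / s) with 1 by (field; lra).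
    rewrite pow1. unfold ker. rewrite Rminus_diag, Rmult_0_r.
    change (0, 0) with (RtoC 0). rewrite cexp_0.
    replace (RtoC (cos th)) with (RtoC s * RtoC (cos th / s))%C.
    - rewrite RtoC_mult. ring.
    - rewrite <- RtoC_mult. f_equal. field. lra. }
  assert (IT : cint diff (- (PI / 2)) (psic th) = (vint n th i f1 r - RtoC (s * s) * vint n th (S i) f2 r)%C).
  { unfold diff, vint.
    assert (C1 : ccont_on (vfun n th i f1 r) (- (PI / 2)) (psic th))
      by (apply (vfun_ccont_on rad); auto; intros; now apply csmooth_ccont).
    assert (C2 : ccont_on (vfun n th (S i) f2 r) (- (PI / 2)) (psic th))
      by (apply (vfun_ccont_on rad); auto; intros; now apply csmooth_ccont).
    rewrite cint_minus; auto; [rewrite cint_scal; auto; lra|lra|].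
    intros t Ht. apply ccont_mult; [apply ccont_const|now apply C2]. }
  rewrite <- (cint_Chasles diff (- (PI / 2)) a (psic th)) in IT by (try lra; apply Cdiff).
  rewrite I1, I2, WP in IT.
  replace (vint n th i f1 r) with ((vint n th i f1 r - RtoC (s * s) * vint n th (S i) f2 r)
    + RtoC (s * s) * vint n th (S i) f2 r)%C by ring.
  rewrite <- IT. fold D. ring.
Qed.

(** * Order of vanishing and the Mellin transform *)

Definition Dn (j : nat) (f : R -> C) : R -> C := Nat.iter j dC f.

Definition vanish_order (M : nat) (f : R -> C) : Prop :=
  forall j, (j < M)%nat -> Dn j f 0 = 0%C.

Lemma Dn_shift j f x : Dn j (dC f) x = Dn (S j) f x.
Proof. unfold Dn. rewrite Nat.iter_succ_r. reflexivity. Qed.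

Lemma csmooth_Dn j f : csmooth f -> csmooth (Dn j f).
Proof. intros H; induction j; simpl; auto. now apply csmooth_dC. Qed.

Lemma Dn_Esub j k f : csmooth f -> forall x, Dn j (Esub k f) x = Esub (k - INR j) (Dn j f) x.
Proof.
  intros Hf. induction j as [|j IH]; intros x.
  - simpl. now rewrite Rminus_0_r.
  - change (Dn (S j) (Esub k f) x) with (dC (Dn j (Esub k f)) x).
    rewrite (dC_ext _ _ IH), dC_Eul_comb by now apply csmooth_Dn.
    change (Dn (S j) f) with (dC (Dn j f)). unfold Esub, Eul.
    rewrite S_INR, !RtoC_minus, RtoC_plus. ring.
Qed.

Lemma Dn_Esub_0 j k f : csmooth f -> Dn j (Esub k f) 0 = (RtoC (INR j - k) * Dn j f 0)%C.
Proof.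
  intros Hf. rewrite Dn_Esub by auto. unfold Esub, Eul. rewrite !RtoC_minus. ring.
Qed.

Lemma vanish_order_Esub M k f : csmooth f -> vanish_order M f -> vanish_order M (Esub k f).
Proof. intros Hf H j Hj. rewrite Dn_Esub_0, H by auto. ring. Qed.

Lemma rcont_bounded (g : R -> R) a b : a <= b -> (forall x, continuous g x) ->
  exists K, forall x, a <= x <= b -> g x <= K.
Proof.
  intros Hab Hg. destruct (continuity_ab_maj g a b Hab) as [m [Hm _]].
  - intros x _. apply continuity_pt_filterlim, Hg.
  - exists (g m). intros x Hx. now apply Hm.
Qed.

Lemma ccont_bounded f a b : a <= b -> (forall x, ccont f x) ->
  exists K, 0 <= K /\ forall x, a <= x <= b -> Cmod (f x) <= K.
Proof.
  intros Hab Hf.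
  destruct (rcont_bounded (fun x => Rabs (fst (f x)) + Rabs (snd (f x))) a b Hab) as [K HK].
  - intros x. apply rcont_plus; apply continuous_comp; try apply (Hf x); apply continuous_Rabs.
  - exists K. split.
    + specialize (HK a ltac:(lra)). pose proof (Rabs_pos (fst (f a))). pose proof (Rabs_pos (snd (f a))). lra.
    + intros x Hx. eapply Rle_trans; [apply Cmod_le_sum|]. auto.
Qed.

(** Integrate the bound for the derivative. *)
Lemma vanish_order_bound M : forall f o, 0 < o -> csmooth f -> vanish_order M f ->
  exists K, 0 <= K /\ forall x, 0 <= x <= o -> Cmod (f x) <= K * x ^ M.
Proof.
  induction M as [|M IH]; intros f o Ho Hf HM.
  - destruct (ccont_bounded f 0 o ltac:(lra)) as [K [K0 HK]]; [intros; now apply csmooth_ccont|].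
    exists K. split; auto. intros x Hx. simpl. rewrite Rmult_1_r. auto.
  - destruct (IH (dC f) o Ho) as [K [K0 HK]].
    + now apply csmooth_dC.
    + intros j Hj. rewrite Dn_shift. apply HM. lia.
    + exists (2 * K). split; [lra|]. intros x Hx.
      assert (E : f x = cint (dC f) 0 x).
      { rewrite (cint_derive f); try lra.
        - assert (F0 : f 0 = 0%C) by (apply (HM 0%nat); lia). rewrite F0. ring.
        - intros t _. now apply csmooth_cder.
        - intros t _. now apply csmooth_ccont, csmooth_dC. }
      rewrite E. eapply Rle_trans; [apply (cint_bound _ (K * x ^ M))|].
      * lra.
      * intros t _. now apply csmooth_ccont, csmooth_dC.
      * intros t Ht. eapply Rle_trans; [apply HK; lra|].
        apply Rmult_le_compat_l; auto. apply pow_incr. lra.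
      * simpl. right. ring.
Qed.

(** The power [x ^ la], for [x > 0]. *)
Definition xpow (la : C) (x : R) : C := cexp (la * RtoC (ln x)).

Lemma Cmod_xpow la x : Cmod (xpow la x) = exp (fst la * ln x).
Proof. unfold xpow. rewrite Cmod_cexp. simpl. f_equal. ring. Qed.

Lemma ccont_xpow la x : 0 < x -> ccont (xpow la) x.
Proof.
  intros H. apply ccont_cexp, ccont_mult; [apply ccont_const|]. apply ccont_RtoC.
  derive_cont.
Qed.

Lemma cder_xpow la x : 0 < x -> cder (xpow la) x (la * RtoC (/ x) * xpow la x)%C.
Proof.
  intros H. unfold xpow. apply (cder_cexp (fun t => (la * RtoC (ln t))%C)).
  apply cder_scal, cder_RtoC. auto_derive; auto. field; lra.
Qed.

Lemma xpow_plus a b x : xpow (a + b) x = (xpow a x * xpow b x)%C.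
Proof. unfold xpow. rewrite <- cexp_plus. f_equal. ring. Qed.

Lemma xpow_1 x : 0 < x -> xpow 1 x = RtoC x.
Proof.
  intros H. unfold xpow, cexp. apply Ceq; simpl.
  - rewrite !Rmult_0_l, Rmult_1_l, Rminus_0_r, Rmult_0_r, Rplus_0_r, exp_ln, cos_0 by auto. ring.
  - rewrite !Rmult_0_l, Rmult_1_l, Rmult_0_r, Rplus_0_r, sin_0. ring.
Qed.

Lemma xpow_mult la x y : 0 < x -> 0 < y -> xpow la (x * y) = (xpow la x * xpow la y)%C.
Proof. intros. unfold xpow. rewrite ln_mult, <- cexp_plus by auto. f_equal. rewrite RtoC_plus. ring. Qed.

Definition mellin (f : R -> C) (la : C) (x : R) : C := (f x * xpow (- (la + 1)) x)%C.

Definition Phi (o : R) (f : R -> C) (la : C) : C := cint (mellin f la) 0 o.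

Lemma mellin_bound M f o la : 0 < o -> (0 < M)%nat -> csmooth f -> vanish_order M f -> fst la + 2 <= INR M ->
  exists K, 0 <= K /\ forall x, 0 <= x <= o -> Cmod (mellin f la x) <= K * x.
Proof.
  intros Ho HM0 Hf HM Hla. destruct (vanish_order_bound M f o Ho Hf HM) as [K [K0 HK]].
  set (k := INR M - 2 - fst la). assert (Hk : 0 <= k) by (unfold k; lra).
  exists (K * exp (k * ln o)). split; [apply Rmult_le_pos; [auto|left; apply exp_pos]|].
  intros x [[Hx|Hx] Hxo].
  - unfold mellin. rewrite Cmod_mult, Cmod_xpow.
    eapply Rle_trans; [apply Rmult_le_compat_r; [left; apply exp_pos|apply HK; lra]|].
    rewrite !Rmult_assoc. apply Rmult_le_compat_l; auto.
    rewrite <- Rpower_pow by auto. unfold Rpower. rewrite <- exp_plus.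
    replace (INR M * ln x + fst (- (la + 1))%C * ln x) with (k * ln x + ln x) by (unfold k; simpl; ring).
    rewrite exp_plus, exp_ln by auto. apply Rmult_le_compat_r; [lra|].
    apply exp_le_mono, Rmult_le_compat_l; auto.
    destruct Hxo as [Hxo| ->]; [left; now apply ln_increasing|lra].
  - subst x. unfold mellin.
    assert (F0 : f 0 = 0%C) by (apply (HM 0%nat), HM0).
    rewrite F0, Cmult_0_l, Cmod_0. lra.
Qed.

(** On [0, 1] the constant does not depend on the exponent. *)
Lemma mellin_bound_unit M f : csmooth f -> (0 < M)%nat -> vanish_order M f ->
  exists K, 0 <= K /\ forall (la : C) x, fst la + 2 <= INR M -> 0 <= x <= 1 -> Cmod (mellin f la x) <= K * x.
Proof.
  intros Hf HM0 HM. destruct (vanish_order_bound M f 1 Rlt_0_1 Hf HM) as [K [K0 HK]].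
  exists K. split; auto. intros la x Hla [[Hx|Hx] Hx1].
  - unfold mellin. rewrite Cmod_mult, Cmod_xpow.
    eapply Rle_trans; [apply Rmult_le_compat_r; [left; apply exp_pos|apply HK; lra]|].
    rewrite Rmult_assoc. apply Rmult_le_compat_l; auto.
    rewrite <- Rpower_pow by auto. unfold Rpower. rewrite <- exp_plus.
    rewrite <- (exp_ln x) at 3 by auto. apply exp_le_mono. simpl.
    pose proof (ln_le_0 x Hx1). nra.
  - subst x. assert (F0 : f 0 = 0%C) by (apply (HM 0%nat), HM0).
    unfold mellin. rewrite F0, Cmult_0_l, Cmod_0. lra.
Qed.

(** Joint continuity of the Mellin integrand in the variable and a parameter of
    the exponent; at the origin it is dominated by [K |x|]. *)
Lemma mellin_ccont2 M f (la : R -> C) x t : (0 < M)%nat -> csmooth f -> vanish_order M f ->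
  (forall u, ccont la u) -> (forall u, fst (la u) + 2 <= INR M) -> 0 <= x ->
  ccont2 (fun x t => mellin f (la t) x) x t.
Proof.
  intros HM0 Hf HM Cla Bla [Hx|Hx].
  - unfold mellin, xpow. apply ccont2_mult; [now apply ccont2_fst_var, csmooth_ccont|].
    apply ccont2_cexp, ccont2_mult.
    + apply (ccont2_snd_var (fun t => (- (la t + 1))%C)). apply ccont_opp, ccont_plus; [apply Cla|apply ccont_const].
    + apply (ccont2_fst_var (fun x => RtoC (ln x))). apply ccont_RtoC.
      derive_cont.
  - subst x. destruct (mellin_bound_unit M f Hf HM0 HM) as [K [K0 HK]].
    assert (F0 : f 0 = 0%C) by (apply (HM 0%nat), HM0).
    apply ccont2_squeeze with (fun u _ => (Rabs (fst (f u)) + Rabs (snd (f u))) + K * Rabs u).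
    + exists (mkposreal _ Rlt_0_1). intros u v Hu _. simpl in Hu. rewrite Rminus_0_r in Hu.
      apply Rabs_def2 in Hu.
      pose proof (Rabs_pos (fst (f u))). pose proof (Rabs_pos (snd (f u))). pose proof (Rabs_pos u).
      assert (0 <= K * Rabs u) by (apply Rmult_le_pos; auto).
      destruct (Rle_lt_dec 0 u) as [H3|H3].
      * eapply Rle_trans; [apply HK; auto; lra|]. rewrite (Rabs_pos_eq u) by lra. lra.
      * unfold mellin, xpow. rewrite ln_nonpos by lra.
        replace (- (la v + 1) * RtoC 0)%C with (RtoC 0) by ring. rewrite cexp_0, Cmult_1_r.
        pose proof (Cmod_le_sum (f u)). lra.
    + destruct (csmooth_ccont f 0 Hf) as [A B].
      apply (rcont2_comp (fun u => Rabs (fst (f u)) + Rabs (snd (f u)) + K * Rabs u) (fun u _ => u));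
        [apply continuity_2d_pt_id1|].
      apply rcont_plus; [apply rcont_plus; apply continuous_comp; auto; apply continuous_Rabs|].
      apply rcont_mult; [apply continuous_const|apply continuous_Rabs].
    + rewrite F0. simpl. rewrite !Rabs_R0. ring.
Qed.

Lemma mellin_ccont M f la x : (0 < M)%nat -> csmooth f -> vanish_order M f ->
  fst la + 2 <= INR M -> 0 <= x -> ccont (mellin f la) x.
Proof.
  intros HM0 Hf HM Hla Hx. apply (ccont2_ccont_fst (fun x _ => mellin f la x) x 0).
  apply (mellin_ccont2 M f (fun _ => la)); auto. intros; apply ccont_const.
Qed.

Lemma eq_of_small (z : C) K d : 0 < d -> (forall e, 0 < e <= d -> Cmod z <= K * e) -> z = 0%C.
Proof.
  intros Hd H. apply Cmod_eq_0. apply Rle_antisym; [|apply Cmod_ge_0].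
  apply Rnot_lt_le. intros N.
  assert (HK : 0 < K).
  { specialize (H d ltac:(lra)). destruct (Rle_lt_dec K 0); [|lra]. nra. }
  set (e := Rmin d (Cmod z / (2 * K))).
  assert (He : 0 < e) by (apply Rmin_glb_lt; [lra|apply Rdiv_lt_0_compat; lra]).
  assert (He1 : e <= d) by apply Rmin_l.
  assert (He2 : e <= Cmod z / (2 * K)) by apply Rmin_r.
  specialize (H e ltac:(lra)).
  assert (K * e <= K * (Cmod z / (2 * K))) by (apply Rmult_le_compat_l; lra).
  replace (K * (Cmod z / (2 * K))) with (Cmod z / 2) in H0 by (field; lra). lra.
Qed.

(** The linear rate makes all the limits in the truncation parameter elementary. *)
Definition lin_limit (d : R) (g : R -> C) (L : C) : Prop :=
  exists K, 0 <= K /\ forall e, 0 < e <= d -> Cmod (g e - L) <= K * e.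

Lemma lin_limit_unique d g L L' : 0 < d -> lin_limit d g L -> lin_limit d g L' -> L = L'.
Proof.
  intros Hd [K [K0 HK]] [K' [K0' HK']].
  assert (E : (L - L')%C = 0%C).
  { apply (eq_of_small _ (K + K') d Hd). intros e He.
    replace (L - L')%C with ((g e - L') - (g e - L))%C by ring.
    eapply Rle_trans; [apply Cmod_sub_le|]. specialize (HK e He). specialize (HK' e He). lra. }
  replace L with ((L - L') + L')%C by ring. rewrite E. ring.
Qed.

Lemma lin_limit_plus d g h L L' : lin_limit d g L -> lin_limit d h L' ->
  lin_limit d (fun e => (g e + h e)%C) (L + L')%C.
Proof.
  intros [K [K0 HK]] [K' [K0' HK']]. exists (K + K'). split; [lra|]. intros e He.
  replace (g e + h e - (L + L'))%C with ((g e - L) + (h e - L'))%C by ring.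
  eapply Rle_trans; [apply Cmod_triangle|]. specialize (HK e He). specialize (HK' e He). lra.
Qed.

Lemma lin_limit_scal d c g L : lin_limit d g L -> lin_limit d (fun e => (c * g e)%C) (c * L)%C.
Proof.
  intros [K [K0 HK]]. exists (Cmod c * K). split; [apply Rmult_le_pos; auto; apply Cmod_ge_0|].
  intros e He. replace (c * g e - c * L)%C with (c * (g e - L))%C by ring.
  rewrite Cmod_mult, Rmult_assoc. apply Rmult_le_compat_l; auto. apply Cmod_ge_0.
Qed.

Lemma lin_limit_ext d g h L : (forall e, 0 < e <= d -> g e = h e) -> lin_limit d g L -> lin_limit d h L.
Proof. intros H [K [K0 HK]]. exists K. split; auto. intros e He. rewrite <- H by auto. auto. Qed.

Lemma Phi_lin_limit M o f la d : 0 < o -> d <= o -> (0 < M)%nat -> csmooth f -> vanish_order M f ->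
  fst la + 2 <= INR M -> lin_limit d (fun e => cint (mellin f la) e o) (Phi o f la).
Proof.
  intros Ho Hd HM0 Hf HM Hla. destruct (mellin_bound M f o la Ho HM0 Hf HM Hla) as [K [K0 HK]].
  exists (2 * (K * o)). split; [nra|]. intros e He.
  unfold Phi. rewrite <- (cint_Chasles (mellin f la) 0 e o); try lra.
  - replace (cint (mellin f la) e o - (cint (mellin f la) 0 e + cint (mellin f la) e o))%C
      with (- cint (mellin f la) 0 e)%C by ring.
    rewrite Cmod_opp. eapply Rle_trans; [apply (cint_bound _ (K * o))|].
    + lra.
    + intros x Hx. apply (mellin_ccont M); auto; lra.
    + intros x Hx. eapply Rle_trans; [apply HK; lra|]. apply Rmult_le_compat_l; lra.
    + lra.
  - intros x Hx. apply (mellin_ccont M); auto; lra.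
Qed.

(** Integration by parts; after truncation at [e] the boundary term is [O(e)]. *)
Lemma Phi_Esub M rad o k f la : 0 < rad -> rad <= o -> (0 < M)%nat -> csmooth f -> vanishes rad f ->
  vanish_order M f -> fst la + 2 <= INR M -> Phi o (Esub k f) la = ((la - RtoC k) * Phi o f la)%C.
Proof.
  intros Hr Ho HM0 Hf Hv HM Hla.
  assert (Ho0 : 0 < o) by lra.
  assert (HE : csmooth (Esub k f)) by now apply csmooth_Esub.
  assert (HME : vanish_order M (Esub k f)) by now apply vanish_order_Esub.
  apply (lin_limit_unique o (fun e => cint (mellin (Esub k f) la) e o)); auto.
  - apply (Phi_lin_limit M); auto; lra.
  - assert (F : lin_limit o (fun e => (- (f e * xpow (- la) e))%C) 0%C).
    { destruct (mellin_bound M f o la Ho0 HM0 Hf HM Hla) as [K [K0 HK]].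
      exists (K * o). split; [nra|]. intros e He.
      replace (- (f e * xpow (- la) e) - 0)%C with (- (mellin f la e * RtoC e))%C.
      - rewrite Cmod_opp, Cmod_mult, Cmod_R, (Rabs_pos_eq e) by lra.
        apply Rmult_le_compat_r; [lra|]. eapply Rle_trans; [apply HK; lra|].
        apply Rmult_le_compat_l; lra.
      - unfold mellin. rewrite <- (xpow_1 e) by lra.
        replace (- la)%C with (- (la + 1) + 1)%C by ring. rewrite xpow_plus. ring. }
    pose proof (lin_limit_plus _ _ _ _ _ F
      (lin_limit_scal o (la - RtoC k)%C _ _ (Phi_lin_limit M o f la o Ho0 (Rle_refl o) HM0 Hf HM Hla))) as L.
    rewrite Cplus_0_l in L. revert L. apply lin_limit_ext. intros e He.
    assert (Cm : forall g, csmooth g -> ccont_on (mellin g la) e o).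
    { intros g Hg x Hx. apply ccont_mult; [now apply csmooth_ccont|apply ccont_xpow; lra]. }
    assert (D : cint (fun x => (mellin (Esub k f) la x - (la - RtoC k) * mellin f la x)%C) e o =
       (f o * xpow (- la) o - f e * xpow (- la) e)%C).
    { apply (cint_derive (fun x => (f x * xpow (- la) x)%C)); [lra| |].
      - intros x Hx. eapply cder_eq.
        + apply cder_mult; [now apply csmooth_cder|apply cder_xpow; lra].
        + unfold mellin, Esub, Eul.
          replace (- la)%C with (- (la + 1) + 1)%C by ring.
          rewrite xpow_plus, xpow_1 by lra.
          assert (RtoC x <> 0%C) by (intros X; apply RtoC_inj in X; lra).
          rewrite RtoC_inv by lra. field. auto.
      - intros x Hx. apply ccont_minus; [now apply Cm|].
        apply ccont_mult; [apply ccont_const|now apply Cm]. }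
    rewrite cint_minus, cint_scal in D; try lra; auto.
    2:{ intros x Hx. apply ccont_mult; [apply ccont_const|now apply Cm]. }
    rewrite (Hv o) in D by (rewrite Rabs_pos_eq; lra).
    replace (cint (mellin (Esub k f) la) e o) with
      ((cint (mellin (Esub k f) la) e o - (la - RtoC k) * cint (mellin f la) e o)
        + (la - RtoC k) * cint (mellin f la) e o)%C by ring.
    rewrite D. ring.
Qed.

Lemma xpow_INR m x : 0 < x -> xpow (RtoC (INR m)) x = RtoC (x ^ m).
Proof.
  intros Hx. induction m as [|m IH].
  - simpl. unfold xpow. rewrite Cmult_0_l. apply cexp_0.
  - rewrite S_INR, RtoC_plus, xpow_plus, IH, xpow_1 by auto.
    rewrite <- tech_pow_Rmult, RtoC_mult. ring.
Qed.

Lemma xpow_opp_inv la x : (xpow (- la) x * xpow la x)%C = 1%C.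
Proof.
  rewrite <- xpow_plus. unfold xpow. replace (- la + la)%C with (RtoC 0) by ring.
  rewrite Cmult_0_l. apply cexp_0.
Qed.

Lemma xpow_inv la x : 0 < x -> xpow la (/ x) = xpow (- la) x.
Proof. intros H. unfold xpow. rewrite ln_Rinv by auto. f_equal. rewrite RtoC_opp. ring. Qed.

Lemma xpow_opp_INR m x : 0 < x -> xpow (- RtoC (INR m)) x = RtoC (/ x ^ m).
Proof.
  intros Hx. rewrite <- xpow_inv, xpow_INR by (try apply Rinv_0_lt_compat; auto).
  now rewrite pow_inv.
Qed.

(** Both sides are [d ^ (la - 2 J)] times the angular factor and [sin th / cos ^ 2], where
    [d = sin th / cos psi]. *)
Lemma vker_power n th (J : nat) la psi : 0 < th < PI / 2 -> 0 < cos psi ->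
  (vker n th J psi * xpow la (sin th / cos psi))%C =
  (cexp ((la - RtoC (2 * INR J) + 1) * RtoC (ln (sin th))) *
   (cpw (la - RtoC (2 * INR J)) psi * ker n th psi))%C.
Proof.
  intros Hth Hc. destruct (sin_cos_bounds th Hth) as [[Hs _] _].
  assert (Hic : 0 < / cos psi) by now apply Rinv_0_lt_compat.
  change (cexp ((la - RtoC (2 * INR J) + 1) * RtoC (ln (sin th)))) with (xpow (la - RtoC (2 * INR J) + 1) (sin th)).
  unfold vker, cpw.
  change (cexp (- (la - RtoC (2 * INR J) + 4) * RtoC (ln (cos psi)))) with (xpow (- (la - RtoC (2 * INR J) + 4)) (cos psi)).
  unfold Rdiv. rewrite (xpow_mult la) by auto. rewrite xpow_inv by auto.
  replace (sin th * / (cos psi * cos psi) * (cos psi * / sin th) ^ (2 * J)) with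
    (sin th * / (cos psi ^ 2) * ((cos psi) ^ (2 * J) * / (sin th) ^ (2 * J))).
  2:{ rewrite Rpow_mult_distr, pow_inv. simpl. rewrite Rmult_1_r. ring. }
  replace (cos psi * cos psi) with (cos psi ^ 2) by (simpl; ring).
  replace (2 * INR J) with (INR (2 * J)) by (rewrite mult_INR; simpl; ring).
  rewrite !RtoC_mult. rewrite <- !xpow_INR, <- !xpow_opp_INR by auto.
  rewrite <- (xpow_1 (sin th)) by auto.
  set (a := RtoC (INR (2 * J))). set (S := sin th). set (Q := cos psi).
  replace (RtoC (INR 2)) with (RtoC 2) by (simpl; f_equal; ring).
  replace (la - a + 1)%C with (1 + (- a + la))%C by ring.
  replace (- (la - a + 4))%C with ((- RtoC 2 + (a + - la)) + - RtoC 2)%C.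
  2:{ replace (RtoC 4) with (RtoC 2 + RtoC 2)%C by (rewrite <- RtoC_plus; f_equal; ring). ring. }
  rewrite !xpow_plus.
  transitivity (ker n th psi * (xpow 1 S * xpow (- a) S * xpow la S * (xpow (- RtoC 2) Q * xpow a Q * xpow (- la) Q)) * 1)%C.
  - ring.
  - rewrite <- (xpow_opp_inv (RtoC 2) Q). ring.
Qed.

Lemma mellin_beyond M rad f la X : 0 < rad -> (0 < M)%nat -> csmooth f -> vanishes rad f ->
  vanish_order M f -> fst la + 2 <= INR M -> rad <= X ->
  cint (mellin f la) 0 X = cint (mellin f la) 0 rad.
Proof.
  intros Hr HM0 Hf Hv HM Hla HX.
  rewrite <- (cint_Chasles _ 0 rad X); try lra.
  - rewrite (cint_zero (mellin f la) rad X); [ring|lra|].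
    intros x Hx. unfold mellin. rewrite Hv; [ring|]. rewrite Rabs_pos_eq; lra.
  - intros x Hx. apply (mellin_ccont M); auto; lra.
Qed.

Lemma mellin_head_bound M rad f la : 0 < rad -> (0 < M)%nat -> csmooth f -> vanishes rad f ->
  vanish_order M f -> fst la + 2 <= INR M ->
  exists K, 0 <= K /\ forall X, 0 <= X -> Cmod (cint (mellin f la) 0 X) <= K * X.
Proof.
  intros Hr HM0 Hf Hv HM Hla.
  destruct (mellin_bound M f rad la Hr HM0 Hf HM Hla) as [K [K0 HK]].
  exists (2 * (K * rad)). split; [nra|].
  assert (B : forall X, 0 <= X <= rad -> Cmod (cint (mellin f la) 0 X) <= 2 * (K * rad) * X).
  { intros X HX. eapply Rle_trans; [apply (cint_bound _ (K * rad))|].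
    - lra.
    - intros x Hx. apply (mellin_ccont M); auto; lra.
    - intros x Hx. eapply Rle_trans; [apply HK; lra|]. apply Rmult_le_compat_l; lra.
    - lra. }
  intros X HX. destruct (Rle_lt_dec X rad) as [H|H]; [apply B; lra|].
  rewrite (mellin_beyond M rad); auto; [|lra]. eapply Rle_trans; [apply B; lra|].
  apply Rmult_le_compat_l; [nra|lra].
Qed.

Lemma outer_ge rad th : 0 < th < PI / 2 -> 0 < rad -> rad <= outer rad th.
Proof.
  intros Hth Hr. destruct (sin_cos_bounds th Hth) as [Hs _]. unfold outer.
  apply Rmult_le_reg_r with (sin th); [lra|]. unfold Rdiv. rewrite Rmult_assoc, Rinv_l by lra. nra.
Qed.

(** For a fixed direction, the substitution [x = r * sin th / cos psi]. *)
Lemma inner_mellin M rad n th (J : nat) f la e psi : 0 < th < PI / 2 -> 0 < rad -> (0 < M)%nat ->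
  csmooth f -> vanishes rad f -> vanish_order M f -> fst la + 2 <= INR M ->
  0 < cos psi -> 0 < e <= outer rad th ->
  cint (fun r => (xpow (- (la + 1)) r * vfun n th J f r psi)%C) e (outer rad th) =
  (vker n th J psi * xpow la (sin th / cos psi) *
    (Phi (outer rad th) f la - cint (mellin f la) 0 (e * (sin th / cos psi))))%C.
Proof.
  intros Hth Hr HM0 Hf Hv HM Hla Hc He. destruct (sin_cos_bounds th Hth) as [[Hs _] _].
  pose proof (outer_ge rad th Hth Hr) as Ho. set (o := outer rad th) in *.
  set (ka := sin th / cos psi). assert (Hka : 0 < ka) by (apply Rdiv_lt_0_compat; lra).
  assert (Cm : forall x, 0 <= x -> ccont (mellin f la) x) by (intros; apply (mellin_ccont M); auto).
  assert (Ek : 0 < e * ka) by (apply Rmult_lt_0_compat; lra).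
  assert (Eok : e * ka <= o * ka) by (apply Rmult_le_compat_r; lra).
  assert (Sub : cint (fun t => (RtoC ka * mellin f la (t * ka))%C) e o = cint (mellin f la) (e * ka) (o * ka)).
  { apply (cint_comp (mellin f la) (fun t => t * ka) (fun _ => ka)); try lra.
    - intros t Ht. apply Cm. apply Rmult_le_pos; lra.
    - intros t Ht. split; [auto_derive; auto; ring|apply continuous_const]. }
  assert (Ce : cint (fun r => (xpow (- (la + 1)) r * vfun n th J f r psi)%C) e o =
    cint (fun t => (vker n th J psi * xpow la ka * (RtoC ka * mellin f la (t * ka)))%C) e o).
  { apply cint_ext; [lra|]. intros t Ht. unfold vfun, mellin.
    replace (t * sin th / cos psi) with (t * ka) by (unfold ka; field; lra).
    rewrite (xpow_mult _ t ka) by lra. rewrite <- (xpow_1 ka) by auto.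
    transitivity (xpow (- (la + 1)) t * (f (t * ka)%R * vker n th J psi) * (xpow (- la) ka * xpow la ka))%C.
    - rewrite xpow_opp_inv. ring.
    - replace (- la)%C with (1 + - (la + 1))%C by ring. rewrite xpow_plus. ring. }
  rewrite Ce, cint_scal, Sub; [|lra|].
  - f_equal.
    assert (Ch : (cint (mellin f la) 0 (e * ka) + cint (mellin f la) (e * ka) (o * ka))%C = cint (mellin f la) 0 (o * ka)).
    { apply cint_Chasles; try lra. intros x Hx. apply Cm; lra. }
    rewrite (mellin_beyond M rad f la (o * ka)) in Ch; auto.
    + unfold Phi. rewrite (mellin_beyond M rad f la o), <- Ch; auto. ring.
    + unfold o, outer, ka. replace (rad / sin th * (sin th / cos psi)) with (rad / cos psi) by (field; lra).
      pose proof (COS_bound psi).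
      apply Rmult_le_reg_r with (cos psi); auto. unfold Rdiv. rewrite Rmult_assoc, Rinv_l by lra. nra.
  - intros t Ht. apply ccont_mult; [apply ccont_const|].
    apply (ccont_comp (mellin f la) (fun t => t * ka)); [|apply Cm, Rmult_le_pos; lra].
    apply rcont_mult; [apply continuous_id|apply continuous_const].
Qed.

(** Exchange the integrals over [r] and [psi].  The window for [Re la - 2 J] is the one in
    which the integral [mult_base] over the directions converges absolutely up to
    [psi = - PI / 2]. *)
Lemma vint_mellin_direct M rad n th (J : nat) f la : 0 < th < PI / 2 -> 0 < rad -> (0 < M)%nat ->
  csmooth f -> vanishes rad f -> vanish_order M f -> fst la + 2 <= INR M ->
  -7 <= fst (la - RtoC (2 * INR J))%C <= -4 ->
  lin_limit (rad / 2)
    (fun e => cint (fun r => (xpow (- (la + 1)) r * vint n th J f r)%C) e (outer rad th))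
    (Phi (outer rad th) f la * mult_base n th (la - RtoC (2 * INR J)))%C.
Proof.
  intros Hth Hr HM0 Hf Hv HM Hla HJ.
  destruct (sin_cos_bounds th Hth) as [[Hs Hs1] _]. destruct (psic_bounds th Hth) as [P1 P2].
  pose proof PI_RGT_0 as PP.
  pose proof (outer_ge rad th Hth Hr) as Ho. set (o := outer rad th) in *.
  set (mu := (la - RtoC (2 * INR J))%C) in *.
  destruct (mellin_head_bound M rad f la Hr HM0 Hf Hv HM Hla) as [K [K0 HK]].
  set (E := exp (fst (mu + 1)%C * ln (sin th))).
  assert (HE : 0 < E) by apply exp_pos.
  exists (2 * (E * K) * 4). split; [assert (0 <= E * K) by nra; lra|].
  intros e He.
  set (base := fun psi => (cexp ((mu + 1) * RtoC (ln (sin th))) * (cpw mu psi * ker n th psi))%C).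
  set (inn := fun psi => cint (fun r => (xpow (- (la + 1)) r * vfun n th J f r psi)%C) e o).
  assert (Cbase : ccont_on base (- (PI / 2)) (psic th)).
  { intros psi Hpsi. apply ccont_mult; [apply ccont_const|]. apply (ccont_on_base n th mu); auto. lra. }
  assert (Cv2 : forall r psi, 0 < r -> ccont2 (vfun n th J f) r psi).
  { intros r psi Hrr. apply (vfun_cont rad); auto. intros; now apply csmooth_ccont. }
  assert (C2 : forall r psi, 0 < r -> ccont2 (fun r psi => (xpow (- (la + 1)) r * vfun n th J f r psi)%C) r psi).
  { intros r psi Hrr. apply ccont2_mult; [|now apply Cv2]. apply ccont2_fst_var. now apply ccont_xpow. }
  assert (Cinn : ccont_on inn (- (PI / 2)) (psic th)).
  { intros psi _. unfold inn.
    (* freeze the radius below [e], where the integrand need not be continuous *)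
    apply ccont_ext with (fun psi => cint (fun r => (xpow (- (la + 1)) (clamp e o r) * vfun n th J f (clamp e o r) psi)%C) e o).
    { intros t. apply cint_ext; [lra|]. intros r Hrr. rewrite clamp_id by lra. reflexivity. }
    apply (ccont_cint_param (fun psi r => (xpow (- (la + 1)) (clamp e o r) * vfun n th J f (clamp e o r) psi)%C)); [lra| |].
    - intros r Hrr.
      assert (Hcl : 0 < clamp e o r) by (pose proof (clamp_in e o r ltac:(lra)); lra).
      destruct (C2 (clamp e o r) psi Hcl) as [A B].
      split; intros eps; [destruct (A eps) as [d Hd]|destruct (B eps) as [d Hd]]; exists d; intros u v Hu Hw;
      apply (Hd (clamp e o v) u); auto; (eapply Rle_lt_trans; [apply clamp_lip|exact Hw]).
    - intros t r Hrr.
      assert (Hcl : 0 < clamp e o r) by (pose proof (clamp_in e o r ltac:(lra)); lra).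
      apply (ccont_comp (fun x => (xpow (- (la + 1)) x * vfun n th J f x t)%C) (clamp e o)).
      + apply continuity_pt_filterlim. intros eps Heps. exists eps. split; auto.
        intros v [_ Hw]. eapply Rle_lt_trans; [apply clamp_lip|exact Hw].
      + now apply ccont2_ccont_fst with (y := t) (g := fun r psi => (xpow (- (la + 1)) r * vfun n th J f r psi)%C), C2. }
  assert (Fub : cint (fun r => (xpow (- (la + 1)) r * vint n th J f r)%C) e o = cint inn (- (PI / 2)) (psic th)).
  { unfold inn. rewrite <- (cint_swap_order (fun r psi => (xpow (- (la + 1)) r * vfun n th J f r psi)%C)); try lra.
    - apply cint_ext; [lra|]. intros r Hrr. unfold vint. rewrite cint_scal; [reflexivity|lra|].
      apply (vfun_ccont_on rad); auto; [intros; now apply csmooth_ccont|lra].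
    - intros r psi Hrr _. apply C2. lra. }
  rewrite Fub.
  assert (Mb : (Phi o f la * mult_base n th mu)%C = cint (fun psi => (Phi o f la * base psi)%C) (- (PI / 2)) (psic th)).
  { rewrite cint_scal; auto; [|lra]. f_equal. unfold mult_base, base. rewrite cint_scal; [reflexivity|lra|].
    apply ccont_on_base; auto. lra. }
  rewrite Mb, <- cint_minus; auto; try lra.
  2:{ intros psi Hpsi. apply ccont_mult; [apply ccont_const|now apply Cbase]. }
  eapply Rle_trans; [apply (cint_bound _ (E * K * e))|].
  - lra.
  - intros psi Hpsi. apply ccont_minus; [now apply Cinn|]. apply ccont_mult; [apply ccont_const|now apply Cbase].
  - intros psi Hpsi.
    assert (Hc : 0 <= cos psi) by (apply cos_ge_0; unfold psic in *; lra).
    destruct Hc as [Hc|Hc].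
    + unfold inn. unfold o. rewrite (inner_mellin M rad); auto; [|fold o; lra]. fold o.
      rewrite vker_power by auto. fold mu. fold (base psi).
      replace (base psi * (Phi o f la - cint (mellin f la) 0 (e * (sin th / cos psi))) - Phi o f la * base psi)%C
        with (- (base psi * cint (mellin f la) 0 (e * (sin th / cos psi))))%C by ring.
      rewrite Cmod_opp, Cmod_mult.
      assert (Hka : 0 < sin th / cos psi) by (apply Rdiv_lt_0_compat; lra).
      assert (B1 : Cmod (base psi) <= E * (cos psi * cos psi)).
      { unfold base. rewrite !Cmod_mult, Cmod_ker, Rmult_1_r.
        change (cexp ((mu + 1) * RtoC (ln (sin th)))) with (xpow (mu + 1) (sin th)). rewrite Cmod_xpow.
        apply Rmult_le_compat_l; [left; apply exp_pos|]. apply Cmod_cpw. lra. }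
      assert (B2 : Cmod (cint (mellin f la) 0 (e * (sin th / cos psi))) <= K * (e * (sin th / cos psi))).
      { apply HK. apply Rmult_le_pos; lra. }
      eapply Rle_trans; [apply Rmult_le_compat; [apply Cmod_ge_0|apply Cmod_ge_0|exact B1|exact B2]|].
      replace (E * (cos psi * cos psi) * (K * (e * (sin th / cos psi)))) with (E * K * e * (sin th * cos psi)) by (field; lra).
      rewrite <- Rmult_1_r. apply Rmult_le_compat_l.
      * apply Rmult_le_pos; [apply Rmult_le_pos; lra|lra].
      * pose proof (COS_bound psi). nra.
    + replace (inn psi) with (RtoC 0).
      * unfold base, cpw. rewrite <- Hc, Rmult_0_l.
        rewrite !Cmult_0_l, !Cmult_0_r. unfold Cminus. rewrite Copp_0, Cplus_0_r, Cmod_0.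
        apply Rmult_le_pos; [apply Rmult_le_pos; lra|lra].
      * symmetry. unfold inn. apply cint_zero; [lra|].
        intros r _. unfold vfun. rewrite vker_cos0 by auto. ring.
  - assert (0 <= E * K * e) by (apply Rmult_le_pos; [apply Rmult_le_pos; lra|lra]).
    replace (2 * (E * K) * 4 * e) with (2 * (E * K * e) * 4) by ring.
    apply Rmult_le_compat_l; lra.
Qed.

(** The function to which [m] uses of [vint_recursion] can be applied in succession,
    starting from the weight [d ^ (- 2 i)]: each use raises the weight by two and thereby
    moves the exponent two units closer to the window of [vint_mellin_direct]. *)
Fixpoint raise (m i : nat) (f : R -> C) : R -> C :=
  match m with
  | 0%nat => f
  | S m => Esub (2 * INR i - 1) (Esub (2 * INR i) (raise m (S i) f))
  end.

Fixpoint raise_factor (m i : nat) (la : C) : C :=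
  match m with
  | 0%nat => 1%C
  | S m => ((la - RtoC (2 * INR i - 1)) * ((la - RtoC (2 * INR i)) * raise_factor m (S i) la))%C
  end.

Definition non_integer (la : C) : Prop := forall z : Z, la <> RtoC (IZR z).

Lemma raise_props M rad m : forall i f, 0 < rad -> csmooth f -> vanishes rad f -> vanish_order M f ->
  csmooth (raise m i f) /\ vanishes rad (raise m i f) /\ vanish_order M (raise m i f).
Proof.
  induction m as [|m IH]; intros i f Hr Hf Hv HM; [simpl; auto|].
  destruct (IH (S i) f Hr Hf Hv HM) as [A [B D]]. cbn [raise].
  repeat split; repeat (apply csmooth_Esub || apply vanishes_Esub || apply vanish_order_Esub); auto.
Qed.

Lemma Phi_raise M rad o m : forall i f la, 0 < rad -> rad <= o -> (0 < M)%nat -> csmooth f -> vanishes rad f ->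
  vanish_order M f -> fst la + 2 <= INR M -> Phi o (raise m i f) la = (raise_factor m i la * Phi o f la)%C.
Proof.
  induction m as [|m IH]; intros i f la Hr Ho HM0 Hf Hv HM Hla; [simpl; ring|].
  destruct (raise_props M rad m (S i) f Hr Hf Hv HM) as [A [B D]]. cbn [raise raise_factor].
  rewrite (Phi_Esub M rad); auto.
  - rewrite (Phi_Esub M rad), IH; auto. ring.
  - now apply csmooth_Esub.
  - now apply vanishes_Esub.
  - now apply vanish_order_Esub.
Qed.

Lemma Esub_ext k f g : (forall x, f x = g x) -> forall x, Esub k f x = Esub k g x.
Proof. intros H x. unfold Esub, Eul. now rewrite (dC_ext f g H), H. Qed.

Lemma Esub_comm a b f x : csmooth f -> Esub a (Esub b f) x = Esub b (Esub a f) x.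
Proof. intros Hf. rewrite !Esub_Esub by auto. now rewrite (Rplus_comm a b), (Rmult_comm a b). Qed.

Lemma csmooth_raise m : forall i f, csmooth f -> csmooth (raise m i f).
Proof. induction m as [|m IH]; intros i f Hf; [exact Hf|]. cbn [raise]. now do 2 apply csmooth_Esub; apply IH. Qed.

Lemma raise_Esub m : forall i f a, csmooth f -> forall x, Esub a (raise m i f) x = raise m i (Esub a f) x.
Proof.
  induction m as [|m IH]; intros i f a Hf x; [reflexivity|]. cbn [raise].
  assert (A : csmooth (raise m (S i) f)) by now apply csmooth_raise.
  rewrite Esub_comm by (now apply csmooth_Esub).
  apply Esub_ext. intros y. rewrite Esub_comm by auto.
  apply Esub_ext. intros z. now apply IH.
Qed.

Lemma vint_ext n th i f g r : (forall x, f x = g x) -> 0 < th < PI / 2 -> vint n th i f r = vint n th i g r.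
Proof.
  intros H Hth. apply cint_ext; [now apply psic_ge|]. intros psi _. unfold vfun. now rewrite H.
Qed.

Lemma ccont_vint rad n th i f r : 0 < th < PI / 2 -> 0 < rad -> csmooth f -> vanishes rad f -> 0 < r ->
  ccont (vint n th i f) r.
Proof. intros. eapply cder_ccont. now apply (cder_vint rad). Qed.

Lemma vint_mellin_raise M rad n th m : forall i f la, 0 < th < PI / 2 -> 0 < rad -> (0 < M)%nat ->
  csmooth f -> vanishes rad f -> vanish_order M f -> fst la + 2 <= INR M -> non_integer la ->
  -7 <= fst la - 2 * INR (i + m) <= -4 ->
  lin_limit (rad / 2)
    (fun e => cint (fun r => (xpow (- (la + 1)) r * vint n th i (raise m i f) r)%C) e (outer rad th))
    (raise_factor m i la * Phi (outer rad th) f la * mult_ext n th m (la - RtoC (2 * INR i)))%C.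
Proof.
  induction m as [|m IH]; intros i f la Hth Hr HM0 Hf Hv HM Hla Hni HJ.
  - cbn [raise raise_factor mult_ext]. rewrite Cmult_1_l. rewrite Nat.add_0_r in HJ.
    apply (vint_mellin_direct M); auto.
  - pose proof (outer_ge rad th Hth Hr) as Ho.
    set (o := outer rad th) in *. set (k := 2 * INR i). set (g := raise m (S i) f).
    destruct (raise_props M rad m (S i) f Hr Hf Hv HM) as [Sg [Vg Og]]. fold g in Sg, Vg, Og.
    set (f' := Esub (k + n) (Esub (k - n) f)).
    assert (Sf' : csmooth f') by (unfold f'; now do 2 apply csmooth_Esub).
    assert (Vf' : vanishes rad f').
    { unfold f'. apply vanishes_Esub; auto; [now apply csmooth_Esub|now apply vanishes_Esub]. }
    assert (Of' : vanish_order M f').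
    { unfold f'. apply vanish_order_Esub; [now apply csmooth_Esub|now apply vanish_order_Esub]. }
    assert (L1 := IH (S i) f' la Hth Hr HM0 Sf' Vf' Of' Hla Hni).
    replace (S i + m)%nat with (i + S m)%nat in L1 by lia. specialize (L1 HJ). fold o in L1.
    assert (Hrad2 : rad / 2 <= o) by lra.
    assert (L2 := Phi_lin_limit M o g la (rad / 2) ltac:(lra) Hrad2 HM0 Sg Og Hla).
    assert (SDg : csmooth (Esub k g)) by now apply csmooth_Esub.
    assert (ODg : vanish_order M (Esub k g)) by now apply vanish_order_Esub.
    assert (L3 := Phi_lin_limit M o (Esub k g) la (rad / 2) ltac:(lra) Hrad2 HM0 SDg ODg Hla).
    rewrite (Phi_Esub M rad) in L3; auto.
    pose proof (lin_limit_plus _ _ _ _ _ (lin_limit_scal _ (RtoC (sin th * sin th)) _ _ L1)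
      (lin_limit_plus _ _ _ _ _ (lin_limit_scal _ (RtoC (cos th)) _ _ L3)
         (lin_limit_scal _ (- (Ci * RtoC (n * sin th)))%C _ _ L2))) as L.
    match type of L with lin_limit _ _ ?A => match goal with |- lin_limit _ _ ?B => replace B with A end end.
    + revert L. apply lin_limit_ext. intros e He.
      assert (Cx : forall x, e <= x <= o -> ccont (xpow (- (la + 1))) x) by (intros; apply ccont_xpow; lra).
      assert (C1 : ccont_on (fun r => (xpow (- (la + 1)) r * vint n th (S i) (raise m (S i) f') r)%C) e o).
      { destruct (raise_props M rad m (S i) f' Hr Sf' Vf' Of') as [Sr [Vr _]].
        intros x Hx. apply ccont_mult; auto. apply (ccont_vint rad); auto. lra. }
      assert (C2 : ccont_on (mellin (Esub k g) la) e o).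
      { intros x Hx. apply ccont_mult; auto. now apply csmooth_ccont. }
      assert (C3 : ccont_on (mellin g la) e o).
      { intros x Hx. apply ccont_mult; auto. now apply csmooth_ccont. }
      rewrite <- !cint_scal; auto; try lra.
      rewrite <- !cint_plus; try lra.
      * apply cint_ext; [lra|]. intros r Hrr. cbn [raise]. fold g. fold k. unfold k.
        rewrite (vint_recursion rad); auto; [|lra]. fold k.
        rewrite (vint_ext n th (S i) (Esub (k + n) (Esub (k - n) g)) (raise m (S i) f')); auto.
        -- unfold mellin. ring.
        -- intros x. unfold f'. rewrite <- raise_Esub by now apply csmooth_Esub.
           apply Esub_ext. intros y. unfold g. now apply raise_Esub.
      * intros x Hx. apply ccont_mult; [apply ccont_const|auto].
      * intros x Hx. apply ccont_plus; apply ccont_mult; try apply ccont_const; auto.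
      * intros x Hx. apply ccont_mult; [apply ccont_const|auto].
      * intros x Hx. apply ccont_mult; [apply ccont_const|auto].
    + unfold f'. rewrite (Phi_Esub M rad), (Phi_Esub M rad); auto.
      2:{ now apply csmooth_Esub. } 2:{ now apply vanishes_Esub. } 2:{ now apply vanish_order_Esub. }
      unfold g. rewrite (Phi_raise M rad); auto.
      cbn [raise_factor mult_ext]. fold k. unfold mult_next.
      set (x := (la - RtoC k)%C).
      assert (Ex : (la - RtoC (2 * INR (S i)))%C = (x - 2)%C).
      { unfold x, k. rewrite S_INR. apply Ceq; simpl; ring. }
      rewrite Ex.
      assert (N0 : x <> 0%C).
      { intros X. apply (Hni (2 * Z.of_nat i)%Z). rewrite mult_IZR, <- INR_IZR_INZ. fold k.
        replace la with (x + RtoC k)%C by (unfold x; ring). rewrite X. ring. }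
      assert (N1 : (x + 1)%C <> 0%C).
      { intros X. apply (Hni (2 * Z.of_nat i - 1)%Z). rewrite minus_IZR, mult_IZR, <- INR_IZR_INZ. fold k.
        replace la with ((x + 1) + RtoC (k - 1))%C by (unfold x; rewrite RtoC_minus; ring). rewrite X. ring. }
      replace (la - RtoC (k - 1))%C with (x + 1)%C by (unfold x; rewrite RtoC_minus; ring).
      replace (la - RtoC (k + n))%C with (x - RtoC n)%C by (unfold x; rewrite RtoC_plus; ring).
      replace (la - RtoC (k - n))%C with (x + RtoC n)%C by (unfold x; rewrite RtoC_minus; ring).
      rewrite (RtoC_mult n n). field. auto.
Qed.

(** * The Mellin transform of the data *)

(** The lower limit is [rad / 2] rather than [0] because the data vanish below [rad]. *)
Definition data_mellin (rad n th : R) (f : R -> C) (la : C) : C :=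
  cint (fun r => (Vt rad n th f r * xpow (- (la + 2)) r)%C) (rad / 2) (outer rad th).

Definition V_zero (rad n th : R) (f : R -> C) : Prop :=
  forall r, 0 < r < rad -> Vt rad n th f r = 0%C.

Lemma ccont_Vt rad n th f r : 0 < th < PI / 2 -> 0 < rad -> csmooth f -> vanishes rad f ->
  0 < r <= outer rad th -> ccont (Vt rad n th f) r.
Proof.
  intros Hth Hr Hf Hv Hrr. destruct (cder_Vt rad n th 0 f r Hth Hr Hf Hv Hrr) as [l [D _]].
  eapply cder_ccont, D.
Qed.

Lemma Vt_bounded rad n th f : 0 < th < PI / 2 -> 0 < rad -> csmooth f -> vanishes rad f ->
  exists K, 0 <= K /\ forall r, rad / 2 <= r <= outer rad th -> Cmod (Vt rad n th f r) <= K.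
Proof.
  intros Hth Hr Hf Hv. pose proof (outer_ge rad th Hth Hr) as Ho. set (o := outer rad th) in *.
  destruct (ccont_bounded (fun r => Vt rad n th f (clamp (rad / 2) o r)) (rad / 2) o ltac:(lra)) as [K [K0 HK]].
  { intros r. apply ccont_comp.
    - apply continuity_pt_filterlim. intros eps Heps. exists eps. split; auto.
      intros v [_ Hw]. eapply Rle_lt_trans; [apply clamp_lip|exact Hw].
    - pose proof (clamp_in (rad / 2) o r ltac:(lra)). apply ccont_Vt; auto. fold o. lra. }
  exists K. split; auto. intros r Hrr. specialize (HK r Hrr). now rewrite clamp_id in HK.
Qed.

Lemma V_zero_Esub rad n th k f : 0 < th < PI / 2 -> 0 < rad -> csmooth f -> vanishes rad f ->
  V_zero rad n th f -> V_zero rad n th (Esub k f).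
Proof.
  intros Hth Hr Hf Hv HV r Hrr. pose proof (outer_ge rad th Hth Hr) as Ho.
  destruct (cder_Vt rad n th k f r Hth Hr Hf Hv ltac:(lra)) as [l [D E]].
  rewrite E, (HV r Hrr).
  assert (L : l = 0%C).
  { assert (Hloc : locally r (fun u => Vt rad n th f u = 0%C)).
    { assert (Hm : 0 < Rmin r (rad - r)) by (apply Rmin_glb_lt; lra).
      exists (mkposreal _ Hm). intros u Hu. unfold ball in Hu; simpl in Hu.
      unfold AbsRing_ball, abs, minus, plus, opp in Hu; simpl in Hu. apply Rabs_def2 in Hu.
      pose proof (Rmin_l r (rad - r)). pose proof (Rmin_r r (rad - r)). apply HV. lra. }
    apply (cder_unique (fun _ => 0%C) r); [|apply cder_const]. destruct D as [D1 D2]. split.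
    - eapply is_derive_ext_loc; [|exact D1]. revert Hloc; apply filter_imp. intros u Hu. now rewrite Hu.
    - eapply is_derive_ext_loc; [|exact D2]. revert Hloc; apply filter_imp. intros u Hu. now rewrite Hu. }
  rewrite L. ring.
Qed.

Lemma Vt_outer rad n th f : 0 < th < PI / 2 -> 0 < rad -> vanishes rad f ->
  Vt rad n th f (outer rad th) = 0%C.
Proof.
  intros Hth Hr Hv. destruct (sin_cos_bounds th Hth) as [[Hs _] _].
  pose proof (outer_ge rad th Hth Hr) as Ho.
  unfold Vt. rewrite cint_point. replace (vint n th 0 f (outer rad th)) with (RtoC 0); [ring|].
  symmetry. apply cint_zero; [now apply psic_ge|]. intros psi _. apply (vfun_zero rad); auto; [lra|].
  unfold outer. replace (rad / sin th * sin th) with rad by (field; lra).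
  assert (Rabs (cos psi) <= 1) by (apply Rabs_le, COS_bound). nra.
Qed.

Lemma data_mellin_Esub rad n th k f la : 0 < th < PI / 2 -> 0 < rad -> csmooth f -> vanishes rad f ->
  V_zero rad n th f -> data_mellin rad n th (Esub k f) la = ((la - RtoC k) * data_mellin rad n th f la)%C.
Proof.
  intros Hth Hr Hf Hv HV. pose proof (outer_ge rad th Hth Hr) as Ho. set (o := outer rad th) in *.
  assert (SE : csmooth (Esub k f)) by now apply csmooth_Esub.
  assert (VE : vanishes rad (Esub k f)) by now apply vanishes_Esub.
  set (F1 := fun r => (Vt rad n th (Esub k f) r * xpow (- (la + 2)) r)%C).
  set (F0 := fun r => (Vt rad n th f r * xpow (- (la + 2)) r)%C).
  assert (C1 : ccont_on F1 (rad / 2) o).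
  { intros x Hx. apply ccont_mult; [apply ccont_Vt; auto; fold o; lra|apply ccont_xpow; lra]. }
  assert (C0 : ccont_on F0 (rad / 2) o).
  { intros x Hx. apply ccont_mult; [apply ccont_Vt; auto; fold o; lra|apply ccont_xpow; lra]. }
  assert (D : cint (fun r => (F1 r - (la - RtoC k) * F0 r)%C) (rad / 2) o = 0%C).
  { rewrite (cint_derive (fun r => (Vt rad n th f r * xpow (- (la + 1)) r)%C)); [|lra| |].
    - unfold o. rewrite Vt_outer by auto. rewrite (HV (rad / 2)) by lra. ring.
    - intros x Hx. destruct (cder_Vt rad n th k f x Hth Hr Hf Hv) as [l [D E]]; [fold o; lra|].
      eapply cder_eq; [apply cder_mult; [exact D|apply cder_xpow; lra]|].
      unfold F1, F0. rewrite E.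
      replace (- (la + 1))%C with (- (la + 2) + 1)%C.
      2:{ apply Ceq; simpl; ring. }
      rewrite xpow_plus, xpow_1 by lra.
      assert (RtoC x <> 0%C) by (intros X; apply RtoC_inj in X; lra).
      rewrite RtoC_inv by lra. set (p := xpow (- (la + 2)) x). set (v := Vt rad n th f x).
      assert (Q : (- (la + 2) + 1)%C = (- la - 1)%C) by (apply Ceq; simpl; ring).
      rewrite Q. field. auto.
    - intros x Hx. apply ccont_minus; auto. apply ccont_mult; [apply ccont_const|auto]. }
  rewrite cint_minus, cint_scal in D; auto; try lra.
  2:{ intros x Hx. apply ccont_mult; [apply ccont_const|auto]. }
  unfold data_mellin. fold o. fold F1. fold F0.
  replace (cint F1 (rad / 2) o) with
    ((cint F1 (rad / 2) o - (la - RtoC k) * cint F0 (rad / 2) o) + (la - RtoC k) * cint F0 (rad / 2) o)%C by ring.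
  rewrite D. ring.
Qed.

Lemma data_mellin_raise rad n th m : forall i f la, 0 < th < PI / 2 -> 0 < rad -> csmooth f -> vanishes rad f ->
  V_zero rad n th f ->
  V_zero rad n th (raise m i f) /\
  data_mellin rad n th (raise m i f) la = (raise_factor m i la * data_mellin rad n th f la)%C.
Proof.
  induction m as [|m IH]; intros i f la Hth Hr Hf Hv HV; [simpl; split; [auto|ring]|].
  destruct (IH (S i) f la Hth Hr Hf Hv HV) as [Z E].
  assert (A : csmooth (raise m (S i) f)) by now apply csmooth_raise.
  assert (B : vanishes rad (raise m (S i) f)).
  { apply (raise_props 0 rad m (S i) f); auto. intros j Hj; lia. }
  cbn [raise raise_factor].
  assert (A' : csmooth (Esub (2 * INR i) (raise m (S i) f))) by now apply csmooth_Esub.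
  assert (B' : vanishes rad (Esub (2 * INR i) (raise m (S i) f))) by now apply vanishes_Esub.
  assert (Z' : V_zero rad n th (Esub (2 * INR i) (raise m (S i) f))) by now apply V_zero_Esub.
  split; [now apply V_zero_Esub|].
  rewrite data_mellin_Esub, data_mellin_Esub, E by auto. ring.
Qed.

Lemma raise_factor_neq_0 m : forall i la, non_integer la -> raise_factor m i la <> 0%C.
Proof.
  induction m as [|m IH]; intros i la H; cbn [raise_factor].
  - intros X. apply RtoC_inj in X. lra.
  - apply Cmult_neq_0; [|apply Cmult_neq_0; [|now apply IH]].
    + intros X. apply (H (2 * Z.of_nat i - 1)%Z). rewrite minus_IZR, mult_IZR, <- INR_IZR_INZ.
      replace la with ((la - RtoC (2 * INR i - 1)) + RtoC (2 * INR i - 1))%C by ring. rewrite X. ring.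
    + intros X. apply (H (2 * Z.of_nat i)%Z). rewrite mult_IZR, <- INR_IZR_INZ.
      replace la with ((la - RtoC (2 * INR i)) + RtoC (2 * INR i))%C by ring. rewrite X. ring.
Qed.

(** Both branches are dilation invariant, so the transform multiplies the Mellin
    transform by a factor.  The integrals over the directions do not converge for large
    [Re la]; so the identity is proved for [raise] of [f], which multiplies both sides
    by the same nonzero number. *)
Lemma mellin_identity M rad n th (J : nat) f (la : C) : 0 < th < PI / 2 -> 0 < rad -> (0 < M)%nat -> (0 < J)%nat ->
  csmooth f -> vanishes rad f -> vanish_order M f -> V_zero rad n th f ->
  fst la + 2 <= INR M -> non_integer la -> -7 <= fst la - 2 * INR J <= -4 ->
  (vmult n th J la * Phi (outer rad th) f la)%C = data_mellin rad n th f la.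
Proof.
  intros Hth Hr HM0 HJ0 Hf Hv HM HV Hla Hni HJ.
  pose proof (outer_ge rad th Hth Hr) as Ho. set (o := outer rad th) in *.
  destruct J as [|m]; [lia|].
  destruct (raise_props M rad m 1 f Hr Hf Hv HM) as [Sg [Vg Og]]. set (g := raise m 1 f) in *.
  set (h := Esub 0 g).
  assert (Sh : csmooth h) by now apply csmooth_Esub.
  assert (Vh : vanishes rad h) by now apply vanishes_Esub.
  assert (Oh : vanish_order M h) by now apply vanish_order_Esub.
  set (F := raise (S m) 0 f).
  assert (EF : F = Esub (-1) h).
  { unfold F, h, g. cbn [raise]. simpl INR. rewrite Rmult_0_r, Rminus_0_l. reflexivity. }
  assert (SF : csmooth F) by (rewrite EF; now apply csmooth_Esub).
  assert (VF : vanishes rad F) by (rewrite EF; now apply vanishes_Esub).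
  destruct (data_mellin_raise rad n th (S m) 0 f la Hth Hr Hf Hv HV) as [ZF DF]. fold F in ZF, DF.
  set (p := raise_factor (S m) 0 la).
  assert (Np : p <> 0%C) by now apply raise_factor_neq_0.
  assert (PF : Phi o F la = (p * Phi o f la)%C) by (apply (Phi_raise M rad); auto).
  assert (PF2 : Phi o F la = ((la + 1) * Phi o h la)%C).
  { rewrite EF, (Phi_Esub M rad) by auto. f_equal. apply Ceq; simpl; ring. }
  assert (N1 : (la + 1)%C <> 0%C).
  { intros X. apply (Hni (-1)%Z). replace la with ((la + 1) - 1)%C by ring. rewrite X. apply Ceq; simpl; ring. }
  (* the truncated transform is constant, and converges to the multiplier *)
  assert (L : data_mellin rad n th F la = (p * Phi o f la * vmult n th (S m) la)%C).
  { apply (lin_limit_unique (rad / 2) (fun _ => data_mellin rad n th F la)); [lra| |].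
    - exists 0. split; [lra|]. intros e He. replace (_ - _)%C with (RtoC 0) by ring. rewrite Cmod_0. lra.
    - assert (L1 := Phi_lin_limit M o h la (rad / 2) ltac:(lra) ltac:(lra) HM0 Sh Oh Hla).
      assert (L2 := vint_mellin_raise M rad n th (S m) 0 f la Hth Hr HM0 Hf Hv HM Hla Hni HJ).
      fold o in L2. fold F in L2. fold p in L2. simpl INR in L2. rewrite Rmult_0_r in L2.
      replace (la - RtoC 0)%C with la in L2 by ring.
      pose proof (lin_limit_plus _ _ _ _ _ (lin_limit_scal _ (-1)%C _ _ L1)
         (lin_limit_scal _ (cexp (0, - th)%R) _ _ L2)) as L.
      match type of L with lin_limit _ _ ?A => match goal with |- lin_limit _ _ ?B => replace B with A end end.
      + revert L. apply lin_limit_ext. intros e He.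
        assert (CV : ccont_on (fun r => (Vt rad n th F r * xpow (- (la + 2)) r)%C) e o).
        { intros x Hx. apply ccont_mult; [apply ccont_Vt; auto; fold o; lra|apply ccont_xpow; lra]. }
        assert (E1 : data_mellin rad n th F la = cint (fun r => (Vt rad n th F r * xpow (- (la + 2)) r)%C) e o).
        { unfold data_mellin. fold o. rewrite <- (cint_Chasles _ e (rad / 2) o); auto; try lra.
          rewrite (cint_zero _ e (rad / 2)); [ring|lra|]. intros x Hx. rewrite ZF by lra. ring. }
        rewrite E1.
        assert (C1 : ccont_on (mellin h la) e o).
        { intros x Hx. apply ccont_mult; [now apply csmooth_ccont|apply ccont_xpow; lra]. }
        assert (C2 : ccont_on (fun r => (xpow (- (la + 1)) r * vint n th 0 F r)%C) e o).
        { intros x Hx. apply ccont_mult; [apply ccont_xpow; lra|apply (ccont_vint rad); auto; lra]. }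
        rewrite <- !cint_scal, <- cint_plus; auto; try lra.
        * apply cint_ext; [lra|]. intros r Hrr. unfold Vt. fold o.
          assert (EI : cint F r o = (- (RtoC r * h r))%C).
          { rewrite (cint_derive (fun x => (RtoC x * h x)%C)); [|lra| |].
            - rewrite (Vh o) by (rewrite Rabs_pos_eq; lra). ring.
            - intros x _. eapply cder_eq; [apply cder_id_mult, csmooth_cder, Sh|].
              rewrite EF. unfold Esub, Eul. apply Ceq; simpl; ring.
            - intros x _. now apply csmooth_ccont. }
          rewrite EI. unfold mellin.
          replace (- (la + 1))%C with (- (la + 2) + 1)%C by (apply Ceq; simpl; ring).
          rewrite xpow_plus, xpow_1 by lra. ring.
        * intros x Hx. apply ccont_mult; [apply ccont_const|auto].
        * intros x Hx. apply ccont_mult; [apply ccont_const|auto].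
      + assert (EH : Phi o h la = (p * Phi o f la / (la + 1))%C).
        { rewrite <- PF, PF2. field. auto. }
        rewrite EH. unfold vmult. field. auto. }
  rewrite DF in L. fold p in L.
  assert (LL : (p * (vmult n th (S m) la * Phi o f la - data_mellin rad n th f la))%C = 0%C).
  { replace (p * (vmult n th (S m) la * Phi o f la - data_mellin rad n th f la))%C with
      (p * Phi o f la * vmult n th (S m) la - p * data_mellin rad n th f la)%C by ring.
    rewrite <- L. ring. }
  destruct (Ceq_dec (vmult n th (S m) la * Phi o f la) (data_mellin rad n th f la)) as [H|H]; auto.
  exfalso. apply (Cmult_neq_0 _ _ Np) in LL; auto. apply Cminus_eq_contra. exact H.
Qed.

(** * Flatness at the origin *)

(** The [nu]-th mode of a smooth function of the plane has the parity of [nu]. *)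
Definition parity_ok (nu : Z) (f : R -> C) : Prop :=
  forall j : nat, Z.odd (Z.of_nat j - nu) = true -> Dn j f 0 = 0%C.

Lemma parity_ok_Esub nu k f : csmooth f -> parity_ok nu f -> parity_ok nu (Esub k f).
Proof. intros Hf H j Hj. rewrite Dn_Esub_0, H by auto. ring. Qed.

(** The properties of an angular mode which the operators [x d/dx - k] preserve. *)
Record mode (rad th : R) (nu : Z) (f : R -> C) : Prop := {
  mode_smooth : csmooth f;
  mode_support : vanishes rad f;
  mode_parity : parity_ok nu f;
  mode_zero : V_zero rad (IZR nu) th f }.

Lemma mode_Esub rad th nu k f : 0 < th < PI / 2 -> 0 < rad -> mode rad th nu f -> mode rad th nu (Esub k f).
Proof.
  intros Hth Hr [A B D E]. split.
  - now apply csmooth_Esub.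
  - now apply vanishes_Esub.
  - now apply parity_ok_Esub.
  - now apply V_zero_Esub.
Qed.

Lemma is_derive_pow_fact j t :
  is_derive (fun t => t ^ S j / INR (fact (S j))) t (t ^ j / INR (fact j)).
Proof.
  pose proof (INR_fact_neq_0 j) as N1. assert (N3 : INR (S j) <> 0) by (apply not_0_INR; lia).
  rewrite fact_simpl, mult_INR. revert N3. generalize (INR (fact j)) as q, N1. intros q Nq N3.
  apply is_derive_ext with (fun t => / (INR (S j) * q) * t ^ S j).
  { intros u. apply Rmult_comm. }
  evar_last.
  - apply (is_derive_scal (fun t => t ^ S j) t). apply (is_derive_pow (fun t => t) (S j) t 1).
    apply (is_derive_id (K := R_AbsRing)).
  - cbn [pred]. revert N3. generalize (INR (S j)). intros p N3. field. auto.
Qed.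

(** Integrate the bound for the derivative. *)
Lemma leading_term j : forall f, csmooth f -> vanish_order j f ->
  exists K, 0 <= K /\ forall x, 0 <= x <= 1 ->
    Cmod (f x - RtoC (x ^ j / INR (fact j)) * Dn j f 0) <= K * x ^ (S j).
Proof.
  induction j as [|j IH]; intros f Hf HM.
  - destruct (ccont_bounded (dC f) 0 1 ltac:(lra)) as [K [K0 HK]].
    { intros x. now apply csmooth_ccont, csmooth_dC. }
    exists (2 * K). split; [lra|]. intros x Hx.
    replace (f x - RtoC (x ^ 0 / INR (fact 0)) * Dn 0 f 0)%C with (cint (dC f) 0 x).
    + eapply Rle_trans; [apply (cint_bound _ K); try lra|].
      * intros t _. now apply csmooth_ccont, csmooth_dC.
      * intros t Ht. apply HK. lra.
      * simpl. lra.
    + rewrite (cint_derive f); try lra.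
      * simpl. replace (1 / 1) with 1 by field. ring.
      * intros t _. now apply csmooth_cder.
      * intros t _. now apply csmooth_ccont, csmooth_dC.
  - destruct (IH (dC f)) as [K [K0 HK]].
    + now apply csmooth_dC.
    + intros i Hi. rewrite Dn_shift. apply HM. lia.
    + exists (2 * K). split; [lra|]. intros x Hx. set (a := Dn (S j) f 0).
      rewrite Dn_shift in HK. fold a in HK.
      set (F := fun t => (f t - RtoC (t ^ (S j) / INR (fact (S j))) * a)%C).
      set (G := fun t => (dC f t - RtoC (t ^ j / INR (fact j)) * a)%C).
      assert (CG : forall t, ccont G t).
      { intros t. apply ccont_minus; [now apply csmooth_ccont, csmooth_dC|].
        apply ccont_mult; [|apply ccont_const]. apply ccont_RtoC.
        derive_cont. }
      assert (E : F x = cint G 0 x).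
      { rewrite (cint_derive F); [|lra| |intros t _; apply CG].
        - assert (F0 : F 0 = 0%C).
          { unfold F. assert (f0 : f 0 = 0%C) by (apply (HM 0%nat); lia). rewrite f0, pow_i by lia.
            unfold Rdiv. rewrite Rmult_0_l. ring. }
          rewrite F0. ring.
        - intros t _. unfold F, G. apply cder_minus; [now apply csmooth_cder|].
          eapply cder_eq; [apply cder_mult; [|apply cder_const]; apply cder_RtoC, is_derive_pow_fact|].
          rewrite Cmult_0_r, Cplus_0_r. reflexivity. }
      fold (F x). rewrite E. eapply Rle_trans; [apply (cint_bound _ (K * x ^ S j)); try lra|].
      * intros t _. apply CG.
      * intros t Ht. eapply Rle_trans; [apply HK; lra|].
        apply Rmult_le_compat_l; auto. apply pow_incr. lra.
      * rewrite <- (tech_pow_Rmult x (S j)). right. ring.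
Qed.

Lemma no_leading_term j f K d : csmooth f -> vanish_order j f -> 0 < d <= 1 ->
  (forall x, 0 < x <= d -> Cmod (f x) <= K * x ^ S j) -> Dn j f 0 = 0%C.
Proof.
  intros Hf HM Hd HK. destruct (leading_term j f Hf HM) as [K' [K0' HK']].
  set (a := Dn j f 0) in *. pose proof (INR_fact_lt_0 j) as Fp.
  apply (eq_of_small a ((K + K') * INR (fact j)) d); [lra|]. intros x Hx.
  specialize (HK x Hx). specialize (HK' x ltac:(lra)).
  assert (Xp : 0 < x ^ j) by (apply pow_lt; lra).
  assert (A : Cmod (RtoC (x ^ j / INR (fact j)) * a) <= (K + K') * x ^ S j).
  { replace (RtoC (x ^ j / INR (fact j)) * a)%C with
      (f x - (f x - RtoC (x ^ j / INR (fact j)) * a))%C by ring.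
    eapply Rle_trans; [apply Cmod_sub_le|]. lra. }
  rewrite Cmod_mult, Cmod_R, Rabs_pos_eq in A by (left; now apply Rdiv_lt_0_compat).
  rewrite <- tech_pow_Rmult in A.
  apply Rmult_le_reg_l with (x ^ j / INR (fact j)); [now apply Rdiv_lt_0_compat|].
  replace (x ^ j / INR (fact j) * ((K + K') * INR (fact j) * x)) with ((K + K') * (x * x ^ j)) by (field; lra).
  exact A.
Qed.

Lemma data_mellin_bounded rad n th f (m : R) : 0 < th < PI / 2 -> 0 < rad -> csmooth f -> vanishes rad f -> 0 <= m ->
  exists K, 0 <= K /\ forall la : C, Rabs (fst la + 2) <= m -> Cmod (data_mellin rad n th f la) <= K.
Proof.
  intros Hth Hr Hf Hv Hm. pose proof (outer_ge rad th Hth Hr) as Ho. set (o := outer rad th) in *.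
  destruct (Vt_bounded rad n th f Hth Hr Hf Hv) as [Kv [Kv0 HKv]]. fold o in HKv.
  set (L := Rabs (ln (rad / 2)) + Rabs (ln o)).
  exists (2 * (Kv * exp (m * L)) * (o - rad / 2)).
  assert (E0 := exp_pos (m * L)).
  split; [apply Rmult_le_pos; [|lra]; assert (0 <= Kv * exp (m * L)) by nra; lra|].
  intros la Hla. apply cint_bound; [lra| |].
  - intros x Hx. apply ccont_mult; [apply ccont_Vt; auto; fold o; lra|apply ccont_xpow; lra].
  - intros x Hx. rewrite Cmod_mult, Cmod_xpow. apply Rmult_le_compat; [apply Cmod_ge_0|left; apply exp_pos| |].
    + now apply HKv.
    + apply exp_le_mono. eapply Rle_trans; [apply Rle_abs|]. rewrite Rabs_mult.
      apply Rmult_le_compat; try apply Rabs_pos.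
      * replace (fst (- (la + 2))%C) with (- (fst la + 2)) by (simpl; ring). now rewrite Rabs_Ropp.
      * assert (ln (rad / 2) <= ln x) by (destruct (proj1 Hx) as [H| <-]; [left; apply ln_increasing; lra|lra]).
        assert (ln x <= ln o) by (destruct (proj2 Hx) as [H1| ->]; [left; apply ln_increasing; lra|lra]).
        pose proof (Rle_abs (ln o)). pose proof (Rle_abs (- ln (rad / 2))) as H2. rewrite Rabs_Ropp in H2.
        pose proof (Rabs_pos (ln o)). pose proof (Rabs_pos (ln (rad / 2))).
        unfold L. apply Rabs_le. lra.
Qed.

Lemma abs_ln_bound x : 0 < x -> Rabs (ln x) <= x + / x.
Proof.
  intros Hx. assert (Hi : 0 < / x) by now apply Rinv_0_lt_compat.
  pose proof (exp_ineq1_le (ln x)) as A. rewrite exp_ln in A by auto.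
  pose proof (exp_ineq1_le (- ln x)) as B. rewrite exp_Ropp, exp_ln in B by auto.
  apply Rabs_le. lra.
Qed.

(** The factor [|ln x|] that arises from the change of the exponent is absorbed by the
    additional order of vanishing. *)
Lemma Phi_shift_limit M o f (a : R) : 0 < o -> (0 < M)%nat -> csmooth f -> vanish_order M f ->
  a + 3 <= INR M ->
  lin_limit (1 / 16) (fun e => Phi o f (RtoC (a + e))) (Phi o f (RtoC a)).
Proof.
  intros Ho HM0 Hf HM Ha.
  assert (H1 : fst (RtoC (a + 1)) + 2 <= INR M) by (simpl; lra).
  destruct (mellin_bound M f o (RtoC (a + 1)) Ho HM0 Hf HM H1) as [K [K0 HK]].
  set (q := (o * o + 1) * (o * o + 1)).
  assert (q0 : 0 <= q) by (unfold q; nra).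
  exists (2 * (2 * K * q) * o). split; [apply Rmult_le_pos; [nra|lra]|].
  intros e He. unfold Phi.
  assert (Cm : forall b, b <= a + 1 -> ccont_on (mellin f (RtoC b)) 0 o).
  { intros b Hb x Hx. apply (mellin_ccont M); auto; simpl; lra. }
  rewrite <- cint_minus; try lra; try (apply Cm; lra).
  eapply Rle_trans; [apply (cint_bound _ (2 * K * q * e))|].
  - lra.
  - intros x Hx. apply ccont_minus; apply Cm; lra.
  - intros x [[Hx|Hx] Hxo].
    + assert (E : (mellin f (RtoC (a + e)) x - mellin f (RtoC a) x)%C =
         (mellin f (RtoC (a + 1)) x * (RtoC x * (cexp (RtoC (- e * ln x)) - 1)))%C).
      { unfold mellin. replace (- (RtoC a + 1))%C with (- (RtoC (a + 1) + 1) + 1)%C by (apply Ceq; simpl; ring).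
        replace (- (RtoC (a + e) + 1))%C with ((- (RtoC (a + 1) + 1) + 1) + RtoC (- e))%C by (apply Ceq; simpl; ring).
        rewrite !xpow_plus, xpow_1 by auto.
        replace (xpow (RtoC (- e)) x) with (cexp (RtoC (- e * ln x))).
        - ring.
        - unfold xpow. f_equal. apply Ceq; simpl; ring. }
      rewrite E, !Cmod_mult, Cmod_R, (Rabs_pos_eq x) by lra.
      set (l := Rabs (ln x)).
      assert (l0 : 0 <= l) by apply Rabs_pos.
      assert (Hi : 0 < / x) by now apply Rinv_0_lt_compat.
      assert (B1 : Cmod (cexp (RtoC (- e * ln x)) - 1) <= 2 * (e * l) * exp l).
      { eapply Rle_trans; [apply cexp_sub1_bound|].
        rewrite Cmod_R, Rabs_mult, Rabs_Ropp, (Rabs_pos_eq e) by lra. fold l.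
        apply Rmult_le_compat_l; [nra|]. apply exp_le_mono. nra. }
      assert (B2 : exp l <= x + / x).
      { unfold l, Rabs. destruct (Rcase_abs (ln x)).
        - rewrite exp_Ropp, exp_ln by auto. lra.
        - rewrite exp_ln by auto. lra. }
      assert (B3 : l <= x + / x) by now apply abs_ln_bound.
      assert (B4 : x * x * ((x + / x) * (x + / x)) <= q).
      { replace (x * x * ((x + / x) * (x + / x))) with ((x * x + 1) * (x * x + 1)) by (field; lra).
        unfold q. assert (x * x <= o * o) by nra. assert (0 < x * x) by nra. nra. }
      assert (B5 : l * exp l <= (x + / x) * (x + / x)).
      { apply Rmult_le_compat; auto. left; apply exp_pos. }
      pose proof (HK x ltac:(lra)) as HKx.
      apply Rle_trans with (K * x * (x * (2 * (e * l) * exp l))).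
      * apply Rmult_le_compat; auto; [apply Cmod_ge_0|apply Rmult_le_pos; [lra|apply Cmod_ge_0]|].
        apply Rmult_le_compat_l; lra.
      * replace (K * x * (x * (2 * (e * l) * exp l))) with ((2 * K * e) * (x * x * (l * exp l))) by ring.
        replace (2 * K * q * e) with ((2 * K * e) * q) by ring.
        apply Rmult_le_compat_l; [nra|]. eapply Rle_trans; [|exact B4].
        apply Rmult_le_compat_l; nra.
    + subst x. assert (F0 : f 0 = 0%C) by (apply (HM 0%nat), HM0).
      unfold mellin. rewrite F0, !Cmult_0_l. unfold Cminus. rewrite Copp_0, Cplus_0_r, Cmod_0.
      apply Rmult_le_pos; [nra|lra].
  - right. ring.
Qed.

(** Let [j] be the degree of the leading Taylor coefficient [a].  With [E = x d/dx], let
    [f2 = (E - (j + 2)) f] and [H = (E - j) f2]; by parity [f] has no term of degree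
    [j + 1], so [H] vanishes to order [j + 3] and its Mellin transform is continuous at
    [j].  There it is zero: the multiplier stays away from zero near [j], while the
    transform of the data of [H] contains the factor [la - j].  On the other hand, [H] times
    [x ^ (- j - 1)] is the derivative of [f2 x ^ (- j)], so the Mellin transform at [j] is, up
    to sign, the limit of [f2 x ^ (- j)] at 0, which is [- 2 a]. *)
Lemma flat_step rad th nu : 0 < th < PI / 2 -> 0 < rad ->
  exists K0 : nat, forall f, mode rad th nu f ->
    forall j, (K0 <= j)%nat -> vanish_order j f -> Dn j f 0 = 0%C.
Proof.
  intros Hth Hr. destruct (vmult_near_integer nu th Hth) as [K HK].
  set (N := Z.abs_nat nu).
  exists (N + 2 + 2 * K)%nat. intros f Hm j Hj HM.
  destruct (Z.odd (Z.of_nat j - nu)) eqn:Ho; [now apply (mode_parity _ _ _ _ Hm)|].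
  assert (Hk : exists k, (K <= k)%nat /\ j = (N + 2 + 2 * k)%nat).
  { assert (Hev : Z.even (Z.of_nat j - Z.abs nu) = true).
    { rewrite <- Z.negb_odd. destruct (Z.abs_eq_or_opp nu) as [-> | ->].
      - now rewrite Ho.
      - rewrite Z.odd_sub, Z.odd_opp, <- Z.odd_sub, Ho. reflexivity. }
    apply Z.even_spec in Hev. destruct Hev as [m Hm'].
    exists (Z.to_nat (m - 1))%nat. unfold N. split; lia. }
  destruct Hk as [k [HkK Ej]].
  destruct (HK k HkK) as [J [c0 [Hc0 HJ]]].
  assert (EN : Rabs (IZR nu) = INR N).
  { unfold N. rewrite <- abs_IZR, INR_IZR_INZ, Zabs2Nat.id_abs. reflexivity. }
  assert (EJ : Rabs (IZR nu) + 2 + 2 * INR k = INR j).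
  { rewrite EN, Ej, !plus_INR, mult_INR. simpl. ring. }
  rewrite EJ in HJ.
  set (f2 := Esub (INR j + 2) f). set (H := Esub (INR j) f2).
  assert (Sf := mode_smooth _ _ _ _ Hm).
  assert (M2 : mode rad th nu f2) by now apply mode_Esub.
  assert (MH : mode rad th nu H) by now apply mode_Esub.
  assert (OH : vanish_order (j + 3) H).
  { intros i Hi. unfold H, f2. rewrite Dn_Esub_0 by now apply csmooth_Esub. rewrite Dn_Esub_0 by auto.
    assert (Ci : (i < j \/ i = j \/ i = j + 1 \/ i = j + 2)%nat) by lia.
    destruct Ci as [Ci|[-> |[-> | ->]]].
    - rewrite HM by auto. ring.
    - rewrite Rminus_diag. ring.
    - rewrite (mode_parity _ _ _ _ Hm (j + 1)%nat); [ring|].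
      replace (Z.of_nat (j + 1) - nu)%Z with (Z.succ (Z.of_nat j - nu)) by lia.
      rewrite Z.odd_succ, <- Z.negb_odd, Ho. reflexivity.
    - rewrite plus_INR. replace (INR j + INR 2 - (INR j + 2)) with 0 by (simpl; ring). ring. }
  assert (O2 : vanish_order j f2) by now apply vanish_order_Esub.
  set (o := outer rad th). pose proof (outer_ge rad th Hth Hr) as Hor. fold o in Hor.
  assert (Sh := mode_smooth _ _ _ _ MH). assert (S2 := mode_smooth _ _ _ _ M2).
  assert (V2 := mode_support _ _ _ _ M2).
  pose proof (pos_INR j) as Pj.
  assert (IM : INR (j + 3) = INR j + 3) by (rewrite plus_INR; simpl; ring).
  assert (P0 : Phi o H (RtoC (INR j)) = 0%C).
  { apply (lin_limit_unique (1 / 16) (fun e => Phi o H (RtoC (INR j + e)))); [lra| |].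
    - apply (Phi_shift_limit (j + 3)); auto; [lra|lia|lra].
    - destruct (data_mellin_bounded rad (IZR nu) th f2 (INR j + 3) Hth Hr S2 V2 ltac:(lra)) as [Kd [Kd0 HKd]].
      exists (Kd / c0). split; [apply Rmult_le_pos; [auto|left; now apply Rinv_0_lt_compat]|].
      intros e He. destruct (HJ e ltac:(lra)) as [HJ1 HJ2].
      assert (ID : (vmult (IZR nu) th J (RtoC (INR j + e)) * Phi o H (RtoC (INR j + e)))%C =
        (RtoC e * data_mellin rad (IZR nu) th f2 (RtoC (INR j + e)))%C).
      { unfold o. rewrite (mellin_identity (j + 3)); auto.
        - unfold H. rewrite data_mellin_Esub; auto; [|apply (mode_zero _ _ _ _ M2)].
          f_equal. apply Ceq; simpl; ring.
        - lia.
        - destruct J; [|lia]. simpl in HJ1. lra.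
        - apply (mode_support _ _ _ _ MH).
        - apply (mode_zero _ _ _ _ MH).
        - simpl. lra.
        - intros z X. apply RtoC_inj in X. rewrite INR_IZR_INZ in X.
          assert (A : IZR (Z.of_nat j) < IZR z < IZR (Z.of_nat j + 1)) by (rewrite plus_IZR; lra).
          destruct A as [A1 A2]. apply lt_IZR in A1, A2. lia. }
      apply (f_equal Cmod) in ID. rewrite !Cmod_mult, Cmod_R, (Rabs_pos_eq e) in ID by lra.
      assert (B : Cmod (data_mellin rad (IZR nu) th f2 (RtoC (INR j + e))) <= Kd).
      { apply HKd. simpl. rewrite Rabs_pos_eq; lra. }
      replace (Phi o H (RtoC (INR j + e)) - 0)%C with (Phi o H (RtoC (INR j + e))) by ring.
      pose proof (Cmod_ge_0 (Phi o H (RtoC (INR j + e)))) as Q.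
      apply Rmult_le_reg_l with c0; auto.
      replace (c0 * (Kd / c0 * e)) with (e * Kd) by (field; lra).
      apply Rle_trans with (e * Cmod (data_mellin rad (IZR nu) th f2 (RtoC (INR j + e)))).
      + rewrite <- ID. apply Rmult_le_compat_r; auto.
      + apply Rmult_le_compat_l; lra. }
  assert (A2 : Dn j f2 0 = 0%C).
  { assert (L := Phi_lin_limit (j + 3) o H (RtoC (INR j)) (Rmin 1 o) ltac:(lra) (Rmin_r _ _) ltac:(lia) Sh OH
      ltac:(simpl; lra)).
    rewrite P0 in L. destruct L as [KL [KL0 HL]].
    apply (no_leading_term j f2 KL (Rmin 1 o)); auto.
    - split; [apply Rmin_glb_lt; lra|apply Rmin_l].
    - intros x Hx. specialize (HL x Hx). pose proof (Rmin_r 1 o).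
      assert (E : cint (mellin H (RtoC (INR j))) x o = (- (f2 x * RtoC (/ x ^ j)))%C).
      { rewrite (cint_derive (fun t => (f2 t * xpow (- RtoC (INR j)) t)%C)); [|lra| |].
        - rewrite (V2 o) by (rewrite Rabs_pos_eq; lra). rewrite (xpow_opp_INR j x) by lra. ring.
        - intros t Ht. eapply cder_eq; [apply cder_mult; [now apply csmooth_cder|apply cder_xpow; lra]|].
          unfold mellin, H, Esub, Eul.
          replace (- RtoC (INR j))%C with (- (RtoC (INR j) + 1) + 1)%C by ring.
          rewrite xpow_plus, xpow_1 by lra.
          assert (RtoC t <> 0%C) by (intros X; apply RtoC_inj in X; lra).
          rewrite RtoC_inv by lra. field. auto.
        - intros t Ht. apply ccont_mult; [now apply csmooth_ccont|apply ccont_xpow; lra]. }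
      assert (Xp : 0 < x ^ j) by (apply pow_lt; lra).
      rewrite E in HL. replace (- (f2 x * RtoC (/ x ^ j)) - 0)%C with (- (f2 x * RtoC (/ x ^ j)))%C in HL by ring.
      rewrite Cmod_opp, Cmod_mult, Cmod_R, Rabs_pos_eq in HL by (left; now apply Rinv_0_lt_compat).
      rewrite <- tech_pow_Rmult.
      apply Rmult_le_reg_r with (/ x ^ j); [now apply Rinv_0_lt_compat|].
      replace (KL * (x * x ^ j) * / x ^ j) with (KL * x) by (field; lra). exact HL. }
  unfold f2 in A2. rewrite Dn_Esub_0 in A2 by auto.
  replace (INR j - (INR j + 2)) with (-2) in A2 by ring.
  replace (Dn j f 0) with (RtoC (- / 2) * (RtoC (-2) * Dn j f 0))%C.
  - rewrite A2. ring.
  - rewrite Cmult_assoc, <- RtoC_mult. replace (- / 2 * -2) with 1 by field. ring.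
Qed.

(** [(E - (K - 1)) ... (E - 1) E f] with [E = x d/dx]; all its Taylor coefficients of degree
    less than [K] vanish. *)
Fixpoint kill (K : nat) (f : R -> C) : R -> C :=
  match K with 0%nat => f | S K => Esub (INR K) (kill K f) end.

Lemma mode_kill rad th nu K f : 0 < th < PI / 2 -> 0 < rad -> mode rad th nu f -> mode rad th nu (kill K f).
Proof. intros Hth Hr H; induction K; simpl; auto. now apply mode_Esub. Qed.

Lemma vanish_order_kill rad th nu K f : 0 < th < PI / 2 -> 0 < rad -> mode rad th nu f -> vanish_order K (kill K f).
Proof.
  intros Hth Hr H. induction K as [|K IH]; intros j Hj; [lia|]. cbn [kill].
  rewrite Dn_Esub_0 by (apply (mode_smooth rad th nu), mode_kill; auto).
  destruct (Nat.eq_dec j K) as [-> |Hn].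
  - rewrite Rminus_diag. ring.
  - rewrite IH by lia. ring.
Qed.

Lemma kill_flat rad th nu : 0 < th < PI / 2 -> 0 < rad ->
  exists K0, forall f, mode rad th nu f -> forall M, vanish_order M (kill K0 f).
Proof.
  intros Hth Hr. destruct (flat_step rad th nu Hth Hr) as [K0 H]. exists K0. intros f Hm.
  assert (Hk : mode rad th nu (kill K0 f)) by now apply mode_kill.
  induction M as [|M IH]; intros j Hj; [lia|].
  destruct (Nat.eq_dec j M) as [-> |Hn]; [|apply IH; lia].
  destruct (Nat.le_gt_cases K0 M) as [L|L].
  - apply H; auto.
  - apply (vanish_order_kill rad th nu K0 f Hth Hr Hm). exact L.
Qed.

(** * Division by the multiplier *)

Definition cis (t : R) : C := cexp (0, t).

Lemma cder_cis t : cder cis t (Ci * cis t)%C.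
Proof.
  unfold cis. apply (cder_cexp (fun t => (0, t))). split; simpl; auto_derive; auto.
Qed.

Lemma ccont_cis t : ccont cis t.
Proof. eapply cder_ccont, cder_cis. Qed.

Lemma Cmod_cis t : Cmod (cis t) = 1.
Proof. unfold cis. rewrite Cmod_cexp. simpl. apply exp_0. Qed.

Lemma cis_2PI : cis (2 * PI) = 1%C.
Proof. unfold cis, cexp. apply Ceq; simpl; rewrite exp_0, ?cos_2PI, ?sin_2PI; ring. Qed.

Lemma cis_0 : cis 0 = 1%C.
Proof. unfold cis, cexp. apply Ceq; simpl; rewrite exp_0, ?cos_0, ?sin_0; ring. Qed.

Lemma cder_const_on F a b : a <= b -> (forall x, a <= x <= b -> cder F x 0%C) -> F a = F b.
Proof.
  intros Hab H. pose proof (cint_derive F (fun _ => 0%C) a b Hab H) as E.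
  rewrite cint_zero in E; auto. specialize (E ltac:(intros x _; apply ccont_const)).
  replace (F b) with ((F b - F a) + F a)%C by ring. rewrite <- E. ring.
Qed.

(** The mean of [exp (a z)] over the unit circle is its value at the centre, because its
    derivative in [a] is zero.  This mean value property is the only fact from the theory
    of holomorphic functions that is used. *)
Lemma circle_mean (a : R) : cint (fun t => cexp (RtoC a * cis t)) 0 (2 * PI) = RtoC (2 * PI).
Proof.
  pose proof PI_RGT_0 as PP.
  set (I := fun a : R => cint (fun t => cexp (RtoC a * cis t)) 0 (2 * PI)).
  assert (C2 : forall u t, ccont2 (fun a t => (cis t * cexp (RtoC a * cis t))%C) u t).
  { intros u t. apply ccont2_mult; [apply ccont2_snd_var, ccont_cis|].
    apply ccont2_cexp, ccont2_mult; [|apply ccont2_snd_var, ccont_cis].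
    apply ccont2_RtoC, continuity_2d_pt_id1. }
  assert (D : forall u, cder I u (cint (fun t => (cis t * cexp (RtoC u * cis t))%C) 0 (2 * PI))).
  { intros u. unfold I.
    apply (cder_cint_param (fun a t => cexp (RtoC a * cis t)) (fun a t => (cis t * cexp (RtoC a * cis t))%C)).
    - lra.
    - apply filter_forall. intros v t _. eapply cder_eq.
      + apply (cder_cexp (fun a => (RtoC a * cis t)%C)).
        apply cder_mult; [apply cder_RtoC; apply (is_derive_id (K := R_AbsRing))|apply cder_const].
      + unfold one; simpl. ring.
    - intros t _. apply C2.
    - apply filter_forall. intros v t _. apply ccont_cexp, ccont_mult; [apply ccont_const|apply ccont_cis]. }
  assert (Z : forall u, cint (fun t => (cis t * cexp (RtoC u * cis t))%C) 0 (2 * PI) = 0%C).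
  { intros u. destruct (Req_dec u 0) as [-> |Nu].
    - rewrite (cint_derive (fun t => (- Ci * cis t)%C)).
      + rewrite cis_2PI, cis_0. ring.
      + lra.
      + intros t _. eapply cder_eq; [apply cder_scal, cder_cis|].
        rewrite Cmult_0_l, cexp_0. transitivity (- (Ci * Ci) * cis t)%C; [ring|].
        replace (Ci * Ci)%C with (- (1))%C by (apply Ceq; simpl; ring). ring.
      + intros t _. apply ccont2_ccont_snd with (g := fun a t => (cis t * cexp (RtoC a * cis t))%C), C2.
    - assert (NC : RtoC u <> 0%C) by (intros X; apply RtoC_inj in X; auto).
      assert (NI : Ci <> 0%C) by (intros X; apply (f_equal snd) in X; simpl in X; lra).
      rewrite (cint_derive (fun t => (/ (RtoC u * Ci) * cexp (RtoC u * cis t))%C)).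
      + rewrite cis_2PI, cis_0. ring.
      + lra.
      + intros t _. eapply cder_eq.
        * apply cder_scal. apply (cder_cexp (fun t => (RtoC u * cis t)%C)). apply cder_scal, cder_cis.
        * cbv beta. field. auto.
      + intros t _. apply ccont2_ccont_snd with (g := fun a t => (cis t * cexp (RtoC a * cis t))%C), C2. }
  assert (I0 : I 0 = RtoC (2 * PI)).
  { unfold I. rewrite (cint_ext _ (fun _ => 1%C)).
    - apply Ceq; simpl; rewrite rRInt_const; ring.
    - lra.
    - intros t _. rewrite Cmult_0_l. apply cexp_0. }
  rewrite <- I0. fold (I a).
  destruct (Rle_lt_dec a 0) as [Ha|Ha].
  - apply (cder_const_on I a 0 Ha). intros x _. rewrite <- (Z x). apply D.
  - symmetry. apply (cder_const_on I 0 a); [lra|]. intros x _. rewrite <- (Z x). apply D.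
Qed.

Lemma on_circle_re (la : C) rho t : 0 <= rho -> fst (la + RtoC rho * cis t)%C <= fst la + rho.
Proof.
  intros Hr. pose proof (fst_le_Cmod (RtoC rho * cis t)%C) as H.
  rewrite Cmod_mult, Cmod_R, Cmod_cis, (Rabs_pos_eq rho) in H by lra.
  pose proof (Rle_abs (fst (RtoC rho * cis t)%C)).
  replace (fst (la + RtoC rho * cis t)%C) with (fst la + fst (RtoC rho * cis t)%C) by reflexivity. lra.
Qed.

(** In [la] the integrand is an exponential, so [circle_mean] applies to it. *)
Lemma Phi_mean M o f (la : C) rho : 0 < o -> (0 < M)%nat -> csmooth f -> vanish_order M f ->
  0 <= rho -> fst la + rho + 2 <= INR M ->
  cint (fun t => Phi o f (la + RtoC rho * cis t)) 0 (2 * PI) = (RtoC (2 * PI) * Phi o f la)%C.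
Proof.
  intros Ho HM0 Hf HM Hrho Hla. pose proof PI_RGT_0 as PP.
  set (lt := fun t => (la + RtoC rho * cis t)%C).
  assert (Clt : forall u, ccont lt u).
  { intros u. apply ccont_plus; [apply ccont_const|]. apply ccont_mult; [apply ccont_const|apply ccont_cis]. }
  assert (Blt : forall u, fst (lt u) + 2 <= INR M).
  { intros u. pose proof (on_circle_re la rho u Hrho). unfold lt. lra. }
  unfold Phi. fold (lt 0).
  rewrite <- (cint_swap_order (fun x t => mellin f (lt t) x)); [|lra|lra|].
  - rewrite <- cint_scal; [|lra|].
    + apply cint_ext; [lra|]. intros x Hx.
      rewrite (cint_ext _ (fun t => (mellin f la x * cexp (RtoC (- (rho * ln x)) * cis t))%C)); [|lra|].
      * rewrite cint_scal; [rewrite circle_mean; ring|lra|].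
        intros t _. apply ccont_cexp, ccont_mult; [apply ccont_const|apply ccont_cis].
      * intros t _. unfold mellin, lt.
        replace (- (la + RtoC rho * cis t + 1))%C with (- (la + 1) + - (RtoC rho * cis t))%C by ring.
        rewrite xpow_plus. unfold xpow at 2.
        replace (- (RtoC rho * cis t) * RtoC (ln x))%C with (RtoC (- (rho * ln x)) * cis t)%C; [ring|].
        rewrite RtoC_opp, RtoC_mult. ring.
    + intros x Hx. apply (mellin_ccont M); auto; lra.
  - intros x t Hx _. apply (mellin_ccont2 M); auto. lra.
Qed.

Definition flat (f : R -> C) : Prop := forall M, vanish_order M f.

Lemma ccont_Phi_param o f (la : R -> C) B u : 0 < o -> csmooth f -> flat f ->
  (forall u, ccont la u) -> (forall u, fst (la u) <= B) -> ccont (fun t => Phi o f (la t)) u.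
Proof.
  intros Ho Hf Hfl Cla Bla.
  destruct (nfloor_ex (Rabs B + 3)) as [M [HM1 HM2]]; [pose proof (Rabs_pos B); lra|].
  assert (HM0 : (0 < M)%nat).
  { destruct M; [|lia]. simpl in HM2. pose proof (Rabs_pos B). lra. }
  assert (BM : forall u, fst (la u) + 2 <= INR M).
  { intros v. specialize (Bla v). pose proof (Rle_abs B). lra. }
  unfold Phi.
  apply (ccont_cint_param (fun t x => mellin f (la t) x)); [lra| |].
  - intros x Hx. destruct (mellin_ccont2 M f la x u HM0 Hf (Hfl M) Cla BM (proj1 Hx)) as [A D].
    split; now apply continuity_2d_pt_swap.
  - intros t x Hx. apply (mellin_ccont M); auto. lra.
Qed.

(** Only radii [r >= rad] contribute. *)
Lemma data_mellin_decay rad n th f : 0 < th < PI / 2 -> 0 < rad -> csmooth f -> vanishes rad f ->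
  V_zero rad n th f ->
  exists K, 0 <= K /\ forall (la : C) (N : R), 0 <= N -> Rabs (fst la - N) <= 6 -> 0 <= fst la ->
    Cmod (data_mellin rad n th f la) <= K * exp (- N * ln rad).
Proof.
  intros Hth Hr Hf Hv HV. pose proof (outer_ge rad th Hth Hr) as Ho. set (o := outer rad th) in *.
  destruct (Vt_bounded rad n th f Hth Hr Hf Hv) as [Kv [Kv0 HKv]]. fold o in HKv.
  set (E := exp (8 * Rabs (ln rad))). assert (HE : 0 < E) by apply exp_pos.
  exists (2 * (Kv * E) * (o - rad / 2)).
  assert (KE : 0 <= Kv * E) by (apply Rmult_le_pos; lra).
  split; [apply Rmult_le_pos; lra|].
  intros la N HN Hla Hla0.
  replace (2 * (Kv * E) * (o - rad / 2) * exp (- N * ln rad)) with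
    (2 * (Kv * (E * exp (- N * ln rad))) * (o - rad / 2)) by ring.
  assert (HE2 : 0 < E * exp (- N * ln rad)) by (apply Rmult_lt_0_compat; [auto|apply exp_pos]).
  apply cint_bound; [lra| |].
  - intros x Hx. apply ccont_mult; [apply ccont_Vt; auto; fold o; lra|apply ccont_xpow; lra].
  - intros x Hx. rewrite Cmod_mult.
    destruct (Rlt_le_dec x rad) as [L|L].
    + rewrite HV by lra. rewrite Cmod_0, Rmult_0_l. apply Rmult_le_pos; lra.
    + rewrite Cmod_xpow. apply Rmult_le_compat; [apply Cmod_ge_0|left; apply exp_pos| |].
      * now apply HKv.
      * unfold E. rewrite <- exp_plus. apply exp_le_mono.
        replace (fst (- (la + 2))%C) with (- (fst la + 2)) by (simpl; ring).
        assert (Lx : ln rad <= ln x) by (destruct L as [L| <-]; [left; apply ln_increasing; lra|lra]).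
        apply Rle_trans with (- (fst la + 2) * ln rad); [nra|].
        replace (- (fst la + 2) * ln rad) with (- (fst la - N + 2) * ln rad + - N * ln rad) by ring.
        apply Rplus_le_compat_r. eapply Rle_trans; [apply Rle_abs|]. rewrite Rabs_mult, Rabs_Ropp.
        apply Rmult_le_compat_r; [apply Rabs_pos|].
        eapply Rle_trans; [apply Rabs_triang|]. rewrite (Rabs_pos_eq 2) by lra. lra.
Qed.

Lemma half_odd_not_integer (J : nat) (x : R) (z : Z) : Rabs (x - (2 * INR J - 11 / 2)) <= 1 / 4 -> x <> IZR z.
Proof.
  intros H E. rewrite E in H. rewrite INR_IZR_INZ in H. apply Rabs_le_between in H.
  assert (A : IZR (2 * Z.of_nat J - 6) < IZR z < IZR (2 * Z.of_nat J - 5)).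
  { rewrite !minus_IZR, mult_IZR. lra. }
  destruct A as [A1 A2]. apply lt_IZR in A1, A2. lia.
Qed.

(** The quotient [data_mellin / vmult] is bounded on one of two circles around
    each point of the line, hence so is its mean over that circle. *)
Lemma Phi_decay_one rad th nu : 0 < th < PI / 2 -> 0 < rad ->
  exists K : nat, (3 <= K)%nat /\ forall f, mode rad th nu f -> flat f ->
  exists C0, 0 <= C0 /\ forall (J : nat) (y : R), (K <= J)%nat ->
    let la := (2 * INR J - 11 / 2, y) : C in
    Cmod (Phi (outer rad th) f la) <= C0 * Cmod la * exp (- (2 * INR J - 11 / 2) * ln rad).
Proof.
  intros Hth Hr. destruct (vmult_circle (IZR nu) th Hth) as [r [c1 [K [Hr4 [Hc1 HK]]]]].
  exists (K + 3)%nat. split; [lia|]. intros f Hm Hfl.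
  destruct Hm as [Hf Hv _ HV].
  destruct (data_mellin_decay rad (IZR nu) th f Hth Hr Hf Hv HV) as [Kd [Kd0 HKd]].
  exists (2 * (Kd / c1)). split.
  { apply Rmult_le_pos; [lra|]. apply Rmult_le_pos; [auto|left; now apply Rinv_0_lt_compat]. }
  intros J y HJ la. pose proof PI_RGT_0 as PP.
  pose proof (outer_ge rad th Hth Hr) as Hor. set (o := outer rad th) in *.
  set (N := 2 * INR J - 11 / 2).
  assert (HN : 1 / 2 <= N).
  { assert (H : (3 <= J)%nat) by lia. apply le_INR in H. simpl in H. unfold N. lra. }
  assert (Hla : 0 < Cmod la).
  { eapply Rlt_le_trans; [|apply fst_le_Cmod]. apply Rlt_le_trans with N; [lra|]. apply Rle_abs. }
  set (BB := Kd / c1 * Cmod la * exp (- N * ln rad)).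
  assert (OnC : forall rho, 0 < rho <= 1 / 4 ->
     (forall z, Cmod z = rho -> c1 * / Cmod la <= Cmod (vmult (IZR nu) th J (la + z))) ->
     Cmod (Phi o f la) <= 2 * BB).
  { intros rho Hrho Hlow.
    destruct (nfloor_ex (N + 4)) as [M [HM1 HM2]]; [lra|].
    assert (HM0 : (0 < M)%nat) by (destruct M; [simpl in HM2; lra|lia]).
    assert (Pt : forall t, Cmod (Phi o f (la + RtoC rho * cis t)) <= BB).
    { intros t. set (z := (RtoC rho * cis t)%C).
      assert (Hz : Cmod z = rho) by (unfold z; rewrite Cmod_mult, Cmod_R, Cmod_cis, Rabs_pos_eq; lra).
      assert (Hzr : Rabs (fst z) <= 1 / 4) by (pose proof (fst_le_Cmod z); lra).
      assert (Efst : fst (la + z)%C = N + fst z) by reflexivity.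
      apply Rabs_le_between in Hzr as Hzb.
      assert (ID : (vmult (IZR nu) th J (la + z) * Phi o f (la + z))%C = data_mellin rad (IZR nu) th f (la + z)).
      { destruct (nfloor_ex (N + 4)) as [M' [HM1' HM2']]; [lra|].
        apply (mellin_identity M'); auto.
        - destruct M'; [simpl in HM2'; lra|lia].
        - lia.
        - rewrite Efst. lra.
        - intros q X. apply (f_equal fst) in X. rewrite Efst in X. simpl in X.
          apply (half_odd_not_integer J (N + fst z) q); auto.
          replace (N + fst z - (2 * INR J - 11 / 2)) with (fst z) by (unfold N; ring). exact Hzr.
        - rewrite Efst. unfold N. lra. }
      apply (f_equal Cmod) in ID. rewrite Cmod_mult in ID.
      assert (Dd : Cmod (data_mellin rad (IZR nu) th f (la + z)) <= Kd * exp (- N * ln rad)).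
      { apply HKd; [lra| |rewrite Efst; lra]. rewrite Efst. replace (N + fst z - N) with (fst z) by ring. lra. }
      specialize (Hlow z Hz). pose proof (Cmod_ge_0 (Phi o f (la + z))) as Q.
      assert (c1l : 0 < c1 * / Cmod la) by (apply Rmult_lt_0_compat; [auto|now apply Rinv_0_lt_compat]).
      apply Rmult_le_reg_l with (c1 * / Cmod la); auto.
      apply Rle_trans with (Kd * exp (- N * ln rad)).
      - rewrite <- ID in Dd. eapply Rle_trans; [|exact Dd]. now apply Rmult_le_compat_r.
      - unfold BB. right. field. lra. }
    assert (Mn : cint (fun t => Phi o f (la + RtoC rho * cis t)) 0 (2 * PI) = (RtoC (2 * PI) * Phi o f la)%C).
    { apply (Phi_mean M); auto; [lra|lra|]. change (fst la) with N. lra. }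
    assert (Bd : Cmod (cint (fun t => Phi o f (la + RtoC rho * cis t)) 0 (2 * PI)) <= 2 * BB * (2 * PI - 0)).
    { apply cint_bound; [lra| |auto]. intros t _.
      apply (ccont_Phi_param o f (fun t => (la + RtoC rho * cis t)%C) (N + rho)); auto; [lra| |].
      - intros u. apply ccont_plus; [apply ccont_const|]. apply ccont_mult; [apply ccont_const|apply ccont_cis].
      - intros u. apply on_circle_re. lra. }
    rewrite Mn, Cmod_mult, Cmod_R, Rabs_pos_eq in Bd by lra.
    apply Rmult_le_reg_l with (2 * PI); lra. }
  replace (2 * (Kd / c1) * Cmod la * exp (- N * ln rad)) with (2 * BB) by (unfold BB; ring).
  destruct (HK J y ltac:(lia)) as [L|L].
  - apply (OnC r); auto; lra.
  - apply (OnC (r / 2)); auto; lra.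
Qed.

Lemma flat_Esub k f : csmooth f -> flat f -> flat (Esub k f).
Proof. intros Hf H M. apply vanish_order_Esub; auto. Qed.

Lemma Phi_Eul rad o f (la : C) : 0 < rad -> rad <= o -> csmooth f -> vanishes rad f -> flat f ->
  Phi o (Esub 0 f) la = (la * Phi o f la)%C.
Proof.
  intros Hr Ho Hf Hv Hfl.
  destruct (nfloor_ex (Rabs (fst la) + 3)) as [M [HM1 HM2]]; [pose proof (Rabs_pos (fst la)); lra|].
  rewrite (Phi_Esub M rad); auto.
  - f_equal. ring.
  - destruct M; [|lia]. simpl in HM2. pose proof (Rabs_pos (fst la)). lra.
  - pose proof (Rle_abs (fst la)). lra.
Qed.

(** [Phi_decay_one] for [(x d/dx)^3 f], whose Mellin transform is [la ^ 3] times that of [f];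
    now the integral over the vertical line converges. *)
Lemma Phi_decay rad th nu : 0 < th < PI / 2 -> 0 < rad ->
  exists K : nat, (3 <= K)%nat /\ forall f, mode rad th nu f -> flat f ->
  exists C0, 0 <= C0 /\ forall (J : nat) (y : R), (K <= J)%nat ->
    let la := (2 * INR J - 11 / 2, y) : C in
    Cmod (Phi (outer rad th) f la) * (Cmod la * Cmod la) <= C0 * exp (- (2 * INR J - 11 / 2) * ln rad).
Proof.
  intros Hth Hr. destruct (Phi_decay_one rad th nu Hth Hr) as [K [HK3 HK]].
  exists K. split; auto. intros f Hm Hfl.
  pose proof (outer_ge rad th Hth Hr) as Hor.
  assert (M1 : mode rad th nu (Esub 0 f)) by now apply mode_Esub.
  assert (M2 : mode rad th nu (Esub 0 (Esub 0 f))) by now apply mode_Esub.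
  assert (M3 : mode rad th nu (Esub 0 (Esub 0 (Esub 0 f)))) by now apply mode_Esub.
  assert (F1 : flat (Esub 0 f)) by (apply flat_Esub; auto; apply (mode_smooth _ _ _ _ Hm)).
  assert (F2 : flat (Esub 0 (Esub 0 f))) by (apply flat_Esub; auto; apply (mode_smooth _ _ _ _ M1)).
  assert (F3 : flat (Esub 0 (Esub 0 (Esub 0 f)))) by (apply flat_Esub; auto; apply (mode_smooth _ _ _ _ M2)).
  destruct (HK _ M3 F3) as [C0 [HC0 HC]].
  exists C0. split; auto. intros J y HJ la. specialize (HC J y HJ). cbv zeta in HC. fold la in HC.
  destruct Hm as [S0 V0 _ _]. destruct M1 as [S1 V1 _ _]. destruct M2 as [S2 V2 _ _].
  rewrite !(Phi_Eul rad) in HC by auto. rewrite !Cmod_mult in HC.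
  assert (Hla : 0 < Cmod la).
  { eapply Rlt_le_trans; [|apply fst_le_Cmod]. simpl.
    assert (H : (3 <= J)%nat) by lia. apply le_INR in H. simpl in H.
    eapply Rlt_le_trans; [|apply Rle_abs]. lra. }
  apply Rmult_le_reg_l with (Cmod la); auto. lra.
Qed.

(** * Mellin inversion *)

Lemma ccont_mult_bounded (f : R -> C) (b : R -> R) B x : ccont f x -> f x = 0%C ->
  (forall t, Rabs (b t) <= B) -> ccont (fun t => (f t * RtoC (b t))%C) x.
Proof.
  intros [A1 A2] F0 HB.
  apply ccont_squeeze with (fun t => (Rabs (fst (f t)) + Rabs (snd (f t))) * B).
  - apply filter_forall. intros t. rewrite Cmod_mult, Cmod_R.
    apply Rmult_le_compat; auto; [apply Cmod_ge_0|apply Rabs_pos|apply Cmod_le_sum].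
  - apply rcont_mult; [|apply continuous_const].
    apply rcont_plus; apply continuous_comp; auto; apply continuous_Rabs.
  - rewrite F0. simpl. rewrite !Rabs_R0. ring.
Qed.

Lemma sum_sqr_neq0 e t : 0 < e -> e * e + t * t <> 0.
Proof. intros He. nra. Qed.

(** The Poisson kernel of the upper half plane; it is the cosine transform of
    [exp (- e y)], and [poisson_cut] is the same integral cut off at [Y]. *)
Definition poisson (e t : R) : R := e / (e * e + t * t).

Definition poisson_cut (e Y t : R) : R :=
  (e + exp (- e * Y) * (t * sin (t * Y) - e * cos (t * Y))) / (e * e + t * t).

Lemma poisson_bound e t : 0 < e -> 0 < poisson e t <= / e.
Proof.
  intros He. unfold poisson. assert (HD : 0 < e * e + t * t) by nra. split; [apply Rdiv_lt_0_compat; lra|].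
  apply Rmult_le_reg_r with (e * (e * e + t * t)); [apply Rmult_lt_0_compat; lra|].
  replace (e / (e * e + t * t) * (e * (e * e + t * t))) with (e * e) by (field; lra).
  replace (/ e * (e * (e * e + t * t))) with (e * e + t * t) by (field; lra). nra.
Qed.

Lemma poisson_cut_diff e Y t : 0 < e -> 0 < Y ->
  Rabs (poisson_cut e Y t - poisson e t) <= 2 / (e * e * Y).
Proof.
  intros He HY. unfold poisson_cut, poisson.
  set (D := e * e + t * t). assert (HD : 0 < D) by (unfold D; nra).
  replace (_ - e / D) with (exp (- e * Y) * ((t * sin (t * Y) - e * cos (t * Y)) / D)) by (field; lra).
  rewrite Rabs_mult, (Rabs_pos_eq (exp _)) by (left; apply exp_pos).
  assert (B1 : exp (- e * Y) <= / (e * Y)).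
  { replace (- e * Y) with (- (e * Y)) by ring. rewrite exp_Ropp.
    apply Rinv_le_contravar; [nra|]. pose proof (exp_ineq1_le (e * Y)). lra. }
  assert (B2 : Rabs ((t * sin (t * Y) - e * cos (t * Y)) / D) <= 2 / e).
  { unfold Rdiv at 1. rewrite Rabs_mult, Rabs_inv, (Rabs_pos_eq D) by lra.
    assert (Rabs (t * sin (t * Y) - e * cos (t * Y)) <= Rabs t + e).
    { unfold Rminus. eapply Rle_trans; [apply Rabs_triang|]. rewrite Rabs_Ropp, !Rabs_mult, (Rabs_pos_eq e) by lra.
      assert (Rabs (sin (t * Y)) <= 1) by apply Rabs_le, SIN_bound.
      assert (Rabs (cos (t * Y)) <= 1) by apply Rabs_le, COS_bound.
      pose proof (Rabs_pos t). nra. }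
    apply Rmult_le_reg_r with D; auto. rewrite Rmult_assoc, Rinv_l, Rmult_1_r by lra.
    eapply Rle_trans; [exact H|].
    apply Rmult_le_reg_r with e; auto. replace (2 / e * D * e) with (2 * D) by (field; lra).
    unfold D. pose proof (Rabs_pos t). assert (t * t = Rabs t * Rabs t) by (rewrite <- Rabs_mult, Rabs_pos_eq; nra).
    nra. }
  replace (2 / (e * e * Y)) with (/ (e * Y) * (2 / e)) by (field; lra).
  apply Rmult_le_compat; auto; [left; apply exp_pos|apply Rabs_pos].
Qed.

Lemma poisson_integral e Y t : 0 < e -> 0 <= Y ->
  RInt (fun y => exp (- e * y) * cos (t * y)) 0 Y = poisson_cut e Y t.
Proof.
  intros He HY. apply is_RInt_unique.
  replace (poisson_cut e Y t) with (minus (poisson_cut e Y t) (poisson_cut e 0 t)).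
  2:{ unfold poisson_cut at 2, minus, plus, opp; simpl.
      rewrite !Rmult_0_r, exp_0, sin_0, cos_0. field. nra. }
  apply (is_RInt_derive (V := R_CompleteNormedModule) (fun y => poisson_cut e y t)).
  - intros y _. unfold poisson_cut. auto_derive; auto. field. nra.
  - intros y _. derive_cont.
Qed.

Lemma mellin_split f N y x : mellin f (N, y) x = (mellin f (RtoC N) x * cexp (0, - (y * ln x))%R)%C.
Proof.
  unfold mellin, xpow. rewrite <- Cmult_assoc, <- cexp_plus. do 2 f_equal. apply Ceq; simpl; ring.
Qed.

(** The Mellin transform on the vertical line [Re la = N] is the Fourier transform of
    [f x ^ (- N)] in the variable [ln x].  Instead of inverting it exactly, it suffices to
    integrate it against [exp (- e |y|) x0 ^ (i y)]: this gives the mean of [f x ^ (- N)] for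
    the Poisson kernel of width [e], which concentrates at [x0] as [e] tends to 0. *)
Section Inversion.

Variables (o N x0 B : R) (f : R -> C) (M : nat).
Hypothesis HM : N + 3 < INR M.
Hypothesis Ho : 0 < o.
Hypothesis Hx0 : 0 < x0 < o.
Hypothesis HN : 1 <= N.
Hypothesis Hf : csmooth f.
Hypothesis Hfl : flat f.
Hypothesis HB : forall y, Cmod (Phi o f (N, y)) * (Cmod (N, y) * Cmod (N, y)) <= B.

Let l0 : R := ln x0.
Let HM0 : (0 < M)%nat.
Proof. pose proof HM. destruct M; [simpl in *; lra|lia]. Qed.

Let f0 : f 0 = 0%C.
Proof. apply (Hfl 1%nat 0%nat). lia. Qed.

Let Cmel x : 0 <= x -> ccont (mellin f (RtoC N)) x.
Proof. intros Hx. apply (mellin_ccont M); auto. simpl. pose proof HM. lra. Qed.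

Let mel0 : mellin f (RtoC N) 0 = 0%C.
Proof. unfold mellin. rewrite f0. ring. Qed.

Let Cker (b : R -> R) K x : (forall t, Rabs (b t) <= K) -> (0 < x -> continuous b x) -> 0 <= x ->
  ccont (fun t => (mellin f (RtoC N) t * RtoC (b t))%C) x.
Proof.
  intros Hb Cb [Hx|Hx].
  - apply ccont_mult; [apply Cmel; lra|apply ccont_RtoC; auto].
  - subst x. apply ccont_mult_bounded with K; auto. apply Cmel; lra.
Qed.

Let B0 : 0 <= B.
Proof. eapply Rle_trans; [|apply (HB 0)]. apply Rmult_le_pos; [|apply Rmult_le_pos]; apply Cmod_ge_0. Qed.

Let PhiB y : Cmod (Phi o f (N, y)) <= B * / (1 + y * y).
Proof.
  specialize (HB y).
  assert (E : 1 + y * y <= Cmod (N, y) * Cmod (N, y)).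
  { replace (Cmod (N, y) * Cmod (N, y)) with (Cmod (N, y) ^ 2) by ring.
    rewrite Cmod2_alt. simpl. nra. }
  pose proof (Cmod_ge_0 (Phi o f (N, y))).
  apply Rmult_le_reg_r with (1 + y * y); [nra|]. rewrite Rmult_assoc, Rinv_l by nra. nra.
Qed.

Let pk (e x : R) : R := 2 * poisson e (l0 - ln x).

Let Cpk e x : 0 < e -> 0 < x -> continuous (pk e) x.
Proof.
  intros He Hx. unfold pk, poisson. apply (ex_derive_continuous (V := R_NormedModule)).
  auto_derive. repeat split; auto. now apply sum_sqr_neq0.
Qed.

Let pk_bound e t : 0 < e -> Rabs (pk e t) <= 2 * / e.
Proof.
  intros He. unfold pk. destruct (poisson_bound e (l0 - ln t) He). rewrite Rabs_pos_eq; lra.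
Qed.

Lemma poisson_mellin_cut e Y : 0 < e -> 0 < Y ->
  Cmod (cint (fun x => (mellin f (RtoC N) x * RtoC (2 * poisson_cut e Y (l0 - ln x)))%C) 0 o) <= 8 * B.
Proof.
  intros He HY.
  set (S := fun x y : R => (RtoC (exp (- e * y)) *
     (mellin f (N, y) x * cexp (0, y * l0)%R + mellin f (N, (- y)%R) x * cexp (0, - y * l0)%R))%C).
  assert (CL : forall u, ccont (fun y => (N, y) : C) u).
  { intros u. split; simpl; [apply continuous_const|apply continuous_id]. }
  assert (CL' : forall u, ccont (fun y => (N, - y) : C) u).
  { intros u. split; simpl; [apply continuous_const|].
    apply (continuous_opp (V := R_NormedModule) (fun y => y)), continuous_id. }
  assert (BL : forall u : R, fst ((N, u) : C) + 2 <= INR M) by (intros; simpl; pose proof HM; lra).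
  assert (CE : forall u, ccont (fun y => RtoC (exp (- e * y))) u).
  { intros u. apply ccont_RtoC. derive_cont. }
  assert (C0 : forall u, ccont (fun y => cexp (0, y * l0)) u).
  { intros u. apply ccont_cexp. split; simpl; [apply continuous_const|].
    apply rcont_mult; [apply continuous_id|apply continuous_const]. }
  assert (C1 : forall u, ccont (fun y => cexp (0, - y * l0)) u).
  { intros u. apply ccont_cexp. split; simpl; [apply continuous_const|].
    derive_cont. }
  assert (C2 : forall x y, 0 <= x -> ccont2 S x y).
  { intros x y Hx. unfold S. apply ccont2_mult; [apply ccont2_snd_var, CE|].
    apply ccont2_plus; apply ccont2_mult.
    - apply (mellin_ccont2 M f (fun y => (N, y))); auto.
    - apply (ccont2_snd_var (fun y => cexp (0, y * l0))), C0.
    - apply (mellin_ccont2 M f (fun y => (N, - y))); auto.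
    - apply (ccont2_snd_var (fun y => cexp (0, - y * l0))), C1. }
  assert (Eq : cint (fun x => (mellin f (RtoC N) x * RtoC (2 * poisson_cut e Y (l0 - ln x)))%C) 0 o =
     cint (fun x => cint (S x) 0 Y) 0 o).
  { apply cint_ext; [lra|]. intros x Hx.
    rewrite (cint_ext (S x) (fun y => (mellin f (RtoC N) x * RtoC (2 * (exp (- e * y) * cos ((l0 - ln x) * y))))%C));
      [|lra|].
    - rewrite cint_scal; [|lra|].
      + f_equal. apply Ceq; simpl.
        * rewrite rRInt_scal, poisson_integral; auto; [lra|].
          apply (ex_RInt_continuous (V := R_CompleteNormedModule)). intros y _.
          derive_cont.
        * rewrite rRInt_const. ring.
      + intros y _. apply ccont_RtoC. derive_cont.
    - intros y _. unfold S. rewrite (mellin_split f N y), (mellin_split f N (- y)).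
      set (m := mellin f (RtoC N) x).
      transitivity (m * (RtoC (exp (- e * y)) *
         (cexp (0, - (y * ln x))%R * cexp (0, y * l0)%R + cexp (0, - (- y * ln x))%R * cexp (0, - y * l0)%R)))%C; [ring|].
      f_equal. rewrite <- !cexp_plus. unfold cexp. apply Ceq; simpl.
      + replace (- (- y * ln x) + - y * l0) with (- ((l0 - ln x) * y)) by ring.
        replace (- (y * ln x) + y * l0) with ((l0 - ln x) * y) by ring.
        rewrite cos_neg, sin_neg, Rplus_0_r, exp_0. ring.
      + replace (- (- y * ln x) + - y * l0) with (- ((l0 - ln x) * y)) by ring.
        replace (- (y * ln x) + y * l0) with ((l0 - ln x) * y) by ring.
        rewrite cos_neg, sin_neg, Rplus_0_r, exp_0. ring. }
  rewrite Eq, (cint_swap_order S); [|lra|lra|intros; apply C2; lra].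
  assert (CP : forall (s : R -> R) u, (forall u, ccont (fun y => (N, s y) : C) u) ->
     ccont (fun y => Phi o f (N, s y)) u).
  { intros s u Hs. apply (ccont_Phi_param o f (fun y => (N, s y)) N); auto. intros; simpl; lra. }
  assert (Eq2 : cint (fun y => cint (fun x => S x y) 0 o) 0 Y =
     cint (fun y => (RtoC (exp (- e * y)) *
       (Phi o f (N, y) * cexp (0, y * l0)%R + Phi o f (N, (- y)%R) * cexp (0, - y * l0)%R))%C) 0 Y).
  { apply cint_ext; [lra|]. intros y _. unfold S, Phi.
    assert (D1 : ccont_on (mellin f (N, y)) 0 o) by (intros x Hx; apply (mellin_ccont M); auto; lra).
    assert (D2 : ccont_on (mellin f (N, (- y)%R)) 0 o) by (intros x Hx; apply (mellin_ccont M); auto; lra).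
    assert (D1' : ccont_on (fun x => (cexp (0, y * l0)%R * mellin f (N, y) x)%C) 0 o)
      by (intros x Hx; apply ccont_mult; [apply ccont_const|now apply D1]).
    assert (D2' : ccont_on (fun x => (cexp (0, - y * l0)%R * mellin f (N, (- y)%R) x)%C) 0 o)
      by (intros x Hx; apply ccont_mult; [apply ccont_const|now apply D2]).
    rewrite (cint_ext _ (fun x => (RtoC (exp (- e * y)) * (cexp (0, y * l0)%R * mellin f (N, y) x +
        cexp (0, - y * l0)%R * mellin f (N, (- y)%R) x))%C)); [|lra|intros x _; ring].
    rewrite cint_scal, cint_plus, !cint_scal; auto; try lra.
    - ring.
    - intros x Hx. apply ccont_plus; [now apply D1'|now apply D2']. }
  rewrite Eq2.
  assert (Iex : forall u, continuous (fun y => / (1 + y * y)) u).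
  { intros u. apply (ex_derive_continuous (V := R_NormedModule)). auto_derive. nra. }
  eapply Rle_trans; [apply (cint_dominated _ (fun y => 2 * B * / (1 + y * y)))|].
  - lra.
  - intros y _. apply ccont_mult; [apply CE|]. apply ccont_plus; apply ccont_mult.
    + apply (CP (fun y => y)). apply CL.
    + apply C0.
    + apply (CP (fun y => - y)). apply CL'.
    + apply C1.
  - apply (ex_RInt_continuous (V := R_CompleteNormedModule)). intros y _.
    apply rcont_mult; [apply continuous_const|apply Iex].
  - intros y Hy. rewrite Cmod_mult, Cmod_R, Rabs_pos_eq by (left; apply exp_pos).
    assert (E1 : exp (- e * y) <= 1) by (apply exp_le_1; nra).
    assert (E2 : Cmod (Phi o f (N, y) * cexp (0, y * l0)%R + Phi o f (N, (- y)%R) * cexp (0, - y * l0)%R)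
                 <= 2 * B * / (1 + y * y)).
    { eapply Rle_trans; [apply Cmod_triangle|]. rewrite !Cmod_mult, !Cmod_cexp. simpl. rewrite exp_0.
      pose proof (PhiB y). pose proof (PhiB (- y)) as P2. replace (- y * - y) with (y * y) in P2 by ring. lra. }
    pose proof (exp_pos (- e * y)).
    match goal with |- ?a * ?b <= _ => assert (0 <= b) by apply Cmod_ge_0 end. nra.
  - rewrite rRInt_scal.
    + assert (A : RInt (fun y => / (1 + y * y)) 0 Y = atan Y).
      { apply is_RInt_unique. replace (atan Y) with (minus (atan Y) (atan 0)).
        2:{ unfold minus, plus, opp; simpl. rewrite atan_0. ring. }
        apply (is_RInt_derive (V := R_CompleteNormedModule) atan); intros y _; [|apply Iex].
        evar_last; [apply is_derive_Reals, derivable_pt_lim_atan|]. unfold Rsqr. field. nra. }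
      rewrite A. pose proof (atan_bound Y). pose proof PI_4. nra.
    + apply (ex_RInt_continuous (V := R_CompleteNormedModule)). intros y _. apply Iex.
Qed.

Lemma poisson_mellin e : 0 < e ->
  Cmod (cint (fun x => (mellin f (RtoC N) x * RtoC (pk e x))%C) 0 o) <= 8 * B.
Proof.
  intros He.
  assert (Hb : fst (RtoC N) + 2 <= INR M) by (simpl; pose proof HM; lra).
  destruct (mellin_bound M f o (RtoC N) Ho HM0 Hf (Hfl M) Hb) as [K [K0 HK]].
  set (A := cint (fun x => (mellin f (RtoC N) x * RtoC (pk e x))%C) 0 o).
  set (c := 2 * (K * o * (4 / (e * e))) * o).
  assert (c0 : 0 <= c).
  { unfold c. assert (0 <= K * o) by nra. assert (0 < 4 / (e * e)) by (apply Rdiv_lt_0_compat; nra).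
    apply Rmult_le_pos; [|lra]. assert (0 <= K * o * (4 / (e * e))) by (apply Rmult_le_pos; lra). lra. }
  assert (Bd : forall Y, 0 < Y -> Cmod A <= 8 * B + c * / Y).
  { intros Y HY.
    assert (Dc : forall t, Rabs (2 * poisson_cut e Y (l0 - ln t)) <= 2 * / e + 2 * (2 / (e * e * Y))).
    { intros t. pose proof (poisson_cut_diff e Y (l0 - ln t) He HY) as D. pose proof (pk_bound e t He) as P.
      unfold pk in P.
      replace (2 * poisson_cut e Y (l0 - ln t)) with
        (2 * poisson e (l0 - ln t) + 2 * (poisson_cut e Y (l0 - ln t) - poisson e (l0 - ln t))) by ring.
      eapply Rle_trans; [apply Rabs_triang|]. rewrite (Rabs_mult 2 (_ - _)), (Rabs_pos_eq 2) by lra. lra. }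
    assert (Cc : ccont_on (fun x => (mellin f (RtoC N) x * RtoC (2 * poisson_cut e Y (l0 - ln x)))%C) 0 o).
    { intros x Hx. eapply Cker; [exact Dc| |lra]. intros Hxp.
      unfold poisson_cut. apply (ex_derive_continuous (V := R_NormedModule)). auto_derive. repeat split; auto; now apply sum_sqr_neq0. }
    assert (Cp : ccont_on (fun x => (mellin f (RtoC N) x * RtoC (pk e x))%C) 0 o).
    { intros x Hx. eapply Cker; [intros t; now apply pk_bound| |lra]. intros; now apply Cpk. }
    assert (E : A = (cint (fun x => (mellin f (RtoC N) x * RtoC (2 * poisson_cut e Y (l0 - ln x)))%C) 0 o -
       cint (fun x => (mellin f (RtoC N) x * RtoC (2 * poisson_cut e Y (l0 - ln x)) - mellin f (RtoC N) x * RtoC (pk e x))%C) 0 o)%C).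
    { rewrite cint_minus; auto; [|lra]. fold A. ring. }
    rewrite E. eapply Rle_trans; [apply Cmod_sub_le|]. apply Rplus_le_compat; [now apply poisson_mellin_cut|].
    eapply Rle_trans; [apply (cint_bound _ (K * o * (4 / (e * e)) * / Y))|].
    - lra.
    - intros x Hx. apply ccont_minus; [now apply Cc|now apply Cp].
    - intros x Hx.
      replace (mellin f (RtoC N) x * RtoC (2 * poisson_cut e Y (l0 - ln x)) - mellin f (RtoC N) x * RtoC (pk e x))%C
        with (mellin f (RtoC N) x * RtoC (2 * (poisson_cut e Y (l0 - ln x) - poisson e (l0 - ln x))))%C.
      2:{ unfold pk. rewrite !RtoC_mult, RtoC_minus. ring. }
      rewrite Cmod_mult, Cmod_R, Rabs_mult, (Rabs_pos_eq 2) by lra.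
      replace (K * o * (4 / (e * e)) * / Y) with (K * o * (2 * (2 / (e * e * Y)))) by (field; lra).
      apply Rmult_le_compat; [apply Cmod_ge_0| | |].
      + pose proof (Rabs_pos (poisson_cut e Y (l0 - ln x) - poisson e (l0 - ln x))). lra.
      + eapply Rle_trans; [apply HK; lra|]. apply Rmult_le_compat_l; lra.
      + apply Rmult_le_compat_l; [lra|]. now apply poisson_cut_diff.
    - unfold c. right. ring. }
  apply Rnot_lt_le. intros Nn.
  set (g := Cmod A - 8 * B). assert (Hg : 0 < g) by (unfold g; lra).
  assert (HY : 0 < 2 * (c + 1) / g) by (apply Rdiv_lt_0_compat; lra).
  specialize (Bd _ HY).
  replace (c * / (2 * (c + 1) / g)) with (g * (c / (2 * (c + 1)))) in Bd by (field; lra).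
  assert (c / (2 * (c + 1)) <= 1 / 2).
  { apply Rmult_le_reg_r with (2 * (c + 1)); [lra|]. unfold Rdiv at 1. rewrite Rmult_assoc, Rinv_l by lra. lra. }
  unfold g in *. nra.
Qed.

(** Split the range at [x0 - d] and [x0 + d]: outside, the kernel is [O(e)]; inside,
    [f x ^ (- N)] is nearly constant and the mass of the kernel is at least 3. *)
Lemma inversion_bound : Cmod (f x0) * exp (- N * l0) <= 3 * B.
Proof.
  set (G := fun x => (f x * xpow (- RtoC N) x)%C).
  assert (Hb : fst (RtoC N) + 2 <= INR M) by (simpl; pose proof HM; lra).
  destruct (mellin_bound M f o (RtoC N) Ho HM0 Hf (Hfl M) Hb) as [K [K0 HK]].
  set (Km := K * o). assert (Km0 : 0 <= Km) by (unfold Km; nra).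
  assert (EG : Cmod (f x0) * exp (- N * l0) = Cmod (G x0)).
  { unfold G. rewrite Cmod_mult, Cmod_xpow. simpl. reflexivity. }
  rewrite EG. apply Rnot_lt_le. intros Nn.
  set (gap := Cmod (G x0) - 3 * B). assert (Hgap : 0 < gap) by (unfold gap; lra).
  assert (CG : ccont G x0).
  { apply ccont_mult; [now apply csmooth_ccont|apply ccont_xpow; lra]. }
  destruct CG as [CG1 CG2].
  apply continuity_pt_filterlim in CG1, CG2.
  set (eta := gap / 32). assert (Heta : 0 < eta) by (unfold eta; lra).
  destruct (CG1 (eta / 2) ltac:(lra)) as [d1 [Hd1 HG1]].
  destruct (CG2 (eta / 2) ltac:(lra)) as [d2 [Hd2 HG2]].
  set (d := Rmin (Rmin d1 d2) (Rmin x0 (o - x0)) / 2).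
  assert (Hd : 0 < d /\ d < d1 /\ d < d2 /\ d < x0 /\ d < o - x0).
  { assert (0 < Rmin (Rmin d1 d2) (Rmin x0 (o - x0))) by (repeat apply Rmin_glb_lt; lra).
    pose proof (Rmin_l (Rmin d1 d2) (Rmin x0 (o - x0))). pose proof (Rmin_r (Rmin d1 d2) (Rmin x0 (o - x0))).
    pose proof (Rmin_l d1 d2). pose proof (Rmin_r d1 d2).
    pose proof (Rmin_l x0 (o - x0)). pose proof (Rmin_r x0 (o - x0)). unfold d. repeat split; lra. }
  destruct Hd as [D0 [D1 [D2 [D3 D4]]]].
  assert (NG : forall x, x0 - d <= x <= x0 + d -> Cmod (G x - G x0) <= eta).
  { intros x Hx. destruct (Req_dec x0 x) as [E|E].
    - rewrite <- E. unfold Cminus. rewrite Cplus_opp_r, Cmod_0. lra.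
    - assert (Rabs (x - x0) <= d) by (apply Rabs_le; lra).
      assert (A1 : Rabs (fst (G x) - fst (G x0)) < eta / 2).
      { apply (HG1 x). split; [split; [exact I|exact E]|]. simpl. unfold R_dist. lra. }
      assert (A2 : Rabs (snd (G x) - snd (G x0)) < eta / 2).
      { apply (HG2 x). split; [split; [exact I|exact E]|]. simpl. unfold R_dist. lra. }
      eapply Rle_trans; [apply Cmod_le_sum|]. change (Rabs (fst (G x) - fst (G x0)) + Rabs (snd (G x) - snd (G x0)) <= eta). lra. }
  set (a := x0 - d) in *. set (b := x0 + d) in *.
  set (La := l0 - ln a). set (Lb := ln b - l0).
  assert (HLa : 0 < La) by (unfold La, l0, a; assert (ln (x0 - d) < ln x0) by (apply ln_increasing; lra); lra).
  assert (HLb : 0 < Lb) by (unfold Lb, l0, b; assert (ln x0 < ln (x0 + d)) by (apply ln_increasing; lra); lra).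
  set (L := Rmin La Lb). assert (HL : 0 < L) by (apply Rmin_glb_lt; lra).
  assert (L1 : L <= La) by apply Rmin_l. assert (L2 : L <= Lb) by apply Rmin_r.
  set (Cc := 8 * Km * o / (L * L)).
  assert (HCc : 0 <= Cc).
  { unfold Cc. apply Rmult_le_pos; [nra|]. left. apply Rinv_0_lt_compat. nra. }
  set (e := Rmin L (gap / (2 * (Cc + 1)))).
  assert (He : 0 < e) by (apply Rmin_glb_lt; [lra|apply Rdiv_lt_0_compat; lra]).
  assert (He1 : e <= L) by apply Rmin_l.
  assert (He2 : Cc * e <= gap / 2).
  { apply Rle_trans with ((Cc + 1) * (gap / (2 * (Cc + 1)))).
    - apply Rmult_le_compat; try lra. apply Rmin_r.
    - right. field. lra. }
  assert (PM := poisson_mellin e He).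
  set (h := fun x => (mellin f (RtoC N) x * RtoC (pk e x))%C) in *.
  assert (Ch : ccont_on h 0 o).
  { intros x Hx. eapply Cker; [intros t; now apply pk_bound| |lra]. intros; now apply Cpk. }
  assert (Sub : forall u v, 0 <= u -> v <= o -> ccont_on h u v) by (intros u v Hu Hv x Hx; apply Ch; lra).
  assert (Spl : cint h 0 o = (cint h 0 a + (cint h a b + cint h b o))%C).
  { rewrite (cint_Chasles h a b o) by (unfold a, b in *; try lra; apply Sub; unfold a, b in *; lra).
    rewrite (cint_Chasles h 0 a o) by (unfold a, b in *; try lra; apply Sub; unfold a, b in *; lra). reflexivity. }
  (* away from [x0] the kernel is small *)
  assert (Far : forall u v, 0 <= u -> u <= v -> v <= o -> (forall x, u <= x <= v -> 0 < x -> L <= Rabs (l0 - ln x)) ->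
     Cmod (cint h u v) <= Cc / 2 * e).
  { intros u v Hu Huv Hv Hfar.
    eapply Rle_trans; [apply (cint_bound _ (Km * (2 * (e / (L * L)))))|].
    - lra.
    - apply Sub; lra.
    - intros x Hx. assert (HeL : 0 < e / (L * L)) by (apply Rdiv_lt_0_compat; nra).
      destruct (Rle_lt_dec x 0) as [Z|Z].
      + assert (x = 0) by lra. subst x. unfold h. rewrite mel0, Cmult_0_l, Cmod_0.
        apply Rmult_le_pos; lra.
      + unfold h. rewrite Cmod_mult, Cmod_R. apply Rmult_le_compat; [apply Cmod_ge_0|apply Rabs_pos| |].
        * eapply Rle_trans; [apply HK; lra|]. unfold Km. apply Rmult_le_compat_l; lra.
        * unfold pk. destruct (poisson_bound e (l0 - ln x) He). rewrite Rabs_pos_eq by lra.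
          apply Rmult_le_compat_l; [lra|]. unfold poisson, Rdiv. apply Rmult_le_compat_l; [lra|].
          apply Rinv_le_contravar; [apply Rmult_lt_0_compat; lra|]. specialize (Hfar x Hx Z).
          assert (T2 : L * L <= (l0 - ln x) * (l0 - ln x)).
          { replace ((l0 - ln x) * (l0 - ln x)) with (Rabs (l0 - ln x) * Rabs (l0 - ln x)).
            - apply Rmult_le_compat; lra.
            - rewrite <- Rabs_mult. apply Rabs_pos_eq, Rle_0_sqr. }
          assert (0 < e * e) by (apply Rmult_lt_0_compat; lra). lra.
    - unfold Cc. replace (8 * Km * o / (L * L) / 2 * e) with (2 * (Km * (2 * (e / (L * L)))) * o) by (field; lra).
      apply Rmult_le_compat_l; [|lra].
      assert (HeL : 0 < e / (L * L)) by (apply Rdiv_lt_0_compat; nra).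
      assert (0 <= Km * (2 * (e / (L * L)))) by (apply Rmult_le_pos; lra). lra. }
  assert (F1 : Cmod (cint h 0 a) <= Cc / 2 * e).
  { apply Far; try (unfold a; lra). intros x Hx Hxp.
    assert (ln x <= ln a).
    { destruct (proj2 Hx) as [T|T]; [left; apply ln_increasing; lra|rewrite T; lra]. }
    assert (La = l0 - ln a) by reflexivity. rewrite Rabs_pos_eq; lra. }
  assert (F2 : Cmod (cint h b o) <= Cc / 2 * e).
  { apply Far; try (unfold b; lra). intros x Hx Hxp.
    assert (ln b <= ln x).
    { destruct (proj1 Hx) as [T|T]; [left; apply ln_increasing; [unfold b|]; lra|rewrite T; lra]. }
    assert (Lb = ln b - l0) by reflexivity. rewrite Rabs_left1; lra. }
  (* near [x0] the kernel has mass bounded below *)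
  set (w := fun x => pk e x * / x).
  assert (Cw : forall x, 0 < x -> continuous w x).
  { intros x Hx. apply rcont_mult; [now apply Cpk|].
    apply (ex_derive_continuous (V := R_NormedModule)). auto_derive. lra. }
  set (A := RInt w a b).
  assert (EA : A = 2 * (atan (Lb / e) + atan (La / e))).
  { unfold A. apply is_RInt_unique.
    replace (2 * (atan (Lb / e) + atan (La / e))) with
      (minus (2 * atan ((ln b - l0) / e)) (2 * atan ((ln a - l0) / e))).
    2:{ unfold minus, plus, opp; simpl. fold Lb.
        replace ((ln a - l0) / e) with (- (La / e)) by (unfold La; field; lra). rewrite atan_opp. ring. }
    apply (is_RInt_derive (V := R_CompleteNormedModule) (fun x => 2 * atan ((ln x - l0) / e))).
    - intros x. rewrite Rmin_left, Rmax_right by (unfold a, b; lra). intros Hx.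
      assert (0 < x) by (unfold a in Hx; lra).
      unfold w, pk, poisson. auto_derive; [auto|]. field. repeat split; try lra; try (now apply sum_sqr_neq0).
    - intros x. rewrite Rmin_left, Rmax_right by (unfold a, b; lra). intros Hx. apply Cw. unfold a in Hx; lra. }
  assert (AtB : forall l, e <= l -> PI / 4 <= atan (l / e)).
  { intros l Hl. rewrite <- atan_1.
    assert (1 <= l / e) by (apply Rmult_le_reg_r with e; [lra|]; unfold Rdiv; rewrite Rmult_assoc, Rinv_l; lra).
    destruct H as [H| <-]; [left; now apply atan_increasing|lra]. }
  pose proof (AtB Lb ltac:(lra)) as T1. pose proof (AtB La ltac:(lra)) as T2.
  pose proof (atan_bound (Lb / e)) as T3. pose proof (atan_bound (La / e)) as T4.
  pose proof PI_4 as P4. pose proof PI2_3_2 as P3.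
  assert (A3 : 3 <= A <= 8) by (rewrite EA; unfold PI2 in *; lra).
  assert (Exw : ex_RInt w a b).
  { apply (ex_RInt_continuous (V := R_CompleteNormedModule)). intros x.
    rewrite Rmin_left, Rmax_right by (unfold a, b; lra). intros Hx. apply Cw. unfold a in Hx; lra. }
  assert (Near : Cmod (cint h a b - G x0 * RtoC A) <= 16 * eta).
  { assert (Cn : ccont_on (fun x => (G x0 * RtoC (w x))%C) a b).
    { intros x Hx. apply ccont_mult; [apply ccont_const|]. apply ccont_RtoC, Cw. unfold a in Hx; lra. }
    assert (Hab : a <= b) by (unfold a, b; lra).
    assert (ER : (G x0 * RtoC A)%C = cint (fun x => (G x0 * RtoC (w x))%C) a b).
    { rewrite cint_scal; auto.
      - f_equal. apply Ceq; simpl; [reflexivity|rewrite rRInt_const; ring].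
      - intros x Hx. apply ccont_RtoC, Cw. unfold a in Hx; lra. }
    rewrite ER, <- cint_minus; auto; [|apply Sub; unfold a, b; lra].
    eapply Rle_trans; [apply (cint_dominated _ (fun x => eta * w x))|].
    - exact Hab.
    - intros x Hx. apply ccont_minus; [apply Ch; unfold a, b in *; lra|now apply Cn].
    - now apply rex_scal.
    - intros x Hx. assert (Xp : 0 < x) by (unfold a in Hx; lra).
      replace (h x - G x0 * RtoC (w x))%C with ((G x - G x0) * RtoC (w x))%C.
      + rewrite Cmod_mult, Cmod_R.
        assert (W0 : 0 <= w x).
        { unfold w, pk. destruct (poisson_bound e (l0 - ln x) He).
          apply Rmult_le_pos; [lra|left; now apply Rinv_0_lt_compat]. }
        rewrite Rabs_pos_eq by auto. apply Rmult_le_compat_r; auto.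
      + unfold h, G, w, mellin. rewrite RtoC_mult.
        replace (- RtoC N)%C with (- (RtoC N + 1) + 1)%C by ring. rewrite xpow_plus, xpow_1 by auto.
        assert (RtoC x <> 0%C) by (intros X; apply RtoC_inj in X; lra).
        rewrite RtoC_inv by lra. field. auto.
    - rewrite rRInt_scal by auto. fold A. nra. }
  assert (Fin : Cmod (G x0) * A <= 8 * B + 16 * eta + Cc * e).
  { assert (EE : (G x0 * RtoC A)%C = (cint h 0 o - (cint h 0 a + cint h b o) - (cint h a b - G x0 * RtoC A))%C).
    { rewrite Spl. ring. }
    rewrite <- (Rabs_pos_eq A), <- Cmod_R, <- Cmod_mult, EE by lra.
    eapply Rle_trans; [apply Cmod_sub_le|].
    pose proof (Cmod_sub_le (cint h 0 o) (cint h 0 a + cint h b o)).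
    pose proof (Cmod_triangle (cint h 0 a) (cint h b o)). lra. }
  pose proof (Cmod_ge_0 (G x0)) as G0. pose proof B0 as BB.
  unfold eta in Fin. unfold gap in *. nra.
Qed.

End Inversion.

(** * The angular modes vanish *)

(** The inversion bound on the line [Re la = 2 J - 11/2] reads
    [|f x| <= C (x / rad) ^ (2 J - 11/2)], and [J] is arbitrary. *)
Lemma flat_mode_zero rad th nu f x : 0 < th < PI / 2 -> 0 < rad ->
  mode rad th nu f -> flat f -> 0 < x < rad -> f x = 0%C.
Proof.
  intros Hth Hr Hm Hfl Hx.
  destruct (Phi_decay rad th nu Hth Hr) as [K [HK3 HK]].
  destruct (HK f Hm Hfl) as [C0 [HC0 HJ]].
  pose proof (outer_ge rad th Hth Hr) as Ho.
  set (w := ln rad - ln x).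
  assert (Hw : 0 < w) by (unfold w; assert (ln x < ln rad) by (apply ln_increasing; lra); lra).
  assert (Bd : forall J, (K + 3 <= J)%nat -> Cmod (f x) * (INR J * w) <= 3 * C0).
  { intros J HJK. set (N := 2 * INR J - 11 / 2).
    assert (HJ4 : 6 <= INR J).
    { replace 6 with (INR 6) by (simpl; ring). apply le_INR. lia. }
    assert (I := inversion_bound (outer rad th) N x (C0 * exp (- N * ln rad)) f (2 * J)).
    assert (I1 : Cmod (f x) * exp (- N * ln x) <= 3 * (C0 * exp (- N * ln rad))).
    { apply I; try (unfold N; lra); auto.
      - rewrite mult_INR. simpl (INR 2). unfold N. lra.
      - apply (mode_smooth _ _ _ _ Hm).
      - intros y. apply (HJ J y). lia. }
    assert (E : exp (- N * ln rad) * exp (N * w) = exp (- N * ln x)).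
    { rewrite <- exp_plus. f_equal. unfold w. ring. }
    rewrite <- E in I1. pose proof (exp_pos (- N * ln rad)) as P.
    assert (I2 : Cmod (f x) * exp (N * w) <= 3 * C0).
    { apply Rmult_le_reg_r with (exp (- N * ln rad)); [exact P|]. lra. }
    eapply Rle_trans; [|exact I2]. apply Rmult_le_compat_l; [apply Cmod_ge_0|].
    pose proof (exp_ineq1_le (N * w)).
    assert (INR J * w <= N * w) by (apply Rmult_le_compat_r; unfold N; lra). lra. }
  apply Cmod_eq_0. apply Rle_antisym; [|apply Cmod_ge_0]. apply Rnot_lt_le. intros Hc.
  destruct (nfloor_ex (3 * C0 / (Cmod (f x) * w))) as [m [_ Hm2]].
  { apply Rmult_le_pos; [lra|]. left. apply Rinv_0_lt_compat. now apply Rmult_lt_0_compat. }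
  specialize (Bd (K + 3 + m)%nat ltac:(lia)).
  assert (Hcw : 0 < Cmod (f x) * w) by now apply Rmult_lt_0_compat.
  assert (A : 3 * C0 < (INR m + 1) * (Cmod (f x) * w)).
  { apply Rmult_lt_reg_r with (/ (Cmod (f x) * w)); [now apply Rinv_0_lt_compat|].
    rewrite (Rmult_assoc (INR m + 1)), Rinv_r by lra. unfold Rdiv in Hm2. lra. }
  rewrite !plus_INR in Bd. simpl (INR 3) in Bd. pose proof (pos_INR K).
  assert (0 <= INR K * (Cmod (f x) * w)) by nra. lra.
Qed.

(** [(f x^(-k))' = x^(-k-1) (x f' - k f)], so a solution of the Euler equation
    that vanishes beyond [rad] vanishes on the whole half-line. *)
Lemma Esub_zero rad k f : 0 < rad -> csmooth f -> vanishes rad f ->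
  (forall x, 0 < x -> Esub k f x = 0%C) -> forall x, 0 < x -> f x = 0%C.
Proof.
  intros Hr Hf Hv H x Hx.
  destruct (Rle_lt_dec rad x) as [Hl|Hl]; [apply Hv; rewrite Rabs_pos_eq; lra|].
  set (g := fun t => (f t * xpow (- RtoC k) t)%C).
  assert (Dg : forall t, x <= t <= rad -> cder g t 0%C).
  { intros t Ht. assert (Ht0 : 0 < t) by lra. eapply cder_eq.
    - apply cder_mult; [now apply csmooth_cder|now apply cder_xpow].
    - assert (T : RtoC t <> 0%C) by (intros X; apply RtoC_inj in X; lra).
      rewrite RtoC_inv by lra.
      transitivity (xpow (- RtoC k) t * / RtoC t * Esub k f t)%C.
      + unfold Esub, Eul. field. auto.
      + rewrite H by auto. ring. }
  assert (E := cint_derive g (fun _ => 0%C) x rad ltac:(lra) Dg ltac:(intros ? _; apply ccont_const)).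
  rewrite cint_zero in E by (auto; lra).
  assert (G : (f x * xpow (- RtoC k) x)%C = 0%C).
  { change (g x = 0%C). replace (g x) with (g rad - (g rad - g x))%C by ring.
    rewrite <- E. unfold g. rewrite (Hv rad) by (rewrite Rabs_pos_eq; lra). ring. }
  transitivity (f x * xpow (- RtoC k) x * xpow (RtoC k) x)%C.
  - rewrite <- Cmult_assoc, xpow_opp_inv. ring.
  - rewrite G. ring.
Qed.

Lemma mode_vanishes rad th nu f x : 0 < th < PI / 2 -> 0 < rad ->
  mode rad th nu f -> 0 < x -> f x = 0%C.
Proof.
  intros Hth Hr Hm. destruct (kill_flat rad th nu Hth Hr) as [K0 HK].
  specialize (HK f Hm).
  assert (Z : forall x, 0 < x -> kill K0 f x = 0%C).
  { intros y Hy. assert (Mk := mode_kill rad th nu K0 f Hth Hr Hm).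
    destruct (Rlt_le_dec y rad) as [L|L].
    - now apply (flat_mode_zero rad th nu (kill K0 f)).
    - apply (mode_support _ _ _ _ Mk). rewrite Rabs_pos_eq; lra. }
  clear HK. revert x. induction K0 as [|K IH]; [exact Z|].
  apply IH. intros y Hy. assert (Mk := mode_kill rad th nu K f Hth Hr Hm).
  apply (Esub_zero rad (INR K)); auto; apply Mk.
Qed.

(** * Uniqueness of Fourier coefficients *)

Lemma rex_cont (g : R -> R) a b : (forall x, continuous g x) -> ex_RInt g a b.
Proof. intros H. apply (ex_RInt_continuous (V := R_CompleteNormedModule)). auto. Qed.

Lemma RInt_translate (g : R -> R) a b c : (forall x, continuous g x) ->
  RInt (fun x => g (x + c)) a b = RInt g (a + c) (b + c).
Proof.
  intros Hg.
  assert (E := RInt_comp_lin (V := R_CompleteNormedModule) g 1 c a b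
     (rex_cont g (1 * a + c) (1 * b + c) Hg)).
  rewrite !Rmult_1_l in E. rewrite <- E.
  apply RInt_ext. intros x _. unfold scal; simpl; unfold mult; simpl. rewrite !Rmult_1_l. reflexivity.
Qed.

Lemma RInt_periodic (g : R -> R) T c : (forall x, continuous g x) ->
  (forall x, g (x + T) = g x) -> RInt (fun x => g (x + c)) 0 T = RInt g 0 T.
Proof.
  intros Hg HT. rewrite RInt_translate by auto. rewrite Rplus_0_l.
  assert (E1 := RInt_Chasles (V := R_CompleteNormedModule) g c 0 T (rex_cont g _ _ Hg) (rex_cont g _ _ Hg)).
  assert (E2 := RInt_Chasles (V := R_CompleteNormedModule) g c T (T + c) (rex_cont g _ _ Hg) (rex_cont g _ _ Hg)).
  assert (E3 : RInt g T (T + c) = RInt g 0 c).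
  { rewrite <- (RInt_ext (fun x => g (x + T)) g 0 c) by (intros; apply HT).
    rewrite RInt_translate, Rplus_0_l, (Rplus_comm c) by auto. reflexivity. }
  assert (E4 := opp_RInt_swap (V := R_CompleteNormedModule) g c 0 (rex_cont g _ _ Hg)).
  unfold plus, opp in *; simpl in *. lra.
Qed.

Lemma cint_periodic (g : R -> C) T c : (forall x, ccont g x) ->
  (forall x, g (x + T) = g x) -> cint (fun x => g (x + c)) 0 T = cint g 0 T.
Proof.
  intros Hg HT. apply Ceq; simpl.
  - apply (RInt_periodic (fun x => fst (g x))); [apply Hg|intros; now rewrite HT].
  - apply (RInt_periodic (fun x => snd (g x))); [apply Hg|intros; now rewrite HT].
Qed.

(** The weights [((1 - cos b) / 2) ^ k] concentrate at [b = PI]: relative to their size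
    near [PI] they are exponentially small elsewhere.  If [p PI] were positive, the
    integral would be positive for large [k]. *)
Lemma peak_nonpos (p : R -> R) : (forall x, continuous p x) ->
  (forall k, RInt (fun b => p b * ((1 - cos b) / 2) ^ k) 0 (2 * PI) = 0) -> p PI <= 0.
Proof.
  intros Hp Hk. apply Rnot_lt_le. intros Ha. pose proof PI_RGT_0 as PP.
  set (a := p PI) in *.
  destruct (ccont_bounded (fun b => RtoC (p b)) 0 (2 * PI)) as [M [M0 HM]]; [lra|intros; now apply ccont_RtoC|].
  assert (HM' : forall b, 0 <= b <= 2 * PI -> - M <= p b).
  { intros b Hb. specialize (HM b Hb). rewrite Cmod_R in HM. apply Rabs_le_between in HM. lra. }
  assert (Cp := Hp PI). apply continuity_pt_filterlim in Cp.
  destruct (Cp (a / 2) ltac:(lra)) as [d1 [Hd1 Hc]].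
  set (d := Rmin d1 PI / 2).
  assert (Hd : 0 < d /\ d < d1 /\ d < PI).
  { assert (0 < Rmin d1 PI) by (apply Rmin_glb_lt; lra).
    pose proof (Rmin_l d1 PI). pose proof (Rmin_r d1 PI). unfold d. lra. }
  destruct Hd as [D0 [D1 D2]].
  assert (Near : forall b, PI - d <= b <= PI + d -> a / 2 <= p b).
  { intros b Hb. destruct (Req_dec PI b) as [<-|Hn]; [fold a; lra|].
    assert (X : Rabs (p b - p PI) < a / 2).
    { apply Hc. split; [split; [exact I|exact Hn]|]. simpl. unfold R_dist.
      apply Rle_lt_trans with d; [|lra]. apply Rabs_le. lra. }
    apply Rabs_def2 in X. fold a in X. lra. }
  (* the weight at distance [d] and at distance [d / 2] from [PI] *)
  set (q := (1 + cos d) / 2). set (q' := (1 + cos (d / 2)) / 2).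
  assert (Hq : 0 < q < q').
  { unfold q, q'. split.
    - assert (cos PI < cos d) by (apply cos_decreasing_1; lra). rewrite cos_PI in H. lra.
    - assert (cos d < cos (d / 2)) by (apply cos_decreasing_1; lra). lra. }
  assert (T0 : forall b, 0 <= (1 - cos b) / 2) by (intros b; pose proof (COS_bound b); lra).
  assert (E1 : forall x, cos (PI - x) = - cos x) by (intros; rewrite Rtrigo_facts.cos_pi_minus; reflexivity).
  assert (Tcos : forall b, cos b = - cos (PI - b)) by (intros b; rewrite E1; ring).
  assert (CosAbs : forall x, cos (Rabs x) = cos x).
  { intros x. unfold Rabs. destruct (Rcase_abs x); [apply cos_neg|reflexivity]. }
  assert (Tfar : forall b, 0 <= b <= 2 * PI -> d <= Rabs (PI - b) -> (1 - cos b) / 2 <= q).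
  { intros b Hb Hfar. unfold q. rewrite (Tcos b), <- (CosAbs (PI - b)).
    assert (Rabs (PI - b) <= PI) by (apply Rabs_le; lra).
    assert (cos (Rabs (PI - b)) <= cos d) by (apply cos_decr_1; lra). lra. }
  assert (Tnear : forall b, Rabs (PI - b) <= d / 2 -> q' <= (1 - cos b) / 2).
  { intros b Hb. unfold q'. rewrite (Tcos b), <- (CosAbs (PI - b)). pose proof (Rabs_pos (PI - b)).
    assert (cos (d / 2) <= cos (Rabs (PI - b))) by (apply cos_decr_1; lra). lra. }
  assert (Low : forall k b, 0 <= b <= 2 * PI -> - M * q ^ k <= p b * ((1 - cos b) / 2) ^ k).
  { intros k b Hb. pose proof (pow_le _ k (T0 b)) as P1. pose proof (pow_lt q k ltac:(lra)) as P2.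
    destruct (Rle_lt_dec d (Rabs (PI - b))) as [F|F].
    - assert (((1 - cos b) / 2) ^ k <= q ^ k) by (apply pow_incr; split; auto).
      specialize (HM' b Hb).
      apply Rle_trans with (- M * ((1 - cos b) / 2) ^ k); [nra|]. now apply Rmult_le_compat_r.
    - apply Rabs_def2 in F. assert (a / 2 <= p b) by (apply Near; lra).
      assert (0 <= p b * ((1 - cos b) / 2) ^ k) by (apply Rmult_le_pos; lra). nra. }
  assert (High : forall k b, PI - d / 2 <= b <= PI + d / 2 -> a / 2 * q' ^ k <= p b * ((1 - cos b) / 2) ^ k).
  { intros k b Hb. assert (a / 2 <= p b) by (apply Near; lra).
    apply Rmult_le_compat; try lra; [left; apply pow_lt; lra|].
    apply pow_incr. split; [lra|]. apply Tnear, Rabs_le. lra. }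
  assert (Cw : forall k x, continuous (fun b => p b * ((1 - cos b) / 2) ^ k) x).
  { intros k x. apply rcont_mult; auto. derive_cont. }
  assert (LB : forall k u v c, u <= v -> (forall b, u <= b <= v -> c <= p b * ((1 - cos b) / 2) ^ k) ->
     (v - u) * c <= RInt (fun b => p b * ((1 - cos b) / 2) ^ k) u v).
  { intros k u v c Huv H. rewrite <- (rRInt_const c u v). apply RInt_le; auto.
    - apply rex_cont. intros; apply continuous_const.
    - apply rex_cont, Cw.
    - intros b Hb. apply H. lra. }
  assert (Main : forall k, d * (a / 2) * q' ^ k <= 2 * PI * M * q ^ k).
  { intros k. set (w := fun b => p b * ((1 - cos b) / 2) ^ k).
    assert (S1 := RInt_Chasles (V := R_CompleteNormedModule) w 0 (PI - d / 2) (2 * PI)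
       (rex_cont w _ _ (Cw k)) (rex_cont w _ _ (Cw k))).
    assert (S2 := RInt_Chasles (V := R_CompleteNormedModule) w (PI - d / 2) (PI + d / 2) (2 * PI)
       (rex_cont w _ _ (Cw k)) (rex_cont w _ _ (Cw k))).
    assert (S0 := Hk k). fold w in S0. unfold plus in *; simpl in *.
    assert (L1 := LB k 0 (PI - d / 2) (- M * q ^ k) ltac:(lra) ltac:(intros; apply Low; lra)).
    assert (L2 := LB k (PI - d / 2) (PI + d / 2) (a / 2 * q' ^ k) ltac:(lra) ltac:(intros; apply High; lra)).
    assert (L3 := LB k (PI + d / 2) (2 * PI) (- M * q ^ k) ltac:(lra) ltac:(intros; apply Low; lra)).
    fold w in L1, L2, L3. assert (0 <= M * q ^ k * d).
    { apply Rmult_le_pos; [|lra]. apply Rmult_le_pos; auto. apply pow_le. lra. }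
    rewrite S0 in S1. ring_simplify in L1. ring_simplify in L2. ring_simplify in L3. ring_simplify. lra. }
  set (rho := q' / q).
  assert (Hrho : Rabs rho > 1).
  { unfold rho. rewrite Rabs_pos_eq by (left; apply Rdiv_lt_0_compat; lra).
    apply Rmult_lt_reg_r with q; [lra|]. unfold Rdiv. rewrite Rmult_assoc, Rinv_l; lra. }
  assert (Hda : 0 < d * (a / 2)) by (apply Rmult_lt_0_compat; lra).
  destruct (Pow_x_infinity rho Hrho (2 * PI * M / (d * (a / 2)) + 1)) as [k Hk'].
  specialize (Hk' k (le_n k)). specialize (Main k).
  assert (Hr0 : 0 < rho) by (unfold rho; apply Rdiv_lt_0_compat; lra).
  rewrite Rabs_pos_eq in Hk' by (apply pow_le; lra).
  assert (Eq : q' ^ k = rho ^ k * q ^ k) by (unfold rho; rewrite <- Rpow_mult_distr; f_equal; field; lra).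
  rewrite Eq in Main. pose proof (pow_lt q k ltac:(lra)) as Pq.
  assert (Main' : d * (a / 2) * rho ^ k <= 2 * PI * M).
  { apply Rmult_le_reg_r with (q ^ k); auto. lra. }
  assert (d * (a / 2) * (2 * PI * M / (d * (a / 2)) + 1) <= d * (a / 2) * rho ^ k) by (apply Rmult_le_compat_l; lra).
  replace (d * (a / 2) * (2 * PI * M / (d * (a / 2)) + 1)) with (2 * PI * M + d * (a / 2)) in H by (field; lra).
  lra.
Qed.

Lemma cis_plus s t : cis (s + t) = (cis s * cis t)%C.
Proof. unfold cis. rewrite <- cexp_plus. f_equal. apply Ceq; simpl; ring. Qed.

Lemma cis_eq t : cis t = (cos t, sin t).
Proof. unfold cis, cexp. simpl. now rewrite exp_0, !Rmult_1_l. Qed.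

Lemma cis_period n : cis (IZR n * (2 * PI)) = 1%C.
Proof.
  assert (P : forall m, cis (INR m * (2 * PI)) = 1%C).
  { induction m as [|m IH].
    - simpl INR. rewrite Rmult_0_l. apply cis_0.
    - rewrite S_INR, Rmult_plus_distr_r, Rmult_1_l, cis_plus, IH, cis_2PI. ring. }
  destruct (Z_le_gt_dec 0 n) as [H|H].
  - rewrite <- (Z2Nat.id n), <- INR_IZR_INZ by auto. apply P.
  - assert (E : (cis (IZR n * (2 * PI)) * cis (INR (Z.to_nat (- n)) * (2 * PI)))%C = 1%C).
    { rewrite <- cis_plus, INR_IZR_INZ, Z2Nat.id, opp_IZR by lia.
      replace (_ + _) with 0 by ring. apply cis_0. }
    rewrite P in E. rewrite <- E. ring.
Qed.

(** The product of [(1 - cos b) / 2] with an exponential is a combination of three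
    exponentials; so [phi] is orthogonal to all the weights of [peak_nonpos], centred at
    any point, and both signs of its real and imaginary part are excluded there. *)
Lemma fourier_unique (phi : R -> C) : (forall x, ccont phi x) ->
  (forall x, phi (x + 2 * PI) = phi x) ->
  (forall n : Z, cint (fun b => (phi b * cis (IZR n * b))%C) 0 (2 * PI) = 0%C) ->
  forall b, phi b = 0%C.
Proof.
  intros Hc Hper Hn b0. pose proof PI_RGT_0 as PP.
  set (psi := fun b => phi (b + (b0 - PI))).
  assert (Cpsi : forall x, ccont psi x).
  { intros x. apply (ccont_comp phi (fun b => b + (b0 - PI))); auto. derive_cont. }
  assert (Ccis : forall n x, ccont (fun b => cis (IZR n * b)) x).
  { intros n x. apply (ccont_comp cis (fun b => IZR n * b)); [|apply ccont_cis].
    derive_cont. }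
  assert (Hpsi : forall n : Z, cint (fun b => (psi b * cis (IZR n * b))%C) 0 (2 * PI) = 0%C).
  { intros n. set (g := fun b => (phi b * cis (IZR n * b))%C).
    rewrite (cint_ext _ (fun b => (cis (- (IZR n * (b0 - PI)))%R * g (b + (b0 - PI))%R)%C)); [|lra|].
    - rewrite cint_scal; [|lra|].
      + rewrite (cint_periodic g).
        * unfold g. rewrite Hn. ring.
        * intros x. now apply ccont_mult.
        * intros x. unfold g. rewrite Hper, Rmult_plus_distr_l, cis_plus, cis_period. ring.
      + intros x _. apply (ccont_comp g (fun b => b + (b0 - PI))); [|now apply ccont_mult].
        derive_cont.
    - intros b _. unfold g, psi.
      replace (IZR n * b) with (IZR n * (b + (b0 - PI)) + - (IZR n * (b0 - PI))) by ring.
      rewrite cis_plus. ring. }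
  (* [(1 - cos b) / 2 = 1/2 - e^{ib}/4 - e^{-ib}/4] *)
  assert (Hk : forall k n, cint (fun b => (psi b * RtoC (((1 - cos b) / 2) ^ k) * cis (IZR n * b))%C) 0 (2 * PI) = 0%C).
  { assert (Ck : forall k n x, ccont (fun b => (psi b * RtoC (((1 - cos b) / 2) ^ k) * cis (IZR n * b))%C) x).
    { intros k n x. apply ccont_mult; auto. apply ccont_mult; auto. apply ccont_RtoC.
      derive_cont. }
    induction k as [|k IH]; intros n.
    - rewrite <- (Hpsi n). apply cint_ext; [lra|]. intros b _. simpl. ring.
    - set (G := fun n b => (psi b * RtoC (((1 - cos b) / 2) ^ k) * cis (IZR n * b))%C).
      rewrite (cint_ext _ (fun b => (RtoC (1 / 2) * G n b - RtoC (1 / 4) * G (n + 1)%Z b - RtoC (1 / 4) * G (n - 1)%Z b)%C));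
        [|lra|].
      + assert (CG : forall n u v, ccont_on (G n) u v) by (intros m u v x _; apply Ck).
        assert (CS : forall c n u v, ccont_on (fun b => (RtoC c * G n b)%C) u v)
          by (intros c m u v x _; apply ccont_mult; [apply ccont_const|apply Ck]).
        rewrite !cint_minus, !cint_scal; auto; try lra.
        * unfold G. rewrite !IH. ring.
        * intros x Hx. apply ccont_minus; apply (CS _ _ 0 (2 * PI)); auto.
      + intros b _. unfold G. rewrite plus_IZR, minus_IZR.
        replace ((IZR n + 1) * b) with (IZR n * b + b) by ring.
        replace ((IZR n - 1) * b) with (IZR n * b + - b) by ring.
        rewrite !cis_plus, (cis_eq b), (cis_eq (- b)), cos_neg, sin_neg.
        rewrite <- tech_pow_Rmult.
        transitivity (psi b * RtoC (((1 - cos b) / 2) ^ k) * cis (IZR n * b) * RtoC ((1 - cos b) / 2))%C.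
        * rewrite (RtoC_mult ((1 - cos b) / 2)). ring.
        * set (z := (psi b * RtoC (((1 - cos b) / 2) ^ k) * cis (IZR n * b))%C).
          transitivity (z * (RtoC (1 / 2) - RtoC (1 / 4) * (cos b, sin b) - RtoC (1 / 4) * (cos b, - sin b)%R))%C;
            [|unfold z; ring].
          f_equal. apply Ceq; simpl; field. }
  assert (Peak : forall p : R -> R, (forall x, continuous p x) ->
     (forall k, RInt (fun b => p b * ((1 - cos b) / 2) ^ k) 0 (2 * PI) = 0) -> p PI = 0).
  { intros p Hp H. assert (A := peak_nonpos p Hp H).
    assert (B : - p PI <= 0).
    { apply (peak_nonpos (fun b => - p b)).
      - intros x. apply (continuous_opp (V := R_NormedModule)), Hp.
      - intros k. transitivity (RInt (fun b => - (1) * (p b * ((1 - cos b) / 2) ^ k)) 0 (2 * PI)).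
        { apply RInt_ext. intros b _. simpl. ring. }
        rewrite rRInt_scal, H; [apply Rmult_0_r|]. apply rex_cont. intros x. apply rcont_mult; auto.
        derive_cont. }
    lra. }
  replace b0 with (PI + (b0 - PI)) by ring. change (psi PI = 0%C).
  apply Ceq; simpl.
  - apply (Peak (fun b => fst (psi b))); [apply Cpsi|]. intros k.
    specialize (Hk k 0%Z). apply (f_equal fst) in Hk. simpl in Hk. etransitivity; [|exact Hk].
    apply RInt_ext. intros b _. simpl. rewrite Rmult_0_l, exp_0, cos_0, sin_0. ring.
  - apply (Peak (fun b => snd (psi b))); [apply Cpsi|]. intros k.
    specialize (Hk k 0%Z). apply (f_equal snd) in Hk. simpl in Hk. etransitivity; [|exact Hk].
    apply RInt_ext. intros b _. simpl. rewrite Rmult_0_l, exp_0, cos_0, sin_0. ring.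
Qed.

(** * Angular modes of a smooth function of the plane *)

Lemma continuity_2d_pt_comp2 (G h k : R -> R -> R) x y :
  continuity_2d_pt h x y -> continuity_2d_pt k x y -> continuity_2d_pt G (h x y) (k x y) ->
  continuity_2d_pt (fun u v => G (h u v) (k u v)) x y.
Proof.
  intros Hh Hk HG eps. destruct (HG eps) as [d Hd].
  destruct (Hh d) as [d1 H1]. destruct (Hk d) as [d2 H2].
  assert (Hm : 0 < Rmin d1 d2) by (apply Rmin_glb_lt; apply cond_pos).
  exists (mkposreal _ Hm). simpl. intros u v Hu Hv.
  pose proof (Rmin_l d1 d2). pose proof (Rmin_r d1 d2). apply Hd; [apply H1|apply H2]; lra.
Qed.

Lemma ccont2_comp2 (F : R -> R -> C) (h k : R -> R -> R) x y :
  continuity_2d_pt h x y -> continuity_2d_pt k x y -> ccont2 F (h x y) (k x y) ->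
  ccont2 (fun u v => F (h u v) (k u v)) x y.
Proof.
  intros Hh Hk [A B]. split.
  - now apply (continuity_2d_pt_comp2 (fun u v => fst (F u v))).
  - now apply (continuity_2d_pt_comp2 (fun u v => snd (F u v))).
Qed.

Lemma is_derive_comp_2d (G : R -> R -> R) (h k : R -> R) x lh lk :
  (forall u v, ex_diff_n G 1 u v) -> is_derive h x lh -> is_derive k x lk ->
  is_derive (fun t => G (h t) (k t)) x
    (Derive (fun z => G z (k x)) (h x) * lh + Derive (fun z => G (h x) z) (k x) * lk).
Proof.
  intros HG Hh Hk. apply is_derive_Reals. apply derivable_pt_lim_comp_2d; [|now apply is_derive_Reals..].
  apply filterdiff_differentiable_pt_lim.
  apply (is_derive_filterdiff G (h x) (k x) (fun u v => Derive (fun z => G z v) u)).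
  - apply filter_forall. intros [u v]. simpl. apply Derive_correct. apply (HG u v).
  - apply Derive_correct. apply (HG (h x) (k x)).
  - apply (proj1 (continuity_2d_pt_filterlim (fun u v => Derive (fun z => G z v) u) (h x) (k x))).
    destruct (HG (h x) (k x)) as [_ [_ [_ [[A _] _]]]]. exact A.
Qed.

Definition csmooth2 (F : R -> R -> C) : Prop := forall n x y,
  ex_diff_n (fun u v => fst (F u v)) n x y /\ ex_diff_n (fun u v => snd (F u v)) n x y.

Definition dC1 (F : R -> R -> C) (u v : R) : C := dC (fun z => F z v) u.
Definition dC2 (F : R -> R -> C) (u v : R) : C := dC (fun z => F u z) v.

Lemma csmooth2_ccont2 F x y : csmooth2 F -> ccont2 F x y.
Proof. intros H. destruct (H 0%nat x y) as [[A _] [B _]]. split; auto. Qed.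

Lemma csmooth2_dC1 F : csmooth2 F -> csmooth2 (dC1 F).
Proof. intros H n x y. destruct (H (S n) x y) as [A B]. split; [apply A|apply B]. Qed.

Lemma csmooth2_dC2 F : csmooth2 F -> csmooth2 (dC2 F).
Proof. intros H n x y. destruct (H (S n) x y) as [A B]. split; [apply A|apply B]. Qed.

Lemma cder_ray F a b x : csmooth2 F ->
  cder (fun t => F (t * a) (t * b)) x
    (dC1 F (x * a) (x * b) * RtoC a + dC2 F (x * a) (x * b) * RtoC b)%C.
Proof.
  intros H.
  assert (L : forall c, is_derive (fun t => t * c) x c) by (intros c; auto_derive; auto; ring).
  split; simpl.
  - evar_last; [apply (is_derive_comp_2d (fun u v => fst (F u v)) (fun t => t * a) (fun t => t * b) x a b)|].
    + intros u v. apply (H 1%nat).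
    + apply L.
    + apply L.
    + simpl. ring.
  - evar_last; [apply (is_derive_comp_2d (fun u v => snd (F u v)) (fun t => t * a) (fun t => t * b) x a b)|].
    + intros u v. apply (H 1%nat).
    + apply L.
    + apply L.
    + simpl. ring.
Qed.

Definition angular (F : R -> R -> C) (w : R -> C) (x : R) : C :=
  cint (fun t => (F (x * cos t)%R (x * sin t)%R * w t)%C) 0 (2 * PI).

Lemma rcont_cos x : continuous cos x.
Proof. derive_cont. Qed.

Lemma rcont_sin x : continuous sin x.
Proof. derive_cont. Qed.

Lemma ccont2_polar F x t : csmooth2 F -> ccont2 (fun x t => F (x * cos t)%R (x * sin t)%R) x t.
Proof.
  intros H. apply (ccont2_comp2 F (fun x t => x * cos t) (fun x t => x * sin t)).
  - apply continuity_2d_pt_mult; [apply continuity_2d_pt_id1|].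
    apply (rcont2_comp cos (fun _ t => t)); [apply continuity_2d_pt_id2|apply rcont_cos].
  - apply continuity_2d_pt_mult; [apply continuity_2d_pt_id1|].
    apply (rcont2_comp sin (fun _ t => t)); [apply continuity_2d_pt_id2|apply rcont_sin].
  - now apply csmooth2_ccont2.
Qed.

Lemma ccont2_angular F w x t : csmooth2 F -> (forall t, ccont w t) ->
  ccont2 (fun x t => (F (x * cos t)%R (x * sin t)%R * w t)%C) x t.
Proof. intros H Hw. apply ccont2_mult; [now apply ccont2_polar|]. now apply ccont2_snd_var. Qed.

Lemma cder_angular F w x : csmooth2 F -> (forall t, ccont w t) ->
  cder (angular F w) x (angular (dC1 F) (fun t => (RtoC (cos t) * w t)%C) x +
    angular (dC2 F) (fun t => (RtoC (sin t) * w t)%C) x)%C.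
Proof.
  intros H Hw. pose proof PI_RGT_0 as PP.
  assert (W1 : forall t, ccont (fun t => (RtoC (cos t) * w t)%C) t)
    by (intros t; apply ccont_mult; auto; apply ccont_RtoC, rcont_cos).
  assert (W2 : forall t, ccont (fun t => (RtoC (sin t) * w t)%C) t)
    by (intros t; apply ccont_mult; auto; apply ccont_RtoC, rcont_sin).
  assert (A1 : forall x t, ccont2 (fun x t => (dC1 F (x * cos t)%R (x * sin t)%R * (RtoC (cos t) * w t))%C) x t)
    by (intros; apply (ccont2_angular (dC1 F) (fun t => (RtoC (cos t) * w t)%C)); auto; now apply csmooth2_dC1).
  assert (A2 : forall x t, ccont2 (fun x t => (dC2 F (x * cos t)%R (x * sin t)%R * (RtoC (sin t) * w t))%C) x t)
    by (intros; apply (ccont2_angular (dC2 F) (fun t => (RtoC (sin t) * w t)%C)); auto; now apply csmooth2_dC2).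
  unfold angular. rewrite <- cint_plus; [|lra| |].
  2:{ intros t _. apply (ccont2_ccont_snd _ x t (A1 x t)). }
  2:{ intros t _. apply (ccont2_ccont_snd _ x t (A2 x t)). }
  apply (cder_cint_param (fun x t => (F (x * cos t)%R (x * sin t)%R * w t)%C)
     (fun x t => (dC1 F (x * cos t)%R (x * sin t)%R * (RtoC (cos t) * w t) +
                  dC2 F (x * cos t)%R (x * sin t)%R * (RtoC (sin t) * w t))%C)).
  - lra.
  - apply filter_forall. intros u t _. eapply cder_eq.
    + apply cder_mult; [apply (cder_ray F (cos t) (sin t) u H)|apply cder_const].
    + cbv beta. ring.
  - intros t _. apply ccont2_plus; auto.
  - apply filter_forall. intros u t _.
    apply (ccont2_ccont_snd (fun x t => (F (x * cos t)%R (x * sin t)%R * w t)%C)). now apply ccont2_angular.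
Qed.

(** The derivative is a sum of two functions of the same form, with the weights
    [cos t * w t] and [sin t * w t]. *)
Lemma csmooth_angular F w : csmooth2 F -> (forall t, ccont w t) -> csmooth (angular F w).
Proof.
  intros H Hw k. revert F w H Hw. induction k as [|k IH]; intros F w H Hw.
  - intros x. eapply cder_ccont. now apply cder_angular.
  - split.
    + intros x. eapply cder_dC. now apply cder_angular.
    + apply (Ck_ext k (fun x => (angular (dC1 F) (fun t => (RtoC (cos t) * w t)%C) x +
        angular (dC2 F) (fun t => (RtoC (sin t) * w t)%C) x)%C)).
      * intros x. symmetry. apply dC_eq. now apply cder_angular.
      * apply Ck_plus; apply IH; try now apply csmooth2_dC1.
        -- intros t. apply ccont_mult; auto. apply ccont_RtoC, rcont_cos.
        -- now apply csmooth2_dC2.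
        -- intros t. apply ccont_mult; auto. apply ccont_RtoC, rcont_sin.
Qed.

Definition fmode (n : Z) (F : R -> R -> C) : R -> C := angular F (fun t => cis (- IZR n * t)).

Lemma ccont_cis_scal k t : ccont (fun t => cis (k * t)) t.
Proof.
  apply (ccont_comp cis (fun t => k * t)); [|apply ccont_cis].
  derive_cont.
Qed.

Lemma csmooth_fmode n F : csmooth2 F -> csmooth (fmode n F).
Proof. intros H. apply csmooth_angular; auto. intros t. apply ccont_cis_scal. Qed.

Lemma cis_period_opp n t : cis (- IZR n * (t + 2 * PI)) = cis (- IZR n * t).
Proof. rewrite Rmult_plus_distr_l, cis_plus, <- opp_IZR, cis_period, opp_IZR. ring. Qed.

(** Rotating the circle by [chi] multiplies the [n]-th mode by [e^{i n chi}]. *)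
Lemma fmode_rotate n F x chi : csmooth2 F ->
  cint (fun t => (F (x * cos (t + chi))%R (x * sin (t + chi))%R * cis (- IZR n * t)%R)%C) 0 (2 * PI) =
  (cis (IZR n * chi)%R * fmode n F x)%C.
Proof.
  intros H. pose proof PI_RGT_0 as PP.
  set (g := fun t => (F (x * cos t)%R (x * sin t)%R * cis (- IZR n * t)%R)%C).
  assert (Cg : forall t, ccont g t).
  { intros t. apply (ccont2_ccont_snd (fun x t => (F (x * cos t)%R (x * sin t)%R * cis (- IZR n * t)%R)%C)).
    apply (ccont2_angular F (fun t => cis (- IZR n * t))); auto. intros; apply ccont_cis_scal. }
  unfold fmode, angular. fold g. rewrite <- (cint_periodic g (2 * PI) chi); auto.
  - rewrite <- cint_scal; [|lra|].
    + apply cint_ext; [lra|]. intros t _. unfold g.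
      replace (- IZR n * t) with (- IZR n * (t + chi) + IZR n * chi) by ring. rewrite cis_plus. ring.
    + intros t _. apply (ccont_comp g (fun t => t + chi)); auto.
      derive_cont.
  - intros t. unfold g. rewrite cis_period_opp.
    rewrite (cos_plus t), (sin_plus t), cos_2PI, sin_2PI, !Rmult_1_r, !Rmult_0_r, Rminus_0_r, Rplus_0_r.
    reflexivity.
Qed.

Lemma cis_PI n : cis (IZR n * PI) = if Z.odd n then (- (1))%C else 1%C.
Proof.
  rewrite (Z.div2_odd n) at 1. rewrite plus_IZR, mult_IZR, Rmult_plus_distr_r, cis_plus.
  replace (2 * IZR (Z.div2 n) * PI) with (IZR (Z.div2 n) * (2 * PI)) by ring. rewrite cis_period.
  destruct (Z.odd n); simpl.
  - rewrite Rmult_1_l, cis_eq, cos_PI, sin_PI. apply Ceq; simpl; ring.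
  - rewrite Rmult_0_l, cis_0. ring.
Qed.

Lemma Dn_reflect (f : R -> C) s : csmooth f -> (forall x, f (- x)%R = (s * f x)%C) ->
  forall j x, Dn j f (- x) = ((if Z.odd (Z.of_nat j) then - s else s) * Dn j f x)%C.
Proof.
  intros Hf Hs j. induction j as [|j IH]; intros x; [apply Hs|].
  set (s' := if Z.odd (Z.of_nat j) then (- s)%C else s) in *.
  assert (E : (if Z.odd (Z.of_nat (S j)) then (- s)%C else s) = (- s')%C).
  { unfold s'. rewrite Nat2Z.inj_succ, Z.odd_succ, <- Z.negb_odd. destruct (Z.odd (Z.of_nat j)); simpl; ring. }
  rewrite E.
  assert (S1 : csmooth (Dn j f)) by now apply csmooth_Dn.
  assert (D1 : cder (fun t => Dn j f (- t)) x (RtoC (- (1)) * dC (Dn j f) (- x)%R)%C).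
  { apply (cder_comp (Dn j f) (fun t => - t)); [auto_derive; auto; ring|now apply csmooth_cder]. }
  assert (D2 : cder (fun t => Dn j f (- t)) x (s' * dC (Dn j f) x)%C).
  { apply cder_ext with (fun t => (s' * Dn j f t)%C); [intros; now rewrite IH|].
    apply cder_scal. now apply csmooth_cder. }
  assert (U := cder_unique _ _ _ _ D1 D2). change (Dn (S j) f) with (dC (Dn j f)).
  rewrite RtoC_opp in U. transitivity (- (- RtoC 1 * dC (Dn j f) (- x)%R))%C; [ring|]. rewrite U. ring.
Qed.

(** The rotation by [PI] replaces [x] by [- x] and multiplies the mode by [(-1) ^ n]. *)
Lemma fmode_parity n F : csmooth2 F -> parity_ok n (fmode n F).
Proof.
  intros H j Hj.
  assert (R1 : forall x, fmode n F (- x) = (cis (IZR n * PI)%R * fmode n F x)%C).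
  { intros x. rewrite <- (fmode_rotate n F x PI H). unfold fmode, angular. pose proof PI_RGT_0.
    apply cint_ext; [lra|]. intros t _. rewrite neg_cos, neg_sin. do 2 f_equal; ring. }
  assert (D := Dn_reflect (fmode n F) _ (csmooth_fmode n F H) R1 j 0).
  rewrite Ropp_0, cis_PI in D. rewrite Z.odd_sub in Hj.
  set (d := Dn j (fmode n F) 0) in *.
  assert (E : d = (- d)%C).
  { rewrite D at 1. destruct (Z.odd (Z.of_nat j)), (Z.odd n); try discriminate; ring. }
  apply Ceq; simpl.
  - apply (f_equal fst) in E. simpl in E. lra.
  - apply (f_equal snd) in E. simpl in E. lra.
Qed.

Definition outside_zero (rad : R) (F : R -> R -> C) : Prop :=
  forall u v, rad * rad <= u * u + v * v -> F u v = 0%C.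

Lemma polar_norm x t : x * cos t * (x * cos t) + x * sin t * (x * sin t) = x * x.
Proof. pose proof (sin2_cos2 t) as E. unfold Rsqr in E. transitivity (x * x * (sin t * sin t + cos t * cos t)); [ring|]. rewrite E. ring. Qed.

Lemma fmode_vanishes rad n F : 0 < rad -> outside_zero rad F -> vanishes rad (fmode n F).
Proof.
  intros Hr Hz x Hx. pose proof PI_RGT_0. unfold fmode, angular. apply cint_zero; [lra|].
  intros t _. rewrite Hz; [ring|]. rewrite polar_norm.
  replace (x * x) with (Rabs x * Rabs x) by (rewrite <- Rabs_mult; apply Rabs_pos_eq, Rle_0_sqr).
  apply Rmult_le_compat; lra.
Qed.

(** * From the V-line data to the modes *)

(** The foot of the perpendicular is at distance [r * sin th] from the origin, so this is
    the angle from it at which the branch leaves the disk of radius [rad]. *)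
Definition exit_angle (rad th r : R) : R := acos (r * sin th / rad).

(** From this parameter on the second branch is outside the disk. *)
Definition exit_time (rad th r : R) : R := r * (cos th + sin th * tan (exit_angle rad th r)).

Lemma exit_ratio rad th r : 0 < th < PI / 2 -> 0 < r < rad -> 0 < r * sin th / rad < 1.
Proof.
  intros Hth Hr. destruct (sin_cos_bounds th Hth) as [Hs _]. split.
  - apply Rdiv_lt_0_compat; [apply Rmult_lt_0_compat|]; lra.
  - apply Rmult_lt_reg_r with rad; [lra|]. unfold Rdiv. rewrite Rmult_assoc, Rinv_l by lra. nra.
Qed.

Lemma exit_angle_bounds rad th r : 0 < th < PI / 2 -> 0 < r < rad ->
  0 < exit_angle rad th r < PI / 2 /\ cos (exit_angle rad th r) = r * sin th / rad.
Proof.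
  intros Hth Hr. pose proof (exit_ratio rad th r Hth Hr) as Hq. unfold exit_angle.
  set (q := r * sin th / rad) in *. pose proof PI_RGT_0 as PP.
  assert (E : cos (acos q) = q) by (apply cos_acos; lra).
  destruct (acos_bound q) as [B1 B2].
  split; [|exact E]. split.
  - destruct (Req_dec (acos q) 0) as [Z|Z]; [|lra]. rewrite Z, cos_0 in E. lra.
  - apply Rnot_le_lt. intros H. assert (cos (acos q) <= cos (PI / 2)) by (apply cos_decr_1; lra).
    rewrite cos_PI2 in H0. lra.
Qed.

Lemma exit_norm rad th r t : 0 < th < PI / 2 -> 0 < r < rad -> exit_time rad th r <= t ->
  rad * rad <= (t - r * cos th) * (t - r * cos th) + r * sin th * (r * sin th).
Proof.
  intros Hth Hr Ht. destruct (exit_angle_bounds rad th r Hth Hr) as [Ha Hc].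
  destruct (sin_cos_bounds th Hth) as [Hs _].
  unfold exit_time in Ht. set (a := exit_angle rad th r) in *.
  assert (Ca : 0 < cos a) by (apply cos_gt_0; lra).
  assert (Sa : 0 < sin a) by (apply sin_gt_0; lra).
  assert (E : r * sin th = rad * cos a) by (rewrite Hc; field; lra).
  assert (E2 : r * (sin th * tan a) = rad * sin a).
  { unfold tan. transitivity (r * sin th * (sin a / cos a)); [ring|]. rewrite E. field. lra. }
  rewrite E. assert (rad * sin a <= t - r * cos th) by lra.
  assert (rad * sin a * (rad * sin a) <= (t - r * cos th) * (t - r * cos th)).
  { assert (0 <= rad * sin a) by (apply Rmult_le_pos; lra). apply Rmult_le_compat; lra. }
  pose proof (sin2_cos2 a) as S. unfold Rsqr in S.
  assert (rad * rad = rad * sin a * (rad * sin a) + rad * cos a * (rad * cos a)).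
  { transitivity (rad * rad * (sin a * sin a + cos a * cos a)); [rewrite S|]; ring. }
  lra.
Qed.

Lemma exit_time_pos rad th r : 0 < th < PI / 2 -> 0 < r < rad -> 0 < exit_time rad th r.
Proof.
  intros Hth Hr. destruct (exit_angle_bounds rad th r Hth Hr) as [Ha Hc].
  destruct (sin_cos_bounds th Hth) as [Hs [Hco _]].
  unfold exit_time. assert (0 < tan (exit_angle rad th r)) by (apply tan_gt_0; lra).
  apply Rmult_lt_0_compat; [lra|]. assert (0 < sin th * tan (exit_angle rad th r)) by (apply Rmult_lt_0_compat; lra). lra.
Qed.

Definition branch (th r beta t : R) : R * R :=
  (r * cos beta - t * cos (th + beta), r * sin beta - t * sin (th + beta)).

Lemma branch_norm th r beta t :
  fst (branch th r beta t) * fst (branch th r beta t) + snd (branch th r beta t) * snd (branch th r beta t) =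
  (t - r * cos th) * (t - r * cos th) + r * sin th * (r * sin th).
Proof.
  unfold branch; simpl. rewrite cos_plus, sin_plus.
  set (c := cos th). set (s := sin th). set (cb := cos beta). set (sb := sin beta).
  assert (E : cb * cb + sb * sb = 1) by (unfold cb, sb; pose proof (sin2_cos2 beta) as S; unfold Rsqr in S; lra).
  assert (E' : c * c + s * s = 1) by (unfold c, s; pose proof (sin2_cos2 th) as S; unfold Rsqr in S; lra).
  transitivity ((cb * cb + sb * sb) * (r * r - 2 * r * t * c + t * t * (c * c + s * s))); [ring|].
  rewrite E. transitivity (r * r * (c * c + s * s) - 2 * r * t * c + t * t); [|ring].
  rewrite E'. ring.
Qed.

(** The parameter [- phi] is the angle at the origin between the running point and the
    foot of the perpendicular on the line of the branch. *)
Lemma branch_angle th r beta phi : cos phi <> 0 ->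
  let rho := r * sin th / cos phi in
  branch th r beta (r * (cos th + sin th * tan phi)) =
  (rho * cos (beta + (- phi - psic th)), rho * sin (beta + (- phi - psic th))).
Proof.
  intros Hc rho. unfold branch, rho, tan, psic.
  replace (beta + (- phi - (PI / 2 - th))) with (- (PI / 2 - (beta + th - phi))) by ring.
  rewrite cos_neg, sin_neg, cos_shift, sin_shift.
  assert (E : cos th * cos th + sin th * sin th = 1) by (pose proof (sin2_cos2 th) as S; unfold Rsqr in S; lra).
  f_equal.
  - apply Rmult_eq_reg_r with (cos phi); auto.
    transitivity (r * (cos beta * cos phi * 1 - (cos th * cos phi + sin th * sin phi) * cos (th + beta))); [field; auto|].
    rewrite <- E. transitivity (r * sin th * sin (beta + th - phi)); [|field; auto].
    rewrite cos_plus, sin_minus, sin_plus, cos_plus. ring.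
  - apply Rmult_eq_reg_r with (cos phi); auto.
    transitivity (r * (sin beta * cos phi * 1 - (cos th * cos phi + sin th * sin phi) * sin (th + beta))); [field; auto|].
    rewrite <- E. transitivity (r * sin th * - cos (beta + th - phi)); [|field; auto].
    rewrite sin_plus, cos_minus, sin_plus, cos_plus. ring.
Qed.

Lemma cint_flip (g : R -> C) a b : a <= b -> ccont_on g a b ->
  cint (fun x => g (- x)) (- b) (- a) = cint g a b.
Proof.
  intros Hab Hg. destruct (ccont_on_ex g a b Hab Hg) as [E1 E2].
  assert (K : forall p : R -> R, ex_RInt p a b -> RInt (fun x => p (- x)) (- b) (- a) = RInt p a b).
  { intros p Hp. apply is_RInt_unique.
    assert (H := is_RInt_comp_opp (V := R_NormedModule) p (- b) (- a) (- RInt p a b)).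
    rewrite !Ropp_involutive in H.
    apply is_RInt_ext with (fun x => opp (opp (p (- x)))); [intros; apply opp_opp|].
    replace (RInt p a b) with (opp (- RInt p a b)) by (unfold opp; simpl; ring).
    apply (is_RInt_opp (V := R_NormedModule)). apply H.
    apply (is_RInt_swap (V := R_NormedModule) p b a (RInt p a b)).
    now apply (RInt_correct (V := R_CompleteNormedModule)). }
  apply Ceq; simpl.
  - apply (K (fun x => fst (g x)) E1).
  - apply (K (fun x => snd (g x)) E2).
Qed.

(** The data [L + i T] of the field [F], up to a unimodular factor. *)
Definition vline (rad th : R) (F : R -> R -> C) (beta r : R) : C :=
  (cint (fun x => F (x * cos beta)%R (x * sin beta)%R) r rad +
   cexp (0, - th)%R * cint (fun t => F (fst (branch th r beta t)) (snd (branch th r beta t))) 0 (exit_time rad th r))%C.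

Lemma ccont2_branch F th r beta t : csmooth2 F ->
  ccont2 (fun t beta => F (fst (branch th r beta t)) (snd (branch th r beta t))) t beta.
Proof.
  intros H. unfold branch; simpl.
  assert (Sh : continuity_2d_pt (fun _ v : R => th + v) t beta)
    by (apply continuity_2d_pt_plus; [apply continuity_2d_pt_const|apply continuity_2d_pt_id2]).
  apply (ccont2_comp2 F (fun t beta => r * cos beta - t * cos (th + beta)) (fun t beta => r * sin beta - t * sin (th + beta)));
    [| |now apply csmooth2_ccont2]; apply continuity_2d_pt_minus; apply continuity_2d_pt_mult.
  - apply continuity_2d_pt_const.
  - apply (rcont2_comp cos (fun _ v => v)); [apply continuity_2d_pt_id2|apply rcont_cos].
  - apply continuity_2d_pt_id1.
  - apply (rcont2_comp cos (fun _ v => th + v)); [exact Sh|apply rcont_cos].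
  - apply continuity_2d_pt_const.
  - apply (rcont2_comp sin (fun _ v => v)); [apply continuity_2d_pt_id2|apply rcont_sin].
  - apply continuity_2d_pt_id1.
  - apply (rcont2_comp sin (fun _ v => th + v)); [exact Sh|apply rcont_sin].
Qed.

Lemma vint_exit rad n th f r : 0 < th < PI / 2 -> 0 < r < rad -> csmooth f -> vanishes rad f ->
  vint n th 0 f r = cint (vfun n th 0 f r) (- exit_angle rad th r) (psic th).
Proof.
  intros Hth Hr Hf Hv. destruct (exit_angle_bounds rad th r Hth Hr) as [Ha Hc].
  assert (Hpc : 0 < psic th) by (unfold psic; lra).
  assert (Cv : forall a b, ccont_on (vfun n th 0 f r) a b).
  { intros a b. apply (vfun_ccont_on rad); auto; try lra. intros; now apply csmooth_ccont. }
  unfold vint. rewrite <- (cint_Chasles _ (- (PI / 2)) (- exit_angle rad th r) (psic th)); auto; try lra.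
  rewrite cint_zero; [ring|lra|]. intros psi Hpsi.
  apply (vfun_zero rad); auto; try lra.
  assert (0 < cos psi) by (apply cos_gt_0; lra).
  assert (cos psi <= cos (exit_angle rad th r)).
  { rewrite <- (cos_neg psi). apply cos_decr_1; lra. }
  rewrite Rabs_pos_eq by lra. rewrite Hc in H0.
  apply Rle_trans with (rad * (r * sin th / rad)); [apply Rmult_le_compat_l; lra|]. right. field. lra.
Qed.

(** Exchange the integrals, then parametrize the branch by direction as in [branch_angle];
    the integral over [beta] becomes the mode at the distance of the running point, rotated. *)
Lemma vint_branch rad n th F r : 0 < th < PI / 2 -> 0 < r < rad -> csmooth2 F -> outside_zero rad F ->
  cint (fun t => cint (fun beta => (F (fst (branch th r beta t)) (snd (branch th r beta t)) *
      cis (- IZR n * beta)%R)%C) 0 (2 * PI)) 0 (exit_time rad th r) =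
  (RtoC r * vint (IZR n) th 0 (fmode n F) r)%C.
Proof.
  intros Hth Hr HF Hz. pose proof PI_RGT_0 as PP.
  destruct (exit_angle_bounds rad th r Hth Hr) as [Ha Hc].
  destruct (sin_cos_bounds th Hth) as [Hs _].
  assert (Sm : csmooth (fmode n F)) by now apply csmooth_fmode.
  assert (Van : vanishes rad (fmode n F)) by (apply fmode_vanishes; auto; lra).
  assert (Hpc : 0 < psic th < PI / 2) by (unfold psic; lra).
  set (Q := fun t => cint (fun beta => (F (fst (branch th r beta t)) (snd (branch th r beta t)) *
      cis (- IZR n * beta)%R)%C) 0 (2 * PI)).
  set (a := exit_angle rad th r) in *.
  set (h := fun phi => r * (cos th + sin th * tan phi)).
  assert (Cph : forall phi, - psic th <= phi <= a -> 0 < cos phi) by (intros phi Hp; apply cos_gt_0; lra).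
  assert (CQ : forall t, ccont Q t).
  { intros t. apply (ccont_cint_param (fun t beta => (F (fst (branch th r beta t)) (snd (branch th r beta t)) *
      cis (- IZR n * beta)%R)%C)); [lra| |].
    - intros beta _. apply ccont2_mult; [now apply ccont2_branch|].
      apply (ccont2_snd_var (fun beta => cis (- IZR n * beta))), ccont_cis_scal.
    - intros u beta _. apply ccont_mult; [|apply ccont_cis_scal].
      now apply (ccont2_ccont_snd _ u beta (ccont2_branch F th r beta u HF)). }
  assert (H0 : h (- psic th) = 0).
  { unfold h, tan. rewrite sin_neg, cos_neg. unfold psic. rewrite cos_shift, sin_shift. field. lra. }
  assert (H1 : h a = exit_time rad th r) by reflexivity.
  rewrite <- H1, <- H0.
  rewrite <- (cint_comp Q h (fun phi => r * sin th / (cos phi * cos phi))).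
  - rewrite (vint_exit rad) by auto. fold a.
    rewrite <- (cint_flip (vfun (IZR n) th 0 (fmode n F) r)); [|lra|].
    2:{ apply (vfun_ccont_on rad); auto; try lra. intros; now apply csmooth_ccont. }
    rewrite Ropp_involutive, <- cint_scal; [|lra|].
    + apply cint_ext; [lra|]. intros phi Hp. specialize (Cph phi ltac:(lra)).
      assert (EQ : Q (h phi) = (cis (IZR n * (- phi - psic th))%R * fmode n F (r * sin th / cos phi)%R)%C).
      { unfold Q. rewrite <- fmode_rotate by auto. apply cint_ext; [lra|]. intros beta _.
        unfold h. rewrite branch_angle by lra. reflexivity. }
      rewrite EQ. unfold vfun, vker, ker. rewrite cos_neg. fold (cis (IZR n * (- phi - psic th))).
      simpl pow. rewrite Rmult_1_r.
      replace (r * sin th / (cos phi * cos phi)) with (r * (sin th / (cos phi * cos phi))) by (field; lra).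
      rewrite RtoC_mult. ring.
    + intros phi Hp. apply (ccont_comp (vfun (IZR n) th 0 (fmode n F) r) (fun phi => - phi)).
      * derive_cont.
      * apply (vfun_ccont_on rad (IZR n) th 0 (fmode n F) r (- phi) (- phi)); auto; try lra.
        intros; now apply csmooth_ccont.
  - lra.
  - rewrite H0, H1. left. now apply exit_time_pos.
  - intros; apply CQ.
  - intros phi Hp. specialize (Cph phi Hp). split.
    + unfold h, tan. auto_derive; [lra|].
      pose proof (sin2_cos2 phi) as S. unfold Rsqr in S.
      transitivity (r * sin th * ((sin phi * sin phi + cos phi * cos phi) / (cos phi * cos phi))); [field; lra|].
      rewrite S. field. lra.
    + apply (ex_derive_continuous (V := R_NormedModule)). auto_derive. apply Rgt_not_eq, Rmult_lt_0_compat; lra.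
Qed.

(** The data of the [n]-th mode is the [n]-th Fourier coefficient of the data. *)
Lemma fmode_V_zero rad n th F : 0 < th < PI / 2 -> 0 < rad -> csmooth2 F -> outside_zero rad F ->
  (forall beta r, 0 <= beta < 2 * PI -> 0 < r < rad -> vline rad th F beta r = 0%C) ->
  V_zero rad (IZR n) th (fmode n F).
Proof.
  intros Hth Hrad HF Hz HV r Hr. pose proof PI_RGT_0 as PP.
  pose proof (outer_ge rad th Hth Hrad) as Ho. pose proof (exit_time_pos rad th r Hth Hr) as HT.
  assert (Sm : csmooth (fmode n F)) by now apply csmooth_fmode.
  assert (Van : vanishes rad (fmode n F)) by (apply fmode_vanishes; auto; lra).
  unfold Vt. rewrite <- (vint_branch rad) by auto.
  rewrite <- (cint_Chasles (fmode n F) r rad (outer rad th)); try lra.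
  2:{ intros x _. now apply csmooth_ccont. }
  rewrite (cint_zero _ rad); [|lra|intros x Hx; apply Van; rewrite Rabs_pos_eq; lra].
  rewrite Cplus_0_r.
  set (G1 := fun x beta => (F (x * cos beta)%R (x * sin beta)%R * cis (- IZR n * beta)%R)%C).
  set (G2 := fun t beta => (F (fst (branch th r beta t)) (snd (branch th r beta t)) * cis (- IZR n * beta)%R)%C).
  assert (C1 : forall x beta, ccont2 G1 x beta).
  { intros. apply (ccont2_angular F (fun t => cis (- IZR n * t))); auto. intros; apply ccont_cis_scal. }
  assert (C2 : forall t beta, ccont2 G2 t beta).
  { intros. apply ccont2_mult; [now apply ccont2_branch|].
    apply (ccont2_snd_var (fun beta => cis (- IZR n * beta))), ccont_cis_scal. }
  change (fmode n F) with (fun x => cint (G1 x) 0 (2 * PI)).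
  change (fun t => cint (fun beta => (F (fst (branch th r beta t)) (snd (branch th r beta t)) *
      cis (- IZR n * beta)%R)%C) 0 (2 * PI)) with (fun t => cint (G2 t) 0 (2 * PI)).
  rewrite (cint_swap_order G1), (cint_swap_order G2); auto; try lra.
  assert (S1 : forall beta, ccont (fun beta => cint (fun x => G1 x beta) r rad) beta).
  { intros beta. apply (ccont_cint_param (fun beta x => G1 x beta)); [lra| |].
    - intros x _. destruct (C1 x beta) as [A B]. split; now apply continuity_2d_pt_swap.
    - intros u x _. apply (ccont2_ccont_fst G1 x u). apply C1. }
  assert (S2 : forall beta, ccont (fun beta => cint (fun t => G2 t beta) 0 (exit_time rad th r)) beta).
  { intros beta. apply (ccont_cint_param (fun beta x => G2 x beta)); [lra| |].
    - intros x _. destruct (C2 x beta) as [A B]. split; now apply continuity_2d_pt_swap.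
    - intros u x _. apply (ccont2_ccont_fst G2 x u). apply C2. }
  rewrite <- cint_scal, <- cint_plus; try lra.
  - apply cint_zero; [lra|]. intros beta Hb. specialize (HV beta r ltac:(lra) Hr).
    transitivity (cis (- IZR n * beta)%R * vline rad th F beta r)%C; [|rewrite HV; ring].
    unfold vline, G1, G2.
    rewrite (cint_ext _ (fun x => (cis (- IZR n * beta)%R * F (x * cos beta)%R (x * sin beta)%R)%C));
      [|lra|intros; ring].
    rewrite (cint_ext (fun t => _) (fun t => (cis (- IZR n * beta)%R *
      F (fst (branch th r beta t)) (snd (branch th r beta t)))%C) 0); [|lra|intros; ring].
    rewrite !cint_scal; try lra; [ring| |].
    + intros t _. apply (ccont2_ccont_fst _ t beta (ccont2_branch F th r beta t HF)).
    + intros x _. apply (ccont2_ccont_fst _ x beta (ccont2_polar F x beta HF)).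
  - intros beta _. apply S1.
  - intros beta _. apply ccont_mult; [apply ccont_const|apply S2].
  - intros beta _. apply S2.
Qed.

Lemma fmode_mode rad n th F : 0 < th < PI / 2 -> 0 < rad -> csmooth2 F -> outside_zero rad F ->
  (forall beta r, 0 <= beta < 2 * PI -> 0 < r < rad -> vline rad th F beta r = 0%C) ->
  mode rad th n (fmode n F).
Proof.
  intros Hth Hr HF Hz HV. split.
  - now apply csmooth_fmode.
  - now apply fmode_vanishes.
  - now apply fmode_parity.
  - now apply fmode_V_zero.
Qed.

Lemma polar_coordinates (u v : R) : u <> 0 \/ v <> 0 ->
  exists x t, 0 < x /\ u = x * cos t /\ v = x * sin t.
Proof.
  intros H. set (x := sqrt (u * u + v * v)).
  assert (P : 0 < u * u + v * v) by nra.
  assert (Hx : 0 < x) by now apply sqrt_lt_R0.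
  assert (X2 : x * x = u * u + v * v) by (apply sqrt_sqrt; lra).
  assert (Hu : -1 <= u / x <= 1).
  { assert (Rabs u <= Rabs x) by (apply Rsqr_le_abs_0; unfold Rsqr; nra).
    rewrite (Rabs_pos_eq x) in H0 by lra. apply Rabs_le_between in H0.
    split; apply Rmult_le_reg_r with x; auto; unfold Rdiv; rewrite Rmult_assoc, Rinv_l; lra. }
  set (t := acos (u / x)).
  assert (Ct : u = x * cos t) by (unfold t; rewrite cos_acos by auto; field; lra).
  pose proof (sin2_cos2 t) as S. unfold Rsqr in S.
  assert (V2 : v * v = x * sin t * (x * sin t)) by nra.
  destruct (Rle_lt_dec 0 v) as [L|L].
  - exists x, t. repeat split; auto. destruct (acos_bound (u / x)) as [B1 B2].
    assert (0 <= sin t) by (apply sin_ge_0; auto).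
    apply Rsqr_inj; auto; apply Rmult_le_pos; lra.
  - exists x, (- t). rewrite cos_neg, sin_neg. repeat split; auto. destruct (acos_bound (u / x)) as [B1 B2].
    assert (0 <= sin t) by (apply sin_ge_0; auto).
    enough (- v = x * sin t) by lra. apply Rsqr_inj; [lra|apply Rmult_le_pos; lra|]. unfold Rsqr. lra.
Qed.

(** All modes vanish for [x > 0], so [F] vanishes off the origin, and by continuity there too. *)
Lemma vline_injective rad th F : 0 < th < PI / 2 -> 0 < rad -> csmooth2 F -> outside_zero rad F ->
  (forall beta r, 0 <= beta < 2 * PI -> 0 < r < rad -> vline rad th F beta r = 0%C) ->
  forall u v, F u v = 0%C.
Proof.
  intros Hth Hr HF Hz HV.
  assert (Pol : forall x t, 0 < x -> F (x * cos t) (x * sin t) = 0%C).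
  { intros x t Hx. revert t. apply (fourier_unique (fun t => F (x * cos t) (x * sin t))).
    - intros t. apply (ccont2_ccont_snd _ x t (ccont2_polar F x t HF)).
    - intros t. rewrite cos_plus, sin_plus, cos_2PI, sin_2PI, !Rmult_1_r, !Rmult_0_r, Rminus_0_r, Rplus_0_r.
      reflexivity.
    - intros n. rewrite <- (mode_vanishes rad th (- n) (fmode (- n) F) x); auto.
      + unfold fmode, angular. rewrite opp_IZR, Ropp_involutive. reflexivity.
      + now apply fmode_mode. }
  assert (Z : forall u v, u <> 0 \/ v <> 0 -> F u v = 0%C).
  { intros u v H. destruct (polar_coordinates u v H) as [x [t [Hx [-> ->]]]]. now apply Pol. }
  intros u v. destruct (Req_dec u 0) as [Eu|Eu]; [|apply Z; auto].
  destruct (Req_dec v 0) as [Ev|Ev]; [|apply Z; auto]. subst.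
  apply Cmod_eq_0. apply Rle_antisym; [|apply Cmod_ge_0]. apply Rnot_lt_le. intros Hc.
  destruct (csmooth2_ccont2 F 0 0 HF) as [A B].
  assert (Hh : 0 < Cmod (F 0 0) / 2) by lra.
  destruct (A (mkposreal _ Hh)) as [d1 D1]. destruct (B (mkposreal _ Hh)) as [d2 D2]. simpl in *.
  set (d := Rmin d1 d2 / 2).
  assert (Hd : 0 < d /\ d < d1 /\ d < d2).
  { assert (0 < Rmin d1 d2) by (apply Rmin_glb_lt; apply cond_pos).
    pose proof (Rmin_l d1 d2). pose proof (Rmin_r d1 d2). unfold d. lra. }
  assert (Rd : Rabs (d - 0) = d) by (rewrite Rminus_0_r; apply Rabs_pos_eq; lra).
  assert (R0 : Rabs (0 - 0) = 0) by (rewrite Rminus_0_r; apply Rabs_R0).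
  assert (Fd : F d 0 = 0%C) by (apply Z; left; lra).
  specialize (D1 d 0 ltac:(lra) ltac:(pose proof (cond_pos d1); lra)).
  specialize (D2 d 0 ltac:(lra) ltac:(pose proof (cond_pos d2); lra)).
  rewrite Fd in D1, D2. simpl in D1, D2. unfold Rminus in D1, D2. rewrite Rplus_0_l, Rabs_Ropp in D1, D2.
  pose proof (Cmod_le_sum (F 0 0)). lra.
Qed.

(** * Uniqueness for the V-line transforms *)

Lemma ex_diff_n_minus n : forall (G H : R -> R -> R),
  (forall x y, ex_diff_n G n x y) -> (forall x y, ex_diff_n H n x y) ->
  forall x y, ex_diff_n (fun u v => G u v - H u v) n x y.
Proof.
  induction n as [|n IH]; intros G H HG HH x y.
  - split; auto. apply continuity_2d_pt_minus; [apply (HG x y)|apply (HH x y)].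
  - split; [apply continuity_2d_pt_minus; [apply (HG x y)|apply (HH x y)]|].
    split; [apply (ex_derive_minus (V := R_NormedModule) (fun z => G z y)); [apply (HG x y)|apply (HH x y)]|].
    split; [apply (ex_derive_minus (V := R_NormedModule) (fun z => G x z)); [apply (HG x y)|apply (HH x y)]|].
    split.
    + apply ex_diff_n_ext_loc with
        (fun u v => Derive (fun z => G z v) u - Derive (fun z => H z v) u).
      * apply locally_2d_forall. intros u v. symmetry. apply Derive_minus; [apply (HG u v)|apply (HH u v)].
      * apply IH; intros u v; [apply (HG u v)|apply (HH u v)].
    + apply ex_diff_n_ext_loc with
        (fun u v => Derive (fun z => G u z) v - Derive (fun z => H u z) v).
      * apply locally_2d_forall. intros u v. symmetry. apply Derive_minus; [apply (HG u v)|apply (HH u v)].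
      * apply IH; intros u v; [apply (HG u v)|apply (HH u v)].
Qed.

Lemma csmooth2_minus F G : csmooth2 F -> csmooth2 G -> csmooth2 (fun u v => (F u v - G u v)%C).
Proof.
  intros HF HG n x y. split.
  - apply (ex_diff_n_minus n (fun u v => fst (F u v)) (fun u v => fst (G u v))); intros; [apply HF|apply HG].
  - apply (ex_diff_n_minus n (fun u v => snd (F u v)) (fun u v => snd (G u v))); intros; [apply HF|apply HG].
Qed.

Lemma RInt_gen_eventually_zero (k : R -> R) T : (forall s, continuous k s) ->
  (forall s, T <= s -> k s = 0) ->
  RInt_gen k (at_point 0) (Rbar_locally p_infty) = RInt k 0 T.
Proof.
  intros Hk Hz. apply is_RInt_gen_unique. intros P HP.
  apply Filter_prod with (fun a => a = 0) (fun b => T < b).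
  - reflexivity.
  - now exists T.
  - intros a b -> Hb. exists (RInt k 0 T). split; [|now apply locally_singleton]. simpl.
    replace (RInt k 0 T) with (RInt k 0 b); [apply (RInt_correct (V := R_CompleteNormedModule)), rex_cont; auto|].
    assert (E := RInt_Chasles (V := R_CompleteNormedModule) k 0 T b (rex_cont k _ _ Hk) (rex_cont k _ _ Hk)).
    assert (Z : RInt k T b = 0).
    { rewrite (RInt_ext k (fun _ => 0)).
      - rewrite rRInt_const. apply Rmult_0_r.
      - intros s. rewrite Rmin_left by lra. intros Hs. apply Hz. lra. }
    unfold plus in E; simpl in E. lra.
Qed.

Lemma smooth_field_csmooth2 rad f : smooth_field rad f -> csmooth2 (fun u v => f (u, v)).
Proof. intros [[A _] [B _]] n x y. split; [apply A|apply B]. Qed.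

Lemma smooth_field_outside_zero rad f : smooth_field rad f -> outside_zero rad (fun u v => f (u, v)).
Proof.
  intros [[_ [_ A]] [_ [_ B]]] u v H.
  assert (K : forall h : R * R -> R, (forall p, support h p -> disk rad p) -> h (u, v) = 0).
  { intros h Hs. destruct (Req_dec (h (u, v)) 0) as [E|E]; auto. exfalso.
    assert (D : disk rad (u, v)).
    { apply Hs. intros U HU. exists (u, v). split; auto. now apply locally_singleton. }
    unfold disk in D. simpl in D. nra. }
  apply Ceq; simpl; [apply (K (fun p => fst (f p)) A)|apply (K (fun p => snd (f p)) B)].
Qed.

(** For unit vectors [w], [dot w p + i dot (perp w) p] is the product of [p] with
    the conjugate of [w], so [L + i T] is a complex combination of integrals of
    the field itself. *)
Lemma transforms_vline rad th f beta r : 0 < th < PI / 2 -> 0 < r < rad -> smooth_field rad f ->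
  ((longitudinal rad th f beta (rad - r), transverse rad th f beta (rad - r)) : C) =
  (- cis (- beta)%R * vline rad th (fun u v => f (u, v)) beta r)%C.
Proof.
  intros Hth Hr Hf.
  pose proof (smooth_field_csmooth2 rad f Hf) as HF. pose proof (smooth_field_outside_zero rad f Hf) as HZ.
  set (F := (fun u v => f (u, v)) : R -> R -> C) in *. pose proof (exit_time_pos rad th r Hth Hr) as HT.
  set (T := exit_time rad th r) in *.
  set (g := (fun x => F (x * cos beta)%R (x * sin beta)%R) : R -> C).
  set (b := (fun t => F (fst (branch th r beta t)) (snd (branch th r beta t))) : R -> C).
  assert (Cg : forall x, ccont g x) by (intros x; apply (ccont2_ccont_fst _ x beta (ccont2_polar F x beta HF))).
  assert (Cb : forall t, ccont b t) by (intros t; apply (ccont2_ccont_fst _ t beta (ccont2_branch F th r beta t HF))).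
  assert (Cgr : forall s, ccont (fun s => g (rad - s)) s).
  { intros s. apply (ccont_comp g (fun s => rad - s)); auto.
    derive_cont. }
  assert (Bz : forall t, T <= t -> b t = 0%C).
  { intros t Ht. unfold b. apply HZ. rewrite branch_norm. now apply (exit_norm rad th r t). }
  assert (Leg1 : forall s, f (along (x_pt rad beta) s (u_dir beta)) = g (rad - s)).
  { intros s. unfold g, F. f_equal. unfold along, x_pt, u_dir; simpl. f_equal; ring. }
  assert (Leg2 : forall s, f (along (along (x_pt rad beta) (rad - r) (u_dir beta)) s (v_dir th beta)) = b s).
  { intros s. unfold b, F. f_equal. unfold along, x_pt, u_dir, v_dir, branch; simpl. f_equal; ring. }
  assert (I1 : cint (fun s => g (rad - s)) 0 (rad - r) = cint g r rad).
  { rewrite <- (cint_flip g r rad); [|lra|intros x _; apply Cg].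
    assert (Cn : forall x, ccont (fun x => g (- x)) x).
    { intros x. apply (ccont_comp g (fun x => - x)); auto.
      derive_cont. }
    assert (K : forall p : R -> R, (forall x, continuous p x) ->
       RInt (fun s => p (rad - s)) 0 (rad - r) = RInt (fun x => p (- x)) (- rad) (- r)).
    { intros p Hp. transitivity (RInt (fun s => (fun x => p (- x)) (s + - rad)) 0 (rad - r)).
      - apply RInt_ext. intros x _. f_equal. ring.
      - rewrite (RInt_translate (fun x => p (- x))).
        + f_equal; ring.
        + intros x. apply (continuous_comp (fun x => - x) p); [|apply Hp].
          derive_cont. }
    apply Ceq; simpl; [apply (K (fun x => fst (g x)))|apply (K (fun x => snd (g x)))]; apply Cg. }
  unfold vline. fold T. change (cint (fun x => F (x * cos beta)%R (x * sin beta)%R) r rad) with (cint g r rad).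
  change (cint (fun t => F (fst (branch th r beta t)) (snd (branch th r beta t))) 0 T) with (cint b 0 T).
  rewrite <- I1.
  transitivity (cint (fun s => (- cis (- beta)%R * g (rad - s)%R)%C) 0 (rad - r) +
    cint (fun t => (- cis (- (th + beta))%R * b t)%C) 0 T)%C.
  - assert (Cgs : forall s, ccont (fun s => (- cis (- beta)%R * g (rad - s)%R)%C) s)
      by (intros s; apply ccont_mult; [apply ccont_const|apply Cgr]).
    assert (Cbs : forall s, ccont (fun t => (- cis (- (th + beta))%R * b t)%C) s)
      by (intros s; apply ccont_mult; [apply ccont_const|apply Cb]).
    assert (Dg : forall s, (- cis (- beta)%R * g (rad - s)%R)%C =
       (dot (u_dir beta) (g (rad - s)), dot (perp (u_dir beta)) (g (rad - s)))).
    { intros s. rewrite cis_eq, cos_neg, sin_neg. unfold dot, perp, u_dir. apply Ceq; simpl; ring. }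
    assert (Db : forall t, (- cis (- (th + beta))%R * b t)%C =
       (dot (v_dir th beta) (b t), dot (perp (v_dir th beta)) (b t))).
    { intros s. rewrite cis_eq, cos_neg, sin_neg. unfold dot, perp, v_dir. apply Ceq; simpl; ring. }
    assert (Cd : forall s, continuous (fun t => dot (v_dir th beta) (b t)) s /\
       continuous (fun t => dot (perp (v_dir th beta)) (b t)) s).
    { intros s. assert (X : ccont (fun t => (dot (v_dir th beta) (b t), dot (perp (v_dir th beta)) (b t)) : C) s)
        by (apply ccont_ext with (2 := Cbs s); intros t; apply Db). exact X. }
    assert (Gen : forall (w : R * R), (forall s, continuous (fun t => dot w (b t)) s) ->
      RInt_gen (fun s => dot w (f (along (along (x_pt rad beta) (rad - r) (u_dir beta)) s (v_dir th beta))))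
        (at_point 0) (Rbar_locally p_infty) = RInt (fun t => dot w (b t)) 0 T).
    { intros w Hw. rewrite (RInt_gen_eventually_zero _ T).
      - apply RInt_ext. intros s _. now rewrite Leg2.
      - intros s. apply continuous_ext with (fun t => dot w (b t)); [intros; now rewrite Leg2|apply Hw].
      - intros s Hs. rewrite Leg2, Bz by auto. unfold dot. simpl. ring. }
    apply Ceq; simpl; unfold longitudinal, transverse; rewrite Gen; try f_equal.
    + apply RInt_ext. intros s _. rewrite Leg1. exact (f_equal fst (eq_sym (Dg s))).
    + apply RInt_ext. intros s _. exact (f_equal fst (eq_sym (Db s))).
    + intros s. apply (proj1 (Cd s)).
    + apply RInt_ext. intros s _. rewrite Leg1. exact (f_equal snd (eq_sym (Dg s))).
    + apply RInt_ext. intros s _. exact (f_equal snd (eq_sym (Db s))).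
    + intros s. apply (proj2 (Cd s)).
  - rewrite !cint_scal; try lra; [|intros x _; apply Cb|intros x _; apply Cgr].
    replace (- (th + beta)) with (- beta + - th) by ring. rewrite cis_plus. unfold cis at 3. ring.
Qed.

Lemma vline_minus rad th F G beta r : 0 < th < PI / 2 -> 0 < r < rad -> csmooth2 F -> csmooth2 G ->
  vline rad th (fun u v => (F u v - G u v)%C) beta r = (vline rad th F beta r - vline rad th G beta r)%C.
Proof.
  intros Hth Hr HF HG. pose proof (exit_time_pos rad th r Hth Hr) as HT. unfold vline.
  assert (Cg : forall H, csmooth2 H -> ccont_on (fun x => H (x * cos beta)%R (x * sin beta)%R) r rad)
    by (intros H HH x _; apply (ccont2_ccont_fst _ x beta (ccont2_polar H x beta HH))).
  assert (Cb : forall H, csmooth2 H -> ccont_on (fun t => H (fst (branch th r beta t)) (snd (branch th r beta t))) 0 (exit_time rad th r))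
    by (intros H HH t _; apply (ccont2_ccont_fst _ t beta (ccont2_branch H th r beta t HH))).
  rewrite (cint_minus (fun x => F (x * cos beta)%R (x * sin beta)%R) (fun x => G (x * cos beta)%R (x * sin beta)%R)); auto; try lra.
  rewrite (cint_minus (fun t => F (fst (branch th r beta t)) (snd (branch th r beta t)))
     (fun t => G (fst (branch th r beta t)) (snd (branch th r beta t)))); auto; try lra.
  ring.
Qed.

Theorem theorem3p2 (rad theta : R) (hrad : 0 < rad) (htheta : 0 < theta < PI / 2)
    (f g : R * R -> R * R)
    (hf : smooth_field rad f) (hg : smooth_field rad g)
    (hL : forall beta d : R, 0 <= beta < 2 * PI -> 0 <= d <= rad ->
            longitudinal rad theta f beta d = longitudinal rad theta g beta d)
    (hT : forall beta d : R, 0 <= beta < 2 * PI -> 0 <= d <= rad ->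
            transverse rad theta f beta d = transverse rad theta g beta d) :
  forall p : R * R, f p = g p.
Proof.
  pose proof (smooth_field_csmooth2 rad f hf) as Sf. pose proof (smooth_field_csmooth2 rad g hg) as Sg.
  assert (Z : forall u v, (f (u, v) - g (u, v))%C = 0%C).
  { apply (vline_injective rad theta (fun u v => (f (u, v) - g (u, v))%C)); auto.
    - now apply csmooth2_minus.
    - intros u v H. rewrite (smooth_field_outside_zero rad f hf u v H), (smooth_field_outside_zero rad g hg u v H).
      ring.
    - intros beta r Hb Hr.
      rewrite (vline_minus rad theta (fun u v => f (u, v)) (fun u v => g (u, v))) by auto.
      assert (E : (- cis (- beta)%R * vline rad theta (fun u v => f (u, v)) beta r)%C =
                  (- cis (- beta)%R * vline rad theta (fun u v => g (u, v)) beta r)%C).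
      { rewrite <- !transforms_vline by auto. rewrite hL, hT by (auto; lra). reflexivity. }
      apply (f_equal (fun z => (- cis beta * z)%C)) in E.
      assert (U : (cis beta * cis (- beta)%R)%C = 1%C) by (rewrite <- cis_plus, Rplus_opp_r; apply cis_0).
      transitivity ((cis beta * cis (- beta)%R) * vline rad theta (fun u v => f (u, v)) beta r -
        (cis beta * cis (- beta)%R) * vline rad theta (fun u v => g (u, v)) beta r)%C; [rewrite U; ring|].
      transitivity (- cis beta * (- cis (- beta)%R * vline rad theta (fun u v => f (u, v)) beta r) -
        - cis beta * (- cis (- beta)%R * vline rad theta (fun u v => g (u, v)) beta r))%C; [ring|].
      rewrite E. ring. }
  intros [u v]. specialize (Z u v).
  apply Ceq; [apply (f_equal fst) in Z|apply (f_equal snd) in Z]; simpl in Z; lra.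
Qed.
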